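(* Let $\mu>0$, $A_1,A_2>0$, $\gamma,\alpha\ge 1$, $\rho_+>0$, $n_+>0$ be constants, let $u_+<0$, and let $\delta:=|u_--u_+|>0$. Then there exists a set $\Omega_-\subset\mathbb{R}_-$ such that if $u_-\in\Omega_-$ and $\delta$ is sufficiently small, there exists a unique strong solution $(\widetilde\rho,\widetilde u,\widetilde n,\widetilde v)(x)$ to the stationary boundary value problem (BVP) described in the context, which satisfies: (a) for the supersonic or subsonic case $M_+\neq 1$, $$|\partial_x^k(\widetilde\rho-\rho_+,\widetilde u-u_+,\widetilde n-n_+,\widetilde v-u_+)|\le C_1\delta e^{-c_0x},\qquad k=0,1,2,3;$$ (b) for the sonic case $M_+=1$, $$|\partial_x^k(\widetilde\rho-\rho_+,\widetilde u-u_+,\widetilde n-n_+,\widetilde v-u_+)|\le C_2\frac{\delta^{k+1}}{(1+\delta x)^{k+1}},\qquad k=0,1,2,3,$$ and $$(\widetilde u_x,\widetilde v_x)=(a\sigma^2(x),a\sigma^2(x))+O(|\sigma(x)|^3),$$ where $\sigma(x)$ is a smooth function satisfying $\sigma_x=-a\sigma^2+O(|\sigma|^3)$ and $$c_1\frac{\delta}{1+\delta x}\le\sigma(x)\le C_3\frac{\delta}{1+\delta x},\qquad |\partial_x^k\sigma(x)|\le C_3\frac{\delta^{k+1}}{(1+\delta x)^{k+1}},\quad k=0,1,2,3.$$ Here $C_1,C_2,C_3,c_0,c_1$ and $a$ are positive constants.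
   Context: $\mathbb{R}_+=(0,\infty)$, $\mathbb{R}_-=(-\infty,0)$. Pressure functions: $p_1(\rho)=A_1\rho^\gamma$, $p_2(n)=A_2n^\alpha$. The stationary boundary value problem (BVP) for $(\widetilde\rho,\widetilde u,\widetilde n,\widetilde v)(x)$, $x>0$, is $$(\widetilde\rho\widetilde u)_x=0,\quad [\widetilde\rho\widetilde u^2+p_1(\widetilde\rho)]_x=(\mu\widetilde u_x)_x+\widetilde n(\widetilde v-\widetilde u),\quad (\widetilde n\widetilde v)_x=0,\quad [\widetilde n\widetilde v^2+p_2(\widetilde n)]_x=(\widetilde n\widetilde v_x)_x-\widetilde n(\widetilde v-\widetilde u),$$ with $$(\widetilde u,\widetilde v)(0)=(u_-,u_-),\quad \lim_{x\to\infty}(\widetilde\rho,\widetilde u,\widetilde n,\widetilde v)(x)=(\rho_+,u_+,n_+,u_+),\quad \inf_{x\in\mathbb{R}_+}\widetilde\rho(x)>0,\quad \inf_{x\in\mathbb{R}_+}\widetilde n(x)>0,$$ where $u_-<0$. The Mach number and sound speed at the far field are $$M_+:=\frac{|u_+|}{c_+},\qquad c_+:=\Big(\frac{A_1\gamma\rho_+^\gamma+A_2\alpha n_+^\alpha}{\rho_++n_+}\Big)^{1/2}.$$ The cases $M_+>1$, $M_+=1$, $M_+<1$ are called supersonic, sonic, subsonic respectively.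
   Formalization: In the sonic case the constants in the bounds for k=2,3 and in the O(|σ|³) of (u_x,v_x) may depend on u_-, since uniform ones fail as δ→0; nearness of Ω_- to u_+ is claimed only for M_+≥1, because for M_+<1 no data with small δ>0 are solvable. *)

(* Defs.v *)
From Stdlib Require Import Reals.
From Coquelicot Require Import Coquelicot.
Open Scope R_scope.

Definition pressure (A g r : R) : R := A * Rpower r g.

Definition sound_speed (A1 A2 gamma alpha rho_p n_p : R) : R :=
  sqrt ((A1 * gamma * Rpower rho_p gamma + A2 * alpha * Rpower n_p alpha)
        / (rho_p + n_p)).

Definition mach (A1 A2 gamma alpha rho_p n_p u_p : R) : R :=
  Rabs u_p / sound_speed A1 A2 gamma alpha rho_p n_p.

(* Only the values on [0, oo) of the four profiles are ever used. *)
Record profile := Profile {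
  prho : R -> R; pu : R -> R; pn : R -> R; pv : R -> R }.

Definition profile_eq (w w' : profile) : Prop :=
  forall x, 0 <= x ->
    prho w x = prho w' x /\ pu w x = pu w' x /\
    pn w x = pn w' x /\ pv w x = pv w' x.

Definition right_continuous0 (f : R -> R) : Prop :=
  filterlim f (at_right 0) (locally (f 0)).

Definition inf_half_line (f : R -> R) : Rbar :=
  Glb_Rbar (fun y => exists x, 0 < x /\ y = f x).

(* Strong solutions are taken pointwise on (0, oo): the densities are
   differentiable, the velocities twice differentiable, and all four functions
   are continuous up to x = 0.  [ex_derive_n f 2 x] only says that
   [Derive f] is differentiable at x, hence the separate [ex_derive]. *)
Definition regular_profile (w : profile) : Prop :=
  right_continuous0 (prho w) /\ right_continuous0 (pu w) /\
  right_continuous0 (pn w) /\ right_continuous0 (pv w) /\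
  forall x, 0 < x ->
    ex_derive (prho w) x /\ ex_derive (pn w) x /\
    ex_derive (pu w) x /\ ex_derive_n (pu w) 2 x /\
    ex_derive (pv w) x /\ ex_derive_n (pv w) 2 x.

Definition stationary_eqs (mu A1 A2 gamma alpha : R) (w : profile) : Prop :=
  forall x, 0 < x ->
    Derive (fun y => prho w y * pu w y) x = 0 /\
    Derive (fun y => prho w y * pu w y ^ 2 + pressure A1 gamma (prho w y)) x
      = Derive (fun y => mu * Derive (pu w) y) x
        + pn w x * (pv w x - pu w x) /\
    Derive (fun y => pn w y * pv w y) x = 0 /\
    Derive (fun y => pn w y * pv w y ^ 2 + pressure A2 alpha (pn w y)) x
      = Derive (fun y => pn w y * Derive (pv w) y) x
        - pn w x * (pv w x - pu w x).

Definition strong_solution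
    (mu A1 A2 gamma alpha rho_p n_p u_p u_m : R) (w : profile) : Prop :=
  regular_profile w /\
  stationary_eqs mu A1 A2 gamma alpha w /\
  pu w 0 = u_m /\ pv w 0 = u_m /\
  is_lim (prho w) p_infty rho_p /\ is_lim (pu w) p_infty u_p /\
  is_lim (pn w) p_infty n_p /\ is_lim (pv w) p_infty u_p /\
  Rbar_lt 0 (inf_half_line (prho w)) /\ Rbar_lt 0 (inf_half_line (pn w)).

(* |d_x^k (rho - rho_+, u - u_+, n - n_+, v - u_+)|, Euclidean norm of R^4 *)
Definition dev (rho_p n_p u_p : R) (w : profile) (k : nat) (x : R) : R :=
  sqrt (Derive_n (fun y => prho w y - rho_p) k x ^ 2
        + Derive_n (fun y => pu w y - u_p) k x ^ 2
        + Derive_n (fun y => pn w y - n_p) k x ^ 2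
        + Derive_n (fun y => pv w y - u_p) k x ^ 2).

(* [Derive_n] is total, so a bound on [dev] is meaningful only together with
   the existence of the derivatives. *)
Definition derivable_upto (m : nat) (w : profile) : Prop :=
  forall k x, (k <= m)%nat -> 0 < x ->
    ex_derive_n (prho w) k x /\ ex_derive_n (pu w) k x /\
    ex_derive_n (pn w) k x /\ ex_derive_n (pv w) k x.

Definition exp_decay (rho_p n_p u_p C c delta : R) (w : profile) : Prop :=
  derivable_upto 3 w /\
  forall k x, (k <= 3)%nat -> 0 < x ->
    dev rho_p n_p u_p w k x <= C * delta * exp (- c * x).

Definition alg_rate (delta : R) (k : nat) (x : R) : R :=
  delta ^ (k + 1) / (1 + delta * x) ^ (k + 1).

Definition alg_decay
    (m : nat) (rho_p n_p u_p C delta : R) (w : profile) : Prop :=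
  derivable_upto m w /\
  forall k x, (k <= m)%nat -> 0 < x ->
    dev rho_p n_p u_p w k x <= C * alg_rate delta k x.

Definition smooth_half_line (f : R -> R) : Prop :=
  forall k x, 0 < x -> ex_derive_n f k x.

Definition sigma_profile (a c C delta : R) (sigma : R -> R) : Prop :=
  smooth_half_line sigma /\
  forall x, 0 < x ->
    Rabs (Derive sigma x + a * sigma x ^ 2) <= C * Rabs (sigma x) ^ 3 /\
    c * (delta / (1 + delta * x)) <= sigma x
      <= C * (delta / (1 + delta * x)) /\
    forall k, (k <= 3)%nat ->
      Rabs (Derive_n sigma k x) <= C * alg_rate delta k x.

Definition velocity_expansion
    (a K : R) (sigma : R -> R) (w : profile) : Prop :=
  forall x, 0 < x ->
    Rabs (Derive (pu w) x - a * sigma x ^ 2) <= K * Rabs (sigma x) ^ 3 /\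
    Rabs (Derive (pv w) x - a * sigma x ^ 2) <= K * Rabs (sigma x) ^ 3.

(* Main.v *)
Require Import Defs.
From Stdlib Require Import Reals Lra Psatz.
From Coquelicot Require Import Coquelicot.
Open Scope R_scope.

(* The fluxes [rho u = j1] and [n v = j2] are constant, so the densities can be eliminated; integrating the
   total momentum once leaves an autonomous system for [(u, v, y)] with [y = f1 u - mu u'], where
   [f c = j c + A (j / c)^g] is the momentum flux of a phase as a function of its velocity, and a solution is an
   orbit with [u 0 = v 0 = u_-] and [u, v -> u_+].
   The flow preserves the order [u1 <= u2], [v2 <= v1], [y2 <= y1]; hence a convergent orbit is determined by
   [(u, v) 0], which is uniqueness.  The sign of [f1 + f2 - K] at [u_-] decides whether both velocities increase or
   decrease along the whole orbit, and near [u_+] this sign is governed by [(f1 + f2)' u_+], that is by [M_+ - 1],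
   and by convexity.  This rules out all nearby data in the subsonic case and the data [u_- > u_+] in the sonic
   case.  For [M_+ >= 1] and [u_- < u_+] an orbit is found by shooting in [y 0]: the parameters for which
   the orbit leaves the trapping region through one side or the other form two disjoint open sets.
   For [M_+ > 1] a Lyapunov functional gives exponential decay.
   For [M_+ = 1] the pair [(v - u, f1 u - y)] is a fast saddle slaved to [z = u_+ - u], up to an exponentially
   decaying boundary layer, and [z' = - a z^2 + ...]; the choice [sigma x = z (x + 1 / delta)] makes the
   layer harmless. *)

(** * Calculus on an interval *)

(** [Omega] is the set of negative data for which a solution exists; what has to be proved about it
    is that it accumulates at [u_p] when [1 <= M] and that its data close to [u_p] obey the
    estimates. The obstacle in the sonic case is the boundary condition [u 0 = v 0]: it puts the
    orbit off the slow manifold by an amount of order [delta^2], so the bounds on the second and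
    third derivatives contain a term [delta^2 exp (- kap x)], which at [x = 0] is not below a fixed
    multiple of [delta^3]. Hence a constant uniform in the datum for orders 0 and 1, and a constant
    [K] chosen after the datum for the rest. Two devices shape the whole development. Domains are
    written [0 < c / j], a condition invariant under reflection of the line, so that a statement on
    increasing orbits yields one on decreasing orbits. Asymptotic estimates are stated over pairs of
    an orbit and a position, so that their constants are uniform in the boundary data by
    construction. *)

Lemma continuity_pt_of_is_derive (f : R -> R) (x l : R) :
  is_derive f x l -> continuity_pt f x.
Proof.
  intros H. apply continuity_pt_filterlim.
  apply (ex_derive_continuous f x). now exists l.
Qed.

Lemma continuity_pt_pos (f : R -> R) (x : R) :
  continuity_pt f x -> 0 < f x ->
  exists e, 0 < e /\ forall t, Rabs (t - x) < e -> 0 < f t.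
Proof.
  intros Hc Hp. apply continuity_pt_filterlim in Hc.
  assert (H : locally x (fun t => 0 < f t)).
  { apply Hc. now apply (open_gt 0 (f x)). }
  destruct H as [e He]. exists e. split; [apply cond_pos|].
  intros t Ht. now apply He.
Qed.

(** Differentiability is asked only inside the interval, because profiles are merely continuous at
    [x = 0]. *)
Lemma mean_value_open (f df : R -> R) (a b : R) :
  a < b ->
  (forall t, a < t < b -> is_derive f t (df t)) ->
  (forall t, a <= t <= b -> continuity_pt f t) ->
  exists c, a < c < b /\ f b - f a = df c * (b - a).
Proof.
  intros Hab Hd Hc.
  assert (pr1 : forall c, a < c < b -> derivable_pt f c).
  { intros c Hc'. exists (df c). apply is_derive_Reals. now apply Hd. }
  assert (pr2 : forall c, a < c < b -> derivable_pt id c).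
  { intros c Hc'. apply derivable_pt_id. }
  destruct (MVT f id a b pr1 pr2 Hab Hc) as [c [P HP]].
  { intros c _. apply derivable_continuous_pt, derivable_pt_id. }
  exists c. split; [exact P|].
  assert (E1 : derive_pt f c (pr1 c P) = df c).
  { apply derive_pt_eq_0. apply is_derive_Reals. now apply Hd. }
  assert (E2 : derive_pt id c (pr2 c P) = 1).
  { apply derive_pt_eq_0. apply derivable_pt_lim_id. }
  rewrite E1, E2 in HP. unfold id in HP. lra.
Qed.

Lemma nondecreasing_of_derive (f df : R -> R) (a b : R) :
  a <= b ->
  (forall t, a < t < b -> is_derive f t (df t)) ->
  (forall t, a <= t <= b -> continuity_pt f t) ->
  (forall t, a < t < b -> 0 <= df t) -> f a <= f b.
Proof.
  intros Hab Hd Hc Hp. destruct (Req_dec a b) as [->|Hn]; [lra|].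
  destruct (mean_value_open f df a b) as [c [Hc1 Hc2]]; auto; [lra|].
  specialize (Hp c Hc1). nra.
Qed.

Lemma increasing_of_derive (f df : R -> R) (a b : R) :
  a < b ->
  (forall t, a < t < b -> is_derive f t (df t)) ->
  (forall t, a <= t <= b -> continuity_pt f t) ->
  (forall t, a < t < b -> 0 < df t) -> f a < f b.
Proof.
  intros Hab Hd Hc Hp.
  destruct (mean_value_open f df a b) as [c [Hc1 Hc2]]; auto.
  specialize (Hp c Hc1). nra.
Qed.

(** The zero is the supremum of the times up to which [f] has stayed positive. *)
Lemma first_zero (f : R -> R) (a b : R) :
  a <= b -> (forall t, a <= t <= b -> continuity_pt f t) ->
  0 < f a -> f b <= 0 ->
  exists c, a < c <= b /\ f c = 0 /\ forall t, a <= t < c -> 0 < f t.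
Proof.
  intros Hab Hc Ha Hb.
  set (E := fun t => a <= t <= b /\ forall s, a <= s <= t -> 0 < f s).
  assert (HE : bound E) by (exists b; intros t [Ht _]; lra).
  assert (Ea : E a).
  { split; [lra|]. intros s Hs. now replace s with a by lra. }
  destruct (completeness E HE (ex_intro _ a Ea)) as [c [Hub Hlub]].
  assert (Hac : a <= c) by now apply Hub.
  assert (Hcb : c <= b) by (apply Hlub; intros t [Ht _]; lra).
  assert (Hlt : forall t, a <= t < c -> 0 < f t).
  { intros t Ht. destruct (Rlt_dec 0 (f t)) as [H|H]; [exact H|exfalso].
    assert (c <= t); [|lra]. apply Hlub. intros s [Hs1 Hs2].
    destruct (Rle_dec s t) as [H1|H1]; [exact H1|].
    exfalso. apply H. apply Hs2. lra. }
  assert (Hz : f c = 0).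
  { destruct (Rtotal_order (f c) 0) as [H|[H|H]]; [|exact H|].
    - destruct (continuity_pt_pos (fun t => - f t) c) as [e [He1 He2]];
        [apply continuity_pt_opp, Hc; lra|lra|].
      destruct (Req_dec a c) as [->|Hne]; [lra|].
      set (t := Rmax a (c - e / 2)).
      assert (a <= t) by apply Rmax_l.
      assert (c - e/2 <= t) by apply Rmax_r.
      assert (t < c) by (apply Rmax_lub_lt; lra).
      assert (0 < f t) by (apply Hlt; lra).
      assert (0 < - f t); [|lra]. apply He2. apply Rabs_def1; lra.
    - exfalso.
      destruct (continuity_pt_pos f c) as [e [He1 He2]];
        [apply Hc; lra|lra|].
      destruct (Req_dec b c) as [->|Hne]; [lra|].
      set (t := Rmin b (c + e / 2)).
      assert (t <= b) by apply Rmin_l.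
      assert (t <= c + e/2) by apply Rmin_r.
      assert (c < t) by (apply Rmin_glb_lt; lra).
      assert (Et : E t); [|pose proof (Hub t Et); lra].
      split; [lra|]. intros s Hs.
      destruct (Rlt_dec s c); [apply Hlt; lra|].
      apply He2. apply Rabs_def1; lra. }
  exists c. split; [|split; auto]. split; [|lra].
  destruct (Req_dec a c) as [E1|]; [|lra]. rewrite <- E1 in Hz. lra.
Qed.

Lemma last_zero (f : R -> R) (a b : R) :
  a <= b -> (forall t, a <= t <= b -> continuity_pt f t) ->
  f a <= 0 -> 0 < f b ->
  exists c, a <= c < b /\ f c = 0 /\ forall t, c < t <= b -> 0 < f t.
Proof.
  intros Hab Hc Ha Hb.
  destruct (first_zero (fun t => f (- t)) (- b) (- a)) as [c [H1 [H2 H3]]].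
  - lra.
  - intros t Ht. apply (continuity_pt_comp Ropp f).
    + apply continuity_pt_opp, derivable_continuous_pt, derivable_pt_id.
    + apply Hc. lra.
  - now rewrite Ropp_involutive.
  - now rewrite Ropp_involutive.
  - exists (- c). split; [lra|]. split; [exact H2|].
    intros t Ht. rewrite <- (Ropp_involutive t). apply H3. lra.
Qed.

Lemma is_derive_mul_exp (f : R -> R) (A x l : R) :
  is_derive f x l ->
  is_derive (fun t => f t * exp (A * t)) x ((l + A * f x) * exp (A * x)).
Proof.
  intros H. auto_derive.
  - now exists l.
  - replace (Derive (fun x0 => f x0) x) with l
      by (symmetry; now apply is_derive_unique). ring.
Qed.

Lemma continuity_pt_mul_exp (f : R -> R) (A x : R) :
  continuity_pt f x -> continuity_pt (fun t => f t * exp (A * t)) x.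
Proof.
  intros H. apply (continuity_pt_mult f (fun t => exp (A * t))); [exact H|].
  apply (continuity_pt_of_is_derive _ x (A * exp (A * x))).
  auto_derive; [exact I|ring].
Qed.

(** Up to a first zero [f t * exp (A * t)] is nondecreasing, so the zero is never reached. The
    inequality is asked only where [f] is positive, which is where a bound on a coefficient of [f]
    gives it. *)
Lemma linear_ineq_pos (f df : R -> R) (A a b : R) :
  a <= b ->
  (forall t, a < t < b -> is_derive f t (df t)) ->
  (forall t, a <= t <= b -> continuity_pt f t) ->
  (forall t, a < t < b -> 0 < f t -> - A * f t <= df t) ->
  0 < f a -> 0 < f b.
Proof.
  intros Hab Hd Hc Hi Ha. apply Rnot_le_lt. intros Hb.
  destruct (first_zero f a b Hab Hc Ha Hb) as [c [H1 [H2 H3]]].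
  assert (f a * exp (A * a) <= f c * exp (A * c)).
  { apply (nondecreasing_of_derive (fun t => f t * exp (A * t))
      (fun t => (df t + A * f t) * exp (A * t))).
    - lra.
    - intros t Ht. apply is_derive_mul_exp, Hd. lra.
    - intros t Ht. apply continuity_pt_mul_exp, Hc. lra.
    - intros t Ht. apply Rmult_le_pos; [|apply Rlt_le, exp_pos].
      assert (0 < f t) by (apply H3; lra).
      assert (- A * f t <= df t) by (apply Hi; lra). lra. }
  assert (0 < exp (A * a)) by apply exp_pos. rewrite H2 in H. nra.
Qed.

(** The mirror argument, run from the last zero: past it [f] would be negative while
    [f t * exp (- A * t)] is nondecreasing. *)
Lemma linear_ineq_nonneg (f df : R -> R) (A a b : R) :
  a <= b ->
  (forall t, a < t < b -> is_derive f t (df t)) ->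
  (forall t, a <= t <= b -> continuity_pt f t) ->
  (forall t, a < t < b -> f t < 0 -> A * f t <= df t) ->
  0 <= f a -> 0 <= f b.
Proof.
  intros Hab Hd Hc Hi Ha. apply Rnot_lt_le. intros Hb.
  destruct (last_zero (fun t => - f t) a b) as [c [H1 [H2 H3]]];
    try lra; [intros; apply continuity_pt_opp; auto|].
  assert (f c * exp (- A * c) <= f b * exp (- A * b)).
  { apply (nondecreasing_of_derive (fun t => f t * exp (- A * t))
      (fun t => (df t + - A * f t) * exp (- A * t))).
    - lra.
    - intros t Ht. apply is_derive_mul_exp, Hd. lra.
    - intros t Ht. apply continuity_pt_mul_exp, Hc. lra.
    - intros t Ht. apply Rmult_le_pos; [|apply Rlt_le, exp_pos].
      assert (0 < - f t) by (apply H3; lra).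
      assert (A * f t <= df t) by (apply Hi; lra). lra. }
  assert (0 < exp (- A * b)) by apply exp_pos.
  replace (f c) with 0 in H by lra. nra.
Qed.

(* If two quantities grow as long as both are positive, neither can be the first to vanish. *)
Lemma two_barriers (f g df dg : R -> R) (a b : R) :
  a <= b ->
  (forall t, a < t < b -> is_derive f t (df t)) ->
  (forall t, a < t < b -> is_derive g t (dg t)) ->
  (forall t, a <= t <= b -> continuity_pt f t) ->
  (forall t, a <= t <= b -> continuity_pt g t) ->
  (forall t, a < t < b -> 0 < f t -> 0 < g t -> 0 <= df t /\ 0 <= dg t) ->
  0 < f a -> 0 < g a -> 0 < f b /\ 0 < g b.
Proof.
  intros Hab Hf Hg Cf Cg Hi Fa Ga.
  set (h := fun t => Rmin (f t) (g t)).
  assert (Ch : forall t, a <= t <= b -> continuity_pt h t).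
  { intros t Ht. unfold h.
    apply continuity_pt_ext with (fun t => (f t + g t - Rabs (f t - g t)) / 2).
    - intros s. unfold Rmin. destruct (Rle_dec (f s) (g s)).
      + rewrite Rabs_left1; lra.
      + rewrite Rabs_right; lra.
    - apply continuity_pt_mult; [|apply continuity_pt_const; now intros ? ?].
      apply continuity_pt_minus; [apply continuity_pt_plus; auto|].
      apply (continuity_pt_comp (fun t => f t - g t) Rabs);
        [apply continuity_pt_minus; auto|apply Rcontinuity_abs]. }
  enough (0 < h b).
  { unfold h in H. split; eapply Rlt_le_trans; try exact H;
    [apply Rmin_l|apply Rmin_r]. }
  apply Rnot_le_lt. intros Hb.
  destruct (first_zero h a b Hab Ch) as [c [H1 [H2 H3]]]; auto.
  { now apply Rmin_glb_lt. }
  assert (Hpos : forall t, a <= t < c -> 0 < f t /\ 0 < g t).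
  { intros t Ht. specialize (H3 t Ht). unfold h in H3.
    split; eapply Rlt_le_trans; try exact H3; [apply Rmin_l|apply Rmin_r]. }
  assert (f a <= f c).
  { apply (nondecreasing_of_derive f df); [lra|intros; apply Hf; lra|
      intros; apply Cf; lra|].
    intros t Ht. destruct (Hpos t); [lra|]. apply Hi; auto; lra. }
  assert (g a <= g c).
  { apply (nondecreasing_of_derive g dg); [lra|intros; apply Hg; lra|
      intros; apply Cg; lra|].
    intros t Ht. destruct (Hpos t); [lra|]. apply Hi; auto; lra. }
  unfold h in H2. revert H2. unfold Rmin. destruct (Rle_dec (f c) (g c)); lra.
Qed.

Lemma abs_increment_le (f df g dg : R -> R) (a b : R) :
  a <= b ->
  (forall t, a < t < b -> is_derive f t (df t)) ->
  (forall t, a < t < b -> is_derive g t (dg t)) ->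
  (forall t, a <= t <= b -> continuity_pt f t) ->
  (forall t, a <= t <= b -> continuity_pt g t) ->
  (forall t, a < t < b -> Rabs (df t) <= dg t) ->
  Rabs (f b - f a) <= g b - g a.
Proof.
  intros Hab Hf Hg Cf Cg Hi. apply Rabs_le. split.
  - enough (g a + f a <= g b + f b) by lra.
    apply (nondecreasing_of_derive (fun t => g t + f t) (fun t => dg t + df t));
      auto.
    + intros t Ht. apply (is_derive_plus g f); auto.
    + intros t Ht. apply continuity_pt_plus; auto.
    + intros t Ht. specialize (Hi t Ht). apply Rabs_le_between in Hi. lra.
  - enough (g a - f a <= g b - f b) by lra.
    apply (nondecreasing_of_derive (fun t => g t - f t) (fun t => dg t - df t));
      auto.
    + intros t Ht. apply (is_derive_minus g f); auto.
    + intros t Ht. apply continuity_pt_minus; auto.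
    + intros t Ht. specialize (Hi t Ht). apply Rabs_le_between in Hi. lra.
Qed.

Lemma lipschitz_of_derive (f df : R -> R) (B a b : R) :
  (forall t, Rmin a b <= t <= Rmax a b -> is_derive f t (df t)) ->
  (forall t, Rmin a b <= t <= Rmax a b -> Rabs (df t) <= B) ->
  Rabs (f b - f a) <= B * Rabs (b - a).
Proof.
  intros Hd Hb.
  destruct (MVT_gen f a b df) as [c [Hc E]].
  - intros t Ht. apply Hd. lra.
  - intros t Ht. apply (continuity_pt_of_is_derive _ _ (df t)). now apply Hd.
  - rewrite E, Rabs_mult. apply Rmult_le_compat_r; [apply Rabs_pos|now apply Hb].
Qed.

Lemma continuity_pt_lipschitz (f : R -> R) (L x : R) :
  0 <= L -> (forall t, Rabs (f t - f x) <= L * Rabs (t - x)) -> continuity_pt f x.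
Proof.
  intros HL H e He. exists (e / (L + 1)). split.
  - apply Rdiv_lt_0_compat; lra.
  - intros t [_ Ht]. simpl in *. unfold R_dist in *.
    apply Rle_lt_trans with (1 := H t).
    apply Rle_lt_trans with ((L + 1) * Rabs (t - x)).
    + apply Rmult_le_compat_r; [apply Rabs_pos|lra].
    + apply Rmult_lt_compat_l with (r := L + 1) in Ht; [|lra].
      replace ((L + 1) * (e / (L + 1))) with e in Ht by (field; lra). exact Ht.
Qed.

Lemma Rmax0_lipschitz (x y : R) : Rabs (Rmax 0 x - Rmax 0 y) <= Rabs (x - y).
Proof.
  unfold Rmax. destruct (Rle_dec 0 x), (Rle_dec 0 y); split_Rabs; lra.
Qed.

Lemma is_derive_primitive (phi : R -> R) (a c x : R) :
  (forall t, continuity_pt phi t) ->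
  is_derive (fun x => c + RInt phi a x) x (phi x).
Proof.
  intros Hc.
  assert (H : is_derive (RInt phi a) x (phi x)).
  { apply (is_derive_RInt phi (RInt phi a) a x).
    - exists (mkposreal 1 Rlt_0_1). intros y _. apply (@RInt_correct R_CompleteNormedModule).
      apply (@ex_RInt_continuous R_CompleteNormedModule). intros z _. now apply continuity_pt_filterlim.
    - now apply continuity_pt_filterlim. }
  replace (phi x) with (0 + phi x) by ring.
  apply (is_derive_plus (fun _ => c) (RInt phi a)); [|exact H].
  apply (is_derive_const c).
Qed.

(** A derivative that stays close to some [m <> 0] makes [h] move, over a long enough interval, by
    more than its oscillation [2 * B]. *)
Lemma limit_of_derivative_zero (h dh : R -> R) (X0 B m : R) :
  (forall x, X0 < x -> is_derive h x (dh x)) ->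
  (forall x, X0 < x -> Rabs (h x) <= B) -> is_lim dh p_infty m -> m = 0.
Proof.
  intros Hd Hb Hm. destruct (Req_dec m 0) as [|Hne]; [assumption|exfalso].
  assert (Hp : 0 < Rabs m / 2) by (apply Rabs_pos_lt in Hne; lra).
  apply is_lim_spec in Hm. simpl in Hm.
  destruct (Hm (mkposreal _ Hp)) as [X HX]. simpl in HX.
  set (x := Rmax X0 X + 1).
  assert (X0 <= Rmax X0 X) by apply Rmax_l.
  assert (X <= Rmax X0 X) by apply Rmax_r.
  assert (B0 : 0 <= B) by (eapply Rle_trans; [apply Rabs_pos|apply (Hb (X0 + 1)); lra]).
  set (t := (2 * B + 1) / (Rabs m / 2)).
  assert (Ht : t * (Rabs m / 2) = 2 * B + 1) by (unfold t; field; lra).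
  assert (tp : 0 < t) by (apply Rdiv_lt_0_compat; lra).
  destruct (mean_value_open h dh x (x + t)) as [c [Hc E]].
  - lra.
  - intros s Hs. apply Hd. unfold x in Hs. lra.
  - intros s Hs. apply (continuity_pt_of_is_derive _ _ (dh s)), Hd.
    unfold x in Hs. lra.
  - assert (A1 := Hb x ltac:(unfold x; lra)).
    assert (A2 := Hb (x + t) ltac:(unfold x; lra)).
    assert (A3 := HX c ltac:(unfold x in Hc; lra)).
    apply Rabs_le_between in A1. apply Rabs_le_between in A2. apply Rabs_def2 in A3.
    replace (x + t - x) with t in E by ring.
    unfold Rabs in *. destruct (Rcase_abs m); nra.
Qed.

Lemma nondecreasing_bounded_limit (f : R -> R) (M : R) :
  (forall x y, 0 <= x <= y -> f x <= f y) -> (forall x, 0 <= x -> f x <= M) ->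
  exists l : R, is_lim f p_infty l /\ l <= M /\ forall x, 0 <= x -> f x <= l.
Proof.
  intros Hi HM.
  set (E := fun z => exists x, 0 <= x /\ z = f x).
  destruct (completeness E) as [l [Hub Hlub]].
  - exists M. intros z [x [Hx ->]]. auto.
  - exists (f 0), 0. split; [lra|reflexivity].
  - exists l. split; [|split].
    + apply is_lim_spec. intros eps. simpl.
      assert (H : exists x, 0 <= x /\ l - eps < f x).
      { apply Classical_Prop.NNPP. intros H. pose proof (cond_pos eps).
        assert (l <= l - eps); [|lra]. apply Hlub. intros z [x [Hx ->]].
        apply Rnot_lt_le. intros Hl. apply H. exists x. split; auto. }
      destruct H as [x0 [Hx0 Hl]]. exists x0. intros x Hx.
      assert (f x <= l) by (apply Hub; exists x; split; [lra|reflexivity]).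
      assert (f x0 <= f x) by (apply Hi; lra).
      pose proof (cond_pos eps). apply Rabs_def1; lra.
    + apply Hlub. intros z [x [Hx ->]]. auto.
    + intros x Hx. apply Hub. exists x. auto.
Qed.

(** * Picard iteration *)

Section Picard.
Variables (I : Type) (F : I -> (I -> R) -> R) (L B : R).
Hypothesis L_pos : 0 < L.
Hypothesis B_pos : 0 < B.
Hypothesis F_bounded : forall i s, Rabs (F i s) <= B.
Hypothesis F_lipschitz : forall s s' e, (forall j, Rabs (s j - s' j) <= e) ->
  forall i, Rabs (F i s - F i s') <= L * e.

(** [Rmax 0 t] freezes the iterates to the left of 0: the integrand is then continuous on the whole
    line and the primitive is differentiable at 0 as well. *)
Fixpoint picard (y0 : I -> R) (k : nat) : I -> R -> R :=
  match k with
  | O => fun i _ => y0 i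
  | S k => fun i x =>
      y0 i + RInt (fun t => F i (fun j => picard y0 k j (Rmax 0 t))) 0 x
  end.

Lemma continuity_field (y : I -> R -> R) (i : I) (x : R) :
  (forall j s t, Rabs (y j s - y j t) <= B * Rabs (s - t)) ->
  continuity_pt (fun t => F i (fun j => y j (Rmax 0 t))) x.
Proof.
  intros Hy. apply (continuity_pt_lipschitz _ (L * B)); [nra|].
  intros t. rewrite Rmult_assoc. apply F_lipschitz. intros j.
  eapply Rle_trans; [apply Hy|].
  apply Rmult_le_compat_l; [lra|apply Rmax0_lipschitz].
Qed.

Lemma lipschitz_primitive (phi : R -> R) (c : R) :
  (forall t, continuity_pt phi t) -> (forall t, Rabs (phi t) <= B) ->
  forall s t, Rabs ((c + RInt phi 0 s) - (c + RInt phi 0 t)) <= B * Rabs (s - t).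
Proof.
  intros Hc Hb s t.
  apply (lipschitz_of_derive (fun x => c + RInt phi 0 x) phi); intros; auto.
  now apply is_derive_primitive.
Qed.

Lemma picard_lipschitz (y0 : I -> R) (k : nat) (j : I) (s t : R) :
  Rabs (picard y0 k j s - picard y0 k j t) <= B * Rabs (s - t).
Proof.
  revert j s t. induction k as [|k IH]; intros j s t; simpl.
  - rewrite Rminus_diag, Rabs_R0. apply Rmult_le_pos; [lra|apply Rabs_pos].
  - apply (lipschitz_primitive (fun t => F j (fun i => picard y0 k i (Rmax 0 t)))).
    + intros x. now apply continuity_field.
    + intros x. apply F_bounded.
Qed.

Lemma is_derive_picard (y0 : I -> R) (k : nat) (i : I) (x : R) :
  is_derive (picard y0 (S k) i) x (F i (fun j => picard y0 k j (Rmax 0 x))).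
Proof.
  apply (is_derive_primitive (fun t => F i (fun j => picard y0 k j (Rmax 0 t)))).
  intros t. apply continuity_field. apply picard_lipschitz.
Qed.

Lemma picard_0 (y0 : I -> R) (k : nat) (i : I) : picard y0 k i 0 = y0 i.
Proof.
  destruct k; simpl; [reflexivity|].
  rewrite RInt_point. apply Rplus_0_r.
Qed.

Lemma continuity_picard (y0 : I -> R) (k : nat) (i : I) (x : R) :
  continuity_pt (picard y0 k i) x.
Proof.
  apply (continuity_pt_lipschitz _ B); [lra|]. intros t. apply picard_lipschitz.
Qed.

Lemma continuity_exp_mult (c a x : R) : continuity_pt (fun t => c * exp (a * t)) x.
Proof.
  apply (continuity_pt_of_is_derive _ x (c * a * exp (a * x))).
  auto_derive; [exact Logic.I|ring].
Qed.

(* In the norm weighted by exp (- 2 L x), the Picard map is a contraction of ratio 1/2. *)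
Lemma picard_step (y0 : I -> R) (k : nat) (i : I) (x : R) :
  0 <= x ->
  Rabs (picard y0 (S k) i x - picard y0 k i x)
    <= B / (2 * L) * (/ 2) ^ k * exp (2 * L * x).
Proof.
  revert i x. induction k as [|k IH]; intros i x Hx.
  - assert (H := picard_lipschitz y0 1 i x 0). rewrite picard_0 in H.
    rewrite Rminus_0_r, (Rabs_pos_eq x Hx) in H.
    eapply Rle_trans; [apply H|].
    assert (1 + 2 * L * x <= exp (2 * L * x)) by apply exp_ineq1_le.
    rewrite pow_O, Rmult_1_r.
    apply Rle_trans with (B / (2 * L) * (2 * L * x)); [apply Req_le; field; lra|].
    apply Rmult_le_compat_l; [|lra]. apply Rlt_le, Rdiv_lt_0_compat; lra.
  - set (M := B / (2 * L) * (/ 2) ^ S k).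
    assert (HM : M = B / (2 * L) * (/ 2) ^ k / 2) by (unfold M; simpl; field; lra).
    assert (M0 : 0 <= M).
    { unfold M. apply Rmult_le_pos; [apply Rlt_le, Rdiv_lt_0_compat; lra|].
      apply pow_le; lra. }
    set (f := fun t => picard y0 (S (S k)) i t - picard y0 (S k) i t).
    set (g := fun t => M * exp (2 * L * t)).
    assert (H : Rabs (f x - f 0) <= g x - g 0).
    { apply (abs_increment_le f
        (fun t => F i (fun j => picard y0 (S k) j (Rmax 0 t)) -
                  F i (fun j => picard y0 k j (Rmax 0 t)))
        g (fun t => M * (2 * L) * exp (2 * L * t))); auto.
      - intros t Ht. apply (is_derive_minus (picard y0 (S (S k)) i) (picard y0 (S k) i));
          apply is_derive_picard.
      - intros t Ht. unfold g. auto_derive; [exact Logic.I|ring].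
      - intros t Ht. apply continuity_pt_minus; apply continuity_picard.
      - intros t Ht. apply continuity_exp_mult.
      - intros t Ht. rewrite Rmax_right by lra.
        eapply Rle_trans; [apply F_lipschitz; intros j; apply IH; lra|].
        rewrite HM. apply Req_le. field. lra. }
    unfold f in H at 2. rewrite !picard_0, Rminus_diag, Rminus_0_r in H.
    unfold g in H at 2. rewrite Rmult_0_r, exp_0 in H.
    unfold f, g in H. lra.
Qed.

(** The geometric sum is kept in telescoped form so that the induction on [n] closes; letting [n]
    grow gives the error bound for the limit. *)
Lemma picard_cauchy (y0 : I -> R) (n k : nat) (i : I) (x : R) :
  0 <= x ->
  Rabs (picard y0 (n + k) i x - picard y0 k i x)
    <= B / L * exp (2 * L * x) * ((/ 2) ^ k - (/ 2) ^ (n + k)).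
Proof.
  intros Hx. induction n as [|n IH]; [change (0 + k)%nat with k|change (S n + k)%nat with (S (n + k))].
  - rewrite !Rminus_diag, Rabs_R0. lra.
  - replace (picard y0 (S (n + k)) i x - picard y0 k i x) with
      ((picard y0 (S (n + k)) i x - picard y0 (n + k) i x)
       + (picard y0 (n + k) i x - picard y0 k i x)) by ring.
    eapply Rle_trans; [apply Rabs_triang|].
    assert (H := picard_step y0 (n + k) i x Hx).
    replace (B / (2 * L)) with (B / L / 2) in H by (field; lra).
    change ((/2) ^ S (n + k)) with (/2 * (/2) ^ (n + k)).
    revert IH H. generalize ((/2) ^ (n + k)) ((/2) ^ k) (B / L) (exp (2 * L * x)).
    intros p q c E IH H.
    apply Rle_trans with (c / 2 * p * E + c * E * (q - p)); [lra|].
    apply Req_le. field.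
Qed.

Lemma picard_converges (y0 : I -> R) (i : I) (x : R) :
  0 <= x -> ex_finite_lim_seq (fun k => picard y0 k i x).
Proof.
  intros Hx. apply ex_lim_seq_cauchy_corr. intros eps.
  set (C := B / L * exp (2 * L * x)).
  assert (HC : 0 < C).
  { apply Rmult_lt_0_compat; [apply Rdiv_lt_0_compat; lra|apply exp_pos]. }
  assert (Hg : is_lim_seq (fun k => (/2) ^ k) 0)
    by (apply is_lim_seq_geom; rewrite Rabs_pos_eq; lra).
  apply is_lim_seq_spec in Hg.
  assert (He : 0 < eps / (2 * C)) by (apply Rdiv_lt_0_compat; [apply cond_pos|lra]).
  destruct (Hg (mkposreal _ He)) as [N HN]. exists N.
  assert (HE : forall n, (N <= n)%nat ->
    Rabs (picard y0 n i x - picard y0 N i x) < eps / 2).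
  { intros n Hn. replace n with ((n - N) + N)%nat by lia.
    eapply Rle_lt_trans; [now apply picard_cauchy|]. fold C.
    specialize (HN N (Nat.le_refl N)). simpl in HN.
    rewrite Rminus_0_r, Rabs_pos_eq in HN by (apply pow_le; lra).
    assert (0 <= (/2) ^ (n - N + N)) by (apply pow_le; lra).
    apply Rle_lt_trans with (C * (/2) ^ N).
    - apply Rmult_le_compat_l; lra.
    - apply Rmult_lt_compat_l with (r := C) in HN; [|exact HC].
      replace (C * (eps / (2 * C))) with (eps / 2) in HN by (field; lra).
      exact HN. }
  intros n m Hn Hm.
  replace (picard y0 n i x - picard y0 m i x) with
    ((picard y0 n i x - picard y0 N i x) - (picard y0 m i x - picard y0 N i x))
    by ring.
  eapply Rle_lt_trans; [apply Rabs_triang|]. rewrite Rabs_Ropp.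
  specialize (HE n Hn) as H1. specialize (HE m Hm) as H2. lra.
Qed.

Definition picard_lim (y0 : I -> R) (i : I) (x : R) : R :=
  real (Lim_seq (fun k => picard y0 k i x)).

Lemma picard_lim_correct (y0 : I -> R) (i : I) (x : R) :
  0 <= x -> is_lim_seq (fun k => picard y0 k i x) (picard_lim y0 i x).
Proof. intros Hx. apply Lim_seq_correct'. now apply picard_converges. Qed.

Lemma is_lim_seq_abs_le (a : nat -> R) (l c M : R) :
  is_lim_seq a l -> (forall n, Rabs (a n - c) <= M) -> Rabs (l - c) <= M.
Proof.
  intros Ha Hb.
  assert (H : is_lim_seq (fun n => Rabs (a n - c)) (Rabs (l - c))).
  { apply (is_lim_seq_abs (fun n => a n - c) (l - c)).
    apply (is_lim_seq_minus' a (fun _ => c)); [exact Ha|apply is_lim_seq_const]. }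
  apply (is_lim_seq_le _ (fun _ => M) _ _ Hb H (is_lim_seq_const M)).
Qed.

Lemma picard_lim_close (y0 : I -> R) (k : nat) (i : I) (x : R) :
  0 <= x ->
  Rabs (picard_lim y0 i x - picard y0 k i x) <= B / L * exp (2 * L * x) * (/ 2) ^ k.
Proof.
  intros Hx.
  apply (is_lim_seq_abs_le (fun n => picard y0 (n + k) i x)).
  - apply is_lim_seq_incr_n with (N := k) (u := fun n => picard y0 n i x).
    now apply picard_lim_correct.
  - intros n. eapply Rle_trans; [now apply picard_cauchy|].
    apply Rmult_le_compat_l.
    + apply Rmult_le_pos; [apply Rlt_le, Rdiv_lt_0_compat; lra|apply Rlt_le, exp_pos].
    + assert (0 <= (/2) ^ (n + k)) by (apply pow_le; lra). lra.
Qed.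

Lemma picard_lim_lipschitz (y0 : I -> R) (j : I) (s t : R) :
  0 <= s -> 0 <= t ->
  Rabs (picard_lim y0 j s - picard_lim y0 j t) <= B * Rabs (s - t).
Proof.
  intros Hs Ht.
  assert (H : is_lim_seq (fun k => picard y0 k j s - picard y0 k j t)
    (picard_lim y0 j s - picard_lim y0 j t)).
  { apply is_lim_seq_minus'; now apply picard_lim_correct. }
  apply (is_lim_seq_abs_le _ _ 0 (B * Rabs (s - t))) in H.
  - now rewrite Rminus_0_r in H.
  - intros k. rewrite Rminus_0_r. apply picard_lipschitz.
Qed.

(** Defined as an integral along the limit, so that differentiability comes for free; [flow_picard]
    then identifies it with the limit itself. *)
Definition flow (y0 : I -> R) (i : I) (x : R) : R :=
  y0 i + RInt (fun t => F i (fun j => picard_lim y0 j (Rmax 0 t))) 0 x.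

Lemma is_derive_flow_aux (y0 : I -> R) (i : I) (x : R) :
  is_derive (flow y0 i) x (F i (fun j => picard_lim y0 j (Rmax 0 x))).
Proof.
  apply (is_derive_primitive (fun t => F i (fun j => picard_lim y0 j (Rmax 0 t)))).
  intros t. apply (continuity_pt_lipschitz _ (L * B)); [nra|].
  intros s. rewrite Rmult_assoc. apply F_lipschitz. intros j.
  eapply Rle_trans; [apply picard_lim_lipschitz; apply Rmax_l|].
  apply Rmult_le_compat_l; [lra|apply Rmax0_lipschitz].
Qed.

Lemma flow_0 (y0 : I -> R) (i : I) : flow y0 i 0 = y0 i.
Proof. unfold flow. rewrite RInt_point. apply Rplus_0_r. Qed.

Lemma flow_picard (y0 : I -> R) (k : nat) (i : I) (x : R) :
  0 <= x ->
  Rabs (flow y0 i x - picard y0 (S k) i x)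
    <= B / (2 * L) * (/ 2) ^ k * exp (2 * L * x).
Proof.
  intros Hx.
  set (M := B / (2 * L) * (/ 2) ^ k).
  assert (M0 : 0 <= M).
  { unfold M. apply Rmult_le_pos; [apply Rlt_le, Rdiv_lt_0_compat; lra|].
    apply pow_le; lra. }
  set (f := fun t => flow y0 i t - picard y0 (S k) i t).
  set (g := fun t => M * exp (2 * L * t)).
  assert (H : Rabs (f x - f 0) <= g x - g 0).
  { assert (D : forall t, is_derive f t
      (F i (fun j => picard_lim y0 j (Rmax 0 t)) -
                F i (fun j => picard y0 k j (Rmax 0 t)))).
    { intros t. apply (is_derive_minus (flow y0 i) (picard y0 (S k) i));
        [apply is_derive_flow_aux|apply is_derive_picard]. }
    apply (abs_increment_le f
      (fun t => F i (fun j => picard_lim y0 j (Rmax 0 t)) -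
                F i (fun j => picard y0 k j (Rmax 0 t)))
      g (fun t => M * (2 * L) * exp (2 * L * t))); auto.
    - intros t Ht. unfold g. auto_derive; [exact Logic.I|ring].
    - intros t Ht. eapply continuity_pt_of_is_derive; apply D.
    - intros t Ht. apply continuity_exp_mult.
    - intros t Ht. rewrite Rmax_right by lra.
      eapply Rle_trans; [apply F_lipschitz; intros j; apply picard_lim_close; lra|].
      unfold M. apply Req_le. field. lra. }
  unfold f in H at 2. rewrite flow_0, picard_0, Rminus_diag, Rminus_0_r in H.
  unfold g in H at 2. rewrite Rmult_0_r, exp_0 in H.
  unfold f, g in H. lra.
Qed.

Lemma flow_is_picard_lim (y0 : I -> R) (i : I) (x : R) :
  0 <= x -> flow y0 i x = picard_lim y0 i x.
Proof.
  intros Hx.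
  assert (H : is_lim_seq (fun k => picard y0 (S k) i x) (flow y0 i x)).
  { apply is_lim_seq_spec. intros eps.
    set (C := B / (2 * L) * exp (2 * L * x)).
    assert (Hg : is_lim_seq (fun k => C * (/2) ^ k) (C * 0)).
    { apply (is_lim_seq_scal_l (fun k => (/2)^k) C 0).
      apply is_lim_seq_geom; rewrite Rabs_pos_eq; lra. }
    rewrite Rmult_0_r in Hg. apply is_lim_seq_spec in Hg.
    destruct (Hg eps) as [N HN]. exists N. intros n Hn.
    specialize (HN n Hn). rewrite Rminus_0_r in HN.
    rewrite Rabs_minus_sym. eapply Rle_lt_trans; [now apply flow_picard|].
    eapply Rle_lt_trans; [|exact HN].
    eapply Rle_trans; [|apply Rle_abs]. unfold C. lra. }
  apply (is_lim_seq_incr_1 (fun k => picard y0 k i x)) in H.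
  apply is_lim_seq_unique in H. unfold picard_lim. now rewrite H.
Qed.

(** The extensionality premise on [F] replaces functional extensionality when the limit is rewritten
    as the flow. *)
Lemma is_derive_flow (y0 : I -> R) (i : I) (x : R) :
  (forall s s' i, (forall j, s j = s' j) -> F i s = F i s') ->
  0 <= x -> is_derive (flow y0 i) x (F i (fun j => flow y0 j x)).
Proof.
  intros Hext Hx. assert (H := is_derive_flow_aux y0 i x).
  rewrite Rmax_right in H by exact Hx.
  rewrite (Hext _ (fun j => flow y0 j x)) in H; [exact H|].
  intros j. now rewrite flow_is_picard_lim.
Qed.

Lemma continuity_flow (y0 : I -> R) (i : I) (x : R) : continuity_pt (flow y0 i) x.
Proof. eapply continuity_pt_of_is_derive. apply is_derive_flow_aux. Qed.

Lemma picard_dependence (y0 y1 : I -> R) (e : R) (k : nat) (i : I) (x : R) :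
  0 <= x -> (forall j, Rabs (y0 j - y1 j) <= e) ->
  Rabs (picard y0 k i x - picard y1 k i x) <= e * exp (L * x).
Proof.
  intros Hx He. revert i x Hx.
  (* [I] may be empty, so the sign of [e] is available only once an index is given. *)
  assert (e0 : forall i : I, 0 <= e)
    by (intros i; eapply Rle_trans; [apply Rabs_pos|apply (He i)]).
  induction k as [|k IH]; intros i x Hx.
  - simpl. apply Rle_trans with (1 := He i).
    assert (0 <= L * x) by nra.
    assert (1 <= exp (L * x)) by (pose proof (exp_ineq1_le (L * x)); lra).
    specialize (e0 i). nra.
  - set (f := fun t => picard y0 (S k) i t - picard y1 (S k) i t).
    set (g := fun t => e * exp (L * t)).
    assert (H : Rabs (f x - f 0) <= g x - g 0).
    { apply (abs_increment_le f
        (fun t => F i (fun j => picard y0 k j (Rmax 0 t)) -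
                  F i (fun j => picard y1 k j (Rmax 0 t)))
        g (fun t => e * L * exp (L * t))); auto.
      - intros t Ht. apply (is_derive_minus (picard y0 (S k) i) (picard y1 (S k) i));
          apply is_derive_picard.
      - intros t Ht. unfold g. auto_derive; [exact Logic.I|ring].
      - intros t Ht. apply continuity_pt_minus; apply continuity_picard.
      - intros t Ht. apply continuity_exp_mult.
      - intros t Ht. rewrite Rmax_right by lra.
        eapply Rle_trans; [apply F_lipschitz; intros j; apply IH; lra|].
        lra. }
    unfold f in H at 2. rewrite !picard_0 in H.
    unfold g in H at 2. rewrite Rmult_0_r, exp_0 in H.
    change (Rabs (f x) <= g x).
    replace (f x) with ((f x - (y0 i - y1 i)) + (y0 i - y1 i)) by ring.
    eapply Rle_trans; [apply Rabs_triang|]. specialize (He i). lra.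
Qed.

Lemma flow_dependence (y0 y1 : I -> R) (e : R) (i : I) (x : R) :
  0 <= x -> (forall j, Rabs (y0 j - y1 j) <= e) ->
  Rabs (flow y0 i x - flow y1 i x) <= e * exp (L * x).
Proof.
  intros Hx He. rewrite !flow_is_picard_lim by exact Hx.
  assert (H : is_lim_seq (fun k => picard y0 k i x - picard y1 k i x)
    (picard_lim y0 i x - picard_lim y1 i x)).
  { apply is_lim_seq_minus'; now apply picard_lim_correct. }
  apply (is_lim_seq_abs_le _ _ 0 (e * exp (L * x))) in H.
  - now rewrite Rminus_0_r in H.
  - intros k. rewrite Rminus_0_r. now apply picard_dependence.
Qed.

End Picard.

(** * Orbits of the reduced system *)

Lemma continuity_bounded (f : R -> R) (a b : R) :
  (forall t, a <= t <= b -> continuity_pt f t) ->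
  exists A, 0 < A /\ forall t, a <= t <= b -> Rabs (f t) <= A.
Proof.
  intros Hc. destruct (Rle_dec a b) as [Hab|Hab].
  - destruct (continuity_ab_maj (fun t => Rabs (f t)) a b Hab) as [m [Hm _]].
    { intros c Hc'. apply (continuity_pt_comp f Rabs); [auto|apply Rcontinuity_abs]. }
    exists (Rabs (f m) + 1). split; [pose proof (Rabs_pos (f m)); lra|].
    intros t Ht. specialize (Hm t Ht). simpl in Hm. lra.
  - exists 1. split; [lra|]. intros t Ht. lra.
Qed.

Lemma continuity_lower_bound (f : R -> R) (a b : R) :
  (forall t, a <= t <= b -> continuity_pt f t) ->
  (forall t, a <= t <= b -> 0 < f t) ->
  exists m, 0 < m /\ forall t, a <= t <= b -> m <= f t.
Proof.
  intros Hc Hp. destruct (Rle_dec a b) as [Hab|Hab].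
  - destruct (continuity_ab_min f a b Hab Hc) as [m [Hm Hm']].
    exists (f m). split; auto.
  - exists 1. split; [lra|]. intros t Ht. lra.
Qed.

(** Division by zero returns zero, so positivity of the quotient alone forces both numbers to be
    nonzero. *)
Lemma sgn_div (c j : R) : 0 < c / j -> c <> 0 /\ j <> 0 /\ 0 < j / c.
Proof.
  intros H.
  assert (Hj : j <> 0).
  { intros E. rewrite E in H. unfold Rdiv in H. rewrite Rinv_0, Rmult_0_r in H. lra. }
  assert (Hc : c <> 0).
  { intros E. rewrite E in H. unfold Rdiv in H. rewrite Rmult_0_l in H. lra. }
  split; [|split]; auto.
  replace (j / c) with (/ (c / j)) by (field; auto). now apply Rinv_0_lt_compat.
Qed.

(** The domain [0 < c / j] is the open half-line of the sign of [j]. Leaving that sign open makes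
    the notion stable under [c -> - c], [j -> - j]. *)
Definition C1_on (j : R) (f df : R -> R) : Prop :=
  forall c, 0 < c / j -> is_derive f c (df c) /\ continuity_pt df c.

(* Both densities are eliminated through the conserved fluxes: with [j] the second flux, [n = j / v], so that [y = f1 u - mu u'] and [f2 v - n v' = K - y] for the total momentum [K]. *)
Record orbit_on (f1 f2 : R -> R) (mu j K : R) (u v y : R -> R) (x0 x1 : R) : Prop :=
 { orbit_cu : forall x, x0 <= x <= x1 -> continuity_pt u x;
   orbit_cv : forall x, x0 <= x <= x1 -> continuity_pt v x;
   orbit_cy : forall x, x0 <= x <= x1 -> continuity_pt y x;
   orbit_u : forall x, x0 <= x <= x1 -> 0 < u x / j;
   orbit_v : forall x, x0 <= x <= x1 -> 0 < v x / j;
   orbit_du : forall x, x0 < x < x1 -> is_derive u x ((f1 (u x) - y x) / mu);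
   orbit_dv : forall x, x0 < x < x1 ->
     is_derive v x (v x / j * (f2 (v x) + y x - K));
   orbit_dy : forall x, x0 < x < x1 -> is_derive y x (j * (1 - u x / v x)) }.

Arguments orbit_cu {f1 f2 mu j K u v y x0 x1}.
Arguments orbit_cv {f1 f2 mu j K u v y x0 x1}.
Arguments orbit_cy {f1 f2 mu j K u v y x0 x1}.
Arguments orbit_u {f1 f2 mu j K u v y x0 x1}.
Arguments orbit_v {f1 f2 mu j K u v y x0 x1}.
Arguments orbit_du {f1 f2 mu j K u v y x0 x1}.
Arguments orbit_dv {f1 f2 mu j K u v y x0 x1}.
Arguments orbit_dy {f1 f2 mu j K u v y x0 x1}.

Lemma orbit_on_sub f1 f2 mu j K u v y x0 x1 a b :
  orbit_on f1 f2 mu j K u v y x0 x1 -> x0 <= a -> b <= x1 ->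
  orbit_on f1 f2 mu j K u v y a b.
Proof.
  intros [] Ha Hb. split; intros x Hx;
  match goal with H : forall x, _ -> ?P |- _ => idtac end; auto with real;
  first [apply orbit_cu0|apply orbit_cv0|apply orbit_cy0|apply orbit_u0
        |apply orbit_v0|apply orbit_du0|apply orbit_dv0|apply orbit_dy0]; lra.
Qed.

Lemma is_derive_reflect (f : R -> R) (c l : R) :
  is_derive f (- c) l -> is_derive (fun t => f (- t)) c (- l).
Proof.
  intros H. replace (- l) with (scal (- 1) l) by (unfold scal; simpl; unfold mult; simpl; ring).
  apply (is_derive_comp f Ropp); [exact H|]. auto_derive; [exact I|ring].
Qed.

Lemma C1_on_opp (j : R) (f df : R -> R) :
  C1_on j f df -> C1_on (- j) (fun c => - f (- c)) (fun c => df (- c)).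
Proof.
  intros H c Hc.
  assert (Hc' : 0 < - c / j).
  { destruct (sgn_div _ _ Hc) as [_ [Hj _]].
    replace (- c / j) with (c / - j) by (field; lra). exact Hc. }
  destruct (H _ Hc') as [H1 H2]. split.
  - rewrite <- (Ropp_involutive (df (- c))).
    now apply (is_derive_opp (fun t => f (- t))), is_derive_reflect.
  - apply (continuity_pt_comp Ropp df); [|exact H2].
    apply continuity_pt_opp, derivable_continuous_pt, derivable_pt_id.
Qed.

(** Changing the signs of the velocities, of [y], of the flux and of the total momentum preserves
    the form of the system and exchanges increasing and decreasing orbits, so sign statements
    transfer from one kind to the other. *)
Lemma orbit_on_opp f1 f2 mu j K u v y x0 x1 :
  orbit_on f1 f2 mu j K u v y x0 x1 ->
  orbit_on (fun c => - f1 (- c)) (fun c => - f2 (- c)) mu (- j) (- K)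
    (fun x => - u x) (fun x => - v x) (fun x => - y x) x0 x1.
Proof.
  intros H.
  assert (Hj : forall c, 0 < c / j -> - c / - j = c / j).
  { intros c Hc. destruct (sgn_div _ _ Hc) as [_ [E _]]. field. lra. }
  destruct H as [cu cv cy pu pv du dv dy].
  split; intros x Hx; try (apply continuity_pt_opp; auto).
  - rewrite Hj; auto.
  - rewrite Hj; auto.
  - rewrite Ropp_involutive.
    replace ((- f1 (u x) - - y x) / mu) with (opp ((f1 (u x) - y x) / mu))
      by (unfold opp; simpl; unfold Rdiv; ring).
    apply @is_derive_opp. auto.
  - rewrite Ropp_involutive, Hj by (apply pv; lra).
    replace (v x / j * (- f2 (v x) + - y x - - K))
      with (opp (v x / j * (f2 (v x) + y x - K))) by (unfold opp; simpl; ring).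
    apply @is_derive_opp. auto.
  - destruct (sgn_div _ _ (pv x ltac:(lra))) as [E _].
    replace (- j * (1 - - u x / - v x)) with (opp (j * (1 - u x / v x)))
      by (unfold opp; simpl; field; lra).
    apply @is_derive_opp. auto.
Qed.

(** * Signs of the velocity derivatives along an orbit *)

Section Orbits.
Variables (f1 df1 f2 df2 : R -> R) (mu j K : R).
Hypothesis mu_pos : 0 < mu.
Hypothesis C1_f1 : C1_on j f1 df1.
Hypothesis C1_f2 : C1_on j f2 df2.

Lemma C1_on_continuity (f df : R -> R) (c : R) :
  C1_on j f df -> 0 < c / j -> continuity_pt f c.
Proof. intros H Hc. eapply continuity_pt_of_is_derive. now apply H. Qed.

Lemma C1_on_mult_id (f df : R -> R) :
  C1_on j f df -> C1_on j (fun c => c * f c) (fun c => f c + c * df c).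
Proof.
  intros H c Hc. destruct (H c Hc) as [H1 H2]. split.
  - replace (f c + c * df c) with (plus (mult one (f c)) (mult c (df c)))
      by (unfold plus, mult, one; simpl; ring).
    apply (is_derive_mult (fun c => c) f); [apply @is_derive_id|exact H1|].
    intros; apply Rmult_comm.
  - apply continuity_pt_plus; [eapply continuity_pt_of_is_derive; exact H1|].
    apply continuity_pt_mult; [apply derivable_continuous_pt, derivable_pt_id|exact H2].
Qed.

Lemma orbit_cP u v y x0 x1 x :
  orbit_on f1 f2 mu j K u v y x0 x1 -> x0 <= x <= x1 ->
  continuity_pt (fun t => f1 (u t) - y t) x.
Proof.
  intros [] Hx. apply continuity_pt_minus; auto.
  apply (continuity_pt_comp u f1); auto. eapply C1_on_continuity; eauto.
Qed.

Lemma orbit_cQ u v y x0 x1 x :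
  orbit_on f1 f2 mu j K u v y x0 x1 -> x0 <= x <= x1 ->
  continuity_pt (fun t => f2 (v t) + y t - K) x.
Proof.
  intros [] Hx. apply continuity_pt_minus; [|apply continuity_pt_const; now intros ? ?].
  apply continuity_pt_plus; auto.
  apply (continuity_pt_comp v f2); auto. eapply C1_on_continuity; eauto.
Qed.

(** The quantity is [mu u']. It obeys a scalar equation, linear up to the source
    [- j * (1 - u / v)], which has the sign of [u - v] because [j / v > 0]. For [f2 v + y - K] the
    source is the opposite one. *)
Lemma orbit_dP u v y x0 x1 x :
  orbit_on f1 f2 mu j K u v y x0 x1 -> x0 < x < x1 ->
  is_derive (fun t => f1 (u t) - y t) x
    (df1 (u x) * ((f1 (u x) - y x) / mu) - j * (1 - u x / v x)).
Proof.
  intros H Hx. apply (is_derive_minus (fun t => f1 (u t)) y).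
  - rewrite Rmult_comm. apply (is_derive_comp f1 u).
    + apply C1_f1. apply (orbit_u H). lra.
    + apply (orbit_du H). lra.
  - apply (orbit_dy H). lra.
Qed.

Lemma orbit_dQ u v y x0 x1 x :
  orbit_on f1 f2 mu j K u v y x0 x1 -> x0 < x < x1 ->
  is_derive (fun t => f2 (v t) + y t - K) x
    (df2 (v x) * (v x / j * (f2 (v x) + y x - K)) + j * (1 - u x / v x)).
Proof.
  intros H Hx.
  replace (df2 (v x) * (v x / j * (f2 (v x) + y x - K)) + j * (1 - u x / v x))
    with (minus (plus (scal (v x / j * (f2 (v x) + y x - K)) (df2 (v x)))
      (j * (1 - u x / v x))) zero)
    by (unfold minus, plus, opp, scal, zero; simpl; unfold mult; simpl; ring).
  apply (is_derive_minus (fun t => f2 (v t) + y t) (fun _ => K));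
    [|apply @is_derive_const].
  apply (is_derive_plus (fun t => f2 (v t)) y).
  - apply (is_derive_comp f2 v).
    + apply C1_f2. apply (orbit_v H). lra.
    + apply (orbit_dv H). lra.
  - apply (orbit_dy H). lra.
Qed.

Lemma coupling_sign (a c : R) : 0 < c / j ->
  (a <= c -> 0 <= j * (1 - a / c)) /\ (c <= a -> j * (1 - a / c) <= 0) /\
  (a < c -> 0 < j * (1 - a / c)) /\ (c < a -> j * (1 - a / c) < 0).
Proof.
  intros Hc. destruct (sgn_div _ _ Hc) as [E1 [E2 E3]].
  replace (j * (1 - a / c)) with (j / c * (c - a)) by (field; auto).
  repeat split; intros; nra.
Qed.

(** Compactness supplies the single rate [A] needed by the linear differential inequalities. *)
Lemma orbit_coef_bound u v y x0 x1 :
  orbit_on f1 f2 mu j K u v y x0 x1 ->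
  exists A, 0 < A /\ forall x, x0 <= x <= x1 ->
    Rabs (df1 (u x) / mu) <= A /\ Rabs (df2 (v x) * (v x / j)) <= A.
Proof.
  intros H.
  destruct (continuity_bounded (fun x => df1 (u x) / mu) x0 x1) as [A1 [H1 H1']].
  { intros x Hx. apply continuity_pt_mult; [|apply continuity_pt_const; now intros ? ?].
    apply (continuity_pt_comp u df1); [now apply H|]. apply C1_f1. now apply H. }
  destruct (continuity_bounded (fun x => df2 (v x) * (v x / j)) x0 x1) as [A2 [H2 H2']].
  { intros x Hx. apply continuity_pt_mult.
    - apply (continuity_pt_comp v df2); [now apply H|]. apply C1_f2. now apply H.
    - apply continuity_pt_mult; [now apply H|apply continuity_pt_const; now intros ? ?]. }
  exists (A1 + A2). split; [lra|]. intros x Hx.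
  specialize (H1' x Hx). specialize (H2' x Hx). simpl in *. lra.
Qed.

Lemma Rmult_lower (c A p : R) : Rabs c <= A -> 0 <= p -> - A * p <= c * p.
Proof. intros H Hp. apply Rabs_le_between in H. nra. Qed.

Lemma Rmult_upper (c A p : R) : Rabs c <= A -> p <= 0 -> A * p <= c * p.
Proof. intros H Hp. apply Rabs_le_between in H. nra. Qed.

(** On a stretch where [u <= v] the source pushes [f1 u - y] down and [f2 v + y - K] up, so a sign
    taken at the left end persists. The next three lemmas are variants, the last one for
    [v <= u]. *)
Lemma orbit_P_nonpos u v y x0 x1 :
  x0 <= x1 -> orbit_on f1 f2 mu j K u v y x0 x1 ->
  (forall x, x0 < x < x1 -> u x <= v x) ->
  f1 (u x0) - y x0 <= 0 -> f1 (u x1) - y x1 <= 0.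
Proof.
  intros Hx H Huv H0. destruct (orbit_coef_bound _ _ _ _ _ H) as [A [HA HA']].
  enough (0 <= - (f1 (u x1) - y x1)) by lra.
  apply (linear_ineq_nonneg (fun t => - (f1 (u t) - y t))
    (fun x => opp (df1 (u x) * ((f1 (u x) - y x) / mu) - j * (1 - u x / v x))) A x0 x1);
    auto; [| | |lra].
  - intros t Ht. apply (is_derive_opp (fun t => f1 (u t) - y t)).
    eapply orbit_dP; eauto.
  - intros t Ht. apply continuity_pt_opp. eapply orbit_cP; eauto.
  - intros t Ht Hn. unfold opp; simpl.
    destruct (HA' t ltac:(lra)) as [B1 _].
    assert (C := proj1 (coupling_sign (u t) (v t) (orbit_v H t (conj (Rlt_le _ _ (proj1 Ht)) (Rlt_le _ _ (proj2 Ht)))))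
      (Huv t Ht)).
    assert (D := Rmult_upper _ A (- (f1 (u t) - y t)) B1 ltac:(lra)).
    replace (- (df1 (u t) * ((f1 (u t) - y t) / mu) - j * (1 - u t / v t)))
      with (df1 (u t) / mu * - (f1 (u t) - y t) + j * (1 - u t / v t))
      by (unfold Rdiv; ring).
    lra.
Qed.

Lemma orbit_Q_nonneg u v y x0 x1 :
  x0 <= x1 -> orbit_on f1 f2 mu j K u v y x0 x1 ->
  (forall x, x0 < x < x1 -> u x <= v x) ->
  0 <= f2 (v x0) + y x0 - K -> 0 <= f2 (v x1) + y x1 - K.
Proof.
  intros Hx H Huv H0. destruct (orbit_coef_bound _ _ _ _ _ H) as [A [HA HA']].
  apply (linear_ineq_nonneg (fun t => f2 (v t) + y t - K)
    (fun x => df2 (v x) * (v x / j * (f2 (v x) + y x - K)) + j * (1 - u x / v x)) A x0 x1);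
    auto.
  - intros t Ht. eapply orbit_dQ; eauto.
  - intros t Ht. eapply orbit_cQ; eauto.
  - intros t Ht Hn.
    destruct (HA' t ltac:(lra)) as [_ B1].
    assert (C := proj1 (coupling_sign (u t) (v t) (orbit_v H t (conj (Rlt_le _ _ (proj1 Ht)) (Rlt_le _ _ (proj2 Ht)))))
      (Huv t Ht)).
    assert (D := Rmult_upper _ A _ B1 (Rlt_le _ _ Hn)). lra.
Qed.

Lemma orbit_Q_pos u v y x0 x1 :
  x0 <= x1 -> orbit_on f1 f2 mu j K u v y x0 x1 ->
  (forall x, x0 < x < x1 -> u x <= v x) ->
  0 < f2 (v x0) + y x0 - K -> 0 < f2 (v x1) + y x1 - K.
Proof.
  intros Hx H Huv H0. destruct (orbit_coef_bound _ _ _ _ _ H) as [A [HA HA']].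
  apply (linear_ineq_pos (fun t => f2 (v t) + y t - K)
    (fun x => df2 (v x) * (v x / j * (f2 (v x) + y x - K)) + j * (1 - u x / v x)) A x0 x1);
    auto.
  - intros t Ht. eapply orbit_dQ; eauto.
  - intros t Ht. eapply orbit_cQ; eauto.
  - intros t Ht Hn.
    destruct (HA' t ltac:(lra)) as [_ B1].
    assert (C := proj1 (coupling_sign (u t) (v t) (orbit_v H t (conj (Rlt_le _ _ (proj1 Ht)) (Rlt_le _ _ (proj2 Ht)))))
      (Huv t Ht)).
    assert (D := Rmult_lower _ A _ B1 (Rlt_le _ _ Hn)). lra.
Qed.

Lemma orbit_P_pos u v y x0 x1 :
  x0 <= x1 -> orbit_on f1 f2 mu j K u v y x0 x1 ->
  (forall x, x0 < x < x1 -> v x <= u x) ->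
  0 < f1 (u x0) - y x0 -> 0 < f1 (u x1) - y x1.
Proof.
  intros Hx H Huv H0. destruct (orbit_coef_bound _ _ _ _ _ H) as [A [HA HA']].
  apply (linear_ineq_pos (fun t => f1 (u t) - y t)
    (fun x => df1 (u x) * ((f1 (u x) - y x) / mu) - j * (1 - u x / v x)) A x0 x1);
    auto.
  - intros t Ht. eapply orbit_dP; eauto.
  - intros t Ht. eapply orbit_cP; eauto.
  - intros t Ht Hn.
    destruct (HA' t ltac:(lra)) as [B1 _].
    assert (C := proj1 (proj2 (coupling_sign (u t) (v t) (orbit_v H t (conj (Rlt_le _ _ (proj1 Ht)) (Rlt_le _ _ (proj2 Ht))))))
      (Huv t Ht)).
    assert (D := Rmult_lower _ A _ B1 (Rlt_le _ _ Hn)).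
    replace (df1 (u t) * ((f1 (u t) - y t) / mu))
      with (df1 (u t) / mu * (f1 (u t) - y t)) by (field; lra). lra.
Qed.

Lemma orbit_gap_derive u v y x0 x1 x :
  orbit_on f1 f2 mu j K u v y x0 x1 -> x0 < x < x1 ->
  is_derive (fun t => v t - u t) x
    (v x / j * (f2 (v x) + y x - K) - (f1 (u x) - y x) / mu).
Proof.
  intros H Hx. apply (is_derive_minus v u); now apply H.
Qed.

(** While the gap is positive both sign conditions persist, hence [u' <= 0 <= v'] and the gap cannot
    shrink; so it never closes and the conditions never stop holding. Velocities with a common limit
    therefore cannot enter this trap. *)
Lemma orbit_trap u v y x0 x1 :
  x0 <= x1 -> orbit_on f1 f2 mu j K u v y x0 x1 ->
  u x0 < v x0 -> f1 (u x0) - y x0 <= 0 -> 0 <= f2 (v x0) + y x0 - K ->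
  v x0 - u x0 <= v x1 - u x1.
Proof.
  intros Hx H Huv HP HQ.
  assert (Hc : forall t, x0 <= t <= x1 -> continuity_pt (fun t => v t - u t) t)
    by (intros t Ht; apply continuity_pt_minus; now apply H).
  assert (Hi : forall b, x0 <= b <= x1 ->
    (forall t, x0 <= t < b -> 0 < v t - u t) -> v x0 - u x0 <= v b - u b).
  { intros b Hb Hpos.
    apply (nondecreasing_of_derive (fun t => v t - u t)
      (fun x => v x / j * (f2 (v x) + y x - K) - (f1 (u x) - y x) / mu));
      [lra| | |].
    - intros t Ht. eapply orbit_gap_derive; [exact H|lra].
    - intros t Ht. apply Hc. lra.
    - intros t Ht.
      assert (Ht' : orbit_on f1 f2 mu j K u v y x0 t) by (eapply orbit_on_sub; [exact H|lra|lra]).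
      assert (U : forall x, x0 < x < t -> u x <= v x).
      { intros s Hs. specialize (Hpos s ltac:(lra)). lra. }
      assert (f1 (u t) - y t <= 0) by (apply (orbit_P_nonpos u v y x0 t); auto; lra).
      assert (0 <= f2 (v t) + y t - K) by (apply (orbit_Q_nonneg u v y x0 t); auto; lra).
      assert (0 < v t / j) by (apply H; lra).
      assert (0 < / mu) by (apply Rinv_0_lt_compat; lra).
      unfold Rdiv at 2. nra. }
  apply Hi; [lra|]. intros t Ht.
  destruct (Rlt_dec 0 (v t - u t)) as [|Hn]; [assumption|exfalso].
  destruct (first_zero (fun t => v t - u t) x0 t) as [c [C1 [C2 C3]]]; try lra.
  { intros; apply Hc; lra. }
  assert (v x0 - u x0 <= v c - u c) by (apply Hi; [lra|exact C3]). lra.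
Qed.

Lemma derive_neg_before (g : R -> R) (x l d : R) :
  is_derive g x l -> l < 0 -> g x = 0 -> 0 < d ->
  exists s, x - d < s < x /\ 0 < g s.
Proof.
  intros D Hl E Hd. apply is_derive_Reals in D.
  destruct (D (- l / 2) ltac:(lra)) as [e He].
  set (h := Rmin (e / 2) (d / 2)).
  assert (0 < h) by (apply Rmin_glb_lt; [pose proof (cond_pos e); lra|lra]).
  assert (h <= e / 2) by apply Rmin_l.
  assert (h <= d / 2) by apply Rmin_r.
  specialize (He (- h) ltac:(lra)).
  rewrite Rabs_Ropp, (Rabs_pos_eq h) in He by lra.
  specialize (He ltac:(pose proof (cond_pos e); lra)).
  rewrite E, Rminus_0_r in He. apply Rabs_def2 in He.
  exists (x + - h). split; [lra|].
  assert (H2 : g (x + - h) / - h < 0) by lra.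
  apply Rnot_le_lt. intros Hn.
  assert (0 <= g (x + - h) / - h); [|lra].
  replace (g (x + - h) / - h) with (- g (x + - h) / h) by (field; lra).
  apply Rmult_le_pos; [lra|]. apply Rlt_le, Rinv_0_lt_compat; lra.
Qed.

(** At a zero only the source is left in the equation; it makes the derivative negative, so the
    quantity would have been positive just before. *)
Lemma orbit_P_neg u v y x0 x1 x :
  orbit_on f1 f2 mu j K u v y x0 x1 -> x0 < x < x1 -> u x < v x ->
  (forall s, x0 < s <= x -> f1 (u s) - y s <= 0) -> f1 (u x) - y x < 0.
Proof.
  intros H Hx Huv HP. destruct (HP x ltac:(lra)) as [|E]; [assumption|exfalso].
  assert (D := orbit_dP u v y x0 x1 x H Hx). rewrite E in D.
  assert (C := proj1 (proj2 (proj2 (coupling_sign (u x) (v x)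
    (orbit_v H x (conj (Rlt_le _ _ (proj1 Hx)) (Rlt_le _ _ (proj2 Hx))))))) Huv).
  destruct (derive_neg_before _ _ _ (x - x0) D) as [s [Hs1 Hs2]]; auto;
    [unfold Rdiv at 1; lra|lra|].
  specialize (HP s ltac:(lra)). lra.
Qed.

Lemma orbit_Q_pos_strict u v y x0 x1 x :
  orbit_on f1 f2 mu j K u v y x0 x1 -> x0 < x < x1 -> u x < v x ->
  (forall s, x0 < s <= x -> 0 <= f2 (v s) + y s - K) -> 0 < f2 (v x) + y x - K.
Proof.
  intros H Hx Huv HQ. destruct (HQ x ltac:(lra)) as [|E]; [assumption|exfalso].
  assert (D := orbit_dQ u v y x0 x1 x H Hx). rewrite <- E in D.
  assert (C := proj1 (proj2 (proj2 (coupling_sign (u x) (v x)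
    (orbit_v H x (conj (Rlt_le _ _ (proj1 Hx)) (Rlt_le _ _ (proj2 Hx))))))) Huv).
  apply (is_derive_opp (fun t => f2 (v t) + y t - K)) in D.
  destruct (derive_neg_before _ _ _ (x - x0) D) as [s [Hs1 Hs2]];
    [unfold opp; simpl; lra|unfold opp; simpl; lra|lra|].
  unfold opp in Hs2; simpl in Hs2. specialize (HQ s ltac:(lra)). lra.
Qed.

(* On the diagonal [u = v] the signs of the velocities decide on which side the orbit continues. *)
Lemma orbit_leave u v y x0 x1 :
  x0 < x1 -> orbit_on f1 f2 mu j K u v y x0 x1 ->
  f1 (u x0) - y x0 <= 0 -> 0 <= f2 (v x0) + y x0 - K ->
  u x0 < v x0 \/
  (u x0 = v x0 /\ (f1 (u x0) - y x0 < 0 \/ 0 < f2 (v x0) + y x0 - K)) ->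
  exists x2, x0 < x2 <= x1 /\ forall x, x0 < x <= x2 ->
    u x < v x /\ f1 (u x) - y x < 0 /\ 0 < f2 (v x) + y x - K.
Proof.
  intros Hx H HP HQ Hne.
  assert (E : exists x2, x0 < x2 <= x1 /\ forall x, x0 < x <= x2 -> u x < v x).
  { destruct Hne as [Hlt|[Huv Hne]].
    - destruct (continuity_pt_pos (fun t => v t - u t) x0) as [e [He1 He2]].
      + apply continuity_pt_minus; apply H; lra.
      + lra.
      + exists (Rmin x1 (x0 + e / 2)).
        assert (L1 : Rmin x1 (x0 + e / 2) <= x1) by apply Rmin_l.
        assert (L2 : Rmin x1 (x0 + e / 2) <= x0 + e / 2) by apply Rmin_r.
        assert (L3 : x0 < Rmin x1 (x0 + e / 2)) by (apply Rmin_glb_lt; lra).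
        split; [lra|]. intros x Hx'.
        specialize (He2 x ltac:(apply Rabs_def1; lra)). lra.
    - set (g := fun x => v x / j * (f2 (v x) + y x - K) - (f1 (u x) - y x) / mu).
      assert (Hg : continuity_pt g x0).
      { unfold g. apply continuity_pt_minus.
        - apply continuity_pt_mult.
          + apply continuity_pt_mult; [apply H; lra|apply continuity_pt_const; now intros ? ?].
          + eapply orbit_cQ; [exact H|lra].
        - apply continuity_pt_mult; [|apply continuity_pt_const; now intros ? ?].
          eapply orbit_cP; [exact H|lra]. }
      assert (Hg0 : 0 < g x0).
      { unfold g. assert (0 < v x0 / j) by (apply H; lra).
        assert (0 < / mu) by (apply Rinv_0_lt_compat; lra).
        unfold Rdiv at 2. destruct Hne; nra. }
      destruct (continuity_pt_pos g x0 Hg Hg0) as [e [He1 He2]].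
      exists (Rmin x1 (x0 + e / 2)).
      assert (L1 : Rmin x1 (x0 + e / 2) <= x1) by apply Rmin_l.
      assert (L2 : Rmin x1 (x0 + e / 2) <= x0 + e / 2) by apply Rmin_r.
      assert (L3 : x0 < Rmin x1 (x0 + e / 2)) by (apply Rmin_glb_lt; lra).
      split; [lra|]. intros x Hx'.
      assert (v x0 - u x0 < v x - u x); [|lra].
      apply (increasing_of_derive (fun t => v t - u t) g); [lra| | |].
      + intros t Ht. eapply orbit_gap_derive; [exact H|lra].
      + intros t Ht. apply continuity_pt_minus; apply H; lra.
      + intros t Ht. apply He2. apply Rabs_def1; lra. }
  destruct E as [x2 [Hx2 Huv]].
  assert (Hsub : forall x, x0 < x <= x2 -> orbit_on f1 f2 mu j K u v y x0 x)
    by (intros; eapply orbit_on_sub; [exact H|lra|lra]).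
  assert (HP' : forall x, x0 < x <= x2 -> f1 (u x) - y x <= 0).
  { intros x Hx'. apply (orbit_P_nonpos u v y x0 x); auto; [lra|].
    intros s Hs. apply Rlt_le, Huv. lra. }
  assert (HQ' : forall x, x0 < x <= x2 -> 0 <= f2 (v x) + y x - K).
  { intros x Hx'. apply (orbit_Q_nonneg u v y x0 x); auto; [lra|].
    intros s Hs. apply Rlt_le, Huv. lra. }
  (* Halving keeps every point strictly inside, where strict signs can be read off the
     derivative. *)
  exists (x0 + (x2 - x0) / 2). split; [lra|]. intros x Hx'.
  split; [apply Huv; lra|split].
  - apply (orbit_P_neg u v y x0 x1 x); auto; [lra|apply Huv; lra|].
    intros s Hs. apply HP'. lra.
  - apply (orbit_Q_pos_strict u v y x0 x1 x); auto; [lra|apply Huv; lra|].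
    intros s Hs. apply HQ'. lra.
Qed.

End Orbits.

Lemma orbit_leave_opp f1 df1 f2 df2 mu j K u v y x0 x1 :
  0 < mu -> C1_on j f1 df1 -> C1_on j f2 df2 ->
  x0 < x1 -> orbit_on f1 f2 mu j K u v y x0 x1 ->
  0 <= f1 (u x0) - y x0 -> f2 (v x0) + y x0 - K <= 0 ->
  v x0 < u x0 \/
  (u x0 = v x0 /\ (0 < f1 (u x0) - y x0 \/ f2 (v x0) + y x0 - K < 0)) ->
  exists x2, x0 < x2 <= x1 /\ forall x, x0 < x <= x2 ->
    v x < u x /\ 0 < f1 (u x) - y x /\ f2 (v x) + y x - K < 0.
Proof.
  intros Hmu H1 H2 Hx H HP HQ Hne.
  destruct (orbit_leave _ _ _ _ _ _ _ Hmu (C1_on_opp _ _ _ H1) (C1_on_opp _ _ _ H2)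
    _ _ _ x0 x1 Hx (orbit_on_opp _ _ _ _ _ _ _ _ _ _ H)) as [x2 [Hx2 HE]];
    rewrite ?Ropp_involutive; [lra|lra| |].
  - destruct Hne as [Hne|[Hne Hne2]]; [left; lra|right; split; [lra|]].
    destruct Hne2; [left; lra|right; lra].
  - exists x2. split; [exact Hx2|]. intros x Hx'.
    specialize (HE x Hx'). rewrite !Ropp_involutive in HE. lra.
Qed.

(** * Order preservation and uniqueness *)

Section Pairs.
Variables (f1 df1 f2 df2 : R -> R) (mu j K : R).
Hypothesis mu_pos : 0 < mu.
Hypothesis C1_f1 : C1_on j f1 df1.
Hypothesis C1_f2 : C1_on j f2 df2.

(** After division by [j] both curves run in a compact interval of the positive half-line, on which
    [dh] is bounded; the segment between two of their values stays there too. *)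
Lemma lipschitz_along (h dh u1 u2 : R -> R) (x0 x1 : R) :
  C1_on j h dh ->
  (forall x, x0 <= x <= x1 -> continuity_pt u1 x /\ 0 < u1 x / j) ->
  (forall x, x0 <= x <= x1 -> continuity_pt u2 x /\ 0 < u2 x / j) ->
  exists A, 0 < A /\ forall x, x0 <= x <= x1 ->
    Rabs (h (u2 x) - h (u1 x)) <= A * Rabs (u2 x - u1 x).
Proof.
  intros Hh H1 H2.
  destruct (Rle_dec x0 x1) as [Hx|Hx]; [|exists 1; split; [lra|intros; lra]].
  assert (cc : forall w x, continuity_pt w x -> continuity_pt (fun t => w t / j) x).
  { intros w x Hc. apply continuity_pt_mult; [exact Hc|apply continuity_pt_const; now intros ? ?]. }
  destruct (continuity_lower_bound (fun x => u1 x / j) x0 x1) as [m1 [m1p M1]];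
    [intros; apply cc; now apply H1|intros; now apply H1|].
  destruct (continuity_lower_bound (fun x => u2 x / j) x0 x1) as [m2 [m2p M2]];
    [intros; apply cc; now apply H2|intros; now apply H2|].
  destruct (continuity_bounded (fun x => u1 x / j) x0 x1) as [B1 [B1p B1']];
    [intros; apply cc; now apply H1|].
  destruct (continuity_bounded (fun x => u2 x / j) x0 x1) as [B2 [B2p B2']];
    [intros; apply cc; now apply H2|].
  assert (Hj : j <> 0) by (destruct (sgn_div _ _ (proj2 (H1 x0 ltac:(lra)))); tauto).
  set (m := Rmin m1 m2).
  assert (mp : 0 < m) by now apply Rmin_glb_lt.
  assert (ml1 : m <= m1) by apply Rmin_l. assert (ml2 : m <= m2) by apply Rmin_r.
  destruct (continuity_bounded (fun t => dh (j * t)) m (B1 + B2)) as [A [HA HA']].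
  { intros t Ht. apply (continuity_pt_comp (fun t => j * t) dh).
    - apply continuity_pt_mult; [apply continuity_pt_const; now intros ? ?|].
      apply derivable_continuous_pt, derivable_pt_id.
    - apply Hh. replace (j * t / j) with t by (field; auto). lra. }
  exists A. split; [exact HA|]. intros x Hx'.
  specialize (M1 x Hx'). specialize (M2 x Hx').
  specialize (B1' x Hx'). specialize (B2' x Hx'). simpl in *.
  apply Rabs_le_between in B1'. apply Rabs_le_between in B2'.
  assert (Ht : forall t, Rmin (u1 x) (u2 x) <= t <= Rmax (u1 x) (u2 x) ->
    m <= t / j <= B1 + B2).
  { intros t Ht. unfold Rdiv in *. set (i := / j) in *.
    revert Ht. unfold Rmin, Rmax. destruct (Rle_dec (u1 x) (u2 x)); intros Ht;
    (destruct (Rle_dec 0 i); [split; nra|split; nra]). }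
  apply (lipschitz_of_derive h dh).
  - intros t Ht'. apply Hh. specialize (Ht t Ht'). lra.
  - intros t Ht'. specialize (Ht t Ht').
    replace t with (j * (t / j)) by (field; auto). apply HA'. exact Ht.
Qed.

(** The signs of [b], [d], [e], [g] are the point: once the differences of [v] and of [y] are
    replaced by their opposites, every coupling coefficient is positive, so the system of
    differences is cooperative. This is the source of the monotonicity of the flow. *)
Lemma orbit_difference u1 v1 y1 u2 v2 y2 x0 x1 :
  orbit_on f1 f2 mu j K u1 v1 y1 x0 x1 ->
  orbit_on f1 f2 mu j K u2 v2 y2 x0 x1 ->
  exists A, 0 < A /\ forall x, x0 < x < x1 ->
    exists a b c d e g,
      Rabs a <= A /\ 0 < b <= A /\ Rabs c <= A /\ 0 < d <= A /\
      0 < e <= A /\ 0 < g <= A /\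
      is_derive (fun t => u2 t - u1 t) x (a * (u2 x - u1 x) - b * (y2 x - y1 x)) /\
      is_derive (fun t => v2 t - v1 t) x (c * (v2 x - v1 x) + d * (y2 x - y1 x)) /\
      is_derive (fun t => y2 t - y1 t) x (- e * (u2 x - u1 x) + g * (v2 x - v1 x)).
Proof.
  intros H1 H2.
  destruct (lipschitz_along f1 df1 u1 u2 x0 x1 C1_f1) as [A1 [A1p HA1]];
    [intros; split; now apply H1|intros; split; now apply H2|].
  destruct (lipschitz_along (fun c => c * f2 c) (fun c => f2 c + c * df2 c) v1 v2 x0 x1)
    as [A2 [A2p HA2]];
    [now apply C1_on_mult_id|intros; split; now apply H1|intros; split; now apply H2|].
  destruct (continuity_bounded y1 x0 x1) as [By [Byp HBy]]; [intros; now apply H1|].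
  assert (cc : forall w x, continuity_pt w x -> continuity_pt (fun t => w t / j) x).
  { intros w x Hc. apply continuity_pt_mult; [exact Hc|apply continuity_pt_const; now intros ? ?]. }
  assert (ci : forall w x, continuity_pt w x -> 0 < w x / j -> continuity_pt (fun t => j / w t) x).
  { intros w x Hc Hp. apply continuity_pt_mult; [apply continuity_pt_const; now intros ? ?|].
    apply continuity_pt_inv; [exact Hc|]. now apply (sgn_div _ j). }
  destruct (continuity_bounded (fun x => v2 x / j) x0 x1) as [Bv [Bvp HBv]];
    [intros; apply cc; now apply H2|].
  destruct (continuity_bounded (fun x => j / v1 x) x0 x1) as [Be [Bep HBe]];
    [intros; apply ci; now apply H1|].
  destruct (continuity_bounded (fun x => j / v1 x * (u2 x / j * (j / v2 x))) x0 x1) as [Bg [Bgp HBg]].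
  { intros x Hx. apply continuity_pt_mult; [apply ci; now apply H1|].
    apply continuity_pt_mult; [apply cc; now apply H2|apply ci; now apply H2]. }
  assert (mi : 0 < / mu) by now apply Rinv_0_lt_compat.
  set (A := (A1 + 1) * / mu + (A2 + By + Rabs K) * Rabs (/ j) + Bv + Be + Bg).
  assert (N1 : 0 <= Rabs (/ j)) by apply Rabs_pos.
  assert (N2 : 0 <= Rabs K) by apply Rabs_pos.
  assert (T1 : 0 < A1 * / mu) by now apply Rmult_lt_0_compat.
  assert (T2 : 0 <= (A2 + By + Rabs K) * Rabs (/ j)) by (apply Rmult_le_pos; lra).
  exists A. split; [unfold A; lra|]. intros x Hx.
  assert (Hx' : x0 <= x <= x1) by lra.
  destruct (sgn_div _ _ (orbit_v H1 x Hx')) as [E1 [E2 E3]].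
  destruct (sgn_div _ _ (orbit_v H2 x Hx')) as [E4 [_ E5]].
  assert (P1 := orbit_u H2 x Hx'). assert (P2 := orbit_v H2 x Hx').
  set (U := u2 x - u1 x). set (V := v2 x - v1 x). set (Y := y2 x - y1 x).
  (* Difference quotients, with the value 0 where the two orbits agree. *)
  set (qa := if Req_EM_T U 0 then 0 else (f1 (u2 x) - f1 (u1 x)) / U).
  set (qc := if Req_EM_T V 0 then 0 else (v2 x * f2 (v2 x) - v1 x * f2 (v1 x)) / V).
  specialize (HA1 x Hx'). specialize (HA2 x Hx'). specialize (HBy x Hx').
  simpl in HA2. fold U in HA1. fold V in HA2.
  assert (Qa : Rabs qa <= A1 /\ f1 (u2 x) - f1 (u1 x) = qa * U).
  { unfold qa. destruct (Req_EM_T U 0) as [E|E].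
    - rewrite Rabs_R0. split; [lra|].
      replace (u2 x) with (u1 x) by (unfold U in E; lra). lra.
    - split; [|field; auto]. unfold Rdiv. rewrite Rabs_mult, Rabs_inv.
      apply Rabs_pos_lt in E. apply Rmult_le_reg_r with (Rabs U); [exact E|].
      rewrite Rmult_assoc, Rinv_l, Rmult_1_r by lra. exact HA1. }
  assert (Qc : Rabs qc <= A2 /\ v2 x * f2 (v2 x) - v1 x * f2 (v1 x) = qc * V).
  { unfold qc. destruct (Req_EM_T V 0) as [E|E].
    - rewrite Rabs_R0. split; [lra|].
      replace (v2 x) with (v1 x) by (unfold V in E; lra). lra.
    - split; [|field; auto]. unfold Rdiv. rewrite Rabs_mult, Rabs_inv.
      apply Rabs_pos_lt in E. apply Rmult_le_reg_r with (Rabs V); [exact E|].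
      rewrite Rmult_assoc, Rinv_l, Rmult_1_r by lra. exact HA2. }
  destruct Qa as [Qa1 Qa2]. destruct Qc as [Qc1 Qc2].
  exists (qa / mu), (/ mu), ((qc + y1 x - K) * / j), (v2 x / j), (j / v1 x),
    (j / v1 x * (u2 x / j * (j / v2 x))).
  assert (mA : forall z, Rabs z <= A1 -> Rabs (z / mu) <= A).
  { intros z Hz. unfold Rdiv. rewrite Rabs_mult, (Rabs_pos_eq (/ mu)) by lra.
    apply Rle_trans with (A1 * / mu); [apply Rmult_le_compat_r; lra|unfold A; lra]. }
  refine (conj _ (conj (conj _ _) (conj _ (conj (conj _ _) (conj (conj _ _)
    (conj (conj _ _) (conj _ (conj _ _)))))))).
  - now apply mA.
  - exact mi.
  - unfold A. lra.
  - rewrite Rabs_mult.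
    apply Rle_trans with ((A2 + By + Rabs K) * Rabs (/ j)); [|unfold A; lra].
    apply Rmult_le_compat_r; [exact N1|]. unfold Rminus.
    eapply Rle_trans; [apply Rabs_triang|]. rewrite Rabs_Ropp.
    apply Rplus_le_compat_r. eapply Rle_trans; [apply Rabs_triang|]. lra.
  - exact P2.
  - specialize (HBv x Hx'). simpl in HBv. rewrite Rabs_pos_eq in HBv by lra. unfold A; lra.
  - exact E3.
  - specialize (HBe x Hx'). simpl in HBe. rewrite Rabs_pos_eq in HBe by lra. unfold A; lra.
  - apply Rmult_lt_0_compat; [exact E3|]. now apply Rmult_lt_0_compat.
  - specialize (HBg x Hx'). simpl in HBg.
    eapply Rle_trans; [apply Rle_abs|]. unfold A; lra.
  - replace (qa / mu * U - / mu * Y)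
      with ((f1 (u2 x) - y2 x) / mu - (f1 (u1 x) - y1 x) / mu).
    + apply (is_derive_minus u2 u1); [now apply H2|now apply H1].
    + unfold Y. replace (f1 (u2 x)) with (f1 (u1 x) + qa * U) by lra. field; lra.
  - replace ((qc + y1 x - K) * / j * V + v2 x / j * Y)
      with (v2 x / j * (f2 (v2 x) + y2 x - K) - v1 x / j * (f2 (v1 x) + y1 x - K)).
    + apply (is_derive_minus v2 v1); [now apply H2|now apply H1].
    + unfold Y. replace ((qc + y1 x - K) * / j * V) with ((qc * V + (y1 x - K) * V) / j)
        by (field; auto).
      rewrite <- Qc2. unfold V. field; auto.
  - replace (- (j / v1 x) * U + j / v1 x * (u2 x / j * (j / v2 x)) * V)
      with (j * (1 - u2 x / v2 x) - j * (1 - u1 x / v1 x)).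
    + apply (is_derive_minus y2 y1); [now apply H2|now apply H1].
    + unfold U, V. field; auto.
Qed.

(** The squared distance satisfies [|N'| <= 10 A N], so a zero at either end propagates to the
    other. The backward direction serves later to show that an equilibrium is not reached in finite
    time. *)
Lemma orbit_unique u1 v1 y1 u2 v2 y2 x0 x1 :
  x0 <= x1 ->
  orbit_on f1 f2 mu j K u1 v1 y1 x0 x1 ->
  orbit_on f1 f2 mu j K u2 v2 y2 x0 x1 ->
  (u1 x0 = u2 x0 /\ v1 x0 = v2 x0 /\ y1 x0 = y2 x0) <->
  (u1 x1 = u2 x1 /\ v1 x1 = v2 x1 /\ y1 x1 = y2 x1).
Proof.
  intros Hx H1 H2.
  destruct (orbit_difference _ _ _ _ _ _ _ _ H1 H2) as [A [HA HD]].
  set (U := fun t => u2 t - u1 t). set (V := fun t => v2 t - v1 t).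
  set (Y := fun t => y2 t - y1 t).
  set (N := fun t => U t * U t + V t * V t + Y t * Y t).
  assert (HN : forall x, x0 < x < x1 -> exists l, is_derive N x l /\ Rabs l <= 10 * A * N x).
  { intros x Hx'. destruct (HD x Hx') as (a & b & c & d & e & g & Ha & Hb & Hc & Hd & He & Hg & D1 & D2 & D3).
    fold (U x) (V x) (Y x) in D1, D2, D3.
    exists (2 * U x * (a * U x - b * Y x) + 2 * V x * (c * V x + d * Y x)
      + 2 * Y x * (- e * U x + g * V x)). split.
    - assert (sq : forall h l, is_derive h x l -> is_derive (fun t => h t * h t) x (2 * h x * l)).
      { intros h l Hl. replace (2 * h x * l) with (plus (mult l (h x)) (mult (h x) l))
          by (unfold plus, mult; simpl; ring).
        apply (is_derive_mult h h); auto. intros; apply Rmult_comm. }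
      apply (is_derive_plus (fun t => U t * U t + V t * V t) (fun t => Y t * Y t)).
      + apply (is_derive_plus (fun t => U t * U t) (fun t => V t * V t)); now apply sq.
      + now apply sq.
    - unfold N. apply Rabs_le_between in Ha. apply Rabs_le_between in Hc.
      generalize (U x) (V x) (Y x). intros p q r.
      assert (B : forall k s t, - A <= k <= A -> Rabs (k * (s * t)) <= A * ((s * s + t * t) / 2)).
      { intros k s t Hk. rewrite Rabs_mult.
        apply Rmult_le_compat; try apply Rabs_pos; [now apply Rabs_le|].
        pose proof (Rle_0_sqr (s - t)). pose proof (Rle_0_sqr (s + t)).
        unfold Rsqr in *. apply Rabs_le. lra. }
      assert (B1 := B a p p Ha). assert (B2 := B b p r ltac:(lra)).
      assert (B3 := B c q q Hc). assert (B4 := B d q r ltac:(lra)).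
      assert (B5 := B e r p ltac:(lra)). assert (B6 := B g r q ltac:(lra)).
      apply Rabs_le_between in B1. apply Rabs_le_between in B2. apply Rabs_le_between in B3.
      apply Rabs_le_between in B4. apply Rabs_le_between in B5. apply Rabs_le_between in B6.
      assert (0 <= A * (p * p)) by (apply Rmult_le_pos; nra).
      assert (0 <= A * (q * q)) by (apply Rmult_le_pos; nra).
      assert (0 <= A * (r * r)) by (apply Rmult_le_pos; nra).
      apply Rabs_le. split; lra. }
  assert (CN : forall x, x0 <= x <= x1 -> continuity_pt N x).
  { intros x Hx'.
    assert (CU : continuity_pt U x) by (apply continuity_pt_minus; [now apply H2|now apply H1]).
    assert (CV : continuity_pt V x) by (apply continuity_pt_minus; [now apply H2|now apply H1]).
    assert (CY : continuity_pt Y x) by (apply continuity_pt_minus; [now apply H2|now apply H1]).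
    apply (continuity_pt_plus (fun t => U t * U t + V t * V t) (fun t => Y t * Y t)).
    - apply (continuity_pt_plus (fun t => U t * U t) (fun t => V t * V t));
        now apply continuity_pt_mult.
    - now apply continuity_pt_mult. }
  assert (DN : forall x, x0 < x < x1 -> is_derive N x (Derive N x) /\ Rabs (Derive N x) <= 10 * A * N x).
  { intros x Hx'. destruct (HN x Hx') as [l [D L]].
    rewrite (is_derive_unique _ _ _ D). now split. }
  assert (F : N x1 * exp (- (10 * A) * x1) <= N x0 * exp (- (10 * A) * x0)).
  { enough (- (N x0 * exp (- (10 * A) * x0)) <= - (N x1 * exp (- (10 * A) * x1))) by lra.
    apply (nondecreasing_of_derive (fun t => - (N t * exp (- (10 * A) * t)))
      (fun t => opp ((Derive N t + - (10 * A) * N t) * exp (- (10 * A) * t)))); auto.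
    - intros t Ht. apply (is_derive_opp (fun t => N t * exp (- (10 * A) * t))).
      apply is_derive_mul_exp. now apply DN.
    - intros t Ht. apply continuity_pt_opp, continuity_pt_mul_exp. auto.
    - intros t Ht. destruct (DN t Ht) as [_ L]. apply Rabs_le_between in L.
      unfold opp; simpl. pose proof (exp_pos (- (10 * A) * t)). nra. }
  assert (G : N x0 * exp ((10 * A) * x0) <= N x1 * exp ((10 * A) * x1)).
  { apply (nondecreasing_of_derive (fun t => N t * exp ((10 * A) * t))
      (fun t => (Derive N t + (10 * A) * N t) * exp ((10 * A) * t))); auto.
    - intros t Ht. apply is_derive_mul_exp. now apply DN.
    - intros t Ht. apply continuity_pt_mul_exp. auto.
    - intros t Ht. destruct (DN t Ht) as [_ L]. apply Rabs_le_between in L.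
      pose proof (exp_pos (10 * A * t)). nra. }
  assert (Z : forall x, N x = 0 <-> u1 x = u2 x /\ v1 x = v2 x /\ y1 x = y2 x).
  { intros x. unfold N, U, V, Y. split.
    - intros E. assert (forall s, 0 <= s * s) by (intros; nra).
      assert (Q1 := H (u2 x - u1 x)). assert (Q2 := H (v2 x - v1 x)). assert (Q3 := H (y2 x - y1 x)).
      assert (S : forall s, s * s = 0 -> s = 0) by (intros; nra).
      assert (S1 := S (u2 x - u1 x) ltac:(lra)). assert (S2 := S (v2 x - v1 x) ltac:(lra)).
      assert (S3 := S (y2 x - y1 x) ltac:(lra)). lra.
    - intros [-> [-> ->]]. ring. }
  assert (P : forall x, 0 <= N x) by (intros; unfold N; nra).
  rewrite <- !Z. assert (P0 := P x0). assert (P1 := P x1).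
  pose proof (exp_pos (- (10 * A) * x1)). pose proof (exp_pos (10 * A * x0)).
  split; intros E; rewrite E in *; nra.
Qed.

(* The flow is monotone for the order [u1 <= u2], [v2 <= v1], [y2 <= y1]. *)
Lemma orbit_order u1 v1 y1 u2 v2 y2 x0 x1 :
  x0 <= x1 ->
  orbit_on f1 f2 mu j K u1 v1 y1 x0 x1 ->
  orbit_on f1 f2 mu j K u2 v2 y2 x0 x1 ->
  u1 x0 <= u2 x0 -> v2 x0 <= v1 x0 -> y2 x0 < y1 x0 ->
  u1 x1 <= u2 x1 /\ v2 x1 <= v1 x1 /\ y2 x1 - y1 x1 <= y2 x0 - y1 x0.
Proof.
  intros Hx H1 H2 Hu Hv Hy.
  destruct (orbit_difference _ _ _ _ _ _ _ _ H1 H2) as [A [HA HD]].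
  set (U := fun t => u2 t - u1 t). set (V := fun t => v2 t - v1 t).
  set (Y := fun t => y2 t - y1 t).
  assert (CU : forall x, x0 <= x <= x1 -> continuity_pt U x)
    by (intros; apply continuity_pt_minus; [now apply H2|now apply H1]).
  assert (CV : forall x, x0 <= x <= x1 -> continuity_pt V x)
    by (intros; apply continuity_pt_minus; [now apply H2|now apply H1]).
  assert (CY : forall x, x0 <= x <= x1 -> continuity_pt Y x)
    by (intros; apply continuity_pt_minus; [now apply H2|now apply H1]).
  assert (Dr : forall x, x0 < x < x1 -> is_derive U x (Derive U x) /\
    is_derive V x (Derive V x) /\ is_derive Y x (Derive Y x)).
  { intros x Hx'. destruct (HD x Hx') as (a & b & c & d & e & g & _ & _ & _ & _ & _ & _ & D1 & D2 & D3).
    split; [|split]; apply Derive_correct; eexists; eassumption. }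
  (* As long as [Y] is negative it drives [U] up and [V] down, and their signs in turn keep [Y]
     nonincreasing; [T] closes this loop. *)
  assert (S : forall c, x0 <= c <= x1 -> (forall t, x0 <= t < c -> Y t < 0) ->
    0 <= U c /\ V c <= 0).
  { intros c Hc Hn. split.
    - apply (linear_ineq_nonneg U (Derive U) A x0 c); [lra| | | |unfold U; lra].
      + intros t Ht. apply Dr. lra.
      + intros t Ht. apply CU. lra.
      + intros t Ht Hneg.
        destruct (HD t ltac:(lra)) as (a & b & c' & d & e & g & Ha & Hb & _ & _ & _ & _ & D1 & _ & _).
        change (is_derive U t (a * U t - b * Y t)) in D1.
        rewrite (is_derive_unique _ _ _ D1).
        assert (R1 := Rmult_upper a A (U t) Ha ltac:(lra)).
        specialize (Hn t ltac:(lra)). nra.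
    - enough (0 <= - V c) by lra.
      apply (linear_ineq_nonneg (fun t => - V t) (fun t => opp (Derive V t)) A x0 c);
        [lra| | | |unfold V; lra].
      + intros t Ht. apply (is_derive_opp V). apply Dr. lra.
      + intros t Ht. apply continuity_pt_opp, CV. lra.
      + intros t Ht Hneg.
        destruct (HD t ltac:(lra)) as (a & b & c' & d & e & g & _ & _ & Hc' & Hd & _ & _ & _ & D2 & _).
        change (is_derive V t (c' * V t + d * Y t)) in D2.
        rewrite (is_derive_unique _ _ _ D2). unfold opp; simpl.
        assert (R1 := Rmult_upper c' A (- V t) Hc' ltac:(lra)).
        specialize (Hn t ltac:(lra)). nra. }
  assert (T : forall c, x0 <= c <= x1 -> (forall t, x0 <= t < c -> Y t < 0) -> Y c <= Y x0).
  { intros c Hc Hn.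
    enough (- Y x0 <= - Y c) by lra.
    apply (nondecreasing_of_derive (fun t => - Y t) (fun t => opp (Derive Y t)) x0 c); [lra| | |].
    - intros t Ht. apply (is_derive_opp Y), Dr. lra.
    - intros t Ht. apply continuity_pt_opp, CY. lra.
    - intros t Ht.
      destruct (HD t ltac:(lra)) as (a & b & c' & d & e & g & _ & _ & _ & _ & He & Hg & _ & _ & D3).
      change (is_derive Y t (- e * U t + g * V t)) in D3.
      rewrite (is_derive_unique _ _ _ D3). unfold opp; simpl.
      destruct (S t ltac:(lra)); [intros; apply Hn; lra|]. nra. }
  assert (Hn : forall t, x0 <= t <= x1 -> Y t < 0).
  { intros t Ht. apply Rnot_le_lt. intros Hp.
    destruct (first_zero (fun t => - Y t) x0 t) as [c [C1 [C2 C3]]]; [lra| |unfold Y; lra|lra|].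
    - intros s Hs. apply continuity_pt_opp, CY. lra.
    - assert (Y c <= Y x0).
      { apply T; [lra|]. intros s Hs. specialize (C3 s Hs). lra. }
      assert (Y x0 < 0) by (unfold Y; lra). lra. }
  destruct (S x1 ltac:(lra)) as [S1 S2]; [intros; apply Hn; lra|].
  assert (T1 := T x1 ltac:(lra)). specialize (T1 ltac:(intros; apply Hn; lra)).
  unfold U, V, Y in *. repeat split; lra.
Qed.

End Pairs.

(** * Orbits on the half-line with a common limit *)

Definition orbit (f1 f2 : R -> R) (mu j K : R) (u v y : R -> R) : Prop :=
  forall X, 0 < X -> orbit_on f1 f2 mu j K u v y 0 X.

Lemma is_lim_comp_continuity (f u : R -> R) (b : R) :
  continuity_pt f b -> is_lim u p_infty b -> is_lim (fun x => f (u x)) p_infty (f b).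
Proof.
  intros Hf Hu. apply continuity_pt_filterlim in Hf.
  unfold is_lim in *. simpl in *. eapply filterlim_comp; eassumption.
Qed.

Lemma gap_not_bounded_below (u v : R -> R) (b X d : R) :
  is_lim u p_infty b -> is_lim v p_infty b -> 0 < d ->
  ~ (forall x, X <= x -> d <= v x - u x).
Proof.
  intros Hu Hv Hd H.
  assert (L : is_lim (fun x => v x - u x) p_infty (b - b)) by now apply is_lim_minus'.
  rewrite Rminus_diag in L.
  apply is_lim_spec in L. destruct (L (mkposreal d Hd)) as [X1 HX]. simpl in HX.
  assert (X <= Rmax X X1 + 1) by (pose proof (Rmax_l X X1); lra).
  assert (X1 < Rmax X X1 + 1) by (pose proof (Rmax_r X X1); lra).
  specialize (H _ H0). specialize (HX _ H1). rewrite Rminus_0_r in HX.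
  apply Rabs_def2 in HX. lra.
Qed.

Section Convergent.
Variables (f1 df1 f2 df2 : R -> R) (mu j K : R).
Hypothesis mu_pos : 0 < mu.
Hypothesis C1_f1 : C1_on j f1 df1.
Hypothesis C1_f2 : C1_on j f2 df2.

(** With equal initial velocities, two orbits can differ only through [y 0]. A strict gap in [y] is
    preserved by [orbit_order], while the convergence of both [u1] and [u2] to [b] leaves nothing to
    compensate it. *)
Lemma orbit_convergent_unique u1 v1 y1 u2 v2 y2 b :
  orbit f1 f2 mu j K u1 v1 y1 -> orbit f1 f2 mu j K u2 v2 y2 ->
  0 < b / j -> is_lim u1 p_infty b -> is_lim u2 p_infty b ->
  u1 0 = u2 0 -> v1 0 = v2 0 -> y2 0 <= y1 0 ->
  forall x, 0 <= x -> u1 x = u2 x /\ v1 x = v2 x /\ y1 x = y2 x.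
Proof.
  intros H1 H2 Hb L1 L2 Eu Ev [Hy|Ey] x Hx.
  - exfalso.
    assert (O : forall t, 0 <= t -> u1 t <= u2 t /\ y2 t - y1 t <= y2 0 - y1 0).
    { intros t Ht. destruct (orbit_order f1 df1 f2 df2 mu j K mu_pos C1_f1 C1_f2
        u1 v1 y1 u2 v2 y2 0 t Ht) as [A [B C]]; try lra.
      - eapply orbit_on_sub; [apply (H1 (t + 1)); lra|lra|lra].
      - eapply orbit_on_sub; [apply (H2 (t + 1)); lra|lra|lra]. }
    (* once [u2 - u1] is small its derivative exceeds a positive constant, yet it is nonnegative and tends to 0 *)
    assert (L' : is_lim (fun x => f1 (u2 x) - f1 (u1 x)) p_infty (f1 b - f1 b)).
    { apply is_lim_minus'; apply is_lim_comp_continuity; auto;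
      eapply C1_on_continuity; eauto. }
    rewrite Rminus_diag in L'.
    assert (Hc : 0 < (y1 0 - y2 0) / 2) by lra.
    apply is_lim_spec in L'. destruct (L' (mkposreal _ Hc)) as [X HX]. simpl in HX.
    set (c := (y1 0 - y2 0) / 2 / mu).
    assert (cp : 0 < c) by now apply Rdiv_lt_0_compat.
    apply (gap_not_bounded_below u1 u2 b (Rmax 0 X + 2) c L1 L2 cp).
    intros x' Hx'. pose proof (Rmax_l 0 X). pose proof (Rmax_r 0 X).
    set (x0 := x' - 1).
    destruct (mean_value_open (fun t => u2 t - u1 t)
      (fun t => (f1 (u2 t) - y2 t) / mu - (f1 (u1 t) - y1 t) / mu) x0 x') as [s [Hs E]].
    + unfold x0; lra.
    + intros t Ht. apply (is_derive_minus u2 u1).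
      * apply (orbit_du (H2 (t + 1) ltac:(unfold x0 in Ht; lra))). unfold x0 in Ht; lra.
      * apply (orbit_du (H1 (t + 1) ltac:(unfold x0 in Ht; lra))). unfold x0 in Ht; lra.
    + intros t Ht. apply continuity_pt_minus.
      * apply (orbit_cu (H2 (t + 1) ltac:(unfold x0 in Ht; lra))). unfold x0 in Ht; lra.
      * apply (orbit_cu (H1 (t + 1) ltac:(unfold x0 in Ht; lra))). unfold x0 in Ht; lra.
    + unfold x0 in Hs. specialize (HX s ltac:(lra)). rewrite Rminus_0_r in HX.
      apply Rabs_def2 in HX.
      destruct (O x0 ltac:(unfold x0; lra)) as [O1 _].
      destruct (O s ltac:(lra)) as [_ O2].
      replace (x' - x0) with 1 in E by (unfold x0; ring).
      assert (c <= (f1 (u2 s) - y2 s) / mu - (f1 (u1 s) - y1 s) / mu).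
      { replace ((f1 (u2 s) - y2 s) / mu - (f1 (u1 s) - y1 s) / mu)
          with ((f1 (u2 s) - f1 (u1 s) - (y2 s - y1 s)) / mu) by (field; lra).
        unfold c. apply Rmult_le_compat_r; [apply Rlt_le, Rinv_0_lt_compat; lra|lra]. }
      lra.
  - destruct (orbit_unique f1 df1 f2 df2 mu j K mu_pos C1_f1 C1_f2
      u1 v1 y1 u2 v2 y2 0 x Hx) as [A _].
    + eapply orbit_on_sub; [apply (H1 (x + 1)); lra|lra|lra].
    + eapply orbit_on_sub; [apply (H2 (x + 1)); lra|lra|lra].
    + apply A. auto.
Qed.

End Convergent.

(** * Monotone orbits *)

Lemma orbit_opp f1 f2 mu j K u v y :
  orbit f1 f2 mu j K u v y ->
  orbit (fun c => - f1 (- c)) (fun c => - f2 (- c)) mu (- j) (- K)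
    (fun x => - u x) (fun x => - v x) (fun x => - y x).
Proof. intros H X HX. apply orbit_on_opp. auto. Qed.

Lemma orbit_shift f1 f2 mu j K u v y a b :
  orbit f1 f2 mu j K u v y -> 0 <= a -> a <= b ->
  orbit_on f1 f2 mu j K u v y a b.
Proof. intros H Ha Hb. eapply orbit_on_sub; [apply (H (b + 1)); lra|lra|lra]. Qed.

Section Trap.
Variables (f1 df1 f2 df2 : R -> R) (mu j K b : R) (u v y : R -> R).
Hypothesis mu_pos : 0 < mu.
Hypothesis C1_f1 : C1_on j f1 df1.
Hypothesis C1_f2 : C1_on j f2 df2.
Hypothesis Horb : orbit f1 f2 mu j K u v y.
Hypothesis lim_u : is_lim u p_infty b.
Hypothesis lim_v : is_lim v p_infty b.

Lemma convergent_no_trap x0 :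
  0 <= x0 -> u x0 < v x0 -> f1 (u x0) - y x0 <= 0 -> 0 <= f2 (v x0) + y x0 - K -> False.
Proof.
  intros Hx Huv HP HQ.
  apply (gap_not_bounded_below u v b x0 (v x0 - u x0)); auto; [lra|].
  intros x Hx'.
  apply (orbit_trap f1 df1 f2 df2 mu j K mu_pos C1_f1 C1_f2 u v y x0 x); auto.
  now apply orbit_shift.
Qed.

(** Away from an equilibrium, such a diagonal point moves at once into the trap. *)
Lemma convergent_no_diagonal x0 :
  0 <= x0 -> u x0 = v x0 -> f1 (u x0) - y x0 <= 0 -> 0 <= f2 (v x0) + y x0 - K ->
  f1 (u x0) - y x0 < 0 \/ 0 < f2 (v x0) + y x0 - K -> False.
Proof.
  intros Hx Huv HP HQ Hne.
  destruct (orbit_leave f1 df1 f2 df2 mu j K mu_pos C1_f1 C1_f2 u v y x0 (x0 + 1))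
    as [x2 [H2 H3]]; auto; [lra|apply orbit_shift; auto; lra|].
  destruct (H3 x2 ltac:(lra)) as [A [B C]].
  apply (convergent_no_trap x2); lra.
Qed.

End Trap.

Lemma is_lim_opp_finite (u : R -> R) (b : R) :
  is_lim u p_infty b -> is_lim (fun x => - u x) p_infty (- b).
Proof. intros H. now apply (is_lim_opp u p_infty b). Qed.

Section Monotone.
Variables (f1 df1 f2 df2 : R -> R) (mu j K b : R) (u v y : R -> R).
Hypothesis mu_pos : 0 < mu.
Hypothesis C1_f1 : C1_on j f1 df1.
Hypothesis C1_f2 : C1_on j f2 df2.
Hypothesis Horb : orbit f1 f2 mu j K u v y.
Hypothesis lim_u : is_lim u p_infty b.
Hypothesis lim_v : is_lim v p_infty b.

Lemma convergent_no_trap_opp x0 :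
  0 <= x0 -> v x0 < u x0 -> 0 <= f1 (u x0) - y x0 -> f2 (v x0) + y x0 - K <= 0 -> False.
Proof.
  intros Hx Huv HP HQ.
  apply (convergent_no_trap _ _ _ _ _ _ _ (- b) _ _ _ mu_pos (C1_on_opp _ _ _ C1_f1)
    (C1_on_opp _ _ _ C1_f2) (orbit_opp _ _ _ _ _ _ _ _ Horb)
    (is_lim_opp_finite _ _ lim_u) (is_lim_opp_finite _ _ lim_v) x0); rewrite ?Ropp_involutive; lra.
Qed.

Lemma convergent_no_diagonal_opp x0 :
  0 <= x0 -> u x0 = v x0 -> 0 <= f1 (u x0) - y x0 -> f2 (v x0) + y x0 - K <= 0 ->
  0 < f1 (u x0) - y x0 \/ f2 (v x0) + y x0 - K < 0 -> False.
Proof.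
  intros Hx Huv HP HQ Hne.
  apply (convergent_no_diagonal _ _ _ _ _ _ _ (- b) _ _ _ mu_pos (C1_on_opp _ _ _ C1_f1)
    (C1_on_opp _ _ _ C1_f2) (orbit_opp _ _ _ _ _ _ _ _ Horb)
    (is_lim_opp_finite _ _ lim_u) (is_lim_opp_finite _ _ lim_v) x0); rewrite ?Ropp_involutive; lra.
Qed.

Lemma orbit_constant c :
  0 < c / j -> f1 c + f2 c = K -> orbit f1 f2 mu j K (fun _ => c) (fun _ => c) (fun _ => f1 c).
Proof.
  intros Hc HK X HX.
  destruct (sgn_div _ _ Hc) as [E1 [E2 _]].
  split; intros x Hx; auto; try (apply continuity_pt_const; now intros ? ?).
  - replace ((f1 c - f1 c) / mu) with 0 by (field; lra). apply @is_derive_const.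
  - replace (c / j * (f2 c + f1 c - K)) with 0 by (rewrite <- HK; field; auto).
    apply @is_derive_const.
  - replace (j * (1 - c / c)) with 0 by (field; auto). apply @is_derive_const.
Qed.

Lemma continuity_pt_near (f : R -> R) (x d : R) :
  continuity_pt f x -> f x < d -> exists e, 0 < e /\ forall t, Rabs (t - x) < e -> f t < d.
Proof.
  intros Hf Hd. destruct (continuity_pt_pos (fun t => d - f t) x) as [e [He H]].
  - apply continuity_pt_minus; [apply continuity_pt_const; now intros ? ?|exact Hf].
  - lra.
  - exists e. split; [exact He|]. intros t Ht. specialize (H t Ht). lra.
Qed.

(** At the first zero of the smaller of the two quantities the order of [u] and [v] decides. If
    [u < v], the source has kept [Q] positive, so [P] vanishes and the orbit is trapped; [v < u] is
    symmetric. If [u = v], the orbit either leaves into a trap or sits at an equilibrium, which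
    backward uniqueness forbids. *)
Theorem orbit_monotone :
  u 0 = v 0 -> 0 < f1 (u 0) + f2 (u 0) - K ->
  forall x, 0 <= x -> 0 < f1 (u x) - y x /\ 0 < f2 (v x) + y x - K.
Proof.
  intros Huv HK.
  set (P := fun x => f1 (u x) - y x). set (Q := fun x => f2 (v x) + y x - K).
  assert (Hs : P 0 + Q 0 = f1 (u 0) + f2 (u 0) - K) by (unfold P, Q; rewrite <- Huv; ring).
  (* The sum is positive at 0, so a nonpositive summand would leave the other one positive and send
     the diagonal point into a trap. *)
  assert (P0 : 0 < P 0).
  { apply Rnot_le_lt. intros H. apply (convergent_no_diagonal f1 df1 f2 df2 mu j K b u v y mu_pos
      C1_f1 C1_f2 Horb lim_u lim_v 0); fold (P 0) (Q 0); lra. }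
  assert (Q0 : 0 < Q 0).
  { apply Rnot_le_lt. intros H. apply (convergent_no_diagonal_opp 0); fold (P 0) (Q 0); lra. }
  assert (CP : forall x, 0 <= x -> continuity_pt P x).
  { intros x Hx. apply (orbit_cP f1 df1 f2 mu j K C1_f1 u v y x (x + 1));
      [apply orbit_shift; auto; lra|lra]. }
  assert (CQ : forall x, 0 <= x -> continuity_pt Q x).
  { intros x Hx. apply (orbit_cQ f1 f2 df2 mu j K C1_f2 u v y x (x + 1));
      [apply orbit_shift; auto; lra|lra]. }
  (* This is the minimum of [P] and [Q], in a form whose continuity is immediate. *)
  set (m := fun x => (P x + Q x - Rabs (P x - Q x)) / 2).
  assert (Cm : forall x, 0 <= x -> continuity_pt m x).
  { intros x Hx. apply continuity_pt_mult; [|apply continuity_pt_const; now intros ? ?].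
    apply continuity_pt_minus; [apply continuity_pt_plus; auto|].
    apply (continuity_pt_comp (fun t => P t - Q t) Rabs); [|apply Rcontinuity_abs].
    apply continuity_pt_minus; auto. }
  assert (Hm : forall x, 0 < m x <-> 0 < P x /\ 0 < Q x)
    by (intros x; unfold m; split_Rabs; lra).
  assert (Hm0 : forall x, m x = 0 -> 0 <= P x /\ 0 <= Q x /\ (P x = 0 \/ Q x = 0))
    by (intros x; unfold m; split_Rabs; lra).
  intros x Hx. apply Hm. apply Rnot_le_lt. intros Hneg.
  destruct (first_zero m 0 x Hx) as [X [X1 [X2 X3]]]; auto;
    [intros; apply Cm; lra|now apply Hm|].
  apply Hm0 in X2. destruct X2 as [HP [HQ HPQ]].
  assert (cg : continuity_pt (fun t => v t - u t) X).
  { assert (H := Horb (X + 1) ltac:(lra)).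
    apply continuity_pt_minus; apply H; lra. }
  assert (HO : forall a, 0 <= a -> a <= X -> orbit_on f1 f2 mu j K u v y a X)
    by (intros; now apply orbit_shift).
  destruct (Rtotal_order (u X) (v X)) as [L|[L|L]].
  - assert (QX : 0 < Q X).
    { destruct (continuity_pt_pos _ X cg ltac:(lra)) as [e [He1 He2]].
      set (a := Rmax 0 (X - e / 2)).
      assert (0 <= a) by apply Rmax_l. assert (X - e / 2 <= a) by apply Rmax_r.
      assert (a < X) by (apply Rmax_lub_lt; lra).
      apply (orbit_Q_pos f1 df1 f2 df2 mu j K C1_f1 C1_f2 u v y a X); [lra|apply HO; lra| |].
      - intros t Ht. specialize (He2 t ltac:(apply Rabs_def1; lra)). lra.
      - apply Hm, X3. lra. }
    apply (convergent_no_trap f1 df1 f2 df2 mu j K b u v y mu_pos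
      C1_f1 C1_f2 Horb lim_u lim_v X); fold (P X) (Q X); lra.
  - destruct (Req_dec (P X) 0) as [EP|EP]; [destruct (Req_dec (Q X) 0) as [EQ|EQ]|].
    + (* an equilibrium is not reached in finite time *)
      assert (E : f1 (u X) + f2 (u X) = K) by (unfold P, Q in EP, EQ; rewrite <- L in EQ; lra).
      assert (Hu : 0 < u X / j) by (apply (orbit_u (HO 0 ltac:(lra) ltac:(lra))); lra).
      assert (Hc : orbit_on f1 f2 mu j K (fun _ => u X) (fun _ => u X) (fun _ => f1 (u X)) 0 X)
        by (apply (orbit_constant (u X) Hu E); lra).
      destruct (orbit_unique f1 df1 f2 df2 mu j K mu_pos C1_f1 C1_f2
        _ _ _ _ _ _ 0 X ltac:(lra) (HO 0 ltac:(lra) ltac:(lra)) Hc) as [_ A].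
      destruct A as [A1 [A2 A3]]; [unfold P in EP; repeat split; lra|].
      unfold P in P0. rewrite A1, A3 in P0. lra.
    + apply (convergent_no_diagonal f1 df1 f2 df2 mu j K b u v y mu_pos
        C1_f1 C1_f2 Horb lim_u lim_v X); fold (P X) (Q X); lra.
    + apply (convergent_no_diagonal_opp X); fold (P X) (Q X); lra.
  - assert (PX : 0 < P X).
    { destruct (continuity_pt_near _ X 0 cg ltac:(lra)) as [e [He1 He2]].
      set (a := Rmax 0 (X - e / 2)).
      assert (0 <= a) by apply Rmax_l. assert (X - e / 2 <= a) by apply Rmax_r.
      assert (a < X) by (apply Rmax_lub_lt; lra).
      apply (orbit_P_pos f1 df1 f2 df2 mu j K mu_pos C1_f1 C1_f2 u v y a X); [lra|apply HO; lra| |].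
      - intros t Ht. specialize (He2 t ltac:(apply Rabs_def1; lra)). lra.
      - apply Hm, X3. lra. }
    apply (convergent_no_trap_opp X); fold (P X) (Q X); lra.
Qed.

End Monotone.

(** * Shooting *)

Definition clamp (lo hi c : R) : R := Rmax lo (Rmin hi c).

Lemma clamp_range (lo hi c : R) : lo <= hi -> lo <= clamp lo hi c <= hi.
Proof. intros H. unfold clamp, Rmax, Rmin. destruct (Rle_dec hi c), (Rle_dec _ _); lra. Qed.

Lemma clamp_id (lo hi c : R) : lo <= c <= hi -> clamp lo hi c = c.
Proof. intros H. unfold clamp, Rmax, Rmin. destruct (Rle_dec hi c), (Rle_dec _ _); lra. Qed.

Lemma clamp_lipschitz (lo hi c d : R) : Rabs (clamp lo hi c - clamp lo hi d) <= Rabs (c - d).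
Proof.
  unfold clamp, Rmax, Rmin.
  destruct (Rle_dec hi c), (Rle_dec hi d);
  repeat match goal with |- context [Rle_dec lo ?z] => destruct (Rle_dec lo z) end;
  split_Rabs; lra.
Qed.

(** The distance of two states is any bound [e] valid for all components, which avoids a norm on
    [I -> R]. The class is closed under the operations that build the vector field. *)
Definition bounded_lipschitz {I : Type} (g : (I -> R) -> R) : Prop :=
  exists B L, 0 < B /\ 0 < L /\ (forall s, Rabs (g s) <= B) /\
    forall s s' e, (forall i, Rabs (s i - s' i) <= e) -> Rabs (g s - g s') <= L * e.

Section BoundedLipschitz.
Context {I : Type} (i0 : I).
Implicit Types g h : (I -> R) -> R.

Lemma bounded_lipschitz_const (c : R) : bounded_lipschitz (fun _ : I -> R => c).
Proof.
  exists (Rabs c + 1), 1. pose proof (Rabs_pos c). repeat split; try lra.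
  - intros _. lra.
  - intros s s' e H0. rewrite Rminus_diag, Rabs_R0, Rmult_1_l.
    eapply Rle_trans; [apply Rabs_pos|apply (H0 i0)].
Qed.

Lemma bounded_lipschitz_clamp (lo hi : R) (i : I) :
  lo <= hi -> bounded_lipschitz (fun s => clamp lo hi (s i)).
Proof.
  intros H. exists (Rabs lo + Rabs hi + 1), 1.
  pose proof (Rabs_pos lo). pose proof (Rabs_pos hi). repeat split; try lra.
  - intros s. pose proof (clamp_range lo hi (s i) H). split_Rabs; lra.
  - intros s s' e He. eapply Rle_trans; [apply clamp_lipschitz|]. rewrite Rmult_1_l. apply He.
Qed.

Lemma bounded_lipschitz_plus g h :
  bounded_lipschitz g -> bounded_lipschitz h -> bounded_lipschitz (fun s => g s + h s).
Proof.
  intros (B & L & HB & HL & H1 & H2) (B' & L' & HB' & HL' & H1' & H2').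
  exists (B + B'), (L + L'). repeat split; try lra.
  - intros s. eapply Rle_trans; [apply Rabs_triang|]. specialize (H1 s). specialize (H1' s). lra.
  - intros s s' e He. replace (g s + h s - (g s' + h s')) with ((g s - g s') + (h s - h s')) by ring.
    eapply Rle_trans; [apply Rabs_triang|].
    specialize (H2 _ _ _ He). specialize (H2' _ _ _ He). lra.
Qed.

Lemma bounded_lipschitz_mult g h :
  bounded_lipschitz g -> bounded_lipschitz h -> bounded_lipschitz (fun s => g s * h s).
Proof.
  intros (B & L & HB & HL & H1 & H2) (B' & L' & HB' & HL' & H1' & H2').
  exists (B * B'), (L * B' + B * L'). repeat split; try nra.
  - intros s. rewrite Rabs_mult. apply Rmult_le_compat; try apply Rabs_pos; auto.
  - intros s s' e He.
    replace (g s * h s - g s' * h s') with ((g s - g s') * h s + g s' * (h s - h s')) by ring.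
    eapply Rle_trans; [apply Rabs_triang|]. rewrite !Rabs_mult.
    specialize (H2 _ _ _ He). specialize (H2' _ _ _ He).
    assert (Rabs (g s - g s') * Rabs (h s) <= L * e * B')
      by (apply Rmult_le_compat; try apply Rabs_pos; auto).
    assert (Rabs (g s') * Rabs (h s - h s') <= B * (L' * e))
      by (apply Rmult_le_compat; try apply Rabs_pos; auto).
    lra.
Qed.

Lemma bounded_lipschitz_comp (f df : R -> R) (lo hi : R) (i : I) :
  lo <= hi -> (forall c, lo <= c <= hi -> is_derive f c (df c) /\ continuity_pt df c) ->
  bounded_lipschitz (fun s => f (clamp lo hi (s i))).
Proof.
  intros H Hf.
  destruct (continuity_bounded f lo hi) as [B [HB HB']].
  { intros t Ht. eapply continuity_pt_of_is_derive. now apply Hf. }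
  destruct (continuity_bounded df lo hi) as [L [HL HL']].
  { intros t Ht. now apply Hf. }
  exists B, L. repeat split; auto.
  - intros s. apply HB'. now apply clamp_range.
  - intros s s' e He.
    set (c := clamp lo hi (s i)). set (d := clamp lo hi (s' i)).
    assert (Hc := clamp_range lo hi (s i) H). assert (Hd := clamp_range lo hi (s' i) H).
    fold c in Hc. fold d in Hd.
    assert (Hcd : forall t, Rmin d c <= t <= Rmax d c -> lo <= t <= hi).
    { intros t Ht. unfold Rmin, Rmax in Ht. destruct (Rle_dec d c); lra. }
    eapply Rle_trans.
    + apply (lipschitz_of_derive f df L d c); intros t Ht; [apply Hf|apply HL']; auto.
    + apply Rmult_le_compat_l; [lra|].
      eapply Rle_trans; [apply clamp_lipschitz|apply He].
Qed.

Lemma bounded_lipschitz_opp g :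
  bounded_lipschitz g -> bounded_lipschitz (fun s => - g s).
Proof.
  intros (B & L & HB & HL & H1 & H2). exists B, L. repeat split; auto.
  - intros s. now rewrite Rabs_Ropp.
  - intros s s' e He. replace (- g s - - g s') with (- (g s - g s')) by ring.
    rewrite Rabs_Ropp. now apply H2.
Qed.

End BoundedLipschitz.

(** The supremum of the part of [A] in the interval lies in neither set: openness of [A] would move
    it to the right, openness of [B] to the left. *)
Lemma connected_two_open (A B : R -> Prop) (t0 t1 : R) :
  t0 <= t1 -> A t0 -> B t1 ->
  (forall t, A t -> exists d, 0 < d /\ forall s, Rabs (s - t) < d -> A s) ->
  (forall t, B t -> exists d, 0 < d /\ forall s, Rabs (s - t) < d -> B s) ->
  (forall t, A t -> B t -> False) ->
  exists t, t0 < t < t1 /\ ~ A t /\ ~ B t.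
Proof.
  intros Ht HA HB OA OB D.
  set (E := fun t => t0 <= t <= t1 /\ A t).
  destruct (completeness E) as [s [Hub Hlub]].
  - exists t1. intros t [Ht' _]. lra.
  - exists t0. split; [lra|exact HA].
  - assert (H0 : t0 <= s) by (apply Hub; split; [lra|exact HA]).
    assert (H1 : s <= t1) by (apply Hlub; intros t [Ht' _]; lra).
    assert (nA : ~ A s).
    { intros As. destruct (OA s As) as [d [Hd Hd']].
      destruct (Req_dec s t1) as [E1|E1]; [rewrite E1 in As; now apply (D t1)|].
      set (t := Rmin t1 (s + d / 2)).
      assert (t <= t1) by apply Rmin_l. assert (t <= s + d / 2) by apply Rmin_r.
      assert (s < t) by (apply Rmin_glb_lt; lra).
      assert (t <= s); [|lra]. apply Hub. split; [lra|]. apply Hd'. apply Rabs_def1; lra. }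
    assert (nB : ~ B s).
    { intros Bs. destruct (OB s Bs) as [d [Hd Hd']].
      assert (s <= s - d / 2); [|lra]. apply Hlub. intros t [Ht' At].
      apply Rnot_lt_le. intros Hlt. assert (t <= s) by (apply Hub; split; auto).
      apply (D t At). apply Hd'. apply Rabs_def1; lra. }
    exists s. split; [|split; auto].
    split.
    + destruct H0 as [|E0]; [assumption|]. rewrite E0 in HA. contradiction.
    + destruct H1 as [|E0]; [assumption|]. rewrite <- E0 in HB. contradiction.
Qed.

(** The minimum over the compact interval is positive, and a change of parameter moves the values by
    at most [C |s - t|], uniformly in [x]. *)
Lemma open_positive (g : R -> R -> R) (t X C : R) :
  0 <= X -> (forall x, 0 <= x <= X -> continuity_pt (g t) x) ->
  (forall s x, 0 <= x <= X -> Rabs (g s x - g t x) <= C * Rabs (s - t)) ->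
  (forall x, 0 <= x <= X -> 0 < g t x) ->
  exists d, 0 < d /\ forall s, Rabs (s - t) < d -> forall x, 0 <= x <= X -> 0 < g s x.
Proof.
  intros HX Hc HL Hp.
  destruct (continuity_lower_bound (g t) 0 X Hc Hp) as [m [Hm Hm']].
  exists (m / (Rabs C + 1)). pose proof (Rabs_pos C).
  split; [apply Rdiv_lt_0_compat; lra|]. intros s Hs x Hx.
  specialize (HL s x Hx). specialize (Hm' x Hx).
  assert (Rabs (s - t) * (Rabs C + 1) < m).
  { apply Rmult_lt_compat_r with (r := Rabs C + 1) in Hs; [|lra].
    replace (m / (Rabs C + 1) * (Rabs C + 1)) with m in Hs by (field; lra). exact Hs. }
  assert (C * Rabs (s - t) <= Rabs (s - t) * (Rabs C + 1)).
  { pose proof (Rle_abs C). pose proof (Rabs_pos (s - t)). nra. }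
  apply Rabs_le_between in HL. lra.
Qed.

Inductive component := Cu | Cv | Cy.

(** * The clamped flow and its exit sets *)

Section Shooting.
Variables (f1 df1 f2 df2 : R -> R) (mu j K a b : R).
Hypothesis mu_pos : 0 < mu.
Hypothesis j_neg : j < 0.
Hypothesis a_lt_b : a < b.
Hypothesis b_neg : b < 0.
Hypothesis C1_f1 : C1_on j f1 df1.
Hypothesis C1_f2 : C1_on j f2 df2.
Hypothesis flux_b : f1 b + f2 b = K.
Hypothesis flux_gt : forall c, a <= c < b -> K < f1 c + f2 c.

(** The clamping window has [[a, b]] in its interior and stays inside the negative half-line, where
    the fluxes are continuously differentiable. *)
Let lo := a - 1.
Let hi := b / 2.

Lemma neg_domain c : c < 0 -> 0 < c / j.
Proof.
  intros Hc. replace (c / j) with (- c * / - j) by (field; lra).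
  apply Rmult_lt_0_compat; [lra|apply Rinv_0_lt_compat; lra].
Qed.

Definition cl (c : R) : R := clamp lo hi c.

Lemma cl_range c : lo <= cl c <= hi.
Proof. apply clamp_range. unfold lo, hi. lra. Qed.

Lemma cl_domain c : 0 < cl c / j.
Proof. apply neg_domain. pose proof (cl_range c). unfold hi in *. lra. Qed.

Section Field.
Variable Ymax : R.
Hypothesis Ymax_pos : 0 < Ymax.

Definition cly (c : R) : R := clamp (- Ymax) Ymax c.

(** Clamping makes the field globally bounded and Lipschitz, so that the flow exists for all
    [x >= 0] and is Lipschitz in the shooting parameter. Divisions are written as products to match
    the closure rules. *)
Definition field (i : component) (s : component -> R) : R :=
  match i with
  | Cu => (f1 (cl (s Cu)) - cly (s Cy)) * / mu
  | Cv => cl (s Cv) * / j * (f2 (cl (s Cv)) + cly (s Cy) - K)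
  | Cy => j * (1 - cl (s Cu) * / cl (s Cv))
  end.

Lemma field_bounded_lipschitz :
  exists L B, 0 < L /\ 0 < B /\ (forall i s, Rabs (field i s) <= B) /\
    forall s s' e, (forall k, Rabs (s k - s' k) <= e) ->
      forall i, Rabs (field i s - field i s') <= L * e.
Proof.
  assert (lh : lo <= hi) by (unfold lo, hi; lra).
  assert (dom : forall c, lo <= c <= hi -> 0 < c / j).
  { intros c Hc. apply neg_domain. unfold hi in Hc. lra. }
  assert (U : bounded_lipschitz (field Cu)).
  { apply bounded_lipschitz_mult; [|apply (bounded_lipschitz_const Cu)].
    apply bounded_lipschitz_plus.
    - apply (bounded_lipschitz_comp f1 df1); auto.
    - apply bounded_lipschitz_opp, bounded_lipschitz_clamp. lra. }
  assert (V : bounded_lipschitz (field Cv)).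
  { apply bounded_lipschitz_mult; [apply bounded_lipschitz_mult|].
    - now apply bounded_lipschitz_clamp.
    - apply (bounded_lipschitz_const Cu).
    - apply (bounded_lipschitz_plus (fun s => f2 (cl (s Cv)) + cly (s Cy)) (fun _ => - K)).
      + apply bounded_lipschitz_plus.
        * apply (bounded_lipschitz_comp f2 df2); auto.
        * apply bounded_lipschitz_clamp. lra.
      + apply (bounded_lipschitz_const Cu). }
  assert (Y : bounded_lipschitz (field Cy)).
  { apply (bounded_lipschitz_mult (fun _ => j)); [apply (bounded_lipschitz_const Cu)|].
    apply (bounded_lipschitz_plus (fun _ => 1)); [apply (bounded_lipschitz_const Cu)|].
    apply bounded_lipschitz_opp, bounded_lipschitz_mult; [now apply bounded_lipschitz_clamp|].
    apply (bounded_lipschitz_comp Rinv (fun c => - / c ^ 2)); auto.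
    intros c Hc. assert (c <> 0) by (unfold hi in Hc; lra). split.
    - auto_derive; [auto|field; auto].
    - apply continuity_pt_opp, continuity_pt_inv; [|now apply pow_nonzero].
      apply derivable_continuous_pt, derivable_pt_pow. }
  destruct U as (B1 & L1 & HB1 & HL1 & H1 & H1'). destruct V as (B2 & L2 & HB2 & HL2 & H2 & H2').
  destruct Y as (B3 & L3 & HB3 & HL3 & H3 & H3').
  exists (L1 + L2 + L3), (B1 + B2 + B3). repeat split; try lra.
  - intros [] s; [specialize (H1 s)|specialize (H2 s)|specialize (H3 s)]; lra.
  - intros s s' e He. assert (0 <= e) by (eapply Rle_trans; [apply Rabs_pos|apply (He Cu)]).
    specialize (H1' s s' e He). specialize (H2' s s' e He). specialize (H3' s s' e He).
    intros []; nra.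
Qed.

Lemma shooting_flow :
  exists (Phi : R -> component -> R -> R) (L : R), 0 < L /\
    (forall t, Phi t Cu 0 = a /\ Phi t Cv 0 = a /\ Phi t Cy 0 = t) /\
    (forall t i x, 0 <= x -> is_derive (Phi t i) x (field i (fun k => Phi t k x))) /\
    (forall t i x, continuity_pt (Phi t i) x) /\
    (forall s t i x, 0 <= x -> Rabs (Phi s i x - Phi t i x) <= Rabs (s - t) * exp (L * x)).
Proof.
  destruct field_bounded_lipschitz as (L & B & HL & HB & H1 & H2).
  set (init := fun t i => match i with Cy => t | _ => a end).
  exists (fun t => flow component field (init t)), L.
  split; [exact HL|split; [|split; [|split]]].
  - intros t. now rewrite !flow_0.
  - intros t i x Hx. apply (is_derive_flow component field L B HL HB H1 H2); [|exact Hx].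
    intros s s' [] E; unfold field; now rewrite !E.
  - intros t i x. apply (continuity_flow component field L B HL HB H1 H2).
  - intros s t i x Hx. apply (flow_dependence component field L B HL HB H1 H2); [exact Hx|].
    intros []; unfold init; rewrite ?Rminus_diag, ?Rabs_R0; try apply Rabs_pos. apply Rle_refl.
Qed.

End Field.

Lemma clamped_flux (f df : R -> R) :
  C1_on j f df -> exists A B, 0 < A /\ 0 < B /\ (forall c, Rabs (f (cl c)) <= B) /\
    forall c d, Rabs (f (cl c) - f (cl d)) <= A * Rabs (c - d).
Proof.
  intros Hf.
  destruct (bounded_lipschitz_comp (I := unit) f df lo hi tt) as (B & L & HB & HL & H1 & H2).
  - unfold lo, hi; lra.
  - intros c Hc. apply Hf, neg_domain. unfold hi in Hc. lra.
  - exists L, B. repeat split; auto.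
    + intros c. apply (H1 (fun _ => c)).
    + intros c d. apply (H2 (fun _ => c) (fun _ => d)). intros _. apply Rle_refl.
Qed.

Lemma continuity_cl c : continuity_pt cl c.
Proof.
  apply (continuity_pt_lipschitz _ 1); [lra|]. intros t. rewrite Rmult_1_l.
  apply clamp_lipschitz.
Qed.

(** The orbit sought never reaches the boundary of the region [P > 0], [Q > 0], [u < b], [v < b].
    Touching the boundary is shown to imply crossing it, and crossing is an open condition on the
    parameter; connectedness then leaves a parameter whose orbit touches nothing. *)
Lemma shooting_trapped :
  exists u v y, u 0 = a /\ v 0 = a /\ orbit f1 f2 mu j K u v y /\
    forall x, 0 <= x -> 0 < f1 (u x) - y x /\ 0 < f2 (v x) + y x - K /\
      a <= u x < b /\ a <= v x < b.
Proof.
  destruct (clamped_flux f1 df1 C1_f1) as (A1 & B1 & HA1 & HB1 & bd1 & lip1).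
  destruct (clamped_flux f2 df2 C1_f2) as (A2 & B2 & HA2 & HB2 & bd2 & lip2).
  pose proof (Rabs_pos K) as HK.
  (* Strictly above the possible sizes of [f1] and [K - f2] on the window: while [P] and [Q] are
     nonnegative, the clamped [y] lies between [K - f2] and [f1], so its clamp is inactive. *)
  set (Ymax := B1 + B2 + Rabs K + 1).
  assert (Yp : 0 < Ymax) by (unfold Ymax; lra).
  destruct (shooting_flow Ymax Yp) as (Phi & L & HL & Phi0 & dPhi & cPhi & lipPhi).
  set (U := fun t x => Phi t Cu x). set (V := fun t x => Phi t Cv x).
  set (Y := fun t x => Phi t Cy x).
  set (P := fun t x => f1 (cl (U t x)) - cly Ymax (Y t x)).
  set (Q := fun t x => f2 (cl (V t x)) + cly Ymax (Y t x) - K).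
  assert (cc : forall f df t i x, C1_on j f df -> continuity_pt (fun x => f (cl (Phi t i x))) x).
  { intros f df t i x Hf. apply (continuity_pt_comp (fun x => cl (Phi t i x)) f).
    - apply (continuity_pt_comp (Phi t i) cl); [apply cPhi|apply continuity_cl].
    - eapply continuity_pt_of_is_derive. apply Hf, cl_domain. }
  assert (cy : forall t x, continuity_pt (fun x => cly Ymax (Y t x)) x).
  { intros t x. apply (continuity_pt_comp (Phi t Cy) (cly Ymax)); [apply cPhi|].
    apply (continuity_pt_lipschitz _ 1); [lra|]. intros s. rewrite Rmult_1_l. apply clamp_lipschitz. }
  assert (cP : forall t x, continuity_pt (P t) x).
  { intros t x. apply continuity_pt_minus; [eapply cc; exact C1_f1|apply cy]. }
  assert (cQ : forall t x, continuity_pt (Q t) x).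
  { intros t x. apply continuity_pt_minus; [|apply continuity_pt_const; now intros ? ?].
    apply continuity_pt_plus; [eapply cc; exact C1_f2|apply cy]. }
  assert (cU : forall t x, continuity_pt (fun x => b - U t x) x)
    by (intros; apply continuity_pt_minus; [apply continuity_pt_const; now intros ? ?|apply cPhi]).
  assert (cV : forall t x, continuity_pt (fun x => b - V t x) x)
    by (intros; apply continuity_pt_minus; [apply continuity_pt_const; now intros ? ?|apply cPhi]).
  assert (lipX : forall s t i x X, 0 <= x <= X ->
    Rabs (Phi s i x - Phi t i x) <= exp (L * X) * Rabs (s - t)).
  { intros s t i x X Hx. eapply Rle_trans; [apply lipPhi; lra|]. rewrite Rmult_comm.
    apply Rmult_le_compat_r; [apply Rabs_pos|].
    destruct (Req_dec x X) as [->|]; [apply Rle_refl|]. apply Rlt_le, exp_increasing. nra. }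
  assert (lipP : forall s t x X, 0 <= x <= X ->
    Rabs (P s x - P t x) <= (A1 + 1) * exp (L * X) * Rabs (s - t)).
  { intros s t x X Hx. unfold P.
    assert (E1 := lip1 (U s x) (U t x)). assert (E2 := clamp_lipschitz (- Ymax) Ymax (Y s x) (Y t x)).
    assert (E3 := lipX s t Cu x X Hx). assert (E4 := lipX s t Cy x X Hx).
    fold (U s x) (U t x) in E3. fold (Y s x) (Y t x) in E4.
    fold (cly Ymax (Y s x)) (cly Ymax (Y t x)) in E2.
    apply Rle_trans with (A1 * (exp (L * X) * Rabs (s - t)) + exp (L * X) * Rabs (s - t)); [|lra].
    assert (A1 * Rabs (U s x - U t x) <= A1 * (exp (L * X) * Rabs (s - t)))
      by (apply Rmult_le_compat_l; lra).
    revert E1 E2. split_Rabs; lra. }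
  assert (lipQ : forall s t x X, 0 <= x <= X ->
    Rabs (Q s x - Q t x) <= (A2 + 1) * exp (L * X) * Rabs (s - t)).
  { intros s t x X Hx. unfold Q.
    assert (E1 := lip2 (V s x) (V t x)). assert (E2 := clamp_lipschitz (- Ymax) Ymax (Y s x) (Y t x)).
    assert (E3 := lipX s t Cv x X Hx). assert (E4 := lipX s t Cy x X Hx).
    fold (V s x) (V t x) in E3. fold (Y s x) (Y t x) in E4.
    fold (cly Ymax (Y s x)) (cly Ymax (Y t x)) in E2.
    apply Rle_trans with (A2 * (exp (L * X) * Rabs (s - t)) + exp (L * X) * Rabs (s - t)); [|lra].
    assert (A2 * Rabs (V s x - V t x) <= A2 * (exp (L * X) * Rabs (s - t)))
      by (apply Rmult_le_compat_l; lra).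
    revert E1 E2. split_Rabs; lra. }
  assert (lipU : forall s t x X, 0 <= x <= X ->
    Rabs ((b - U s x) - (b - U t x)) <= exp (L * X) * Rabs (s - t)).
  { intros s t x X Hx. replace ((b - U s x) - (b - U t x)) with (- (U s x - U t x)) by ring.
    rewrite Rabs_Ropp. now apply lipX. }
  assert (lipV : forall s t x X, 0 <= x <= X ->
    Rabs ((b - V s x) - (b - V t x)) <= exp (L * X) * Rabs (s - t)).
  { intros s t x X Hx. replace ((b - V s x) - (b - V t x)) with (- (V s x - V t x)) by ring.
    rewrite Rabs_Ropp. now apply lipX. }
  (* [W1] collects the parameters whose orbit exits by [P < 0] or [v > b] while [Q] and [b - u] are
     still positive, [W2] those that exit the other way. All conditions are strict on a compact
     interval, whence openness; at the earlier of two exit times the two sets of conditions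
     contradict each other, whence disjointness. *)
  set (W1 := fun t => exists X, 0 < X /\ (P t X < 0 \/ b < V t X) /\
    forall x, 0 <= x <= X -> 0 < Q t x /\ U t x < b).
  set (W2 := fun t => exists X, 0 < X /\ (Q t X < 0 \/ b < U t X) /\
    forall x, 0 <= x <= X -> 0 < P t x /\ V t x < b).
  assert (D12 : forall t, W2 t -> W1 t -> False).
  { intros t (X2 & HX2 & E2 & F2) (X1 & HX1 & E1 & F1).
    destruct (Rle_dec X1 X2) as [H|H].
    - specialize (F2 X1 ltac:(lra)). lra.
    - specialize (F1 X2 ltac:(lra)). lra. }
  assert (at_point : forall (g : R -> R -> R) (t X C : R),
    (forall s, Rabs (g s X - g t X) <= C * Rabs (s - t)) -> 0 < g t X ->
    exists d, 0 < d /\ forall s, Rabs (s - t) < d -> 0 < g s X).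
  { intros g t X C HC Hg.
    destruct (open_positive (fun s _ => g s X) t 0 C) as [d [Hd Hd']]; auto; try lra.
    - intros x _. apply continuity_pt_const. now intros ? ?.
    - exists d. split; auto. intros s Hs. apply (Hd' s Hs 0). lra. }
  assert (O1 : forall t, W1 t -> exists d, 0 < d /\ forall s, Rabs (s - t) < d -> W1 s).
  { intros t (X & HX & E & F).
    destruct (open_positive Q t X ((A2 + 1) * exp (L * X))) as [d1 [Hd1 Q1]];
      [lra|auto|intros; now apply lipQ|intros x Hx; now apply F|].
    destruct (open_positive (fun t x => b - U t x) t X (exp (L * X))) as [d2 [Hd2 Q2]];
      [lra|auto|intros; now apply lipU|intros x Hx; specialize (F x Hx); lra|].
    assert (E' : exists d, 0 < d /\ forall s, Rabs (s - t) < d -> P s X < 0 \/ b < V s X).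
    { destruct E as [E|E].
      - destruct (at_point (fun t x => - P t x) t X ((A1 + 1) * exp (L * X))) as [d [Hd Hd']].
        + intros s. replace (- P s X - - P t X) with (- (P s X - P t X)) by ring.
          rewrite Rabs_Ropp. apply lipP. lra.
        + lra.
        + exists d. split; auto. intros s Hs. left. specialize (Hd' s Hs). lra.
      - destruct (at_point (fun t x => V t x - b) t X (exp (L * X))) as [d [Hd Hd']].
        + intros s. replace (V s X - b - (V t X - b)) with (V s X - V t X) by ring.
          apply lipX. lra.
        + lra.
        + exists d. split; auto. intros s Hs. right. specialize (Hd' s Hs). lra. }
    destruct E' as [d3 [Hd3 Q3]].
    exists (Rmin d1 (Rmin d2 d3)). split; [now repeat apply Rmin_glb_lt|].
    intros s Hs. pose proof (Rmin_l d1 (Rmin d2 d3)). pose proof (Rmin_r d1 (Rmin d2 d3)).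
    pose proof (Rmin_l d2 d3). pose proof (Rmin_r d2 d3).
    exists X. split; [exact HX|]. split; [apply Q3; lra|].
    intros x Hx. specialize (Q1 s ltac:(lra) x Hx). specialize (Q2 s ltac:(lra) x Hx). simpl in Q2. lra. }
  assert (O2 : forall t, W2 t -> exists d, 0 < d /\ forall s, Rabs (s - t) < d -> W2 s).
  { intros t (X & HX & E & F).
    destruct (open_positive P t X ((A1 + 1) * exp (L * X))) as [d1 [Hd1 Q1]];
      [lra|auto|intros; now apply lipP|intros x Hx; now apply F|].
    destruct (open_positive (fun t x => b - V t x) t X (exp (L * X))) as [d2 [Hd2 Q2]];
      [lra|auto|intros; now apply lipV|intros x Hx; specialize (F x Hx); lra|].
    assert (E' : exists d, 0 < d /\ forall s, Rabs (s - t) < d -> Q s X < 0 \/ b < U s X).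
    { destruct E as [E|E].
      - destruct (at_point (fun t x => - Q t x) t X ((A2 + 1) * exp (L * X))) as [d [Hd Hd']].
        + intros s. replace (- Q s X - - Q t X) with (- (Q s X - Q t X)) by ring.
          rewrite Rabs_Ropp. apply lipQ. lra.
        + lra.
        + exists d. split; auto. intros s Hs. left. specialize (Hd' s Hs). lra.
      - destruct (at_point (fun t x => U t x - b) t X (exp (L * X))) as [d [Hd Hd']].
        + intros s. replace (U s X - b - (U t X - b)) with (U s X - U t X) by ring.
          apply lipX. lra.
        + lra.
        + exists d. split; auto. intros s Hs. right. specialize (Hd' s Hs). lra. }
    destruct E' as [d3 [Hd3 Q3]].
    exists (Rmin d1 (Rmin d2 d3)). split; [now repeat apply Rmin_glb_lt|].
    intros s Hs. pose proof (Rmin_l d1 (Rmin d2 d3)). pose proof (Rmin_r d1 (Rmin d2 d3)).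
    pose proof (Rmin_l d2 d3). pose proof (Rmin_r d2 d3).
    exists X. split; [exact HX|]. split; [apply Q3; lra|].
    intros x Hx. specialize (Q1 s ltac:(lra) x Hx). specialize (Q2 s ltac:(lra) x Hx). simpl in Q2. lra. }
  (* the clamped flow is a genuine orbit as long as the clamps are inactive *)
  assert (orb : forall t x0 x1, 0 <= x0 ->
    (forall x, x0 <= x <= x1 -> lo < U t x < hi /\ lo < V t x < hi /\ - Ymax < Y t x < Ymax) ->
    orbit_on f1 f2 mu j K (U t) (V t) (Y t) x0 x1 /\
    forall x, x0 <= x <= x1 -> P t x = f1 (U t x) - Y t x /\ Q t x = f2 (V t x) + Y t x - K).
  { intros t x0 x1 Hx0 Hg.
    assert (E : forall x, x0 <= x <= x1 -> cl (U t x) = U t x /\ cl (V t x) = V t x /\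
      cly Ymax (Y t x) = Y t x).
    { intros x Hx. destruct (Hg x Hx) as [G1 [G2 G3]].
      split; [|split]; apply clamp_id; lra. }
    split.
    - split; intros x Hx; try apply cPhi; try (apply neg_domain; destruct (Hg x Hx); unfold hi in *; lra);
      destruct (E x ltac:(lra)) as [E1 [E2 E3]].
      + assert (D := dPhi t Cu x ltac:(lra)). unfold field in D. fold (U t x) (Y t x) in D.
        rewrite E1, E3 in D. exact D.
      + assert (D := dPhi t Cv x ltac:(lra)). unfold field in D. fold (V t x) (Y t x) in D.
        rewrite E2, E3 in D. exact D.
      + assert (D := dPhi t Cy x ltac:(lra)). unfold field in D. fold (V t x) (U t x) in D.
        rewrite E2, E1 in D. exact D.
    - intros x Hx. unfold P, Q. destruct (E x Hx) as [E1 [E2 E3]]. now rewrite E1, E2, E3. }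
  assert (good_near : forall t X, (lo < U t X < hi /\ lo < V t X < hi /\ - Ymax < Y t X < Ymax) ->
    exists e, 0 < e /\ forall x, Rabs (x - X) < e ->
      lo < U t x < hi /\ lo < V t x < hi /\ - Ymax < Y t x < Ymax).
  { intros t X [G1 [G2 G3]].
    assert (N : forall i p q, p < Phi t i X < q -> exists e, 0 < e /\
      forall x, Rabs (x - X) < e -> p < Phi t i x < q).
    { intros i p q Hpq.
      destruct (continuity_pt_near (Phi t i) X q (cPhi t i X) ltac:(lra)) as [e1 [He1 H1]].
      destruct (continuity_pt_pos (fun x => Phi t i x - p) X) as [e2 [He2 H2]];
        [apply continuity_pt_minus; [apply cPhi|apply continuity_pt_const; now intros ? ?]|lra|].
      exists (Rmin e1 e2). split; [now apply Rmin_glb_lt|].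
      intros x Hx. pose proof (Rmin_l e1 e2). pose proof (Rmin_r e1 e2).
      specialize (H1 x ltac:(lra)). specialize (H2 x ltac:(lra)). lra. }
    destruct (N Cu lo hi G1) as [e1 [He1 H1]]. destruct (N Cv lo hi G2) as [e2 [He2 H2]].
    destruct (N Cy (- Ymax) Ymax G3) as [e3 [He3 H3]].
    exists (Rmin e1 (Rmin e2 e3)). split; [now repeat apply Rmin_glb_lt|].
    intros x Hx. pose proof (Rmin_l e1 (Rmin e2 e3)). pose proof (Rmin_r e1 (Rmin e2 e3)).
    pose proof (Rmin_l e2 e3). pose proof (Rmin_r e2 e3).
    split; [apply H1|split; [apply H2|apply H3]]; lra. }
  (* as long as both velocities increase, no clamp is active *)
  assert (good : forall t X, 0 <= X -> U t X <= b -> V t X <= b -> 0 <= P t X -> 0 <= Q t X ->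
    (forall x, 0 < x < X -> 0 < P t x /\ 0 < Q t x) ->
    a <= U t X /\ a <= V t X /\ lo < U t X < hi /\ lo < V t X < hi /\ - Ymax < Y t X < Ymax).
  { intros t X HX HU HV HP HQ Hin.
    destruct (Phi0 t) as [I1 [I2 I3]].
    assert (mi : 0 < / mu) by now apply Rinv_0_lt_compat.
    assert (LU : a <= U t X).
    { rewrite <- I1. apply (nondecreasing_of_derive (Phi t Cu)
        (fun x => field Ymax Cu (fun k => Phi t k x))); auto.
      - intros s Hs. apply dPhi. lra.
      - intros s Hs. destruct (Hin s Hs). unfold field. fold (U t s) (Y t s) (P t s). nra. }
    assert (LV : a <= V t X).
    { rewrite <- I2. apply (nondecreasing_of_derive (Phi t Cv)
        (fun x => field Ymax Cv (fun k => Phi t k x))); auto.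
      - intros s Hs. apply dPhi. lra.
      - intros s Hs. destruct (Hin s Hs). unfold field. fold (V t s) (Y t s) (Q t s).
        pose proof (cl_domain (V t s)). unfold Rdiv in *. nra. }
    assert (YY : - Ymax < cly Ymax (Y t X) < Ymax).
    { unfold P in HP. unfold Q in HQ. specialize (bd1 (U t X)). specialize (bd2 (V t X)).
      apply Rabs_le_between in bd1. apply Rabs_le_between in bd2.
      pose proof (Rle_abs K). pose proof (Rle_abs (- K)). rewrite Rabs_Ropp in *.
      unfold Ymax in *. lra. }
    split; [exact LU|split; [exact LV|split; [unfold lo, hi; lra|split; [unfold lo, hi; lra|]]]].
    revert YY. unfold cly, clamp, Rmax, Rmin.
    destruct (Rle_dec Ymax (Y t X)); destruct (Rle_dec (- Ymax) _); lra. }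
  assert (init : forall t, U t 0 = a /\ V t 0 = a /\ P t 0 = f1 a - cly Ymax t /\
    Q t 0 = f2 a + cly Ymax t - K).
  { intros t. destruct (Phi0 t) as [I1 [I2 I3]].
    assert (E : cl a = a) by (apply clamp_id; unfold lo, hi; lra).
    unfold P, Q, U, V, Y. rewrite I1, I2, I3, E. auto. }
  assert (range : - Ymax < K - f2 a /\ f1 a < Ymax).
  { specialize (bd1 a). specialize (bd2 a).
    replace (cl a) with a in bd1, bd2 by (symmetry; apply clamp_id; unfold lo, hi; lra).
    apply Rabs_le_between in bd1. apply Rabs_le_between in bd2.
    pose proof (Rle_abs K). pose proof (Rle_abs (- K)). rewrite Rabs_Ropp in *.
    unfold Ymax. lra. }
  assert (fa := flux_gt a ltac:(lra)).
  assert (init' : forall t, K - f2 a <= t <= f1 a -> P t 0 = f1 a - t /\ Q t 0 = f2 a + t - K).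
  { intros t Ht. destruct (init t) as [_ [_ [I1 I2]]].
    replace (cly Ymax t) with t in I1, I2 by (symmetry; apply clamp_id; lra). auto. }
  (* Touching implies crossing. Where [P = 0] and [u <= v], [orbit_leave] makes [P] negative at
     once; where [v = b], the positive sign of [Q] carries [v] beyond [b]. *)
  assert (exit1 : forall t X, 0 <= X -> U t X < b -> V t X < b \/ (V t X = b /\ 0 < Q t X) ->
    0 < Q t X -> 0 <= P t X ->
    (P t X = 0 /\ U t X <= V t X) \/ V t X = b ->
    (forall x, 0 <= x < X -> 0 < P t x /\ 0 < Q t x /\ U t x < b /\ V t x < b) -> W1 t).
  { intros t X HX HU HV HQ HP HE Hin.
    assert (G : a <= U t X /\ a <= V t X /\ lo < U t X < hi /\ lo < V t X < hi /\ - Ymax < Y t X < Ymax)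
      by (apply good; try lra; intros x Hx; destruct (Hin x ltac:(lra)) as [? [? _]]; auto).
    destruct G as [_ [_ G]].
    destruct (good_near t X G) as [e [He Ge]].
    destruct (continuity_pt_pos (Q t) X (cQ t X) HQ) as [e1 [He1 Q1]].
    destruct (continuity_pt_pos (fun x => b - U t x) X (cU t X) ltac:(lra)) as [e2 [He2 Q2]].
    assert (Fin : forall x, X < x -> x < X + e1 -> x < X + e2 ->
      (P t x < 0 \/ b < V t x) -> W1 t).
    { intros x Hx Hx1 Hx2 E. exists x. split; [lra|]. split; [exact E|].
      intros s Hs. destruct (Rlt_dec s X) as [H|H].
      - destruct (Hin s ltac:(lra)) as [_ [? [? _]]]. auto.
      - specialize (Q1 s ltac:(apply Rabs_def1; lra)).
        specialize (Q2 s ltac:(apply Rabs_def1; lra)). simpl in Q2. split; lra. }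
    set (h := Rmin (e / 2) (Rmin (e1 / 2) (e2 / 2))).
    assert (hp : 0 < h) by (unfold h; repeat apply Rmin_glb_lt; lra).
    assert (h <= e / 2) by apply Rmin_l.
    assert (hh : h <= Rmin (e1 / 2) (e2 / 2)) by apply Rmin_r.
    assert (h <= e1 / 2) by (eapply Rle_trans; [exact hh|apply Rmin_l]).
    assert (h <= e2 / 2) by (eapply Rle_trans; [exact hh|apply Rmin_r]).
    destruct HE as [[HE HE']|HE].
    - destruct (orb t X (X + h) HX) as [O PQ].
      { intros x Hx. apply Ge. apply Rabs_def1; lra. }
      destruct (PQ X ltac:(lra)) as [EP EQ].
      destruct (orbit_leave f1 df1 f2 df2 mu j K mu_pos C1_f1 C1_f2 _ _ _ X (X + h) ltac:(lra) O)
        as [x2 [Hx2 H2]]; try lra.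
      destruct (H2 x2 ltac:(lra)) as [_ [HPn _]].
      apply (Fin x2); try lra. left. destruct (PQ x2 ltac:(lra)). lra.
    - apply (Fin (X + h)); try lra. right. rewrite <- HE.
      apply (increasing_of_derive (Phi t Cv) (fun x => field Ymax Cv (fun k => Phi t k x))); auto; [lra| |].
      + intros s Hs. apply dPhi. lra.
      + intros s Hs. unfold field. fold (V t s) (Y t s) (Q t s).
        specialize (Q1 s ltac:(apply Rabs_def1; lra)).
        apply Rmult_lt_0_compat; [apply cl_domain|exact Q1]. }
  assert (exit2 : forall t X, 0 <= X -> V t X < b -> U t X < b \/ (U t X = b /\ 0 < P t X) ->
    0 < P t X -> 0 <= Q t X ->
    (Q t X = 0 /\ V t X <= U t X) \/ U t X = b ->
    (forall x, 0 <= x < X -> 0 < P t x /\ 0 < Q t x /\ U t x < b /\ V t x < b) -> W2 t).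
  { intros t X HX HV HU HP HQ HE Hin.
    assert (G : a <= U t X /\ a <= V t X /\ lo < U t X < hi /\ lo < V t X < hi /\ - Ymax < Y t X < Ymax)
      by (apply good; try lra; intros x Hx; destruct (Hin x ltac:(lra)) as [? [? _]]; auto).
    destruct G as [_ [_ G]].
    destruct (good_near t X G) as [e [He Ge]].
    destruct (continuity_pt_pos (P t) X (cP t X) HP) as [e1 [He1 Q1]].
    destruct (continuity_pt_pos (fun x => b - V t x) X (cV t X) ltac:(lra)) as [e2 [He2 Q2]].
    assert (Fin : forall x, X < x -> x < X + e1 -> x < X + e2 ->
      (Q t x < 0 \/ b < U t x) -> W2 t).
    { intros x Hx Hx1 Hx2 E. exists x. split; [lra|]. split; [exact E|].
      intros s Hs. destruct (Rlt_dec s X) as [H|H].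
      - destruct (Hin s ltac:(lra)) as [? [_ [_ ?]]]. auto.
      - specialize (Q1 s ltac:(apply Rabs_def1; lra)).
        specialize (Q2 s ltac:(apply Rabs_def1; lra)). simpl in Q2. split; lra. }
    set (h := Rmin (e / 2) (Rmin (e1 / 2) (e2 / 2))).
    assert (hp : 0 < h) by (unfold h; repeat apply Rmin_glb_lt; lra).
    assert (h <= e / 2) by apply Rmin_l.
    assert (hh : h <= Rmin (e1 / 2) (e2 / 2)) by apply Rmin_r.
    assert (h <= e1 / 2) by (eapply Rle_trans; [exact hh|apply Rmin_l]).
    assert (h <= e2 / 2) by (eapply Rle_trans; [exact hh|apply Rmin_r]).
    destruct HE as [[HE HE']|HE].
    - destruct (orb t X (X + h) HX) as [O PQ].
      { intros x Hx. apply Ge. apply Rabs_def1; lra. }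
      destruct (PQ X ltac:(lra)) as [EP EQ].
      destruct (orbit_leave_opp f1 df1 f2 df2 mu j K _ _ _ X (X + h) mu_pos C1_f1 C1_f2 ltac:(lra) O)
        as [x2 [Hx2 H2]]; try lra.
      destruct (H2 x2 ltac:(lra)) as [_ [_ HQn]].
      apply (Fin x2); try lra. left. destruct (PQ x2 ltac:(lra)). lra.
    - apply (Fin (X + h)); try lra. right. rewrite <- HE.
      apply (increasing_of_derive (Phi t Cu) (fun x => field Ymax Cu (fun k => Phi t k x))); auto; [lra| |].
      + intros s Hs. apply dPhi. lra.
      + intros s Hs. unfold field. fold (U t s) (Y t s) (P t s).
        specialize (Q1 s ltac:(apply Rabs_def1; lra)).
        apply Rmult_lt_0_compat; [exact Q1|now apply Rinv_0_lt_compat]. }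
  (* At the left end of the parameter interval [Q 0 = 0], at the right end [P 0 = 0]; these orbits
     exit immediately, through [W2] and [W1]. *)
  destruct (connected_two_open W2 W1 (K - f2 a) (f1 a)) as [t [Ht [N2 N1]]]; auto; [lra| | |].
  - destruct (init (K - f2 a)) as [I1 [I2 _]]. destruct (init' (K - f2 a) ltac:(lra)) as [I3 I4].
    apply (exit2 _ 0); try lra. intros; lra.
  - destruct (init (f1 a)) as [I1 [I2 _]]. destruct (init' (f1 a) ltac:(lra)) as [I3 I4].
    apply (exit1 _ 0); try lra. intros; lra.
  - destruct (init t) as [I1 [I2 _]]. destruct (init' t ltac:(lra)) as [I3 I4].
    assert (All : forall x, 0 <= x -> 0 < P t x /\ 0 < Q t x /\ U t x < b /\ V t x < b).
    { set (m2 := fun f g : R -> R => fun x => (f x + g x - Rabs (f x - g x)) / 2).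
      assert (Hm2 : forall f g x, (0 < m2 f g x <-> 0 < f x /\ 0 < g x) /\
        (m2 f g x = 0 -> 0 <= f x /\ 0 <= g x /\ (f x = 0 \/ g x = 0)) /\
        (0 <= m2 f g x -> 0 <= f x /\ 0 <= g x))
        by (intros f g x; unfold m2; split_Rabs; lra).
      assert (Cm2 : forall f g x, continuity_pt f x -> continuity_pt g x -> continuity_pt (m2 f g) x).
      { intros f g x Hf Hg. apply continuity_pt_mult; [|apply continuity_pt_const; now intros ? ?].
        apply continuity_pt_minus; [apply continuity_pt_plus; auto|].
        apply (continuity_pt_comp (fun t => f t - g t) Rabs); [|apply Rcontinuity_abs].
        apply continuity_pt_minus; auto. }
      set (bU := fun x => b - U t x). set (bV := fun x => b - V t x).
      (* The minimum of the four quantities that define the region; its first zero is the first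
         contact with the boundary. *)
      set (m := m2 (m2 (P t) (Q t)) (m2 bU bV)).
      assert (Hm : forall x, 0 < m x <-> 0 < P t x /\ 0 < Q t x /\ U t x < b /\ V t x < b).
      { intros x. unfold m. destruct (Hm2 (m2 (P t) (Q t)) (m2 bU bV) x) as [E _].
        destruct (Hm2 (P t) (Q t) x) as [E1 _]. destruct (Hm2 bU bV x) as [E2 _].
        rewrite E, E1, E2. unfold bU, bV. lra. }
      assert (Hm0 : forall x, m x = 0 -> 0 <= P t x /\ 0 <= Q t x /\ U t x <= b /\ V t x <= b /\
        (P t x = 0 \/ Q t x = 0 \/ U t x = b \/ V t x = b)).
      { intros x E. destruct (Hm2 (m2 (P t) (Q t)) (m2 bU bV) x) as [_ [F _]].
        destruct (F E) as [F1 [F2 F3]].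
        destruct (Hm2 (P t) (Q t) x) as [_ [F4 F4']]. destruct (Hm2 bU bV x) as [_ [F5 F5']].
        destruct (F4' F1). destruct (F5' F2). unfold bU, bV in *.
        destruct F3 as [F3|F3]; [destruct (F4 F3) as [_ [_ ?]]|destruct (F5 F3) as [_ [_ ?]]]; lra. }
      intros x Hx. apply Hm. apply Rnot_le_lt. intros Hneg.
      destruct (first_zero m 0 x Hx) as [X [X1 [X2 X3]]]; auto.
      { intros s Hs. unfold m. apply Cm2; apply Cm2; auto; apply cU || apply cV. }
      { apply Hm. lra. }
      assert (Hin : forall s, 0 <= s < X -> 0 < P t s /\ 0 < Q t s /\ U t s < b /\ V t s < b)
        by (intros s Hs; apply Hm, X3; lra).
      destruct (Hm0 X X2) as [HP [HQ [HU [HV HE]]]].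
      assert (G : forall s, 0 <= s <= X -> a <= U t s /\ a <= V t s /\
        lo < U t s < hi /\ lo < V t s < hi /\ - Ymax < Y t s < Ymax).
      { intros s Hs. assert (0 <= P t s /\ 0 <= Q t s /\ U t s <= b /\ V t s <= b).
        { destruct (Req_dec s X) as [->|]; [auto|]. destruct (Hin s ltac:(lra)) as [? [? [? ?]]]. lra. }
        apply good; try lra. intros z Hz. destruct (Hin z ltac:(lra)) as [? [? _]]. auto. }
      destruct (orb t 0 X ltac:(lra)) as [O PQ].
      { intros s Hs. now apply G. }
      destruct (PQ X ltac:(lra)) as [EP EQ].
      assert (cg : continuity_pt (fun x => V t x - U t x) X)
        by (apply continuity_pt_minus; apply cPhi).
      destruct (Rtotal_order (U t X) (V t X)) as [Luv|[Luv|Luv]].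
      - assert (QX : 0 < Q t X).
        { destruct (continuity_pt_pos _ X cg ltac:(lra)) as [e [He1 He2]].
          set (s := Rmax 0 (X - e / 2)).
          assert (0 <= s) by apply Rmax_l. assert (X - e / 2 <= s) by apply Rmax_r.
          assert (s < X) by (apply Rmax_lub_lt; lra).
          rewrite EQ. apply (orbit_Q_pos f1 df1 f2 df2 mu j K C1_f1 C1_f2 (U t) (V t) (Y t) s X); [lra| | |].
          - eapply orbit_on_sub; [exact O|lra|lra].
          - intros z Hz. specialize (He2 z ltac:(apply Rabs_def1; lra)). lra.
          - destruct (PQ s ltac:(lra)) as [_ EQs]. rewrite <- EQs. apply Hin. lra. }
        apply N1. apply (exit1 t X); auto; lra.
      - destruct (Req_dec (P t X) 0) as [EP0|EP0]; [destruct (Req_dec (Q t X) 0) as [EQ0|EQ0]|].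
        (* A diagonal point where both quantities vanish is an equilibrium; backward uniqueness
           would make the whole orbit constant, against [P > 0] at 0. *)
        + assert (E : f1 (U t X) + f2 (U t X) = K) by (rewrite <- Luv in EQ; lra).
          assert (Hu : 0 < U t X / j) by (apply O; lra).
          assert (Hc : orbit_on f1 f2 mu j K (fun _ => U t X) (fun _ => U t X) (fun _ => f1 (U t X)) 0 X)
            by (apply (orbit_constant f1 f2 mu j K mu_pos (U t X) Hu E); lra).
          destruct (orbit_unique f1 df1 f2 df2 mu j K mu_pos C1_f1 C1_f2
            _ _ _ _ _ _ 0 X ltac:(lra) O Hc) as [_ A].
          destruct A as [A1' [A2' A3']]; [repeat split; lra|].
          destruct (PQ 0 ltac:(lra)) as [EP' _]. rewrite A1', A3' in EP'. lra.
        (* At the corner [u = v = b] the sum [P + Q] is [f1 b + f2 b - K = 0], so both nonnegative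
           quantities would vanish. *)
        + destruct (Req_dec (U t X) b) as [Eb|Eb].
          { rewrite <- Luv in EQ. rewrite Eb in EQ, EP. lra. }
          apply N1. apply (exit1 t X); auto; lra.
        + destruct (Req_dec (U t X) b) as [Eb|Eb].
          { rewrite <- Luv in EQ. rewrite Eb in EQ, EP. lra. }
          apply N2. apply (exit2 t X); auto; lra.
      - assert (PX : 0 < P t X).
        { destruct (continuity_pt_near _ X 0 cg ltac:(lra)) as [e [He1 He2]].
          set (s := Rmax 0 (X - e / 2)).
          assert (0 <= s) by apply Rmax_l. assert (X - e / 2 <= s) by apply Rmax_r.
          assert (s < X) by (apply Rmax_lub_lt; lra).
          rewrite EP. apply (orbit_P_pos f1 df1 f2 df2 mu j K mu_pos C1_f1 C1_f2 (U t) (V t) (Y t) s X); [lra| | |].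
          - eapply orbit_on_sub; [exact O|lra|lra].
          - intros z Hz. specialize (He2 z ltac:(apply Rabs_def1; lra)). lra.
          - destruct (PQ s ltac:(lra)) as [EPs _]. rewrite <- EPs. apply Hin. lra. }
        apply N2. apply (exit2 t X); auto; lra. }
    assert (G : forall X, 0 <= X -> a <= U t X /\ a <= V t X /\
      lo < U t X < hi /\ lo < V t X < hi /\ - Ymax < Y t X < Ymax).
    { intros X HX. destruct (All X HX) as [? [? [? ?]]]. apply good; try lra.
      intros s Hs. destruct (All s ltac:(lra)) as [? [? _]]. auto. }
    assert (O : forall X, 0 < X -> orbit_on f1 f2 mu j K (U t) (V t) (Y t) 0 X /\
      forall x, 0 <= x <= X -> P t x = f1 (U t x) - Y t x /\ Q t x = f2 (V t x) + Y t x - K).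
    { intros X HX. apply orb; [lra|]. intros x Hx. now apply G. }
    exists (U t), (V t), (Y t). split; [exact I1|split; [exact I2|split]].
    + intros X HX. now apply O.
    + intros x Hx. destruct (All x Hx) as [? [? [? ?]]].
      destruct (O (x + 1) ltac:(lra)) as [_ PQ]. destruct (PQ x ltac:(lra)) as [<- <-].
      destruct (G x Hx) as [? [? _]]. repeat split; auto.
Qed.

End Shooting.

(** * Convergence of the trapped orbit *)

Lemma is_lim_const_R (c : R) : is_lim (fun _ => c) p_infty c.
Proof. apply is_lim_const. Qed.

Lemma is_lim_mult_R (f g : R -> R) (a b : R) :
  is_lim f p_infty a -> is_lim g p_infty b -> is_lim (fun x => f x * g x) p_infty (a * b).
Proof.
  intros Hf Hg. apply (is_lim_mult f g p_infty a b); auto. exact I.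
Qed.

Lemma coupling_limit (j : R) (u v : R -> R) (a b : R) :
  b <> 0 -> is_lim u p_infty a -> is_lim v p_infty b ->
  is_lim (fun x => j * (1 - u x / v x)) p_infty (j * (1 - a / b)).
Proof.
  intros Hb Hu Hv. apply is_lim_mult_R; [apply is_lim_const_R|].
  apply is_lim_minus'; [apply is_lim_const_R|].
  apply is_lim_mult_R; [exact Hu|].
  apply (is_lim_comp_continuity Rinv v b); [|exact Hv].
  apply continuity_pt_inv; [apply derivable_continuous_pt, derivable_pt_id|exact Hb].
Qed.

(** Both velocities are nondecreasing and bounded, so they converge. Since [y] is bounded, its
    derivative can only tend to 0, and the two limits agree. The quantity [f1 u + f2 v - K] is the
    derivative of a bounded function too, so the common limit is a zero of [f1 + f2 - K], and only
    [b] qualifies. *)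
Lemma shooting_converges (f1 df1 f2 df2 : R -> R) (mu j K a b : R) :
  0 < mu -> j < 0 -> a < b -> b < 0 ->
  C1_on j f1 df1 -> C1_on j f2 df2 ->
  f1 b + f2 b = K -> (forall c, a <= c < b -> K < f1 c + f2 c) ->
  exists u v y, u 0 = a /\ v 0 = a /\ orbit f1 f2 mu j K u v y /\
    is_lim u p_infty b /\ is_lim v p_infty b /\
    forall x, 0 <= x -> a <= u x /\ a <= v x.
Proof.
  intros Hmu Hj Hab Hb C1 C2 Kb Hgt.
  destruct (shooting_trapped f1 df1 f2 df2 mu j K a b) as (u & v & y & Iu & Iv & O & T); auto.
  exists u, v, y. split; [exact Iu|split; [exact Iv|split; [exact O|]]].
  assert (dom : forall c, c < 0 -> 0 < c / j).
  { intros c Hc. replace (c / j) with (- c * / - j) by (field; lra).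
    apply Rmult_lt_0_compat; [lra|apply Rinv_0_lt_compat; lra]. }
  assert (mi : 0 < / mu) by now apply Rinv_0_lt_compat.
  assert (cu : forall x, 0 <= x -> continuity_pt u x)
    by (intros x Hx; apply (orbit_cu (O (x + 1) ltac:(lra))); lra).
  assert (cv : forall x, 0 <= x -> continuity_pt v x)
    by (intros x Hx; apply (orbit_cv (O (x + 1) ltac:(lra))); lra).
  assert (du : forall x, 0 < x -> is_derive u x ((f1 (u x) - y x) / mu))
    by (intros x Hx; apply (orbit_du (O (x + 1) ltac:(lra))); lra).
  assert (dv : forall x, 0 < x -> is_derive v x (v x / j * (f2 (v x) + y x - K)))
    by (intros x Hx; apply (orbit_dv (O (x + 1) ltac:(lra))); lra).
  assert (dy : forall x, 0 < x -> is_derive y x (j * (1 - u x / v x)))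
    by (intros x Hx; apply (orbit_dy (O (x + 1) ltac:(lra))); lra).
  destruct (nondecreasing_bounded_limit u b) as [lu [Lu [Lu1 Lu2]]].
  { intros s t Hst. apply (nondecreasing_of_derive u (fun x => (f1 (u x) - y x) / mu)); [lra| | |].
    - intros; apply du; lra.
    - intros; apply cu; lra.
    - intros r Hr. destruct (T r ltac:(lra)) as [? _]. unfold Rdiv. nra. }
  { intros x Hx. destruct (T x Hx) as [_ [_ [? _]]]. lra. }
  destruct (nondecreasing_bounded_limit v b) as [lv [Lv [Lv1 Lv2]]].
  { intros s t Hst. apply (nondecreasing_of_derive v (fun x => v x / j * (f2 (v x) + y x - K))); [lra| | |].
    - intros; apply dv; lra.
    - intros; apply cv; lra.
    - intros r Hr. destruct (T r ltac:(lra)) as [_ [? [_ ?]]].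
      assert (0 < v r / j) by (apply dom; lra). nra. }
  { intros x Hx. destruct (T x Hx) as [_ [_ [_ ?]]]. lra. }
  assert (bd : forall f df, C1_on j f df -> exists B, 0 < B /\ forall c, a <= c <= b -> Rabs (f c) <= B).
  { intros f df Hf. apply continuity_bounded. intros t Ht.
    eapply C1_on_continuity; [exact Hf|apply dom; lra]. }
  destruct (bd f1 df1 C1) as [B1 [HB1 HB1']]. destruct (bd f2 df2 C2) as [B2 [HB2 HB2']].
  assert (G0 : j * (1 - lu / lv) = 0).
  { apply (limit_of_derivative_zero y (fun x => j * (1 - u x / v x)) 0 (B1 + B2 + Rabs K)).
    - exact dy.
    - intros x Hx. destruct (T x ltac:(lra)) as [T1 [T2 [T3 T4]]].
      specialize (HB1' (u x) ltac:(lra)). specialize (HB2' (v x) ltac:(lra)).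
      revert HB1' HB2'. split_Rabs; lra.
    - apply coupling_limit; auto. apply Rlt_not_eq; lra. }
  assert (Elv : lu = lv).
  { assert (lv <> 0) by (apply Rlt_not_eq; lra).
    assert (1 - lu / lv = 0) by (apply Rmult_integral in G0; destruct G0; lra).
    replace lu with (lu / lv * lv) by (field; auto). replace (lu / lv) with 1 by lra. ring. }
  assert (Ea : a <= lu) by (rewrite <- Iu; apply Lu2; lra).
  (* [mu u' + n v' = f1 u + f2 v - K], and [n v' = j v' / v]: hence the primitive with a
     logarithm. *)
  assert (F0 : f1 lu + f2 lu - K = 0).
  { apply (limit_of_derivative_zero (fun x => mu * u x + j * ln (v x / j))
      (fun x => f1 (u x) + f2 (v x) - K) 0
      (mu * (- a) + Rabs j * (Rabs (ln (a / j)) + Rabs (ln (b / j))))).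
    - intros x Hx.
      assert (Hv : 0 < v x / j) by (apply dom; destruct (T x ltac:(lra)); lra).
      replace (f1 (u x) + f2 (v x) - K) with
        (plus (scal mu ((f1 (u x) - y x) / mu))
          (scal j (scal (v x / j * (f2 (v x) + y x - K) * / j) (/ (v x / j)))))
        by (unfold plus, scal; simpl; unfold mult; simpl; destruct (sgn_div _ _ Hv) as [? [? _]]; field; repeat split; auto; lra).
      apply (is_derive_plus (fun x => mu * u x) (fun x => j * ln (v x / j))).
      + apply (is_derive_scal u). now apply du.
      + apply (is_derive_scal (fun x => ln (v x / j))).
        apply (is_derive_comp ln (fun x => v x / j)).
        * apply is_derive_Reals, derivable_pt_lim_ln. exact Hv.
        * unfold Rdiv.
          replace (v x * / j * (f2 (v x) + y x - K) * / j) with (/ j * (v x / j * (f2 (v x) + y x - K)))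
            by (unfold Rdiv; ring).
          apply (is_derive_ext (fun x => / j * v x)); [intros; apply Rmult_comm|].
          apply (is_derive_scal v). now apply dv.
    - intros x Hx. destruct (T x ltac:(lra)) as [_ [_ [T3 T4]]].
      eapply Rle_trans; [apply Rabs_triang|]. rewrite !Rabs_mult.
      apply Rplus_le_compat.
      + rewrite (Rabs_pos_eq mu) by lra. apply Rmult_le_compat_l; [lra|]. apply Rabs_le. lra.
      + apply Rmult_le_compat_l; [apply Rabs_pos|].
        assert (N : forall c d, c <= d -> d < 0 -> ln (d / j) <= ln (c / j)).
        { intros c d Hcd Hd. assert (d / j <= c / j).
          { assert (/ j < 0) by (apply Rinv_lt_0_compat; lra). unfold Rdiv. nra. }
          destruct (Req_dec (c / j) (d / j)) as [->|]; [lra|].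
          apply Rlt_le, ln_increasing; [apply dom; lra|lra]. }
        assert (N1 := N a (v x) ltac:(lra) ltac:(lra)). assert (N2 := N (v x) b ltac:(lra) ltac:(lra)).
        split_Rabs; lra.
    - apply is_lim_minus'; [|apply is_lim_const_R]. apply is_lim_plus'.
      + apply is_lim_comp_continuity; auto. eapply C1_on_continuity; [exact C1|apply dom; lra].
      + rewrite Elv. apply is_lim_comp_continuity; auto. eapply C1_on_continuity; [exact C2|apply dom; lra]. }
  assert (lu = b).
  { destruct Lu1 as [Lt|]; [|assumption]. specialize (Hgt lu ltac:(lra)). lra. }
  subst lv. rewrite H in *. repeat split; auto; apply T; auto.
Qed.

(** * Reduction of the boundary value problem *)

Definition flux (j A g c : R) : R := j * c + A * Rpower (j / c) g.
Definition dflux (j A g c : R) : R := j - g * A * Rpower (j / c) g / c.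

Lemma ex_derive_mult_R (f g : R -> R) (x : R) :
  ex_derive f x -> ex_derive g x -> ex_derive (fun t => f t * g t) x.
Proof. intros Hf Hg. now apply (ex_derive_mult f g). Qed.

Lemma is_derive_Rpower_quot (j g c : R) :
  0 < j / c -> c <> 0 ->
  is_derive (fun c => Rpower (j / c) g) c (- (g / c) * Rpower (j / c) g).
Proof.
  intros Hj Hc. unfold Rpower.
  assert (Hj0 : j <> 0) by (intros ->; unfold Rdiv in Hj; rewrite Rmult_0_l in Hj; lra).
  auto_derive; [auto|]. unfold Rdiv. field. auto.
Qed.

Lemma is_derive_flux (j A g c : R) :
  0 < j / c -> c <> 0 -> is_derive (flux j A g) c (dflux j A g c).
Proof.
  intros Hj Hc. unfold flux, dflux.
  replace (j - g * A * Rpower (j / c) g / c)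
    with (plus (scal j 1) (scal A (- (g / c) * Rpower (j / c) g)))
    by (unfold plus, scal; simpl; unfold mult; simpl; field; auto).
  apply (is_derive_plus (fun c => j * c) (fun c => A * Rpower (j / c) g)).
  - apply (is_derive_scal (fun c => c)). apply @is_derive_id.
  - apply (is_derive_scal (fun c => Rpower (j / c) g)). now apply is_derive_Rpower_quot.
Qed.

Lemma continuity_dflux (j A g c : R) :
  0 < j / c -> c <> 0 -> continuity_pt (dflux j A g) c.
Proof.
  intros Hj Hc. unfold dflux.
  apply continuity_pt_minus; [apply continuity_pt_const; now intros ? ?|].
  apply continuity_pt_mult.
  - apply continuity_pt_mult; [apply continuity_pt_const; now intros ? ?|].
    eapply continuity_pt_of_is_derive. now apply is_derive_Rpower_quot.
  - apply continuity_pt_inv; [apply derivable_continuous_pt, derivable_pt_id|exact Hc].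
Qed.

Lemma neg_div_pos (a b : R) : a < 0 -> b < 0 -> 0 < a / b.
Proof.
  intros Ha Hb. replace (a / b) with (- a * / - b) by (field; lra).
  apply Rmult_lt_0_compat; [lra|apply Rinv_0_lt_compat; lra].
Qed.

Lemma div_pos_neg (a b : R) : 0 < a / b -> b < 0 -> a < 0.
Proof.
  intros H Hb. apply Rnot_le_lt. intros Ha.
  assert (/ b < 0) by now apply Rinv_lt_0_compat. unfold Rdiv in H. nra.
Qed.

Lemma C1_on_flux (i j A g : R) :
  i < 0 -> j < 0 -> C1_on i (flux j A g) (dflux j A g).
Proof.
  intros Hi Hj c Hc. assert (c < 0) by (eapply div_pos_neg; eauto).
  split; [apply is_derive_flux|apply continuity_dflux]; try (now apply neg_div_pos); lra.
Qed.

Lemma flux_density (j A g r c : R) : c <> 0 -> r * c = j ->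
  r * c ^ 2 + pressure A g r = flux j A g c.
Proof.
  intros Hc Hr. unfold flux, pressure. replace (j / c) with r by (rewrite <- Hr; field; auto).
  rewrite <- Hr. ring.
Qed.

Lemma const_of_derive_zero (h : R -> R) (l : R) :
  (forall x, 0 < x -> is_derive h x 0) -> is_lim h p_infty l -> forall x, 0 < x -> h x = l.
Proof.
  intros Hd Hl x Hx.
  assert (E : forall y, x < y -> h y = h x).
  { intros y Hy. destruct (mean_value_open h (fun _ => 0) x y Hy) as [c [_ E]]; [| |lra].
    - intros t Ht. apply Hd. lra.
    - intros t Ht. eapply continuity_pt_of_is_derive. apply Hd. lra. }
  assert (L : is_lim h p_infty (h x)).
  { apply (is_lim_ext_loc (fun _ => h x)); [|apply is_lim_const].
    exists x. intros y Hy. symmetry. now apply E. }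
  apply is_lim_unique in L. apply is_lim_unique in Hl. rewrite L in Hl. now injection Hl.
Qed.

(** The constant extension to the left turns one-sided continuity at 0 into the two-sided continuity
    with which orbits and primitives are stated. *)
Lemma continuity_extend0 (f : R -> R) (x : R) :
  right_continuous0 f -> (forall x, 0 < x -> ex_derive f x) ->
  continuity_pt (fun t => f (Rmax 0 t)) x.
Proof.
  intros H0 H. destruct (Rtotal_order x 0) as [Hx|[->|Hx]].
  - apply continuity_pt_ext_loc with (fun _ => f 0); [|apply continuity_pt_const; now intros ? ?].
    exists (mkposreal (- x) ltac:(lra)). intros t Ht. simpl in Ht.
    unfold ball in Ht; simpl in Ht. unfold AbsRing_ball, abs, minus, plus, opp in Ht; simpl in Ht.
    apply Rabs_def2 in Ht. now rewrite Rmax_left by lra.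
  - intros e He. apply filterlim_locally with (eps := mkposreal e He) in H0.
    destruct H0 as [d Hd]. exists d. split; [apply cond_pos|].
    intros t [_ Ht]. simpl in *. unfold R_dist in *.
    rewrite (Rmax_left 0 0) by lra.
    unfold Rmax. destruct (Rle_dec 0 t) as [Hn|Hn].
    + destruct Hn as [Hn|<-]; [|rewrite Rminus_diag, Rabs_R0; exact He].
      apply Hd; [|exact Hn]. exact Ht.
    + rewrite Rminus_diag, Rabs_R0. exact He.
  - apply continuity_pt_ext_loc with f.
    + exists (mkposreal x Hx). intros t Ht.
      unfold ball in Ht; simpl in Ht. unfold AbsRing_ball, abs, minus, plus, opp in Ht; simpl in Ht.
      apply Rabs_def2 in Ht. now rewrite Rmax_right by lra.
    + apply continuity_pt_filterlim. apply (ex_derive_continuous f x). now apply H.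
Qed.

Lemma is_derive_extend0 (f : R -> R) (x l : R) :
  0 < x -> is_derive f x l -> is_derive (fun t => f (Rmax 0 t)) x l.
Proof.
  intros Hx H. apply is_derive_ext_loc with f; [|exact H].
  exists (mkposreal x Hx). intros t Ht.
  unfold ball in Ht; simpl in Ht. unfold AbsRing_ball, abs, minus, plus, opp in Ht; simpl in Ht.
  apply Rabs_def2 in Ht. now rewrite Rmax_right by lra.
Qed.

Lemma right_continuous_const (f : R -> R) (l : R) :
  right_continuous0 f -> (forall x, 0 < x -> f x = l) -> f 0 = l.
Proof.
  intros H E.
  assert (L : filterlim f (at_right 0) (locally l)).
  { apply (filterlim_ext_loc (fun _ => l)); [|apply filterlim_const].
    exists (mkposreal 1 Rlt_0_1). intros y _ Hy. symmetry. now apply E. }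
  exact (filterlim_locally_unique f (f 0) l H L).
Qed.

Lemma inf_half_line_le (f : R -> R) (x : R) :
  Rbar_lt 0 (inf_half_line f) -> 0 < x -> 0 < f x.
Proof.
  intros H Hx. unfold inf_half_line in H.
  assert (L := proj1 (Glb_Rbar_correct (fun y => exists x, 0 < x /\ y = f x)) (f x)
    (ex_intro _ x (conj Hx eq_refl))).
  exact (Rbar_lt_le_trans 0 _ (f x) H L).
Qed.

Lemma inf_half_line_ge (f : R -> R) (m : R) :
  0 < m -> (forall x, 0 < x -> m <= f x) -> Rbar_lt 0 (inf_half_line f).
Proof.
  intros Hm H. apply Rbar_lt_le_trans with m; [exact Hm|].
  apply Glb_Rbar_correct. intros y [x [Hx ->]]. simpl. now apply H.
Qed.

Lemma locally_positive (x : R) (P : R -> Prop) :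
  0 < x -> (forall t, 0 < t -> P t) -> locally x P.
Proof.
  intros Hx H. exists (mkposreal x Hx). intros t Ht. apply H.
  unfold ball in Ht; simpl in Ht. unfold AbsRing_ball, abs, minus, plus, opp in Ht; simpl in Ht.
  apply Rabs_def2 in Ht. lra.
Qed.

Lemma eventually_bounded (h : R -> R) (l : R) :
  is_lim h p_infty l -> exists X, forall x, X < x -> Rabs (h x) <= Rabs l + 1.
Proof.
  intros H. apply is_lim_spec in H. destruct (H (mkposreal 1 Rlt_0_1)) as [X HX].
  exists X. intros x Hx. specialize (HX x Hx). simpl in HX. split_Rabs; lra.
Qed.

Section Reduction.
Variables (mu A1 A2 gamma alpha rho_p n_p u_p : R).
Hypothesis mu_pos : 0 < mu.
Hypothesis rho_pos : 0 < rho_p.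
Hypothesis n_pos : 0 < n_p.
Hypothesis u_neg : u_p < 0.

Let j1 := rho_p * u_p.
Let j2 := n_p * u_p.
Let f1 := flux j1 A1 gamma.
Let f2 := flux j2 A2 alpha.
Let K := f1 u_p + f2 u_p.

Lemma j1_neg : j1 < 0. Proof. unfold j1. nra. Qed.
Lemma j2_neg : j2 < 0. Proof. unfold j2. nra. Qed.

(** The product [r c] is constant on [x > 0]; its value is read at infinity and carried to 0 by
    right continuity. The sign of [c] comes from the positive density, except at 0, where the
    infimum says nothing and [u_m < 0] decides. *)
Lemma conserved_flux (r c : R -> R) (r_p u_m : R) :
  0 < r_p -> right_continuous0 r -> right_continuous0 c -> c 0 = u_m ->
  (forall x, 0 < x -> ex_derive r x /\ ex_derive c x) ->
  (forall x, 0 < x -> Derive (fun y => r y * c y) x = 0) ->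
  is_lim r p_infty r_p -> is_lim c p_infty u_p -> Rbar_lt 0 (inf_half_line r) ->
  u_m < 0 ->
  forall x, 0 <= x -> c x < 0 /\ r x * c x = r_p * u_p /\ r x = r_p * u_p / c x.
Proof.
  intros Hr Rr Rc C0 D Z Lr Lc I Hm.
  assert (E : forall x, 0 < x -> r x * c x = r_p * u_p).
  { apply (const_of_derive_zero (fun x => r x * c x)).
    - intros x Hx. rewrite <- (Z x Hx). apply Derive_correct.
      destruct (D x Hx). now apply ex_derive_mult_R.
    - now apply is_lim_mult_R. }
  assert (E0 : r 0 * c 0 = r_p * u_p).
  { apply (right_continuous_const (fun x => r x * c x)); [|exact E].
    unfold right_continuous0 in *.
    eapply (filterlim_comp_2 r c Rmult); [exact Rr|exact Rc|].
    apply (filterlim_mult (r 0) (c 0)). }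
  intros x Hx.
  assert (Hc : c x < 0).
  { destruct Hx as [Hx|<-]; [|lra].
    assert (0 < r x) by now apply inf_half_line_le. specialize (E x Hx). nra. }
  assert (Ex : r x * c x = r_p * u_p) by (destruct Hx as [Hx|<-]; auto).
  split; [exact Hc|split; [exact Ex|]]. rewrite <- Ex. field. lra.
Qed.

(** Nothing is known about [Derive (pu w)] at 0, so [y] is rebuilt from the base point 1 as a
    primitive of [j2 * (1 - u / v)], which extends continuously to 0. The constant of the total
    momentum is identified without assuming that the derivatives converge: [mu u + j2 ln (v / j2)]
    has a limit, and so has its derivative, which must therefore tend to 0. *)
Lemma orbit_of_solution (u_m : R) (w : profile) :
  u_m < 0 -> strong_solution mu A1 A2 gamma alpha rho_p n_p u_p u_m w ->
  exists u v y, orbit f1 f2 mu j2 K u v y /\ u 0 = u_m /\ v 0 = u_m /\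
    is_lim u p_infty u_p /\ is_lim v p_infty u_p /\
    forall x, 0 <= x -> u x < 0 /\ v x < 0 /\
      pu w x = u x /\ pv w x = v x /\ prho w x = j1 / u x /\ pn w x = j2 / v x.
Proof.
  intros Hm ((R1 & R2 & R3 & R4 & Reg) & Eqs & U0 & V0 & L1 & L2 & L3 & L4 & I1 & I2).
  assert (J1 := j1_neg). assert (J2 := j2_neg).
  assert (Fu := conserved_flux (prho w) (pu w) rho_p u_m rho_pos R1 R2 U0
    ltac:(intros; split; now apply Reg) ltac:(intros; now apply Eqs) L1 L2 I1 Hm).
  assert (Fv := conserved_flux (pn w) (pv w) n_p u_m n_pos R3 R4 V0
    ltac:(intros; split; now apply Reg) ltac:(intros; now apply Eqs) L3 L4 I2 Hm).
  fold j1 in Fu. fold j2 in Fv.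
  set (u := fun x => pu w (Rmax 0 x)). set (v := fun x => pv w (Rmax 0 x)).
  assert (Eu : forall x, 0 <= x -> u x = pu w x) by (intros; unfold u; now rewrite Rmax_right).
  assert (Ev : forall x, 0 <= x -> v x = pv w x) by (intros; unfold v; now rewrite Rmax_right).
  assert (Nu : forall x, u x < 0) by (intros; apply Fu, Rmax_l).
  assert (Nv : forall x, v x < 0) by (intros; apply Fv, Rmax_l).
  assert (Cu : forall x, continuity_pt u x) by (intros; apply continuity_extend0; auto; intros; now apply Reg).
  assert (Cv : forall x, continuity_pt v x) by (intros; apply continuity_extend0; auto; intros; now apply Reg).
  assert (CG : forall x, continuity_pt (fun x => j2 * (1 - u x / v x)) x).
  { intros x. apply continuity_pt_mult; [apply continuity_pt_const; now intros ? ?|].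
    apply continuity_pt_minus; [apply continuity_pt_const; now intros ? ?|].
    apply continuity_pt_div; auto. specialize (Nv x). lra. }
  assert (Du : forall x, 0 < x -> is_derive (pu w) x (Derive (pu w) x))
    by (intros; apply Derive_correct; now apply Reg).
  assert (Dv : forall x, 0 < x -> is_derive (pv w) x (Derive (pv w) x))
    by (intros; apply Derive_correct; now apply Reg).
  assert (DDu : forall x, 0 < x -> ex_derive (Derive (pu w)) x) by (intros; now apply Reg).
  assert (DDv : forall x, 0 < x -> ex_derive (Derive (pv w)) x) by (intros; now apply Reg).
  set (y1 := fun x => f1 (pu w x) - mu * Derive (pu w) x).
  set (r := fun x => pn w x * Derive (pv w) x).
  assert (Df1 : forall x, 0 < x -> is_derive (fun x => f1 (pu w x)) x (Derive (pu w) x * dflux j1 A1 gamma (pu w x))).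
  { intros x Hx. apply (is_derive_comp f1 (pu w)); [|now apply Du].
    destruct (Fu x ltac:(lra)) as [? _]. apply is_derive_flux; [now apply neg_div_pos|lra]. }
  assert (Df2 : forall x, 0 < x -> is_derive (fun x => f2 (pv w x)) x (Derive (pv w) x * dflux j2 A2 alpha (pv w x))).
  { intros x Hx. apply (is_derive_comp f2 (pv w)); [|now apply Dv].
    destruct (Fv x ltac:(lra)) as [? _]. apply is_derive_flux; [now apply neg_div_pos|lra]. }
  assert (Gx : forall x, 0 < x -> pn w x * (pv w x - pu w x) = j2 * (1 - u x / v x)).
  { intros x Hx. rewrite Eu, Ev by lra. destruct (Fv x ltac:(lra)) as [? [? ->]]. field. lra. }
  assert (Dy1 : forall x, 0 < x -> is_derive y1 x (j2 * (1 - u x / v x))).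
  { intros x Hx. destruct (Eqs x Hx) as [_ [E _]].
    rewrite (Derive_ext_loc _ (fun x => f1 (pu w x))) in E.
    2:{ apply locally_positive; [exact Hx|]. intros t Ht.
        destruct (Fu t ltac:(lra)) as [? [? _]]. apply flux_density; lra. }
    rewrite <- (Gx x Hx).
    replace (pn w x * (pv w x - pu w x)) with
      (Derive (fun x => f1 (pu w x)) x - Derive (fun y => mu * Derive (pu w) y) x).
    2:{ change (Derive (fun x => f1 (pu w x)) x = Derive (fun y => mu * Derive (pu w) y) x
          + pn w x * (pv w x - pu w x)) in E. lra. }
    apply (is_derive_minus (fun x => f1 (pu w x)) (fun y => mu * Derive (pu w) y)).
    - apply Derive_correct. eexists. now apply Df1.
    - apply Derive_correct. apply ex_derive_scal. now apply DDu. }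
  assert (Dr : forall x, 0 < x -> is_derive (fun x => f2 (pv w x) - r x) x (- (j2 * (1 - u x / v x)))).
  { intros x Hx. destruct (Eqs x Hx) as [_ [_ [_ E]]].
    rewrite (Derive_ext_loc _ (fun x => f2 (pv w x))) in E.
    2:{ apply locally_positive; [exact Hx|]. intros t Ht.
        destruct (Fv t ltac:(lra)) as [? [? _]]. apply flux_density; lra. }
    rewrite <- (Gx x Hx).
    replace (- (pn w x * (pv w x - pu w x))) with
      (Derive (fun x => f2 (pv w x)) x - Derive r x).
    2:{ change (Derive (fun x => f2 (pv w x)) x = Derive r x - pn w x * (pv w x - pu w x)) in E. lra. }
    apply (is_derive_minus (fun x => f2 (pv w x)) r).
    - apply Derive_correct. eexists. now apply Df2.
    - apply Derive_correct. apply ex_derive_mult_R; [now apply Reg|now apply DDv]. }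
  set (y := fun x => y1 1 + RInt (fun x => j2 * (1 - u x / v x)) 1 x).
  assert (Dy : forall x, is_derive y x (j2 * (1 - u x / v x)))
    by (intros; now apply (is_derive_primitive (fun x => j2 * (1 - u x / v x)))).
  assert (eqd : forall g h dg : R -> R, (forall x, 0 < x -> is_derive g x (dg x)) ->
    (forall x, 0 < x -> is_derive h x (dg x)) -> forall x, 0 < x -> g x - h x = g 1 - h 1).
  { intros g h dg Hg Hh x Hx.
    assert (D0 : forall x, 0 < x -> is_derive (fun x => g x - h x) x 0).
    { intros t Ht. replace 0 with (dg t - dg t) by ring.
      apply (is_derive_minus g h); auto. }
    assert (H := lipschitz_of_derive (fun x => g x - h x) (fun _ => 0) 0 1 x).
    assert (P : 0 < Rmin 1 x) by (apply Rmin_glb_lt; lra).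
    specialize (H ltac:(intros; apply D0; lra) ltac:(intros; cbv beta; rewrite Rabs_R0; lra)).
    rewrite Rmult_0_l in H. pose proof (Rabs_pos (g x - h x - (g 1 - h 1))).
    assert (Z : Rabs (g x - h x - (g 1 - h 1)) = 0) by lra.
    apply Rabs_eq_0 in Z. lra. }
  assert (Ey : forall x, 0 < x -> y x = y1 x).
  { intros x Hx. assert (H := eqd y y1 _ (fun x _ => Dy x) Dy1 x Hx).
    unfold y at 2 in H. rewrite RInt_point in H. unfold zero in H; simpl in H. lra. }
  set (K' := y1 1 + (f2 (pv w 1) - r 1)).
  assert (EK : forall x, 0 < x -> y1 x + (f2 (pv w x) - r x) = K').
  { intros x Hx.
    assert (H := eqd y1 (fun x => - (f2 (pv w x) - r x)) _ Dy1).
    assert (D' : forall x, 0 < x -> is_derive (fun x => - (f2 (pv w x) - r x)) x (j2 * (1 - u x / v x))).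
    { intros t Ht. replace (j2 * (1 - u t / v t)) with (opp (- (j2 * (1 - u t / v t))))
        by (unfold opp; simpl; ring).
      apply (is_derive_opp (fun x => f2 (pv w x) - r x)). now apply Dr. }
    specialize (H D' x Hx). simpl in H. unfold K'. lra. }
  assert (Rx : forall x, 0 < x -> r x = f2 (pv w x) + y x - K')
    by (intros x Hx; rewrite (Ey x Hx), <- (EK x Hx); ring).
  assert (Lf : forall f df (s : R -> R), C1_on j2 f df -> is_lim s p_infty u_p ->
    is_lim (fun x => f (s x)) p_infty (f u_p)).
  { intros f df s Hf Hs. apply is_lim_comp_continuity; [|exact Hs].
    eapply C1_on_continuity; [exact Hf|now apply neg_div_pos]. }
  assert (HK : f1 u_p + f2 u_p - K' = 0).
  { set (h := fun x => mu * pu w x + j2 * ln (pv w x / j2)).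
    assert (Lh : is_lim h p_infty (mu * u_p + j2 * ln (u_p / j2))).
    { apply is_lim_plus'; apply is_lim_mult_R; auto; try apply is_lim_const_R.
      apply (is_lim_comp_continuity (fun c => ln (c / j2)) (pv w)); [|exact L4].
      apply (continuity_pt_comp (fun c => c / j2) ln).
      - apply continuity_pt_mult; [apply derivable_continuous_pt, derivable_pt_id|].
        apply continuity_pt_const; now intros ? ?.
      - eapply continuity_pt_of_is_derive. apply is_derive_Reals, derivable_pt_lim_ln.
        now apply neg_div_pos. }
    destruct (eventually_bounded _ _ Lh) as [X HX].
    apply (limit_of_derivative_zero h (fun x => f1 (pu w x) + f2 (pv w x) - K') (Rmax 0 X)
      (Rabs (mu * u_p + j2 * ln (u_p / j2)) + 1)).
    - intros x Hx. assert (0 < x) by (eapply Rle_lt_trans; [apply Rmax_l|exact Hx]).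
      destruct (Fv x ltac:(lra)) as [Hv [_ En]].
      replace (f1 (pu w x) + f2 (pv w x) - K') with
        (plus (scal mu (Derive (pu w) x))
          (scal j2 (scal (scal (/ j2) (Derive (pv w) x)) (/ (pv w x / j2))))).
      + apply (is_derive_plus (fun x => mu * pu w x) (fun x => j2 * ln (pv w x / j2))).
        * apply (is_derive_scal (pu w)). now apply Du.
        * apply (is_derive_scal (fun x => ln (pv w x / j2))).
          apply (is_derive_comp ln (fun x => pv w x / j2)).
          -- apply is_derive_Reals, derivable_pt_lim_ln. now apply neg_div_pos.
          -- apply (is_derive_ext (fun x => / j2 * pv w x)); [intros; apply Rmult_comm|].
             apply (is_derive_scal (pv w)). now apply Dv.
      + assert (H1 := EK x H). unfold y1 in H1.
        replace (f1 (pu w x) + f2 (pv w x) - K') with (mu * Derive (pu w) x + r x) by lra.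
        unfold r. rewrite En. unfold plus, scal; simpl; unfold mult; simpl. field. lra.
    - intros x Hx. apply HX. eapply Rle_lt_trans; [apply Rmax_r|exact Hx].
    - apply is_lim_minus'; [|apply is_lim_const_R]. apply is_lim_plus'.
      + eapply Lf; [|exact L2]. now apply C1_on_flux.
      + eapply Lf; [|exact L4]. now apply C1_on_flux. }
  assert (EKK : K' = K) by (unfold K; lra).
  exists u, v, y. split.
  { intros X HX. split; intros x Hx; auto.
    - eapply continuity_pt_of_is_derive. apply Dy.
    - now apply neg_div_pos.
    - now apply neg_div_pos.
    - replace ((f1 (u x) - y x) / mu) with (Derive (pu w) x).
      + apply is_derive_extend0; [lra|]. apply Du. lra.
      + rewrite Ey, Eu by lra. unfold y1. field. lra.
    - replace (v x / j2 * (f2 (v x) + y x - K)) with (Derive (pv w) x).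
      + apply is_derive_extend0; [lra|]. apply Dv. lra.
      + rewrite Ev, <- EKK, <- Rx by lra. unfold r.
        destruct (Fv x ltac:(lra)) as [? [_ ->]]. field. lra. }
  rewrite Eu, Ev by lra. split; [exact U0|split; [exact V0|split; [|split]]].
  - apply (is_lim_ext_loc (pu w)); [|exact L2]. exists 0. intros x Hx. symmetry. apply Eu. lra.
  - apply (is_lim_ext_loc (pv w)); [|exact L4]. exists 0. intros x Hx. symmetry. apply Ev. lra.
  - intros x Hx. rewrite <- Eu, <- Ev by lra.
    destruct (Fu x Hx) as [? [_ ?]]. destruct (Fv x Hx) as [? [_ ?]].
    rewrite <- Eu in * by lra. rewrite <- Ev in * by lra. repeat split; auto.
Qed.

(** The lower bound [u_m] keeps the negative velocities bounded, so the densities, constant fluxes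
    divided by velocities, stay away from 0. *)
Lemma solution_of_orbit (u_m : R) (u v y : R -> R) :
  u_m < 0 -> orbit f1 f2 mu j2 K u v y -> u 0 = u_m -> v 0 = u_m ->
  is_lim u p_infty u_p -> is_lim v p_infty u_p ->
  (forall x, 0 <= x -> u_m <= u x /\ u_m <= v x) ->
  strong_solution mu A1 A2 gamma alpha rho_p n_p u_p u_m
    (Profile (fun x => j1 / u x) u (fun x => j2 / v x) v).
Proof.
  intros Hm O U0 V0 Lu Lv Hb.
  assert (J1 := j1_neg). assert (J2 := j2_neg).
  assert (Nu : forall x, 0 <= x -> u x < 0).
  { intros x Hx. apply (div_pos_neg _ j2); [|exact J2]. apply (orbit_u (O (x + 1) ltac:(lra))). lra. }
  assert (Nv : forall x, 0 <= x -> v x < 0).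
  { intros x Hx. apply (div_pos_neg _ j2); [|exact J2]. apply (orbit_v (O (x + 1) ltac:(lra))). lra. }
  assert (cu : forall x, 0 <= x -> continuity_pt u x)
    by (intros x Hx; apply (orbit_cu (O (x + 1) ltac:(lra))); lra).
  assert (cv : forall x, 0 <= x -> continuity_pt v x)
    by (intros x Hx; apply (orbit_cv (O (x + 1) ltac:(lra))); lra).
  assert (du : forall x, 0 < x -> is_derive u x ((f1 (u x) - y x) / mu))
    by (intros x Hx; apply (orbit_du (O (x + 1) ltac:(lra))); lra).
  assert (dv : forall x, 0 < x -> is_derive v x (v x / j2 * (f2 (v x) + y x - K)))
    by (intros x Hx; apply (orbit_dv (O (x + 1) ltac:(lra))); lra).
  assert (dP : forall x, 0 < x -> is_derive (fun t => f1 (u t) - y t) x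
    (dflux j1 A1 gamma (u x) * ((f1 (u x) - y x) / mu) - j2 * (1 - u x / v x))).
  { intros x Hx. apply (orbit_dP f1 _ f2 mu j2 K (C1_on_flux j2 j1 A1 gamma J2 J1) u v y 0 (x + 1));
    [apply O; lra|lra]. }
  assert (dQ : forall x, 0 < x -> is_derive (fun t => f2 (v t) + y t - K) x
    (dflux j2 A2 alpha (v x) * (v x / j2 * (f2 (v x) + y x - K)) + j2 * (1 - u x / v x))).
  { intros x Hx. apply (orbit_dQ f1 f2 _ mu j2 K (C1_on_flux j2 j2 A2 alpha J2 J2) u v y 0 (x + 1));
    [apply O; lra|lra]. }
  assert (Eu : forall x, 0 < x -> Derive u x = (f1 (u x) - y x) / mu)
    by (intros; now apply is_derive_unique, du).
  assert (Ev : forall x, 0 < x -> Derive v x = v x / j2 * (f2 (v x) + y x - K))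
    by (intros; now apply is_derive_unique, dv).
  assert (ri : forall j (s : R -> R), s 0 < 0 -> continuity_pt s 0 ->
    right_continuous0 s /\ right_continuous0 (fun x => j / s x)).
  { intros j s Hs Cs.
    assert (R : forall g, continuity_pt g 0 -> right_continuous0 g).
    { intros g Hg. apply continuity_pt_filterlim in Hg.
      unfold right_continuous0. eapply filterlim_filter_le_1; [|exact Hg].
      intros P [d Hd]. exists d. intros t Ht _. now apply Hd. }
    split; apply R; [exact Cs|].
    apply continuity_pt_div; [apply continuity_pt_const; now intros ? ?|exact Cs|lra]. }
  assert (inv_lim : forall j (s : R -> R), is_lim s p_infty u_p ->
    is_lim (fun x => j * u_p / s x) p_infty j).
  { intros j s Hs.
    enough (L : is_lim (fun x => / s x) p_infty (/ u_p)).
    { assert (H := is_lim_mult_R _ _ _ _ (is_lim_const_R (j * u_p)) L).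
      now replace (j * u_p * / u_p) with j in H by (field; lra). }
    apply (is_lim_comp_continuity Rinv s u_p); [|exact Hs].
    apply continuity_pt_inv; [apply derivable_continuous_pt, derivable_pt_id|lra]. }
  assert (exq : forall j (s : R -> R) x, s x < 0 -> ex_derive s x -> ex_derive (fun x => j / s x) x).
  { intros j s x Hs [l Hl]. exists (- (j * l / s x ^ 2)).
    assert (E : Derive (fun x => s x) x = l) by now apply is_derive_unique.
    auto_derive; [split; [now exists l|lra]|]. rewrite E. field. lra. }
  assert (infq : forall j (s : R -> R), j < 0 -> (forall x, 0 < x -> u_m <= s x /\ s x < 0) ->
    Rbar_lt 0 (inf_half_line (fun x => j / s x))).
  { intros j s Hj Hs. apply (inf_half_line_ge _ (j / u_m)); [now apply neg_div_pos|].
    intros x Hx. destruct (Hs x Hx) as [H1 H2].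
    assert (/ s x <= / u_m).
    { apply Ropp_le_cancel. rewrite <- !Rinv_opp. apply Rinv_le_contravar; lra. }
    unfold Rdiv. nra. }
  split; [|split; [|simpl]].
  - unfold regular_profile; simpl.
    destruct (ri j1 u ltac:(lra) ltac:(apply cu; lra)) as [? ?].
    destruct (ri j2 v ltac:(lra) ltac:(apply cv; lra)) as [? ?].
    do 4 (split; [assumption|]). intros x Hx.
    assert (E1 : ex_derive u x) by (eexists; now apply du).
    assert (E2 : ex_derive v x) by (eexists; now apply dv).
    split; [apply exq; auto; apply Nu; lra|].
    split; [apply exq; auto; apply Nv; lra|].
    split; [exact E1|]. split; [|split; [exact E2|]].
    + simpl. apply (ex_derive_ext_loc (fun t => / mu * (f1 (u t) - y t))).
      * apply locally_positive; [exact Hx|]. intros t Ht.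
        change (/ mu * (f1 (u t) - y t) = Derive u t). rewrite Eu by exact Ht. apply Rmult_comm.
      * apply ex_derive_scal. eexists. now apply dP.
    + simpl. apply (ex_derive_ext_loc (fun t => v t * (/ j2 * (f2 (v t) + y t - K)))).
      * apply locally_positive; [exact Hx|]. intros t Ht.
        change (v t * (/ j2 * (f2 (v t) + y t - K)) = Derive v t). rewrite Ev by exact Ht. unfold Rdiv. ring.
      * apply ex_derive_mult_R; [exact E2|]. apply ex_derive_scal. eexists. now apply dQ.
  - intros x Hx. simpl.
    assert (Hu := Nu x ltac:(lra)). assert (Hv := Nv x ltac:(lra)).
    assert (P0 : forall j (s : R -> R), (forall t, 0 < t -> s t < 0) -> Derive (fun t => j / s t * s t) x = 0).
    { intros j s Hs. rewrite (Derive_ext_loc _ (fun _ => j)); [apply Derive_const|].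
      apply locally_positive; [exact Hx|]. intros t Ht. field. specialize (Hs t Ht). lra. }
    split; [apply P0; intros; apply Nu; lra|]. split; [|split; [apply P0; intros; apply Nv; lra|]].
    + rewrite (Derive_ext_loc _ (fun t => f1 (u t))).
      2:{ apply locally_positive; [exact Hx|]. intros t Ht. assert (Hut := Nu t ltac:(lra)).
          apply flux_density; [lra|]. field. lra. }
      rewrite (Derive_ext_loc (fun t => mu * Derive u t) (fun t => f1 (u t) - y t)).
      2:{ apply locally_positive; [exact Hx|]. intros t Ht. rewrite Eu by exact Ht. field. lra. }
      change (Derive (fun t : R => f1 (u t)) x
        = Derive (fun t : R => f1 (u t) - y t) x + j2 / v x * (v x - u x)).
      rewrite (is_derive_unique (fun t : R => f1 (u t) - y t) x _ (dP x Hx)).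
      rewrite (is_derive_unique (fun t : R => f1 (u t)) x (((f1 (u x) - y x) / mu) * dflux j1 A1 gamma (u x))).
      * field. split; lra.
      * apply (is_derive_comp f1 u); [|now apply du]. apply is_derive_flux; [now apply neg_div_pos|lra].
    + rewrite (Derive_ext_loc _ (fun t => f2 (v t))).
      2:{ apply locally_positive; [exact Hx|]. intros t Ht. assert (Hvt := Nv t ltac:(lra)).
          apply flux_density; [lra|]. field. lra. }
      rewrite (Derive_ext_loc (fun t => j2 / v t * Derive v t) (fun t => f2 (v t) + y t - K)).
      2:{ apply locally_positive; [exact Hx|]. intros t Ht. rewrite Ev by exact Ht.
          assert (Hvt := Nv t ltac:(lra)). field. lra. }
      change (Derive (fun t : R => f2 (v t)) x
        = Derive (fun t : R => f2 (v t) + y t - K) x - j2 / v x * (v x - u x)).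
      rewrite (is_derive_unique (fun t : R => f2 (v t) + y t - K) x _ (dQ x Hx)).
      rewrite (is_derive_unique (fun t : R => f2 (v t)) x ((v x / j2 * (f2 (v x) + y x - K)) * dflux j2 A2 alpha (v x))).
      * field. split; lra.
      * apply (is_derive_comp f2 v); [|now apply dv]. apply is_derive_flux; [now apply neg_div_pos|lra].
  - split; [exact U0|split; [exact V0|]].
    split; [unfold j1; now apply inv_lim|]. split; [exact Lu|].
    split; [unfold j2; now apply inv_lim|]. split; [exact Lv|].
    split; apply infq; auto; intros x Hx; (split; [apply Hb; lra|]); [apply Nu|apply Nv]; lra.
Qed.

End Reduction.

(** * Asymptotic estimates *)

(** The constant is uniform over [D]. Later [T] ranges over pairs of an orbit and a position, which
    makes every estimate uniform in the boundary data. *)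
Definition bigO {T : Type} (D : T -> Prop) (f g : T -> R) : Prop :=
  exists C, 0 < C /\ forall t, D t -> Rabs (f t) <= C * g t.

Section BigO.
Context {T : Type} {D : T -> Prop}.
Implicit Types f g h k : T -> R.

Lemma bigO_sub (D' : T -> Prop) f g : (forall t, D' t -> D t) -> bigO D f g -> bigO D' f g.
Proof. intros H [C [HC H']]. exists C. split; auto. Qed.

Lemma bigO_le f g : (forall t, D t -> Rabs (f t) <= g t) -> bigO D f g.
Proof. intros H. exists 1. split; [lra|]. intros t Ht. specialize (H t Ht). lra. Qed.

Lemma bigO_ext f f' g : (forall t, D t -> f t = f' t) -> bigO D f' g -> bigO D f g.
Proof. intros E [C [HC H]]. exists C. split; auto. intros t Ht. rewrite E; auto. Qed.

Lemma bigO_trans f g h : bigO D f g -> bigO D g h -> bigO D f h.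
Proof.
  intros [C [HC H]] [C' [HC' H']]. exists (C * C'). split; [nra|]. intros t Ht.
  specialize (H t Ht). specialize (H' t Ht).
  assert (g t <= Rabs (g t)) by apply Rle_abs. nra.
Qed.

Lemma bigO_plus f f' g : bigO D f g -> bigO D f' g -> bigO D (fun t => f t + f' t) g.
Proof.
  intros [C [HC H]] [C' [HC' H']]. exists (C + C'). split; [lra|]. intros t Ht.
  specialize (H t Ht). specialize (H' t Ht).
  eapply Rle_trans; [apply Rabs_triang|]. lra.
Qed.

Lemma bigO_opp f g : bigO D f g -> bigO D (fun t => - f t) g.
Proof. intros [C [HC H]]. exists C. split; auto. intros t Ht. rewrite Rabs_Ropp. auto. Qed.

Lemma bigO_minus f f' g : bigO D f g -> bigO D f' g -> bigO D (fun t => f t - f' t) g.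
Proof. intros H H'. apply (bigO_plus f (fun t => - f' t)); auto. now apply bigO_opp. Qed.

Lemma bigO_mult f f' g g' :
  bigO D f g -> bigO D f' g' -> bigO D (fun t => f t * f' t) (fun t => g t * g' t).
Proof.
  intros [C [HC H]] [C' [HC' H']]. exists (C * C'). split; [nra|]. intros t Ht.
  specialize (H t Ht). specialize (H' t Ht). rewrite Rabs_mult.
  replace (C * C' * (g t * g' t)) with ((C * g t) * (C' * g' t)) by ring.
  apply Rmult_le_compat; auto using Rabs_pos.
Qed.

Lemma bigO_const c : bigO D (fun _ => c) (fun _ => 1).
Proof. exists (Rabs c + 1). pose proof (Rabs_pos c). split; [lra|]. intros. lra. Qed.

Lemma bigO_mult_1l f f' g : bigO D f (fun _ => 1) -> bigO D f' g -> bigO D (fun t => f t * f' t) g.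
Proof.
  intros H H'. destruct (bigO_mult _ _ _ _ H H') as [C [HC E]]. exists C. split; auto.
  intros t Ht. specialize (E t Ht). cbv beta in E. now rewrite Rmult_1_l in E.
Qed.

Lemma bigO_mult_1r f f' g : bigO D f g -> bigO D f' (fun _ => 1) -> bigO D (fun t => f t * f' t) g.
Proof.
  intros H H'. destruct (bigO_mult _ _ _ _ H H') as [C [HC E]]. exists C. split; auto.
  intros t Ht. specialize (E t Ht). cbv beta in E. now rewrite Rmult_1_r in E.
Qed.

Lemma bigO_scal c f g : bigO D f g -> bigO D (fun t => c * f t) g.
Proof. intros H. apply (bigO_mult_1l (fun _ => c)); auto. apply bigO_const. Qed.

End BigO.

Definition C1_bounded (p q : R) (f df : R -> R) : Prop :=
  (forall c, p <= c <= q -> is_derive f c (df c)) /\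
  exists B, 0 < B /\ forall c, p <= c <= q -> Rabs (df c) <= B.

Lemma between_bounds (b c t : R) : Rmin b c <= t <= Rmax b c -> Rabs (t - b) <= Rabs (c - b).
Proof. unfold Rmin, Rmax. destruct (Rle_dec b c); intros; split_Rabs; lra. Qed.

Lemma between_range (p q b c t : R) :
  p <= b <= q -> p <= c <= q -> Rmin b c <= t <= Rmax b c -> p <= t <= q.
Proof. unfold Rmin, Rmax. destruct (Rle_dec b c); intros; lra. Qed.

Lemma lipschitz_bound (p q : R) (f df : R -> R) :
  C1_bounded p q f df ->
  exists B, 0 < B /\ forall b c, p <= b <= q -> p <= c <= q ->
    Rabs (f c - f b) <= B * Rabs (c - b).
Proof.
  intros [Hd [B [HB HB']]]. exists B. split; auto. intros b c Hb Hc.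
  apply (lipschitz_of_derive f df); intros t Ht; [apply Hd|apply HB'];
  now apply (between_range p q b c).
Qed.

Lemma taylor2_bound (p q : R) (f df ddf : R -> R) :
  C1_bounded p q f df -> C1_bounded p q df ddf ->
  exists B, 0 < B /\ forall b c, p <= b <= q -> p <= c <= q ->
    Rabs (f c - f b - df b * (c - b)) <= B * Rabs (c - b) ^ 2.
Proof.
  intros [Hd _] H2. destruct (lipschitz_bound p q df ddf H2) as [B [HB HB']].
  exists B. split; auto. intros b c Hb Hc.
  replace (f c - f b - df b * (c - b))
    with ((fun t => f t - df b * t) c - (fun t => f t - df b * t) b) by ring.
  replace (B * Rabs (c - b) ^ 2) with ((B * Rabs (c - b)) * Rabs (c - b)) by ring.
  apply (lipschitz_of_derive (fun t => f t - df b * t) (fun t => df t - df b)).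
  - intros t Ht. assert (p <= t <= q) by now apply (between_range p q b c).
    apply (is_derive_minus f (fun t => df b * t)); [now apply Hd|].
    auto_derive; [exact I|ring].
  - intros t Ht. assert (p <= t <= q) by now apply (between_range p q b c).
    eapply Rle_trans; [now apply HB'|]. apply Rmult_le_compat_l; [lra|]. now apply between_bounds.
Qed.

Lemma taylor3_bound (p q : R) (f df ddf dddf : R -> R) :
  C1_bounded p q f df -> C1_bounded p q df ddf -> C1_bounded p q ddf dddf ->
  exists B, 0 < B /\ forall b c, p <= b <= q -> p <= c <= q ->
    Rabs (f c - f b - df b * (c - b) - ddf b / 2 * (c - b) ^ 2) <= B * Rabs (c - b) ^ 3.
Proof.
  intros [Hd _] H2 H3. destruct (taylor2_bound p q df ddf dddf H2 H3) as [B [HB HB']].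
  exists B. split; auto. intros b c Hb Hc.
  set (g := fun t => f t - df b * t - ddf b / 2 * (t - b) ^ 2).
  replace (f c - f b - df b * (c - b) - ddf b / 2 * (c - b) ^ 2) with (g c - g b)
    by (unfold g; ring).
  replace (B * Rabs (c - b) ^ 3) with ((B * Rabs (c - b) ^ 2) * Rabs (c - b)) by ring.
  apply (lipschitz_of_derive g (fun t => df t - df b - ddf b * (t - b))).
  - intros t Ht. assert (p <= t <= q) by now apply (between_range p q b c).
    unfold g. apply (is_derive_minus (fun t => f t - df b * t) (fun t => ddf b / 2 * (t - b) ^ 2)).
    + apply (is_derive_minus f (fun t => df b * t)); [now apply Hd|].
      auto_derive; [exact I|ring].
    + auto_derive; [exact I|field].
  - intros t Ht. assert (p <= t <= q) by now apply (between_range p q b c).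
    eapply Rle_trans; [now apply HB'|]. apply Rmult_le_compat_l; [lra|].
    apply pow_incr. split; [apply Rabs_pos|]. now apply between_bounds.
Qed.

Lemma bigO_comp_bounded {T : Type} (D : T -> Prop) (p q : R) (f df : R -> R) (c : T -> R) :
  C1_bounded p q f df -> (forall t, D t -> p <= c t <= q) ->
  bigO D (fun t => f (c t)) (fun _ => 1).
Proof.
  intros [H _] Hc.
  destruct (continuity_bounded f p q) as [B [HB HB']].
  { intros t Ht. eapply continuity_pt_of_is_derive. now apply H. }
  exists B. split; auto. intros t Ht. rewrite Rmult_1_r. apply HB'. auto.
Qed.

(** * Exponential decay *)

Lemma nondecreasing_le_limit (f : R -> R) (l x : R) :
  is_lim f p_infty l -> (forall y, x <= y -> f x <= f y) -> f x <= l.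
Proof.
  intros Hl H. apply is_lim_spec in Hl. apply Rnot_lt_le. intros Hlt.
  destruct (Hl (mkposreal (f x - l) ltac:(lra))) as [X HX]. simpl in HX.
  pose proof (Rmax_l x X). pose proof (Rmax_r x X).
  specialize (HX (Rmax x X + 1) ltac:(lra)). specialize (H (Rmax x X + 1) ltac:(lra)).
  apply Rabs_def2 in HX. lra.
Qed.

Section Trapped.
Variables (f1 f2 : R -> R) (mu j K b : R) (u v y : R -> R).
Hypothesis mu_pos : 0 < mu.
Hypothesis Horb : orbit f1 f2 mu j K u v y.
Hypothesis lim_u : is_lim u p_infty b.
Hypothesis lim_v : is_lim v p_infty b.
Hypothesis PQ : forall x, 0 <= x -> 0 < f1 (u x) - y x /\ 0 < f2 (v x) + y x - K.

Lemma trapped_increasing x x' : 0 <= x < x' -> u x < u x' /\ v x < v x'.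
Proof.
  intros Hx. assert (O := Horb (x' + 1) ltac:(lra)). split.
  - apply (increasing_of_derive u (fun x => (f1 (u x) - y x) / mu)); [lra| | |].
    + intros t Ht. apply O. lra.
    + intros t Ht. apply O. lra.
    + intros t Ht. apply Rdiv_lt_0_compat; [|exact mu_pos]. apply PQ. lra.
  - apply (increasing_of_derive v (fun x => v x / j * (f2 (v x) + y x - K))); [lra| | |].
    + intros t Ht. apply O. lra.
    + intros t Ht. apply O. lra.
    + intros t Ht. apply Rmult_lt_0_compat; [apply O; lra|apply PQ; lra].
Qed.

Lemma trapped_range x : 0 <= x -> u 0 <= u x < b /\ v 0 <= v x < b.
Proof.
  intros Hx.
  assert (M : forall s t, 0 <= s <= t -> u s <= u t /\ v s <= v t).
  { intros s t Hst. destruct (Req_dec s t) as [->|]; [lra|].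
    destruct (trapped_increasing s t); lra. }
  assert (u (x + 1) <= b).
  { apply nondecreasing_le_limit; auto. intros t Ht. apply M. lra. }
  assert (v (x + 1) <= b).
  { apply nondecreasing_le_limit; auto. intros t Ht. apply M. lra. }
  destruct (trapped_increasing x (x + 1) ltac:(lra)).
  destruct (M 0 x ltac:(lra)). lra.
Qed.

End Trapped.

(** With [S = (b - u) + (b - v)], one has [|T| <= A S] and [T' <= - (beta / 2) S], so [T] decays
    exponentially. No lower bound of [T] by [S] is at hand; instead, as [S] decreases and [T] is
    nonnegative, [T (x - 1)] is at least [(beta / 2) S x], which transfers the decay to [S]. *)
Lemma supersonic_decay (f1 df1 ddf1 f2 df2 ddf2 : R -> R) (mu j K b p q : R) :
  0 < mu -> p < b < q -> (forall c, p <= c <= q -> 0 < c / j) ->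
  C1_bounded p q f1 df1 -> C1_bounded p q df1 ddf1 ->
  C1_bounded p q f2 df2 -> C1_bounded p q df2 ddf2 ->
  f1 b + f2 b = K -> df1 b + df2 b < 0 ->
  exists d0 C c, 0 < d0 /\ 0 < C /\ 0 < c /\ forall u v y,
    orbit f1 f2 mu j K u v y -> u 0 = v 0 -> b - u 0 <= d0 ->
    is_lim u p_infty b -> is_lim v p_infty b ->
    (forall x, 0 <= x -> 0 < f1 (u x) - y x /\ 0 < f2 (v x) + y x - K) ->
    forall x, 0 <= x -> Rabs (u x - b) <= C * (b - u 0) * exp (- c * x) /\
      Rabs (v x - b) <= C * (b - u 0) * exp (- c * x).
Proof.
  intros Hmu Hpq Hdom B1 B1' B2 B2' HK Hneg.
  destruct (sgn_div _ _ (Hdom b ltac:(lra))) as [Nb [Nj Njb]].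
  set (N := j / b). set (kappa := (df2 b - df1 b) / (2 * N)).
  assert (HN : 0 < N) by exact Njb.
  set (beta := - (df1 b + df2 b) / 2).
  assert (Hbeta : 0 < beta) by (unfold beta; lra).
  (* the affine combination [T] below is chosen so that the linear part of [T'] is [- beta (z + zeta)] *)
  set (Psi := fun u v => f1 u + f2 v - K - kappa * (j * (1 - u / v))).
  set (D := fun uv : R * R => p <= fst uv <= b /\ p <= snd uv <= b).
  destruct (taylor2_bound p q f1 df1 ddf1 B1 B1') as [E1 [E1p HE1]].
  destruct (taylor2_bound p q f2 df2 ddf2 B2 B2') as [E2 [E2p HE2]].
  destruct (lipschitz_bound p q f1 df1 B1) as [L1 [L1p HL1]].
  destruct (lipschitz_bound p q f2 df2 B2) as [L2 [L2p HL2]].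
  assert (Hinv : C1_bounded p q Rinv (fun c => - / c ^ 2)).
  { split.
    - intros c Hc. destruct (sgn_div _ _ (Hdom c Hc)) as [Nc _].
      auto_derive; [auto|field; auto].
    - apply continuity_bounded. intros c Hc. destruct (sgn_div _ _ (Hdom c Hc)) as [Nc _].
      apply continuity_pt_opp, continuity_pt_inv; [|now apply pow_nonzero].
      apply derivable_continuous_pt, derivable_pt_pow. }
  destruct (lipschitz_bound p q Rinv _ Hinv) as [L3 [L3p HL3]].
  assert (Hln : C1_bounded p q (fun c => ln (c / b)) (fun c => / c)).
  { split.
    - intros c Hc. destruct (sgn_div _ _ (Hdom c Hc)) as [Nc _].
      assert (0 < c / b).
      { replace (c / b) with ((c / j) * (j / b)) by (field; auto).
        apply Rmult_lt_0_compat; [now apply Hdom|exact Njb]. }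
      auto_derive; [auto|field; auto].
    - apply continuity_bounded. intros c Hc. destruct (sgn_div _ _ (Hdom c Hc)) as [Nc _].
      apply continuity_pt_inv; [apply derivable_continuous_pt, derivable_pt_id|auto]. }
  destruct (lipschitz_bound p q _ _ Hln) as [L4 [L4p HL4]].
  set (E := E1 + E2 + 2 * Rabs kappa * Rabs j * L3).
  assert (HPsi : forall u v, p <= u <= b -> p <= v <= b ->
    Rabs (Psi u v - beta * ((b - u) + (b - v))) <= E * ((b - u) ^ 2 + (b - v) ^ 2)).
  { intros u v Hu Hv.
    destruct (sgn_div _ _ (Hdom v ltac:(lra))) as [Nv _].
    replace (Psi u v - beta * ((b - u) + (b - v))) with
      ((f1 u - f1 b - df1 b * (u - b)) + (f2 v - f2 b - df2 b * (v - b))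
       - kappa * j * ((/ v - / b) * (v - u))).
    2:{ unfold Psi, beta, kappa, N. rewrite <- HK. field. auto. }
    specialize (HE1 b u ltac:(lra) ltac:(lra)). specialize (HE2 b v ltac:(lra) ltac:(lra)).
    specialize (HL3 b v ltac:(lra) ltac:(lra)).
    rewrite <- (Rabs_Ropp (u - b)), (Rabs_pos_eq (- (u - b))) in HE1 by lra.
    rewrite <- (Rabs_Ropp (v - b)), (Rabs_pos_eq (- (v - b))) in HE2, HL3 by lra.
    assert (H3 : Rabs (kappa * j * ((/ v - / b) * (v - u))) <=
      Rabs kappa * Rabs j * (L3 * (b - v) * ((b - u) + (b - v)))).
    { rewrite !Rabs_mult. apply Rmult_le_compat_l.
      - apply Rmult_le_pos; apply Rabs_pos.
      - apply Rmult_le_compat; try apply Rabs_pos; [lra|split_Rabs; lra]. }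
    assert (H4 : L3 * (b - v) * ((b - u) + (b - v)) <= 2 * L3 * ((b - u) ^ 2 + (b - v) ^ 2)).
    { assert (0 <= ((b - u) - (b - v)) ^ 2) by apply pow2_ge_0.
      assert ((b - v) * ((b - u) + (b - v)) <= 2 * ((b - u) ^ 2 + (b - v) ^ 2)) by nra. nra. }
    assert (0 <= Rabs kappa * Rabs j) by (apply Rmult_le_pos; apply Rabs_pos).
    assert (H5 := Rmult_le_compat_l _ _ _ H H4).
    replace (- (u - b)) with (b - u) in * by ring. replace (- (v - b)) with (b - v) in * by ring.
    assert (0 <= (b - u) ^ 2) by apply pow2_ge_0. assert (0 <= (b - v) ^ 2) by apply pow2_ge_0.
    unfold Rminus at 1. eapply Rle_trans; [apply Rabs_triang|]. rewrite Rabs_Ropp.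
    eapply Rle_trans; [apply Rplus_le_compat_r, Rabs_triang|]. unfold E. nra. }
  assert (Ep : 0 < E).
  { unfold E. assert (0 <= Rabs kappa * Rabs j) by (apply Rmult_le_pos; apply Rabs_pos). nra. }
  (* The second entry makes the quadratic remainder at most half of the linear part [beta S]. *)
  set (d0 := Rmin (b - p) (beta / (2 * E))).
  assert (d0p : 0 < d0).
  { apply Rmin_glb_lt; [lra|]. apply Rdiv_lt_0_compat; lra. }
  set (A := mu + Rabs j * L4 + Rabs kappa * (L1 + L2)).
  assert (Ap : 0 < A).
  { unfold A. pose proof (Rabs_pos j). pose proof (Rabs_pos kappa).
    assert (0 <= Rabs j * L4) by (apply Rmult_le_pos; lra).
    assert (0 <= Rabs kappa * (L1 + L2)) by (apply Rmult_le_pos; lra). lra. }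
  set (c := beta / (2 * A)).
  assert (cp : 0 < c) by (apply Rdiv_lt_0_compat; lra).
  (* [exp c] pays for the step back by one unit; the summand 1 covers [x < 1]. *)
  set (C := (4 * A / beta + 1) * exp c).
  assert (cA : c * A = beta / 2) by (unfold c; field; lra).
  assert (Cp : 0 < 4 * A / beta) by (apply Rdiv_lt_0_compat; lra).
  exists d0, C, c. split; [exact d0p|]. split; [apply Rmult_lt_0_compat; [lra|apply exp_pos]|].
  split; [exact cp|].
  intros u v y O Huv Hd Lu Lv PQ.
  assert (d01 : d0 <= b - p) by apply Rmin_l.
  assert (d02 : d0 <= beta / (2 * E)) by apply Rmin_r.
  assert (Rg := trapped_range f1 f2 mu j K b u v y Hmu O Lu Lv PQ).
  set (d := b - u 0) in *.
  set (S := fun x => (b - u x) + (b - v x)).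
  set (T := fun x => mu * (b - u x) - j * ln (v x / b) + kappa * (y x - f1 b)).
  assert (TS : forall x, 0 <= x -> Rabs (T x) <= A * S x).
  { intros x Hx. destruct (Rg x Hx) as [R1 R2]. destruct (PQ x Hx) as [P1 P2].
    assert (Hu : p <= u x <= q) by (unfold d in Hd; lra).
    assert (Hv : p <= v x <= q) by (unfold d in Hd; lra).
    assert (A1 := HL1 b (u x) ltac:(lra) Hu). assert (A2 := HL2 b (v x) ltac:(lra) Hv).
    assert (A4 := HL4 b (v x) ltac:(lra) Hv). cbv beta in A4.
    replace (b / b) with 1 in A4 by (field; auto). rewrite ln_1, Rminus_0_r in A4.
    rewrite (Rabs_left (u x - b)) in A1 by lra. rewrite (Rabs_left (v x - b)) in A2, A4 by lra.
    assert (A3 : Rabs (y x - f1 b) <= (L1 + L2) * S x).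
    { apply Rabs_le_between in A1. apply Rabs_le_between in A2.
      unfold S. apply Rabs_le. nra. }
    unfold T.
    eapply Rle_trans; [apply Rabs_triang|].
    eapply Rle_trans; [apply Rplus_le_compat_r; unfold Rminus; apply Rabs_triang|].
    rewrite Rabs_Ropp, !Rabs_mult.
    rewrite (Rabs_pos_eq mu), (Rabs_pos_eq (b + - u x)) by lra.
    assert (H1 := Rmult_le_compat_l _ _ _ (Rabs_pos j) A4).
    assert (H2 := Rmult_le_compat_l _ _ _ (Rabs_pos kappa) A3).
    assert (0 <= Rabs j * L4 * (b - u x)).
    { apply Rmult_le_pos; [apply Rmult_le_pos; [apply Rabs_pos|lra]|lra]. }
    assert (0 <= mu * (b - v x)) by (apply Rmult_le_pos; lra).
    unfold Rminus in *. unfold A, S in *. nra. }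
  assert (dT : forall x, 0 < x -> is_derive T x (- Psi (u x) (v x))).
  { intros x Hx. assert (O' := O (x + 1) ltac:(lra)).
    assert (Du := orbit_du O' x ltac:(lra)). assert (Dv := orbit_dv O' x ltac:(lra)).
    assert (Dy := orbit_dy O' x ltac:(lra)). assert (Hv := orbit_v O' x ltac:(lra)).
    destruct (sgn_div _ _ Hv) as [Nv _].
    assert (Hvb : 0 < v x / b).
    { replace (v x / b) with ((v x / j) * (j / b)) by (field; auto). now apply Rmult_lt_0_compat. }
    unfold T.
    assert (Eu : Derive (fun x => u x) x = (f1 (u x) - y x) / mu) by now apply is_derive_unique.
    assert (Ev : Derive (fun x => v x) x = v x / j * (f2 (v x) + y x - K)) by now apply is_derive_unique.
    assert (Ey : Derive (fun x => y x) x = j * (1 - u x / v x)) by now apply is_derive_unique.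
    auto_derive.
    - split; [eexists; exact Du|]. split; [eexists; exact Dv|]. split; [exact Hvb|].
      split; [eexists; exact Dy|exact I].
    - rewrite Eu, Ev, Ey. unfold Psi. field. repeat split; auto; lra. }
  assert (cT : forall x, 0 <= x -> continuity_pt T x).
  { intros x Hx. assert (O' := O (x + 1) ltac:(lra)). unfold T.
    assert (Cu := orbit_cu O' x ltac:(lra)). assert (Cv := orbit_cv O' x ltac:(lra)).
    assert (Cy := orbit_cy O' x ltac:(lra)). destruct (Rg x Hx).
    apply (continuity_pt_plus (fun x => mu * (b - u x) - j * ln (v x / b)) (fun x => kappa * (y x - f1 b))).
    - apply (continuity_pt_minus (fun x => mu * (b - u x)) (fun x => j * ln (v x / b))).
      + apply continuity_pt_mult; [apply continuity_pt_const; now intros ? ?|].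
        apply continuity_pt_minus; [apply continuity_pt_const; now intros ? ?|exact Cu].
      + apply continuity_pt_mult; [apply continuity_pt_const; now intros ? ?|].
        apply (continuity_pt_comp v (fun c => ln (c / b))); [exact Cv|].
        eapply continuity_pt_of_is_derive. apply Hln. unfold d in Hd; lra.
    - apply continuity_pt_mult; [apply continuity_pt_const; now intros ? ?|].
      apply continuity_pt_minus; [exact Cy|apply continuity_pt_const; now intros ? ?]. }
  assert (Sp : forall x, 0 <= x -> 0 < S x <= 2 * d).
  { intros x Hx. destruct (Rg x Hx). unfold S, d. lra. }
  assert (PsiS : forall x, 0 <= x -> beta / 2 * S x <= Psi (u x) (v x)).
  { intros x Hx. destruct (Rg x Hx) as [R1 R2].
    specialize (HPsi (u x) (v x) ltac:(unfold d in Hd; lra) ltac:(unfold d in Hd; lra)).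
    apply Rabs_le_between in HPsi.
    assert (HdE : d * E <= beta / 2).
    { assert (d * E <= beta / (2 * E) * E) by (apply Rmult_le_compat_r; lra).
      replace (beta / (2 * E) * E) with (beta / 2) in H by (field; lra). exact H. }
    assert (E * ((b - u x) ^ 2 + (b - v x) ^ 2) <= beta / 2 * S x); [|unfold S in *; lra].
    assert ((b - u x) ^ 2 + (b - v x) ^ 2 <= d * S x) by (unfold S, d; nra).
    apply Rle_trans with (E * (d * S x)); [apply Rmult_le_compat_l; lra|].
    destruct (Sp x Hx). nra. }
  assert (Tdec : forall x x', 0 <= x <= x' -> T x' * exp (c * x') <= T x * exp (c * x)).
  { intros x x' Hx.
    enough (- (T x * exp (c * x)) <= - (T x' * exp (c * x'))) by lra.
    apply (nondecreasing_of_derive (fun t => - (T t * exp (c * t)))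
      (fun t => opp ((- Psi (u t) (v t) + c * T t) * exp (c * t)))); [lra| | |].
    - intros t Ht. apply (is_derive_opp (fun t => T t * exp (c * t))).
      apply is_derive_mul_exp, dT. lra.
    - intros t Ht. apply continuity_pt_opp, continuity_pt_mul_exp, cT. lra.
    - intros t Ht. unfold opp; simpl.
      specialize (PsiS t ltac:(lra)). specialize (TS t ltac:(lra)).
      assert (c * T t <= beta / 2 * S t).
      { rewrite <- cA, Rmult_assoc. apply Rmult_le_compat_l; [lra|].
        eapply Rle_trans; [apply Rle_abs|exact TS]. }
      pose proof (exp_pos (c * t)). nra. }
  assert (Tmono : forall x x', 0 <= x <= x' -> T x' + beta / 2 * (S x' * (x' - x)) <= T x).
  { intros x x' Hx.
    enough (- T x - beta / 2 * S x' * x <= - T x' - beta / 2 * S x' * x') by lra.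
    apply (nondecreasing_of_derive (fun t => - T t - beta / 2 * S x' * t)
      (fun t => minus (opp (- Psi (u t) (v t))) (beta / 2 * S x'))); [lra| | |].
    - intros t Ht. apply (is_derive_minus (fun t => - T t) (fun t => beta / 2 * S x' * t)).
      + apply (is_derive_opp T), dT. lra.
      + auto_derive; [exact I|ring].
    - intros t Ht. apply continuity_pt_minus; [apply continuity_pt_opp, cT; lra|].
      apply continuity_pt_mult; [apply continuity_pt_const; now intros ? ?|].
      apply derivable_continuous_pt, derivable_pt_id.
    - intros t Ht. unfold opp, minus, plus; simpl.
      specialize (PsiS t ltac:(lra)).
      destruct (trapped_increasing f1 f2 mu j K u v y Hmu O PQ t x' ltac:(lra)).
      assert (S x' <= S t) by (unfold S; lra). unfold opp; simpl. nra. }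
  (* [T] is nonincreasing and tends to 0 together with [S]. *)
  assert (T0 : forall x, 0 <= x -> 0 <= T x).
  { intros x Hx. apply Rnot_lt_le. intros Hlt.
    assert (LS : is_lim S p_infty ((b - b) + (b - b))).
    { apply is_lim_plus'; apply is_lim_minus'; auto; apply is_lim_const. }
    apply is_lim_spec in LS.
    assert (ep : 0 < - T x / A) by (apply Rdiv_lt_0_compat; lra).
    destruct (LS (mkposreal _ ep)) as [X HX]. simpl in HX.
    pose proof (Rmax_l x X). pose proof (Rmax_r x X). set (x' := Rmax x X + 1).
    specialize (HX x' ltac:(unfold x'; lra)).
    assert (H1 := Tmono x x' ltac:(unfold x'; lra)).
    destruct (Sp x' ltac:(unfold x'; lra)) as [S1 _].
    assert (TS' := TS x' ltac:(unfold x'; lra)).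
    assert (0 <= beta / 2 * (S x' * (x' - x))).
    { apply Rmult_le_pos; [lra|]. apply Rmult_le_pos; [lra|unfold x'; lra]. }
    apply Rabs_def2 in HX. apply Rabs_le_between in TS'.
    assert (A * S x' < - T x); [|lra].
    replace (- T x) with (A * (- T x / A)) by (field; lra).
    apply Rmult_lt_compat_l; lra. }
  assert (Sx : forall x, 0 <= x -> S x <= 4 * A / beta * exp c * d * exp (- c * x) \/ x < 1).
  { intros x Hx. destruct (Rlt_dec x 1) as [|H1]; [now right|left].
    assert (Q1 := Tmono (x - 1) x ltac:(lra)). assert (Q2 := T0 x Hx).
    assert (Q3 := Tdec 0 (x - 1) ltac:(lra)).
    rewrite Rmult_0_r, exp_0, Rmult_1_r in Q3.
    assert (Q4 := TS 0 ltac:(lra)). assert (Q5 := Rle_abs (T 0)).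
    assert (Q6 : S 0 <= 2 * d) by (apply Sp; lra).
    assert (Q7 : T 0 <= A * (2 * d)) by nra.
    assert (Q8 : T (x - 1) <= A * (2 * d) * (exp c * exp (- c * x))).
    { apply Rmult_le_reg_r with (exp (c * (x - 1))); [apply exp_pos|].
      rewrite Rmult_assoc, <- !exp_plus.
      replace (c + - c * x + c * (x - 1)) with 0 by ring. rewrite exp_0. lra. }
    replace (x - (x - 1)) with 1 in Q1 by ring.
    apply Rmult_le_reg_l with (beta / 2); [lra|].
    replace (beta / 2 * (4 * A / beta * exp c * d * exp (- c * x)))
      with (A * (2 * d) * (exp c * exp (- c * x))) by (field; lra). lra. }
  intros x Hx.
  assert (dp : 0 < d) by (unfold d; destruct (Rg 0 ltac:(lra)); lra).
  assert (Fin : S x <= 2 * (C * d * exp (- c * x)) /\ b - u x <= C * d * exp (- c * x) /\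
    b - v x <= C * d * exp (- c * x)).
  { destruct (Rg x Hx). destruct (Sx x Hx) as [H1|H1].
    - assert (0 < exp c * d * exp (- c * x)).
      { apply Rmult_lt_0_compat; [apply Rmult_lt_0_compat; [apply exp_pos|lra]|apply exp_pos]. }
      assert (S x <= C * d * exp (- c * x)) by (unfold C; nra).
      unfold S in *. lra.
    - assert (1 <= exp c * exp (- c * x)).
      { rewrite <- exp_plus. pose proof (exp_ineq1_le (c + - c * x)). nra. }
      assert (d <= C * d * exp (- c * x)).
      { unfold C. replace ((4 * A / beta + 1) * exp c * d * exp (- c * x))
          with ((4 * A / beta + 1) * d * (exp c * exp (- c * x))) by ring.
        assert (d <= (4 * A / beta + 1) * d) by nra. nra. }
      unfold S, d in *. lra. }
  destruct (Rg x Hx). destruct Fin as [_ [F1 F2]].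
  rewrite !Rabs_left by lra. lra.
Qed.

(** * Derivatives along an orbit *)

Definition C3_on (j : R) (f df ddf dddf : R -> R) : Prop :=
  C1_on j f df /\ C1_on j df ddf /\ C1_on j ddf dddf.

(* [ju k], [jv k]: the [k]-th derivatives of [u], [v] along an orbit, as functions of the state *)
Section Jets.
Variables (f1 df1 ddf1 f2 df2 ddf2 : R -> R) (mu j K : R).

Definition jG (u v y : R) : R := j * (1 - u / v).
Definition jQ (u v y : R) : R := f2 v + y - K.
Definition ju1 (u v y : R) : R := (f1 u - y) / mu.
Definition jv1 (u v y : R) : R := v / j * jQ u v y.
Definition ju2 (u v y : R) : R := (df1 u * ju1 u v y - jG u v y) / mu.
Definition jQ1 (u v y : R) : R := df2 v * jv1 u v y + jG u v y.
Definition jv2 (u v y : R) : R := (jv1 u v y * jQ u v y + v * jQ1 u v y) / j.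
Definition jG1 (u v y : R) : R := - j * (ju1 u v y * v - u * jv1 u v y) / v ^ 2.
Definition ju3 (u v y : R) : R :=
  (ddf1 u * ju1 u v y ^ 2 + df1 u * ju2 u v y - jG1 u v y) / mu.
Definition jQ2 (u v y : R) : R :=
  ddf2 v * jv1 u v y ^ 2 + df2 v * jv2 u v y + jG1 u v y.
Definition jv3 (u v y : R) : R :=
  (jv2 u v y * jQ u v y + 2 * jv1 u v y * jQ1 u v y + v * jQ2 u v y) / j.

Hypothesis C1_f1 : C1_on j f1 df1.
Hypothesis C1_f2 : C1_on j f2 df2.
Hypothesis C1_df1 : C1_on j df1 ddf1.
Hypothesis C1_df2 : C1_on j df2 ddf2.

Section Along.
Variables (u v y : R -> R).
Hypothesis Horb : orbit f1 f2 mu j K u v y.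
Let along (F : R -> R -> R -> R) (x : R) : R := F (u x) (v x) (y x).

Lemma orbit_is_derive x : 0 < x ->
  is_derive u x (along ju1 x) /\ is_derive v x (along jv1 x) /\
  is_derive y x (along jG x) /\ 0 < u x / j /\ 0 < v x / j /\ v x <> 0 /\ j <> 0.
Proof.
  intros Hx. assert (O := Horb (x + 1) ltac:(lra)).
  assert (Hv := orbit_v O x ltac:(lra)). destruct (sgn_div _ _ Hv) as [? [? _]].
  split; [exact (orbit_du O x ltac:(lra))|]. split; [exact (orbit_dv O x ltac:(lra))|].
  split; [exact (orbit_dy O x ltac:(lra))|]. split; [apply O; lra|auto].
Qed.

Lemma is_derive_comp_orbit (f df s : R -> R) (x l : R) :
  C1_on j f df -> 0 < s x / j -> is_derive s x l -> is_derive (fun t => f (s t)) x (df (s x) * l).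
Proof.
  intros Hf Hs Hl. rewrite Rmult_comm. apply (is_derive_comp f s); [now apply Hf|exact Hl].
Qed.

Lemma is_derive_mult_R (f g : R -> R) (x a b : R) :
  is_derive f x a -> is_derive g x b -> is_derive (fun t => f t * g t) x (a * g x + f x * b).
Proof. intros Hf Hg. apply (is_derive_mult f g); auto. intros; apply Rmult_comm. Qed.

Lemma is_derive_scal_R (f : R -> R) (x a c : R) :
  is_derive f x a -> is_derive (fun t => c * f t) x (c * a).
Proof. intros Hf. now apply (is_derive_scal f). Qed.

Lemma is_derive_plus_R (f g : R -> R) (x a b : R) :
  is_derive f x a -> is_derive g x b -> is_derive (fun t => f t + g t) x (a + b).
Proof. intros Hf Hg. now apply (is_derive_plus f g). Qed.

Lemma is_derive_minus_R (f g : R -> R) (x a b : R) :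
  is_derive f x a -> is_derive g x b -> is_derive (fun t => f t - g t) x (a - b).
Proof. intros Hf Hg. now apply (is_derive_minus f g). Qed.

Lemma is_derive_eq (f : R -> R) (x a b : R) : is_derive f x a -> a = b -> is_derive f x b.
Proof. now intros H <-. Qed.

Lemma is_derive_ext_R (f g : R -> R) (x l : R) :
  (forall t, f t = g t) -> is_derive f x l -> is_derive g x l.
Proof. intros E. now apply is_derive_ext. Qed.

Lemma is_derive_ju1 x : 0 < x -> is_derive (along ju1) x (along ju2 x).
Proof.
  intros Hx. destruct (orbit_is_derive x Hx) as (Du & Dv & Dy & Pu & Pv & Nv & Nj).
  apply (is_derive_ext_R (fun t => / mu * (f1 (u t) - y t))); [intros; apply Rmult_comm|].
  eapply is_derive_eq.
  - apply is_derive_scal_R, is_derive_minus_R; [|exact Dy].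
    apply (is_derive_comp_orbit f1 df1 u); [exact C1_f1|exact Pu|exact Du].
  - unfold along, ju2. unfold Rdiv. ring.
Qed.

Lemma is_derive_jQ x : 0 < x -> is_derive (along jQ) x (along jQ1 x).
Proof.
  intros Hx. destruct (orbit_is_derive x Hx) as (Du & Dv & Dy & Pu & Pv & Nv & Nj).
  eapply is_derive_eq.
  - apply (is_derive_minus_R (fun t => f2 (v t) + y t) (fun _ => K)); [|apply @is_derive_const].
    apply is_derive_plus_R; [|exact Dy].
    apply (is_derive_comp_orbit f2 df2 v); [exact C1_f2|exact Pv|exact Dv].
  - unfold along, jQ1, zero; simpl. ring.
Qed.

Lemma is_derive_jv1 x : 0 < x -> is_derive (along jv1) x (along jv2 x).
Proof.
  intros Hx. destruct (orbit_is_derive x Hx) as (Du & Dv & Dy & Pu & Pv & Nv & Nj).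
  apply (is_derive_ext_R (fun t => / j * (v t * along jQ t))).
  - intros t. unfold along, jv1, Rdiv. ring.
  - eapply is_derive_eq.
    + apply is_derive_scal_R, is_derive_mult_R; [exact Dv|now apply is_derive_jQ].
    + unfold along, jv2, Rdiv. ring.
Qed.

Lemma is_derive_jG x : 0 < x -> is_derive (along jG) x (along jG1 x).
Proof.
  intros Hx. destruct (orbit_is_derive x Hx) as (Du & Dv & Dy & Pu & Pv & Nv & Nj).
  unfold along, jG, jG1.
  assert (Eu : Derive (fun x => u x) x = along ju1 x) by now apply is_derive_unique.
  assert (Ev : Derive (fun x => v x) x = along jv1 x) by now apply is_derive_unique.
  auto_derive.
  - split; [eexists; exact Du|]. split; [eexists; exact Dv|]. split; [exact Nv|exact I].
  - rewrite Eu, Ev. unfold along. field. exact Nv.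
Qed.

Lemma is_derive_ju2 x : 0 < x -> is_derive (along ju2) x (along ju3 x).
Proof.
  intros Hx. destruct (orbit_is_derive x Hx) as (Du & Dv & Dy & Pu & Pv & Nv & Nj).
  apply (is_derive_ext_R (fun t => / mu * (df1 (u t) * along ju1 t - along jG t))).
  - intros t. apply Rmult_comm.
  - eapply is_derive_eq.
    + apply is_derive_scal_R, is_derive_minus_R; [|now apply is_derive_jG].
      apply is_derive_mult_R; [|now apply is_derive_ju1].
      apply (is_derive_comp_orbit df1 ddf1 u); [exact C1_df1|exact Pu|exact Du].
    + unfold along, ju3, Rdiv. ring.
Qed.

Lemma is_derive_jQ1 x : 0 < x -> is_derive (along jQ1) x (along jQ2 x).
Proof.
  intros Hx. destruct (orbit_is_derive x Hx) as (Du & Dv & Dy & Pu & Pv & Nv & Nj).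
  eapply is_derive_eq.
  - apply (is_derive_plus_R (fun t => df2 (v t) * along jv1 t) (along jG)); [|now apply is_derive_jG].
    apply is_derive_mult_R; [|now apply is_derive_jv1].
    apply (is_derive_comp_orbit df2 ddf2 v); [exact C1_df2|exact Pv|exact Dv].
  - unfold along, jQ2. ring.
Qed.

Lemma is_derive_jv2 x : 0 < x -> is_derive (along jv2) x (along jv3 x).
Proof.
  intros Hx. destruct (orbit_is_derive x Hx) as (Du & Dv & Dy & Pu & Pv & Nv & Nj).
  apply (is_derive_ext_R (fun t => / j * (along jv1 t * along jQ t + v t * along jQ1 t))).
  - intros t. apply Rmult_comm.
  - eapply is_derive_eq.
    + apply is_derive_scal_R, is_derive_plus_R; apply is_derive_mult_R.
      * now apply is_derive_jv1.
      * now apply is_derive_jQ.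
      * exact Dv.
      * now apply is_derive_jQ1.
    + unfold along, jv3, Rdiv. ring.
Qed.

End Along.
End Jets.

(** The first three derivatives of a quotient [J / s], that is of a density, in terms of those of
    the velocity [s]. *)
Definition q1 (J s s1 : R) : R := - J * s1 / s ^ 2.
Definition q2 (J s s1 s2 : R) : R := - J * s2 / s ^ 2 + 2 * J * s1 ^ 2 / s ^ 3.
Definition q3 (J s s1 s2 s3 : R) : R :=
  - J * s3 / s ^ 2 + 6 * J * s1 * s2 / s ^ 3 - 6 * J * s1 ^ 3 / s ^ 4.

Lemma is_derive_quot (J : R) (s s1 s2 s3 : R -> R) (x : R) :
  s x <> 0 -> is_derive s x (s1 x) -> is_derive s1 x (s2 x) -> is_derive s2 x (s3 x) ->
  is_derive (fun t => J / s t) x (q1 J (s x) (s1 x)) /\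
  is_derive (fun t => q1 J (s t) (s1 t)) x (q2 J (s x) (s1 x) (s2 x)) /\
  is_derive (fun t => q2 J (s t) (s1 t) (s2 t)) x (q3 J (s x) (s1 x) (s2 x) (s3 x)).
Proof.
  intros Hs D0 D1 D2.
  assert (E0 : Derive (fun x => s x) x = s1 x) by now apply is_derive_unique.
  assert (E1 : Derive (fun x => s1 x) x = s2 x) by now apply is_derive_unique.
  assert (E2 : Derive (fun x => s2 x) x = s3 x) by now apply is_derive_unique.
  assert (X0 : ex_derive (fun x => s x) x) by (eexists; exact D0).
  assert (X1 : ex_derive (fun x => s1 x) x) by (eexists; exact D1).
  assert (X2 : ex_derive (fun x => s2 x) x) by (eexists; exact D2).
  assert (s x * (s x * 1) <> 0) by (repeat apply Rmult_integral_contrapositive_currified; auto; lra).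
  assert (s x * (s x * (s x * 1)) <> 0) by (repeat apply Rmult_integral_contrapositive_currified; auto; lra).
  unfold q1, q2, q3. split; [|split].
  - auto_derive; [auto|]. rewrite E0. field. auto.
  - auto_derive; [repeat split; auto|]. rewrite E0, E1. field. auto.
  - auto_derive; [repeat split; auto|]. rewrite E0, E1, E2. field. auto.
Qed.

Lemma Derive_n_chain (f s0 s1 s2 s3 : R -> R) (c : R) :
  (forall x, 0 < x -> f x = s0 x) ->
  (forall x, 0 < x -> is_derive s0 x (s1 x)) ->
  (forall x, 0 < x -> is_derive s1 x (s2 x)) ->
  (forall x, 0 < x -> is_derive s2 x (s3 x)) ->
  forall x, 0 < x ->
    (forall k, (k <= 3)%nat -> ex_derive_n f k x) /\
    f x - c = s0 x - c /\
    Derive_n (fun y => f y - c) 1 x = s1 x /\ Derive_n (fun y => f y - c) 2 x = s2 x /\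
    Derive_n (fun y => f y - c) 3 x = s3 x.
Proof.
  intros E D0 D1 D2.
  assert (step : forall g h h' : R -> R, (forall x, 0 < x -> g x = h x) ->
    (forall x, 0 < x -> is_derive h x (h' x)) -> forall x, 0 < x -> is_derive g x (h' x)).
  { intros g h h' Eg Dh x Hx. apply (is_derive_ext_loc h); [|now apply Dh].
    apply locally_positive; [exact Hx|]. intros t Ht. symmetry. now apply Eg. }
  assert (chain : forall g, (forall x, 0 < x -> is_derive g x (s1 x)) -> forall x, 0 < x ->
    Derive g x = s1 x /\ is_derive (Derive g) x (s2 x) /\ Derive (Derive g) x = s2 x /\
    is_derive (Derive (Derive g)) x (s3 x)).
  { intros g Dg.
    assert (G1 : forall x, 0 < x -> Derive g x = s1 x) by (intros; now apply is_derive_unique, Dg).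
    assert (G2 := step _ _ _ G1 D1).
    assert (G3 : forall x, 0 < x -> Derive (Derive g) x = s2 x) by (intros; now apply is_derive_unique, G2).
    assert (G4 := step _ _ _ G3 D2). auto. }
  assert (Df := step _ _ _ E D0).
  assert (Dg : forall x, 0 < x -> is_derive (fun y => f y - c) x (s1 x)).
  { intros x Hx. rewrite <- (Rminus_0_r (s1 x)).
    apply (is_derive_minus f (fun _ => c)); [now apply Df|apply @is_derive_const]. }
  intros x Hx. destruct (chain f Df x Hx) as (_ & F2 & _ & F3).
  destruct (chain _ Dg x Hx) as (G1 & _ & G2 & G3).
  split; [|split; [now rewrite E|split; [exact G1|split; [exact G2|now apply is_derive_unique]]]].
  intros k Hk. destruct k as [|[|[|[|k]]]]; [exact I| | | |lia]; eexists; [now apply Df|exact F2|exact F3].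
Qed.

Lemma norm4_le (a b c d : R) :
  sqrt (a ^ 2 + b ^ 2 + c ^ 2 + d ^ 2) <= Rabs a + Rabs b + Rabs c + Rabs d.
Proof.
  rewrite <- (sqrt_pow2 (Rabs a + Rabs b + Rabs c + Rabs d)).
  - apply sqrt_le_1_alt.
    rewrite <- (pow2_abs a), <- (pow2_abs b), <- (pow2_abs c), <- (pow2_abs d).
    pose proof (Rabs_pos a). pose proof (Rabs_pos b). pose proof (Rabs_pos c). pose proof (Rabs_pos d).
    nra.
  - pose proof (Rabs_pos a). pose proof (Rabs_pos b). pose proof (Rabs_pos c). pose proof (Rabs_pos d). lra.
Qed.

(** * A saddle estimate *)

Section Saddle.
Variables (l1 l2 lam eps C M : R) (r s B dr ds dB : R -> R).
Hypothesis lam_pos : 0 < lam.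
Hypothesis l1_ge : lam <= l1.
Hypothesis l2_ge : lam <= l2.
Hypothesis eps_nonneg : 0 <= eps.
Hypothesis M_pos : 0 < M.
Hypothesis eps_small : eps <= lam / 16.
Hypothesis C_small : C <= M * lam / 8.
Hypothesis M_eps_small : M * eps <= lam / 16.
Hypothesis cr : forall x, 0 <= x -> continuity_pt r x.
Hypothesis cs : forall x, 0 <= x -> continuity_pt s x.
Hypothesis cB : forall x, 0 <= x -> continuity_pt B x.
Hypothesis Dr : forall x, 0 < x -> is_derive r x (dr x).
Hypothesis Ds : forall x, 0 < x -> is_derive s x (ds x).
Hypothesis DB : forall x, 0 < x -> is_derive B x (dB x).
Hypothesis B_pos : forall x, 0 <= x -> 0 < B x.
Hypothesis r_eq : forall x, 0 < x -> Rabs (dr x - l1 * r x) <= eps * (Rabs (r x) + Rabs (s x)) + C * B x.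
Hypothesis s_eq : forall x, 0 < x -> Rabs (ds x + l2 * s x) <= eps * (Rabs (r x) + Rabs (s x)) + C * B x.
Hypothesis B_slow : forall x, 0 < x -> Rabs (dB x) <= lam / 4 * B x + eps * (Rabs (r x) + Rabs (s x)).
Hypothesis lim_r : is_lim r p_infty 0.

(* The cone [r > M B], [r > |s|] is forward invariant and [r] grows in it. *)
Lemma saddle_no_escape x0 : 0 <= x0 -> M * B x0 < r x0 -> Rabs (s x0) < r x0 -> False.
Proof.
  intros Hx0 H1 H2.
  assert (sq : forall h l x, is_derive h x l -> is_derive (fun t => h t * h t) x (2 * h x * l)).
  { intros h l x Hl. replace (2 * h x * l) with (plus (mult l (h x)) (mult (h x) l))
      by (unfold plus, mult; simpl; ring).
    apply (is_derive_mult h h); auto. intros; apply Rmult_comm. }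
  assert (err : forall x, 0 < x -> M * B x < r x -> Rabs (s x) < r x ->
    eps * (Rabs (r x) + Rabs (s x)) + C * B x <= lam / 4 * r x).
  { intros x Hx G1 G2. specialize (B_pos x ltac:(lra)).
    assert (0 < r x) by nra. rewrite (Rabs_pos_eq (r x)) by lra.
    assert (C * B x <= M * lam / 8 * B x) by (apply Rmult_le_compat_r; lra).
    assert (lam / 8 * (M * B x) <= lam / 8 * r x) by (apply Rmult_le_compat_l; lra).
    assert (eps * (r x + Rabs (s x)) <= lam / 16 * (2 * r x)).
    { apply Rmult_le_compat; try lra. pose proof (Rabs_pos (s x)). lra. }
    lra. }
  assert (cone : forall x, x0 <= x -> M * B x < r x /\ Rabs (s x) < r x).
  { intros x Hx.
    (* The cone is encoded by differentiable functions, [r - M B] and [r^2 - s^2], so that neither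
       can be the first to vanish. *)
    assert (E : 0 < r x - M * B x /\ 0 < r x * r x - s x * s x).
    { apply (two_barriers (fun t => r t - M * B t) (fun t => r t * r t - s t * s t)
        (fun t => dr t - M * dB t) (fun t => 2 * r t * dr t - 2 * s t * ds t) x0 x Hx).
      - intros t Ht. apply (is_derive_minus r (fun t => M * B t)); [apply Dr; lra|].
        apply (is_derive_scal B). apply DB. lra.
      - intros t Ht. apply (is_derive_minus (fun t => r t * r t) (fun t => s t * s t));
          apply sq; [apply Dr|apply Ds]; lra.
      - intros t Ht. apply continuity_pt_minus; [apply cr; lra|].
        apply continuity_pt_mult; [apply continuity_pt_const; now intros ? ?|apply cB; lra].
      - intros t Ht. apply continuity_pt_minus; apply continuity_pt_mult; (apply cr || apply cs); lra.
      - intros t Ht G1 G2.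
        assert (Bt := B_pos t ltac:(lra)).
        assert (rp : 0 < r t) by nra.
        assert (G3 : Rabs (s t) < r t) by (apply Rabs_def1; nra).
        assert (e := err t ltac:(lra) ltac:(lra) G3).
        assert (R1 := r_eq t ltac:(lra)). assert (S1 := s_eq t ltac:(lra)). assert (B1 := B_slow t ltac:(lra)).
        set (E := eps * (Rabs (r t) + Rabs (s t)) + C * B t) in *.
        apply Rabs_le_between in R1. apply Rabs_le_between in S1. apply Rabs_le_between in B1.
        split.
        + assert (Q1 : lam * r t <= l1 * r t) by (apply Rmult_le_compat_r; lra).
          assert (Q2 : M * (lam / 4 * B t) <= lam / 4 * r t) by nra.
          assert (Q3 : M * (eps * (Rabs (r t) + Rabs (s t))) <= lam / 16 * (2 * r t)).
          { rewrite <- Rmult_assoc. rewrite (Rabs_pos_eq (r t)) by lra.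
            pose proof (Rabs_pos (s t)).
            apply Rmult_le_compat; try lra. nra. }
          assert (Q4 : M * dB t <= M * (lam / 4 * B t + eps * (Rabs (r t) + Rabs (s t))))
            by (apply Rmult_le_compat_l; lra).
          nra.
        + assert (Q1 : lam * (r t * r t) <= l1 * (r t * r t)) by (apply Rmult_le_compat_r; nra).
          assert (Q2 : r t * dr t >= l1 * (r t * r t) - lam / 4 * (r t * r t)) by nra.
          assert (Q3 : 0 <= l2 * (s t * s t)) by (apply Rmult_le_pos; nra).
          assert (Q4 : s t * (ds t + l2 * s t) <= lam / 4 * (r t * r t)).
          { apply Rle_trans with (Rabs (s t) * Rabs (ds t + l2 * s t)).
            - rewrite <- Rabs_mult. apply Rle_abs.
            - replace (lam / 4 * (r t * r t)) with (r t * (lam / 4 * r t)) by ring.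
              apply Rmult_le_compat; try apply Rabs_pos; [lra|]. apply Rabs_le. lra. }
          assert (0 < lam * (r t * r t)) by (apply Rmult_lt_0_compat; nra).
          lra.
      - lra.
      - apply Rabs_def2 in H2. nra. }
    assert (Bx := B_pos x ltac:(lra)). assert (0 < r x) by nra.
    split; [lra|]. apply Rabs_def1; nra. }
  assert (grow : forall x, x0 <= x -> r x0 <= r x).
  { intros x Hx. apply (nondecreasing_of_derive r dr x0 x Hx).
    - intros t Ht. apply Dr. lra.
    - intros t Ht. apply cr. lra.
    - intros t Ht. destruct (cone t ltac:(lra)) as [G1 G2].
      assert (Bt := B_pos t ltac:(lra)). assert (rp : 0 < r t) by nra.
      assert (e := err t ltac:(lra) G1 G2). assert (R1 := r_eq t ltac:(lra)).
      apply Rabs_le_between in R1. nra. }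
  assert (r0 : 0 < r x0) by (specialize (B_pos x0 Hx0); nra).
  apply is_lim_spec in lim_r. destruct (lim_r (mkposreal _ r0)) as [X HX]. simpl in HX.
  pose proof (Rmax_l x0 X). pose proof (Rmax_r x0 X).
  specialize (HX (Rmax x0 X + 1) ltac:(lra)). specialize (grow (Rmax x0 X + 1) ltac:(lra)).
  rewrite Rminus_0_r in HX. apply Rabs_def2 in HX. lra.
Qed.

End Saddle.

(** Escape along the unstable direction [r] is excluded by its limit, so wherever [|s|] exceeds
    [M B] it dominates [|r|], and there [s] decays faster than [B]: starting below [M B], it cannot
    get above. The derivative of [B] may involve [r] and [s], because [B] will contain powers of
    [z], whose derivative is itself given by a fast variable. *)
Lemma saddle_bound (l1 l2 lam eps C M : R) (r s B dr ds dB : R -> R) :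
  0 < lam -> lam <= l1 -> lam <= l2 -> 0 <= eps -> 0 <= C -> 0 < M ->
  eps <= lam / 16 -> C <= M * lam / 8 -> M * eps <= lam / 16 ->
  (forall x, 0 <= x -> continuity_pt r x) ->
  (forall x, 0 <= x -> continuity_pt s x) ->
  (forall x, 0 <= x -> continuity_pt B x) ->
  (forall x, 0 < x -> is_derive r x (dr x)) ->
  (forall x, 0 < x -> is_derive s x (ds x)) ->
  (forall x, 0 < x -> is_derive B x (dB x)) ->
  (forall x, 0 <= x -> 0 < B x) ->
  (forall x, 0 < x -> Rabs (dr x - l1 * r x) <= eps * (Rabs (r x) + Rabs (s x)) + C * B x) ->
  (forall x, 0 < x -> Rabs (ds x + l2 * s x) <= eps * (Rabs (r x) + Rabs (s x)) + C * B x) ->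
  (forall x, 0 < x -> Rabs (dB x) <= lam / 4 * B x + eps * (Rabs (r x) + Rabs (s x))) ->
  is_lim r p_infty 0 -> Rabs (s 0) <= M * B 0 ->
  forall x, 0 <= x -> Rabs (r x) <= M * B x /\ Rabs (s x) <= M * B x.
Proof.
  intros Hlam Hl1 Hl2 Heps HC HM Heps' HC' HM' cr cs cB Dr Ds DB Bp r_eq s_eq B_slow lim s0.
  assert (noesc : forall x, 0 <= x -> M * B x < Rabs (r x) -> Rabs (s x) < Rabs (r x) -> False).
  { intros x Hx H1 H2. destruct (Rle_dec 0 (r x)) as [Hr|Hr].
    - rewrite (Rabs_pos_eq _ Hr) in H1, H2.
      apply (saddle_no_escape l1 l2 lam eps C M r s B dr ds dB) with (x0 := x); auto.
    - rewrite (Rabs_left (r x)) in H1, H2 by lra.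
      apply (saddle_no_escape l1 l2 lam eps C M (fun t => - r t) s B (fun t => - dr t) ds dB)
        with (x0 := x); auto.
      + intros; apply continuity_pt_opp; auto.
      + intros t Ht. apply (is_derive_opp r). auto.
      + intros t Ht. rewrite Rabs_Ropp.
        replace (- dr t - l1 * - r t) with (- (dr t - l1 * r t)) by ring. rewrite Rabs_Ropp. auto.
      + intros t Ht. rewrite Rabs_Ropp. auto.
      + intros t Ht. rewrite Rabs_Ropp. auto.
      + replace 0 with (- 0) by ring. now apply (is_lim_opp r p_infty 0). }
  assert (sB : forall x, 0 <= x -> Rabs (s x) <= M * B x).
  { intros x1 Hx1. apply Rnot_lt_le. intros Hlt.
    (* Squares replace absolute values, which are not differentiable. From its last zero on, [f]
       would be nonincreasing and yet positive. *)
    set (f := fun t => s t * s t - M ^ 2 * (B t * B t)).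
    assert (cf : forall t, 0 <= t -> continuity_pt f t).
    { intros t Ht. apply continuity_pt_minus; [apply continuity_pt_mult; auto|].
      apply continuity_pt_mult; [apply continuity_pt_const; now intros ? ?|].
      apply continuity_pt_mult; auto. }
    assert (sq : forall h l x, is_derive h x l -> is_derive (fun t => h t * h t) x (2 * h x * l)).
    { intros h l x Hl. replace (2 * h x * l) with (plus (mult l (h x)) (mult (h x) l))
        by (unfold plus, mult; simpl; ring).
      apply (is_derive_mult h h); auto. intros; apply Rmult_comm. }
    assert (abs2 : forall t, s t * s t = Rabs (s t) * Rabs (s t)) by (intros; split_Rabs; ring).
    assert (fpos : forall t, 0 <= t -> (0 < f t <-> M * B t < Rabs (s t))).
    { intros t Ht. unfold f. rewrite abs2. specialize (Bp t Ht). pose proof (Rabs_pos (s t)).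
      assert (0 < M * B t) by now apply Rmult_lt_0_compat. split; intros; nra. }
    destruct (last_zero f 0 x1) as [c [C1 [C2 C3]]]; auto.
    - intros t Ht. apply cf. lra.
    - apply Rnot_lt_le. intros H. apply fpos in H; lra.
    - apply fpos; auto.
    - assert (- f c <= - f x1); [|specialize (C3 x1 ltac:(lra)); lra].
      apply (nondecreasing_of_derive (fun t => - f t)
        (fun t => opp (2 * s t * ds t - M ^ 2 * (2 * B t * dB t)))); [lra| | |].
      + intros t Ht. apply (is_derive_opp f).
        apply (is_derive_minus (fun t => s t * s t) (fun t => M ^ 2 * (B t * B t))).
        * apply sq, Ds. lra.
        * apply (is_derive_scal (fun t => B t * B t)). apply sq, DB. lra.
      + intros t Ht. apply continuity_pt_opp, cf. lra.
      + intros t Ht. assert (tp : 0 < t) by lra.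
        assert (G1 : M * B t < Rabs (s t)) by (apply fpos; [lra|apply C3; lra]).
        assert (G2 : Rabs (r t) <= Rabs (s t)).
        { apply Rnot_lt_le. intros G. apply (noesc t); lra. }
        assert (Bt := Bp t ltac:(lra)).
        assert (S1 := s_eq t tp). assert (B1 := B_slow t tp).
        set (S := Rabs (s t)) in *.
        assert (Sp : 0 < S) by (assert (0 < M * B t) by (now apply Rmult_lt_0_compat); lra).
        assert (ee : eps * (Rabs (r t) + S) <= lam / 16 * (2 * S)).
        { pose proof (Rabs_pos (r t)). apply Rmult_le_compat; lra. }
        assert (CB : C * B t <= lam / 8 * S).
        { apply Rle_trans with (M * lam / 8 * B t); [apply Rmult_le_compat_r; lra|].
          replace (M * lam / 8 * B t) with (lam / 8 * (M * B t)) by field.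
          apply Rmult_le_compat_l; lra. }
        assert (Q1 : s t * (ds t + l2 * s t) <= lam / 4 * (S * S)).
        { apply Rle_trans with (S * Rabs (ds t + l2 * s t)).
          - unfold S. rewrite <- Rabs_mult. apply Rle_abs.
          - replace (lam / 4 * (S * S)) with (S * (lam / 4 * S)) by ring.
            apply Rmult_le_compat_l; lra. }
        assert (Q2 : lam * (S * S) <= l2 * (s t * s t)).
        { rewrite abs2. fold S. apply Rmult_le_compat_r; nra. }
        assert (Q3 : - (M * dB t) <= lam / 4 * S + lam / 8 * S).
        { apply Rle_trans with (M * Rabs (dB t)).
          - rewrite <- Ropp_mult_distr_r_reverse. apply Rmult_le_compat_l; [lra|].
            rewrite <- Rabs_Ropp. apply Rle_abs.
          - apply Rle_trans with (M * (lam / 4 * B t + eps * (Rabs (r t) + S)));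
              [apply Rmult_le_compat_l; lra|].
            assert (lam / 4 * (M * B t) <= lam / 4 * S) by (apply Rmult_le_compat_l; lra).
            assert (M * eps * (Rabs (r t) + S) <= lam / 16 * (2 * S)).
            { pose proof (Rabs_pos (r t)). apply Rmult_le_compat; try lra. nra. }
            lra. }
        assert (Q4 : - (M * B t * (M * dB t)) <= S * (lam / 4 * S + lam / 8 * S)).
        { rewrite <- Ropp_mult_distr_r_reverse.
          assert (0 < M * B t) by now apply Rmult_lt_0_compat.
          apply Rle_trans with (M * B t * (lam / 4 * S + lam / 8 * S)).
          - apply Rmult_le_compat_l; lra.
          - apply Rmult_le_compat_r; nra. }
        unfold opp; simpl. assert (0 < lam * (S * S)) by (apply Rmult_lt_0_compat; nra). nra. }
  intros x Hx. split; [|auto]. apply Rnot_lt_le. intros H. specialize (sB x Hx).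
  apply (noesc x); lra.
Qed.

(** For a root [k] of this quadratic equation, [N d - k P] is an eigenfunctional of the linear
    system given by [lin_d] and [lin_P], with eigenvalue [k - F / N]. The roots lie on both sides of
    [F / N], so the eigenvalues have opposite signs. *)
Lemma saddle_coordinates (F N mu : R) :
  0 < N -> 0 < mu ->
  exists k1 k2, k2 < 0 < k1 /\ 0 < k1 - F / N /\ k2 - F / N < 0 /\
    k1 * (k1 - F / N) = 1 + N / mu + k1 * F / mu /\
    k2 * (k2 - F / N) = 1 + N / mu + k2 * F / mu.
Proof.
  intros HN Hm. set (t := F / N + F / mu). set (c := 1 + N / mu).
  assert (cp : 0 < c) by (unfold c; assert (0 < N / mu) by (now apply Rdiv_lt_0_compat); lra).
  set (S := sqrt (t * t + 4 * c)).
  assert (S2 : S * S = t * t + 4 * c) by (apply sqrt_sqrt; nra).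
  assert (S0 : 0 <= S) by apply sqrt_pos.
  assert (Sa : Rabs t < S).
  { pose proof (Rabs_pos t). assert (Rabs t * Rabs t = t * t) by (split_Rabs; ring). nra. }
  apply Rabs_def2 in Sa.
  assert (E : forall k, k * k = t * k + c -> k * (k - F / N) = 1 + N / mu + k * F / mu).
  { intros k Hk. rewrite Rmult_minus_distr_l, Hk. unfold t, c. unfold Rdiv. ring. }
  exists ((t + S) / 2), ((t - S) / 2).
  assert (E1 : (t + S) / 2 * ((t + S) / 2) = t * ((t + S) / 2) + c) by nra.
  assert (E2 : (t - S) / 2 * ((t - S) / 2) = t * ((t - S) / 2) + c) by nra.
  (* the quadratic polynomial is negative at [F / N] *)
  assert (neg : F / N * (F / N) - t * (F / N) - c < 0).
  { unfold t. replace (F / N * (F / N) - (F / N + F / mu) * (F / N) - c)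
      with (- ((F * F) / (N * mu)) - c) by (field; lra).
    assert (0 <= F * F / (N * mu)).
    { apply Rmult_le_pos; [nra|]. apply Rlt_le, Rinv_0_lt_compat. nra. } lra. }
  split; [lra|]. split; [|split; [|split; now apply E]]; nra.
Qed.

(** Linear parts, at the far field, of the equations for [d = v - u] and [P = f1 u - y], with
    [F = df1 b = - df2 b] and [N = j / b], the far-field value of the density [n]. *)
Definition lin_d (F N mu d P : R) : R := - (F / N) * d - (1 / N + 1 / mu) * P.
Definition lin_P (F N mu d P : R) : R := F / mu * P - N * d.

(** The saddle estimate in the original variables. [A] absorbs the norms of the change of variables
    and of its inverse; like [lam], it depends on the linear part alone. *)
Lemma fast_pair_bound (F N mu : R) :
  0 < N -> 0 < mu ->
  exists lam A, 0 < lam /\ 1 <= A /\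
    forall (eps C M : R) (d P B dd dP dB : R -> R),
    0 <= eps -> 0 <= C -> 0 < M ->
    A * eps <= lam / 16 -> A * C <= M * lam / 8 -> M * (A * eps) <= lam / 16 ->
    (forall x, 0 <= x -> continuity_pt d x /\ continuity_pt P x /\ continuity_pt B x /\ 0 < B x) ->
    (forall x, 0 < x -> is_derive d x (dd x) /\ is_derive P x (dP x) /\ is_derive B x (dB x)) ->
    (forall x, 0 < x ->
      Rabs (dd x - lin_d F N mu (d x) (P x)) <= eps * (Rabs (d x) + Rabs (P x)) + C * B x /\
      Rabs (dP x - lin_P F N mu (d x) (P x)) <= eps * (Rabs (d x) + Rabs (P x)) + C * B x /\
      Rabs (dB x) <= lam / 4 * B x + eps * (Rabs (d x) + Rabs (P x))) ->
    is_lim d p_infty 0 -> is_lim P p_infty 0 ->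
    A * (Rabs (d 0) + Rabs (P 0)) <= M * B 0 ->
    forall x, 0 <= x -> Rabs (d x) <= A * M * B x /\ Rabs (P x) <= A * M * B x.
Proof.
  intros HN Hmu.
  destruct (saddle_coordinates F N mu HN Hmu) as (k1 & k2 & [Hk2 Hk1] & H1 & H2 & E1 & E2).
  set (lam := Rmin (k1 - F / N) (F / N - k2)).
  assert (lp : 0 < lam) by (apply Rmin_glb_lt; lra).
  set (A0 := 2 / N + 1 / (k1 - k2)).
  assert (i1 : 0 < / N) by now apply Rinv_0_lt_compat.
  assert (i2 : 0 < / (k1 - k2)) by (apply Rinv_0_lt_compat; lra).
  assert (A0p : 0 < A0) by (unfold A0, Rdiv; lra).
  set (A1 := N + k1 - k2 + 1).
  set (A := (2 * A0 + 1) * A1).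
  assert (A1p : 1 <= A1) by (unfold A1; lra).
  assert (HA1 : 1 <= A) by (unfold A; nra).
  assert (HAA : 2 * A0 <= A) by (unfold A; nra).
  assert (HAA1 : A1 <= A) by (unfold A; nra).
  assert (HAA2 : A0 * A1 <= A) by (unfold A; nra).
  exists lam, A. split; [exact lp|]. split; [exact HA1|].
  intros eps C M d P B dd dP dB Heps HC HM S1 S2 S3 Hc HD HE Ld LP H0.
  set (r := fun x => N * d x - k1 * P x). set (s := fun x => N * d x - k2 * P x).
  assert (mB : forall x, Rabs (d x) + Rabs (P x) <= A0 * (Rabs (r x) + Rabs (s x))).
  { intros x.
    assert (EP : P x = (s x - r x) * / (k1 - k2)) by (unfold r, s; field; lra).
    assert (Ed : d x = (s x * (k1 * / (k1 - k2)) + r x * (- k2 * / (k1 - k2))) * / N)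
      by (unfold r, s; field; lra).
    assert (K1 : 0 <= k1 * / (k1 - k2) <= 1).
    { split; [apply Rmult_le_pos; lra|]. apply Rmult_le_reg_r with (k1 - k2); [lra|].
      rewrite Rmult_assoc, Rinv_l by lra. lra. }
    assert (K2 : 0 <= - k2 * / (k1 - k2) <= 1).
    { split; [apply Rmult_le_pos; lra|]. apply Rmult_le_reg_r with (k1 - k2); [lra|].
      rewrite Rmult_assoc, Rinv_l by lra. lra. }
    pose proof (Rabs_pos (r x)) as pr. pose proof (Rabs_pos (s x)) as ps.
    assert (HP : Rabs (P x) <= (Rabs (r x) + Rabs (s x)) * / (k1 - k2)).
    { rewrite EP, Rabs_mult, (Rabs_pos_eq (/ _)) by lra. apply Rmult_le_compat_r; [lra|].
      split_Rabs; lra. }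
    assert (Hd : Rabs (d x) <= (Rabs (r x) + Rabs (s x)) * / N).
    { rewrite Ed, Rabs_mult, (Rabs_pos_eq (/ N)) by lra. apply Rmult_le_compat_r; [lra|].
      eapply Rle_trans; [apply Rabs_triang|]. rewrite (Rabs_mult (s x)), (Rabs_mult (r x)).
      rewrite (Rabs_pos_eq (k1 * / (k1 - k2))), (Rabs_pos_eq (- k2 * / (k1 - k2))) by lra. nra. }
    unfold A0, Rdiv. nra. }
  set (e := fun x => eps * (Rabs (d x) + Rabs (P x)) + C * B x).
  assert (comb : forall k x p q, Rabs k <= k1 - k2 -> 0 < x -> Rabs p <= e x -> Rabs q <= e x ->
    Rabs (N * p - k * q) <= A * eps * (Rabs (r x) + Rabs (s x)) + A * C * B x).
  { intros k x p q Hk Hx Hp Hq.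
    assert (e0 : 0 <= e x) by (eapply Rle_trans; [apply Rabs_pos|exact Hp]).
    assert (Q1 : Rabs (N * p - k * q) <= A1 * e x).
    { unfold Rminus. eapply Rle_trans; [apply Rabs_triang|]. rewrite Rabs_Ropp, !Rabs_mult.
      rewrite (Rabs_pos_eq N) by lra. pose proof (Rabs_pos k). pose proof (Rabs_pos q).
      assert (Rabs k * Rabs q <= (k1 - k2) * e x) by (apply Rmult_le_compat; lra).
      assert (N * Rabs p <= N * e x) by (apply Rmult_le_compat_l; lra). unfold A1. lra. }
    eapply Rle_trans; [exact Q1|]. unfold e.
    destruct (Hc x ltac:(lra)) as (_ & _ & _ & Bp). specialize (mB x).
    set (m := Rabs (r x) + Rabs (s x)) in *.
    assert (m0 : 0 <= m) by (unfold m; pose proof (Rabs_pos (r x)); pose proof (Rabs_pos (s x)); lra).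
    assert (Q2 : eps * (Rabs (d x) + Rabs (P x)) <= eps * (A0 * m)) by (apply Rmult_le_compat_l; lra).
    assert (Q3 : A1 * (eps * (A0 * m)) <= A * eps * m).
    { replace (A1 * (eps * (A0 * m))) with ((A0 * A1) * (eps * m)) by ring.
      replace (A * eps * m) with (A * (eps * m)) by ring.
      apply Rmult_le_compat_r; [now apply Rmult_le_pos|lra]. }
    assert (Q4 : A1 * (C * B x) <= A * (C * B x))
      by (apply Rmult_le_compat_r; [apply Rmult_le_pos; lra|lra]).
    assert (A1 * (eps * (Rabs (d x) + Rabs (P x))) <= A1 * (eps * (A0 * m)))
      by (apply Rmult_le_compat_l; lra).
    rewrite Rmult_plus_distr_l. lra. }
  assert (Main : forall x, 0 <= x -> Rabs (r x) <= M * B x /\ Rabs (s x) <= M * B x).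
  { apply (saddle_bound (k1 - F / N) (F / N - k2) lam (A * eps) (A * C) M r s B
      (fun x => N * dd x - k1 * dP x) (fun x => N * dd x - k2 * dP x) dB); auto.
    - apply Rmin_l.
    - apply Rmin_r.
    - apply Rmult_le_pos; lra.
    - apply Rmult_le_pos; lra.
    - intros x Hx. destruct (Hc x Hx) as (c1 & c2 & _).
      apply continuity_pt_minus; (apply continuity_pt_mult; [apply continuity_pt_const; now intros ? ?|]); auto.
    - intros x Hx. destruct (Hc x Hx) as (c1 & c2 & _).
      apply continuity_pt_minus; (apply continuity_pt_mult; [apply continuity_pt_const; now intros ? ?|]); auto.
    - intros x Hx. now apply Hc.
    - intros x Hx. destruct (HD x Hx) as (D1 & D2 & _).
      apply (is_derive_minus (fun x => N * d x) (fun x => k1 * P x));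
      [now apply (is_derive_scal d)|now apply (is_derive_scal P)].
    - intros x Hx. destruct (HD x Hx) as (D1 & D2 & _).
      apply (is_derive_minus (fun x => N * d x) (fun x => k2 * P x));
      [now apply (is_derive_scal d)|now apply (is_derive_scal P)].
    - intros x Hx. now apply HD.
    - intros x Hx. now apply Hc.
    - intros x Hx. destruct (HE x Hx) as (e1 & e2 & _).
      replace (N * dd x - k1 * dP x - (k1 - F / N) * r x)
        with (N * (dd x - lin_d F N mu (d x) (P x)) - k1 * (dP x - lin_P F N mu (d x) (P x))).
      + apply comb; auto. rewrite Rabs_pos_eq; lra.
      + assert (E : (k1 - F / N) * r x = (k1 - F / N) * N * d x - (1 + N / mu + k1 * F / mu) * P x)
          by (unfold r; rewrite <- E1; ring).
        rewrite E. unfold lin_d, lin_P. field. lra.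
    - intros x Hx. destruct (HE x Hx) as (e1 & e2 & _).
      replace (N * dd x - k2 * dP x + (F / N - k2) * s x)
        with (N * (dd x - lin_d F N mu (d x) (P x)) - k2 * (dP x - lin_P F N mu (d x) (P x))).
      + apply comb; auto. rewrite Rabs_left; lra.
      + assert (E : (F / N - k2) * s x = - ((k2 - F / N) * N * d x - (1 + N / mu + k2 * F / mu) * P x))
          by (unfold s; rewrite <- E2; ring).
        rewrite E. unfold lin_d, lin_P. field. lra.
    - intros x Hx. destruct (HE x Hx) as (_ & _ & e3).
      eapply Rle_trans; [exact e3|]. apply Rplus_le_compat_l. specialize (mB x).
      set (m := Rabs (r x) + Rabs (s x)) in *.
      assert (m0 : 0 <= m) by (unfold m; pose proof (Rabs_pos (r x)); pose proof (Rabs_pos (s x)); lra).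
      replace (A * eps * m) with (eps * (A * m)) by ring. apply Rmult_le_compat_l; [lra|].
      eapply Rle_trans; [exact mB|]. apply Rmult_le_compat_r; lra.
    - assert (L : is_lim (fun x => N * d x - k1 * P x) p_infty (N * 0 - k1 * 0)).
      { apply is_lim_minus'; [apply (is_lim_scal_l d N p_infty 0)|apply (is_lim_scal_l P k1 p_infty 0)]; auto. }
      now replace (N * 0 - k1 * 0) with 0 in L by ring.
    - eapply Rle_trans; [|exact H0].
      apply Rle_trans with (A1 * (Rabs (d 0) + Rabs (P 0))).
      + unfold s, Rminus. eapply Rle_trans; [apply Rabs_triang|]. rewrite Rabs_Ropp, !Rabs_mult.
        rewrite (Rabs_pos_eq N), (Rabs_left k2) by lra.
        pose proof (Rabs_pos (d 0)). pose proof (Rabs_pos (P 0)). unfold A1. nra.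
      + apply Rmult_le_compat_r; [|lra].
        pose proof (Rabs_pos (d 0)). pose proof (Rabs_pos (P 0)). lra. }
  intros x Hx. destruct (Main x Hx) as [M1 M2]. specialize (mB x).
  assert (G : Rabs (d x) + Rabs (P x) <= A * M * B x).
  { eapply Rle_trans; [exact mB|].
    apply Rle_trans with (A0 * (2 * (M * B x))); [apply Rmult_le_compat_l; lra|].
    replace (A0 * (2 * (M * B x))) with (2 * A0 * (M * B x)) by ring.
    replace (A * M * B x) with (A * (M * B x)) by ring.
    apply Rmult_le_compat_r; [|lra].
    eapply Rle_trans; [apply Rabs_pos|exact M1]. }
  pose proof (Rabs_pos (d x)). pose proof (Rabs_pos (P x)). lra.
Qed.

(** * The sonic case *)

Lemma bigO_weaken {T : Type} (D : T -> Prop) (c : R) (f g h : T -> R) :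
  0 < c -> bigO D f g -> (forall t, D t -> g t <= c * h t) -> bigO D f h.
Proof.
  intros Hc [C [HC H]] H'. exists (C * c). split; [nra|]. intros t Ht.
  eapply Rle_trans; [now apply H|]. rewrite Rmult_assoc. apply Rmult_le_compat_l; [lra|auto].
Qed.

Lemma C1_bounded_of_C1_on (j p q : R) (f df : R -> R) :
  (forall c, p <= c <= q -> 0 < c / j) -> C1_on j f df -> C1_bounded p q f df.
Proof.
  intros Hd H. split; [intros c Hc; now apply H, Hd|].
  apply continuity_bounded. intros c Hc. now apply H, Hd.
Qed.

Lemma is_lim_squeeze0 (f g : R -> R) :
  (forall x, 0 <= x -> Rabs (f x) <= g x) -> is_lim g p_infty 0 -> is_lim f p_infty 0.
Proof.
  intros H Hg. apply is_lim_spec. intros e. apply is_lim_spec in Hg.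
  destruct (Hg e) as [X HX]. exists (Rmax 0 X). intros x Hx.
  pose proof (Rmax_l 0 X). pose proof (Rmax_r 0 X).
  specialize (HX x ltac:(lra)). specialize (H x ltac:(lra)).
  rewrite Rminus_0_r in *. pose proof (Rle_abs (g x)). lra.
Qed.

(** An orbit together with a position on it: a bound over a set of points is uniform both along each
    orbit and over the boundary data. *)
Record point := Point { tu : R -> R; tv : R -> R; ty : R -> R; tx : R }.

Section Sonic.
Variables (f1 df1 ddf1 dddf1 f2 df2 ddf2 dddf2 : R -> R) (mu j K b p q : R).
Hypothesis mu_pos : 0 < mu.
Hypothesis C3_f1 : C3_on j f1 df1 ddf1 dddf1.
Hypothesis C3_f2 : C3_on j f2 df2 ddf2 dddf2.
Hypothesis b_range : p < b < q.
Hypothesis dom : forall c, p <= c <= q -> 0 < c / j.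
Hypothesis flux_b : f1 b + f2 b = K.
Hypothesis sonic : df1 b + df2 b = 0.
Hypothesis convex : 0 < ddf1 b + ddf2 b.

Let F := df1 b.
Let N := j / b.
Let A2 := (ddf1 b + ddf2 b) / 2.

(** Points of increasing orbits issued from the diagonal. Only the initial distance to [b] is
    bounded by [d0]; monotonicity carries the bound to all positions, and [b - p] keeps the orbit
    where the fluxes are controlled. *)
Definition near (d0 : R) (t : point) : Prop :=
  orbit f1 f2 mu j K (tu t) (tv t) (ty t) /\ tu t 0 = tv t 0 /\
  b - tu t 0 <= d0 /\ b - tu t 0 <= b - p /\
  is_lim (tu t) p_infty b /\ is_lim (tv t) p_infty b /\
  (forall x, 0 <= x -> 0 < f1 (tu t x) - ty t x /\ 0 < f2 (tv t x) + ty t x - K) /\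
  0 <= tx t.

Definition at_ (G : R -> R -> R -> R) (t : point) : R :=
  G (tu t (tx t)) (tv t (tx t)) (ty t (tx t)).

Definition jz (u v y : R) : R := b - u.
Definition jd (u v y : R) : R := v - u.
Definition jP (u v y : R) : R := f1 u - y.

Local Notation z := (at_ jz).
Local Notation d := (at_ jd).
Local Notation P := (at_ jP).
Local Notation u1 := (at_ (ju1 f1 mu)).
Local Notation v1 := (at_ (jv1 f2 j K)).
Local Notation u2 := (at_ (ju2 f1 df1 mu j)).
Local Notation v2 := (at_ (jv2 f2 df2 j K)).
Local Notation u3 := (at_ (ju3 f1 df1 ddf1 f2 mu j K)).
Local Notation v3 := (at_ (jv3 f1 f2 df2 ddf2 mu j K)).
Local Notation Q := (at_ (jQ f2 K)).
Local Notation Q1 := (at_ (jQ1 f2 df2 j K)).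
Local Notation Q2 := (at_ (jQ2 f1 f2 df2 ddf2 mu j K)).
Local Notation G := (at_ (jG j)).
Local Notation G1 := (at_ (jG1 f1 f2 mu j K)).

Lemma near_sub d0 d1 t : d0 <= d1 -> near d0 t -> near d1 t.
Proof. unfold near. intros H (? & ? & ? & ?). repeat (split; [tauto||lra|]). tauto. Qed.

Lemma near_range d0 t : near d0 t ->
  0 < z t <= d0 /\ Rabs (d t) <= d0 /\ z t <= b - p /\ Rabs (d t) <= b - p /\
  0 < P t /\ 0 < Q t /\
  p <= tu t (tx t) <= b /\ p <= tv t (tx t) <= b /\ z t <= b - tu t 0.
Proof.
  intros (O & E & H1 & H2 & L1 & L2 & PQ & Hx).
  destruct (trapped_range f1 f2 mu j K b _ _ _ mu_pos O L1 L2 PQ (tx t) Hx) as [R1 R2].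
  destruct (PQ _ Hx). unfold at_, jz, jd, jP, jQ.
  assert (Rabs (tv t (tx t) - tu t (tx t)) <= b - tu t 0) by (apply Rabs_le; lra).
  repeat split; lra.
Qed.

Lemma N_pos : 0 < N.
Proof. now apply (sgn_div _ _ (dom b ltac:(lra))). Qed.

Lemma j_b_nonzero : j <> 0 /\ b <> 0.
Proof. destruct (sgn_div _ _ (dom b ltac:(lra))); tauto. Qed.

Lemma near_v_nonzero d0 t : near d0 t -> tv t (tx t) <> 0.
Proof.
  intros H. destruct (near_range _ _ H) as (_ & _ & _ & _ & _ & _ & _ & R & _).
  now apply (sgn_div _ j), dom; lra.
Qed.

Let B1 : C1_bounded p q f1 df1.
Proof. apply (C1_bounded_of_C1_on j); [exact dom|apply C3_f1]. Qed.
Let B1' : C1_bounded p q df1 ddf1.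
Proof. apply (C1_bounded_of_C1_on j); [exact dom|apply C3_f1]. Qed.
Let B1'' : C1_bounded p q ddf1 dddf1.
Proof. apply (C1_bounded_of_C1_on j); [exact dom|apply C3_f1]. Qed.
Let B2 : C1_bounded p q f2 df2.
Proof. apply (C1_bounded_of_C1_on j); [exact dom|apply C3_f2]. Qed.
Let B2' : C1_bounded p q df2 ddf2.
Proof. apply (C1_bounded_of_C1_on j); [exact dom|apply C3_f2]. Qed.
Let B2'' : C1_bounded p q ddf2 dddf2.
Proof. apply (C1_bounded_of_C1_on j); [exact dom|apply C3_f2]. Qed.

Lemma inv_bounded : C1_bounded p q Rinv (fun c => - / c ^ 2).
Proof.
  split.
  - intros c Hc. destruct (sgn_div _ _ (dom c Hc)) as [Nc _]. auto_derive; [auto|field; auto].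
  - apply continuity_bounded. intros c Hc. destruct (sgn_div _ _ (dom c Hc)) as [Nc _].
    apply continuity_pt_opp, continuity_pt_inv; [|now apply pow_nonzero].
    apply derivable_continuous_pt, derivable_pt_pow.
Qed.

Section Uniform.
Variable d0 : R.
Local Notation D := (near d0).

(** Gauges: [om] dominates the distances of [u] and [v] to [b], and [md] is the size of the fast
    pair. *)
Definition om (t : point) : R := z t + Rabs (d t).
Definition md (t : point) : R := Rabs (d t) + Rabs (P t).

Lemma near_facts t : D t -> 0 < z t /\ z t <= b - p /\ 0 <= Rabs (d t) <= b - p /\ 0 <= Rabs (P t).
Proof.
  intros H. destruct (near_range _ _ H) as (? & ? & ? & ? & ? & _).
  pose proof (Rabs_pos (d t)). pose proof (Rabs_pos (P t)). lra.
Qed.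

Lemma near_u t : D t -> p <= tu t (tx t) <= q.
Proof. intros H. destruct (near_range _ _ H) as (_ & _ & _ & _ & _ & _ & ? & _). lra. Qed.

Lemma near_v t : D t -> p <= tv t (tx t) <= q.
Proof. intros H. destruct (near_range _ _ H) as (_ & _ & _ & _ & _ & _ & _ & ? & _). lra. Qed.

Lemma O_self (f : point -> R) : bigO D f (fun t => Rabs (f t)).
Proof. apply bigO_le. intros; lra. Qed.

Lemma O_self_z : bigO D z z.
Proof. apply bigO_le. intros t Ht. destruct (near_facts t Ht). rewrite Rabs_pos_eq; lra. Qed.

Lemma abs_u_b t : D t -> Rabs (tu t (tx t) - b) = z t.
Proof.
  intros Ht. destruct (near_facts t Ht) as [H _]. unfold at_, jz in *. rewrite Rabs_left; lra.
Qed.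

Lemma abs_v_b t : D t -> Rabs (tv t (tx t) - b) <= om t.
Proof.
  intros Ht. rewrite <- (Rabs_pos_eq (om t)).
  - unfold om, at_, jz, jd. destruct (near_facts t Ht) as [H _]. unfold at_, jz in H. split_Rabs; lra.
  - unfold om. destruct (near_facts t Ht) as [H1 [_ [H2 _]]]. lra.
Qed.

Lemma O_lip_u (f df : R -> R) : C1_bounded p q f df ->
  bigO D (fun t => f (tu t (tx t)) - f b) z.
Proof.
  intros H. destruct (lipschitz_bound p q f df H) as [B [HB HB']].
  exists B. split; [exact HB|]. intros t Ht. rewrite <- (abs_u_b t Ht).
  apply HB'; [lra|now apply near_u].
Qed.

Lemma O_lip_v (f df : R -> R) : C1_bounded p q f df ->
  bigO D (fun t => f (tv t (tx t)) - f b) om.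
Proof.
  intros H. destruct (lipschitz_bound p q f df H) as [B [HB HB']].
  exists B. split; [exact HB|]. intros t Ht.
  apply Rle_trans with (B * Rabs (tv t (tx t) - b)).
  - apply HB'; [lra|now apply near_v].
  - apply Rmult_le_compat_l; [lra|now apply abs_v_b].
Qed.

Lemma O_bdd_u (f df : R -> R) : C1_bounded p q f df -> bigO D (fun t => f (tu t (tx t))) (fun _ => 1).
Proof. intros H. apply (bigO_comp_bounded D p q f df (fun t => tu t (tx t))); auto using near_u. Qed.

Lemma O_bdd_v (f df : R -> R) : C1_bounded p q f df -> bigO D (fun t => f (tv t (tx t))) (fun _ => 1).
Proof. intros H. apply (bigO_comp_bounded D p q f df (fun t => tv t (tx t))); auto using near_v. Qed.

Lemma O_f2_vu :
  bigO D (fun t => f2 (tv t (tx t)) - f2 (tu t (tx t)) + F * d t) (fun t => om t * Rabs (d t)).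
Proof.
  destruct (taylor2_bound p q f2 df2 ddf2 B2 B2') as [E [HE HE']].
  destruct (lipschitz_bound p q df2 ddf2 B2') as [L [HL HL']].
  exists (E + L). split; [lra|]. intros t Ht.
  assert (Hu := near_u t Ht). assert (Hv := near_v t Ht).
  destruct (near_facts t Ht) as [Hz [_ [Hd _]]].
  specialize (HE' _ _ Hu Hv). specialize (HL' b _ ltac:(lra) Hu). rewrite (abs_u_b t Ht) in HL'.
  change (tv t (tx t) - tu t (tx t)) with (d t) in HE'.
  replace (f2 (tv t (tx t)) - f2 (tu t (tx t)) + F * d t) with
    ((f2 (tv t (tx t)) - f2 (tu t (tx t)) - df2 (tu t (tx t)) * d t)
      + (df2 (tu t (tx t)) - df2 b) * d t) by (unfold F; rewrite (Rplus_opp_r_uniq _ _ sonic); ring).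
  eapply Rle_trans; [apply Rabs_triang|]. rewrite Rabs_mult.
  assert (Rabs (df2 (tu t (tx t)) - df2 b) * Rabs (d t) <= L * z t * Rabs (d t))
    by (apply Rmult_le_compat_r; lra).
  unfold om. assert (0 <= z t * Rabs (d t)) by (apply Rmult_le_pos; lra).
  assert (0 <= Rabs (d t) ^ 2) by apply pow2_ge_0. nra.
Qed.

(** The sonic condition removes the linear term; [A2] is half the second derivative of the total
    flux at [b]. *)
Lemma O_flux_u :
  bigO D (fun t => f1 (tu t (tx t)) + f2 (tu t (tx t)) - K - A2 * z t ^ 2) (fun t => z t ^ 3).
Proof.
  destruct (taylor3_bound p q f1 df1 ddf1 dddf1 B1 B1' B1'') as [E1 [HE1 HE1']].
  destruct (taylor3_bound p q f2 df2 ddf2 dddf2 B2 B2' B2'') as [E2 [HE2 HE2']].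
  exists (E1 + E2). split; [lra|]. intros t Ht. assert (Hu := near_u t Ht).
  specialize (HE1' b _ ltac:(lra) Hu). specialize (HE2' b _ ltac:(lra) Hu).
  rewrite (abs_u_b t Ht) in HE1', HE2'.
  replace (f1 (tu t (tx t)) + f2 (tu t (tx t)) - K - A2 * z t ^ 2) with
   ((f1 (tu t (tx t)) - f1 b - df1 b * (tu t (tx t) - b) - ddf1 b / 2 * (tu t (tx t) - b) ^ 2)
   + (f2 (tu t (tx t)) - f2 b - df2 b * (tu t (tx t) - b) - ddf2 b / 2 * (tu t (tx t) - b) ^ 2)).
  - eapply Rle_trans; [apply Rabs_triang|]. lra.
  - unfold A2, at_, jz. rewrite <- flux_b.
    replace (df2 b) with (- df1 b) by lra. field.
Qed.

Lemma O_flux :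
  bigO D (fun t => f1 (tu t (tx t)) + f2 (tv t (tx t)) - K - A2 * z t ^ 2 + F * d t)
    (fun t => z t ^ 3 + om t * Rabs (d t)).
Proof.
  eapply bigO_ext; [|apply bigO_plus].
  2:{ apply (bigO_weaken D 1 _ (fun t => z t ^ 3)); [lra|exact O_flux_u|].
      intros t Ht. destruct (near_facts t Ht) as [? [_ [? _]]].
      assert (0 <= om t * Rabs (d t)) by (apply Rmult_le_pos; unfold om; lra). lra. }
  2:{ apply (bigO_weaken D 1 _ (fun t => om t * Rabs (d t))); [lra|exact O_f2_vu|].
      intros t Ht. destruct (near_facts t Ht) as [? _].
      assert (0 <= z t ^ 3) by (apply pow_le; lra). lra. }
  intros t Ht. simpl. ring.
Qed.

Lemma O_Q : bigO D Q (fun t => z t ^ 2 + md t).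
Proof.
  eapply bigO_ext; [|apply bigO_plus; [apply bigO_plus; [|apply (bigO_scal (A2))]|apply bigO_plus; [apply (bigO_scal (- F))|apply (bigO_scal (-1))]]].
  2:{ apply (bigO_weaken D (1 + 3 * (b - p)) _ (fun t => z t ^ 3 + om t * Rabs (d t))); [lra|exact O_flux|].
      intros t Ht. destruct (near_facts t Ht) as [? [? [? ?]]]. unfold om, md.
      assert (z t ^ 3 <= (b - p) * z t ^ 2).
      { replace (z t ^ 3) with (z t * z t ^ 2) by ring. apply Rmult_le_compat_r; [apply pow_le; lra|lra]. }
      assert (0 <= z t ^ 2) by (apply pow_le; lra).
      assert ((z t + Rabs (d t)) * Rabs (d t) <= 2 * (b - p) * Rabs (d t))
        by (apply Rmult_le_compat_r; lra).
      nra. }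
  2:{ apply (bigO_weaken D 1 _ (fun t => z t ^ 2)); [lra| |].
      - apply bigO_le. intros t Ht. rewrite Rabs_pos_eq; [apply Rle_refl|apply pow2_ge_0].
      - intros t Ht. destruct (near_facts t Ht) as [? [? [? ?]]]. unfold md. lra. }
  2:{ apply (bigO_weaken D 1 _ (fun t => Rabs (d t))); [lra|apply O_self|].
      intros t Ht. destruct (near_facts t Ht) as [? [? [? ?]]]. unfold md.
      pose proof (pow2_ge_0 (z t)). lra. }
  2:{ apply (bigO_weaken D 1 _ (fun t => Rabs (P t))); [lra|apply O_self|].
      intros t Ht. destruct (near_facts t Ht) as [? [? [? ?]]]. unfold md.
      pose proof (pow2_ge_0 (z t)). lra. }
  intros t Ht. cbv beta. unfold at_, jQ, jP, jd, jz. ring.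
Qed.

(** Since [Q = A2 z^2 - F d - P] up to higher order and [v' = (v / j) Q], the fast pair is a linear
    saddle forced by [A2 / N z^2] in its first equation; what remains is of order [om md] and
    [z^3]. *)
Lemma O_d_equation :
  bigO D (fun t => v1 t - u1 t - lin_d F N mu (d t) (P t) - A2 / N * z t ^ 2)
    (fun t => om t * md t + z t ^ 3).
Proof.
  assert (HN := N_pos). destruct j_b_nonzero as [Nj Nb].
  eapply bigO_ext; [|apply bigO_plus; [apply (bigO_scal (/ N))|apply (bigO_scal (/ j))]].
  2:{ apply (bigO_weaken D 1 _ (fun t => z t ^ 3 + om t * Rabs (d t))); [lra|exact O_flux|].
      intros t Ht. destruct (near_facts t Ht) as [? [? [? ?]]].
      assert (om t * Rabs (d t) <= om t * md t) by (apply Rmult_le_compat_l; unfold om, md; lra). lra. }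
  2:{ apply (bigO_weaken D (1 + (b - p)) _ (fun t => om t * (z t ^ 2 + md t))); [lra| |].
      - apply (bigO_mult (fun t => tv t (tx t) - b) Q); [|exact O_Q].
        apply bigO_le. exact abs_v_b.
      - intros t Ht. destruct (near_facts t Ht) as [? [? [? ?]]]. unfold om.
        assert (z t * (z t * Rabs (d t)) <= (b - p) * ((z t + Rabs (d t)) * md t)).
        { apply Rmult_le_compat; try lra. - apply Rmult_le_pos; lra.
          - apply Rmult_le_compat; unfold md; lra. }
        assert (0 <= (b - p) * (z t ^ 3)) by (apply Rmult_le_pos; [lra|apply pow_le; lra]).
        assert (0 <= (b - p) * ((z t + Rabs (d t)) * md t)).
        { apply Rmult_le_pos; [lra|]. apply Rmult_le_pos; unfold md; lra. }
        nra. }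
  intros t Ht. cbv beta. unfold jv1, ju1, lin_d, jQ, jP, jd, jz, at_.
  unfold N. field. repeat split; auto. lra.
Qed.

Lemma O_P_equation :
  bigO D (fun t => mu * u2 t - lin_P F N mu (d t) (P t)) (fun t => om t * md t).
Proof.
  destruct j_b_nonzero as [Nj Nb].
  eapply bigO_ext; [|apply bigO_minus; [apply (bigO_scal (/ mu))|apply (bigO_scal j)]].
  2:{ apply (bigO_weaken D 1 _ (fun t => z t * Rabs (P t))); [lra| |].
      - apply (bigO_mult (fun t => df1 (tu t (tx t)) - df1 b) P); [exact (O_lip_u df1 ddf1 B1')|apply O_self].
      - intros t Ht. destruct (near_facts t Ht) as [? [? [? ?]]]. rewrite Rmult_1_l.
        apply Rmult_le_compat; unfold om, md; lra. }
  2:{ apply (bigO_weaken D 1 _ (fun t => om t * Rabs (d t))); [lra| |].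
      - apply (bigO_mult (fun t => / tv t (tx t) - / b) d); [exact (O_lip_v Rinv _ inv_bounded)|apply O_self].
      - intros t Ht. destruct (near_facts t Ht) as [? [? [? ?]]]. rewrite Rmult_1_l.
        apply Rmult_le_compat_l; unfold om, md; lra. }
  intros t Ht. cbv beta. assert (Nv := near_v_nonzero _ _ Ht).
  unfold ju2, ju1, jG, lin_P, jP, jd, at_, F, N. field. repeat split; auto. lra.
Qed.

End Uniform.

Lemma near_move d0 t x : near d0 t -> 0 <= x -> near d0 (Point (tu t) (tv t) (ty t) x).
Proof. unfold near. simpl. intros H Hx. tauto. Qed.

Definition state_C (H : R -> R -> R -> R) (t : point) (x : R) : R := H (tu t x) (tv t x) (ty t x).

Lemma near_continuity d0 t x : near d0 t -> 0 <= x ->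
  continuity_pt (tu t) x /\ continuity_pt (tv t) x /\ continuity_pt (ty t) x /\
  0 < tu t x / j /\ 0 < tv t x / j.
Proof.
  intros (O & _) Hx. assert (H := O (x + 1) ltac:(lra)).
  split; [apply H; lra|]. split; [apply H; lra|]. split; [apply H; lra|].
  split; apply H; lra.
Qed.

Lemma near_is_derive d0 t x : near d0 t -> 0 < x ->
  is_derive (tu t) x (state_C (ju1 f1 mu) t x) /\
  is_derive (tv t) x (state_C (jv1 f2 j K) t x) /\
  is_derive (state_C (ju1 f1 mu) t) x (state_C (ju2 f1 df1 mu j) t x) /\
  is_derive (state_C (jv1 f2 j K) t) x (state_C (jv2 f2 df2 j K) t x) /\
  is_derive (state_C (ju2 f1 df1 mu j) t) x (state_C (ju3 f1 df1 ddf1 f2 mu j K) t x).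
Proof.
  intros (O & _) Hx. destruct C3_f1 as (c1 & c1' & _). destruct C3_f2 as (c2 & c2' & _).
  destruct (orbit_is_derive f1 f2 mu j K _ _ _ O x Hx) as (D1 & D2 & _).
  split; [exact D1|]. split; [exact D2|].
  split; [now apply (is_derive_ju1 f1 df1 f2 mu j K)|].
  split; [now apply (is_derive_jv1 f1 f2 df2 mu j K)|].
  now apply (is_derive_ju2 f1 df1 ddf1 f2 mu j K).
Qed.

(** * Fast variables against powers of [z] *)

Section FastPair.
Variables (lam A0 : R).
Hypothesis lam_pos : 0 < lam.
Hypothesis A0_ge : 1 <= A0.
(** The conclusion of [fast_pair_bound], assumed for fixed [lam] and [A0] so that the same two
    constants serve every later step. *)
Hypothesis fast : forall (eps C M : R) (d P B dd dP dB : R -> R),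
    0 <= eps -> 0 <= C -> 0 < M ->
    A0 * eps <= lam / 16 -> A0 * C <= M * lam / 8 -> M * (A0 * eps) <= lam / 16 ->
    (forall x, 0 <= x -> continuity_pt d x /\ continuity_pt P x /\ continuity_pt B x /\ 0 < B x) ->
    (forall x, 0 < x -> is_derive d x (dd x) /\ is_derive P x (dP x) /\ is_derive B x (dB x)) ->
    (forall x, 0 < x ->
      Rabs (dd x - lin_d F N mu (d x) (P x)) <= eps * (Rabs (d x) + Rabs (P x)) + C * B x /\
      Rabs (dP x - lin_P F N mu (d x) (P x)) <= eps * (Rabs (d x) + Rabs (P x)) + C * B x /\
      Rabs (dB x) <= lam / 4 * B x + eps * (Rabs (d x) + Rabs (P x))) ->
    is_lim d p_infty 0 -> is_lim P p_infty 0 ->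
    A0 * (Rabs (d 0) + Rabs (P 0)) <= M * B 0 ->
    forall x, 0 <= x -> Rabs (d x) <= A0 * M * B x /\ Rabs (P x) <= A0 * M * B x.

(** The error coefficients are proportional to [d1]; the factor [1 + M] in the denominator of [k]
    meets both thresholds of [fast] at once. *)
Lemma small_enough (E M : R) : 0 < E -> 0 < M ->
  exists d1, 0 < d1 /\ d1 <= b - p /\ d1 <= 1 /\ A0 * (d1 * E) <= lam / 16 /\ M * (A0 * (d1 * E)) <= lam / 16.
Proof.
  intros HE HM. set (k := lam / (16 * A0 * E * (1 + M))).
  assert (den : 0 < 16 * A0 * E * (1 + M)).
  { repeat apply Rmult_lt_0_compat; lra. }
  assert (kp : 0 < k) by now apply Rdiv_lt_0_compat.
  assert (Ek : A0 * (k * E) * (1 + M) = lam / 16) by (unfold k; field; repeat split; lra).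
  exists (Rmin (Rmin (b - p) 1) k).
  assert (H1 : Rmin (Rmin (b - p) 1) k <= k) by apply Rmin_r.
  assert (H2 : Rmin (Rmin (b - p) 1) k <= Rmin (b - p) 1) by apply Rmin_l.
  assert (H3 : 0 < Rmin (Rmin (b - p) 1) k) by (repeat apply Rmin_glb_lt; lra).
  pose proof (Rmin_l (b - p) 1). pose proof (Rmin_r (b - p) 1).
  set (m := Rmin (Rmin (b - p) 1) k) in *.
  assert (H4 : A0 * (m * E) <= A0 * (k * E)).
  { apply Rmult_le_compat_l; [lra|]. apply Rmult_le_compat_r; lra. }
  assert (H5 : 0 < A0 * (m * E)) by (repeat apply Rmult_lt_0_compat; lra).
  repeat split; try lra; nra.
Qed.

Lemma near_limit_d d0 t : near d0 t -> is_lim (fun x => tv t x - tu t x) p_infty 0.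
Proof.
  intros (_ & _ & _ & _ & L1 & L2 & _).
  replace 0 with (b - b) by ring. now apply is_lim_minus'.
Qed.

Lemma near_limit_z d0 t n : near d0 t -> is_lim (fun x => (b - tu t x) ^ S n) p_infty 0.
Proof.
  intros (_ & _ & _ & _ & L1 & _).
  assert (H : is_lim (fun x => b - tu t x) p_infty 0).
  { replace 0 with (b - b) by ring. apply is_lim_minus'; [apply is_lim_const|exact L1]. }
  assert (H' := is_lim_comp_continuity (fun s => s ^ S n) _ 0
    (derivable_continuous_pt _ _ (derivable_pt_pow (S n) 0)) H).
  cbv beta in H'. now replace (0 ^ S n) with 0 in H' by (simpl; ring).
Qed.

Lemma near_limit_P d0 t : near d0 t -> is_lim (fun x => f1 (tu t x) - ty t x) p_infty 0.
Proof.
  intros (_ & _ & _ & _ & L1 & L2 & PQ & _).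
  apply (is_lim_squeeze0 _ (fun x => f1 (tu t x) + f2 (tv t x) - K)).
  - intros x Hx. destruct (PQ x Hx). rewrite Rabs_pos_eq; lra.
  - replace 0 with (f1 b + f2 b - K) by lra.
    apply is_lim_minus'; [|apply is_lim_const].
    apply is_lim_plus'; apply is_lim_comp_continuity; auto;
    eapply continuity_pt_of_is_derive; [apply B1|apply B2]; lra.
Qed.

(** The gauge is [B = z^2]. Its derivative [- 2 z P / mu] is not yet known to be small against
    [z^2], but it is at most [(2 d1 / mu) |P|], which [fast] tolerates. Initially [d = 0], and
    [0 < P < P + Q = A2 z^2 + O(z^3)] because both quantities are positive along the orbit. *)
Lemma sonic_quadratic : exists d1, 0 < d1 /\ d1 <= b - p /\ d1 <= 1 /\
  bigO (near d1) d (fun t => z t ^ 2) /\ bigO (near d1) P (fun t => z t ^ 2).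
Proof.
  assert (HN := N_pos).
  destruct (O_d_equation (b - p)) as [C5 [HC5 H5]].
  destruct (O_P_equation (b - p)) as [C6 [HC6 H6]].
  destruct (O_flux_u (b - p)) as [C2 [HC2 H2]].
  assert (A2p : 0 < A2) by (unfold A2; lra).
  assert (AN : 0 < A2 / N) by now apply Rdiv_lt_0_compat.
  set (C := C5 * (b - p) + A2 / N). set (E := 2 * (C5 + C6) + 2 / mu).
  assert (Cp : 0 < C) by (unfold C; nra).
  assert (mi : 0 < 2 / mu) by (apply Rdiv_lt_0_compat; lra).
  assert (Ep : 0 < E) by (unfold E; lra).
  (* The first summand meets the threshold on [C]; the others bound the initial value of [P] by a
     multiple of [z^2]. *)
  set (M := A0 * (8 * C / lam + A2 + C2 * (b - p))).
  assert (M1 : 0 < 8 * C / lam) by (apply Rdiv_lt_0_compat; lra).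
  assert (M2 : 0 < C2 * (b - p)) by (apply Rmult_lt_0_compat; lra).
  assert (Mp : 0 < M) by (apply Rmult_lt_0_compat; lra).
  destruct (small_enough E M Ep Mp) as (d1 & d1p & d1b & d11 & S1 & S2).
  assert (key : forall t, near d1 t ->
    Rabs (d t) <= A0 * M * z t ^ 2 /\ Rabs (P t) <= A0 * M * z t ^ 2).
  { intros t Ht.
    assert (Hx : forall x, 0 <= x -> near d1 (Point (tu t) (tv t) (ty t) x))
      by (intros; now apply near_move).
    assert (Hx' : forall x, 0 <= x -> near (b - p) (Point (tu t) (tv t) (ty t) x))
      by (intros; eapply near_sub; [exact d1b|auto]).
    assert (Htx : 0 <= tx t) by (destruct Ht as (_ & _ & _ & _ & _ & _ & _ & H); exact H).
    apply (fast (d1 * E) C M (fun x => tv t x - tu t x) (fun x => f1 (tu t x) - ty t x)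
      (fun x => (b - tu t x) ^ 2)
      (fun x => state_C (jv1 f2 j K) t x - state_C (ju1 f1 mu) t x)
      (fun x => mu * state_C (ju2 f1 df1 mu j) t x)
      (fun x => 2 * (b - tu t x) * (- state_C (ju1 f1 mu) t x))); auto.
    - apply Rmult_le_pos; lra.
    - lra.
    - unfold M. replace (A0 * (8 * C / lam + A2 + C2 * (b - p)) * lam / 8)
        with (A0 * C + A0 * ((A2 + C2 * (b - p)) * (lam / 8))) by (field; lra).
      assert (0 <= A0 * ((A2 + C2 * (b - p)) * (lam / 8))); [|lra].
      apply Rmult_le_pos; [lra|]. apply Rmult_le_pos; lra.
    - intros x Hx0. destruct (near_continuity d1 t x Ht Hx0) as (c1 & c2 & c3 & c4 & c5).
      destruct (near_range _ _ (Hx x Hx0)) as (Rz & _). unfold at_, jz in Rz; simpl in Rz.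
      split; [now apply continuity_pt_minus|]. split; [|split].
      + apply continuity_pt_minus; [|exact c3]. apply (continuity_pt_comp (tu t) f1); [exact c1|].
        exact (C1_on_continuity j f1 df1 _ (proj1 C3_f1) c4).
      + apply (continuity_pt_comp (fun x => b - tu t x) (fun s => s ^ 2)).
        * apply continuity_pt_minus; [apply continuity_pt_const; now intros ? ?|exact c1].
        * apply derivable_continuous_pt, derivable_pt_pow.
      + apply pow_lt. lra.
    - intros x Hx0. destruct (near_is_derive d1 t x Ht Hx0) as (D1 & D2 & D3 & D4 & D5).
      split; [now apply is_derive_minus_R|]. split.
      + apply (is_derive_ext_R (fun x => mu * state_C (ju1 f1 mu) t x)).
        * intros s. unfold state_C, ju1. field. lra.
        * now apply is_derive_scal_R.
      + assert (Eu : Derive (fun x => tu t x) x = state_C (ju1 f1 mu) t x) by now apply is_derive_unique.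
        auto_derive; [eexists; exact D1|]. rewrite Eu. ring.
    - intros x Hx0. assert (nx := Hx x ltac:(lra)). assert (nx' := Hx' x ltac:(lra)).
      specialize (H5 _ nx'). specialize (H6 _ nx').
      destruct (near_range _ _ nx) as (Rz & Rd & Rz' & _).
      set (T := Point (tu t) (tv t) (ty t) x) in *.
      change (tv t x - tu t x) with (d T). change (f1 (tu t x) - ty t x) with (P T).
      change (b - tu t x) with (z T).
      change (state_C (jv1 f2 j K) t x) with (v1 T). change (state_C (ju1 f1 mu) t x) with (u1 T).
      change (state_C (ju2 f1 df1 mu j) t x) with (u2 T).
      fold (md T).
      assert (md0 : 0 <= md T) by (unfold md; pose proof (Rabs_pos (d T)); pose proof (Rabs_pos (P T)); lra).
      assert (omd : om T * md T <= 2 * d1 * md T) by (apply Rmult_le_compat_r; unfold om; lra).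
      assert (z2 : 0 <= z T ^ 2) by apply pow2_ge_0.
      assert (z3 : z T ^ 3 <= (b - p) * z T ^ 2).
      { replace (z T ^ 3) with (z T * z T ^ 2) by ring. apply Rmult_le_compat_r; lra. }
      assert (dm : 0 <= d1 * md T) by (apply Rmult_le_pos; lra).
      assert (C5 * (om T * md T) <= C5 * (2 * d1 * md T)) by (apply Rmult_le_compat_l; lra).
      assert (C6 * (om T * md T) <= C6 * (2 * d1 * md T)) by (apply Rmult_le_compat_l; lra).
      assert (C5 * z T ^ 3 <= C5 * ((b - p) * z T ^ 2)) by (apply Rmult_le_compat_l; lra).
      assert (0 <= C5 * (d1 * md T)) by (apply Rmult_le_pos; lra).
      assert (0 <= C6 * (d1 * md T)) by (apply Rmult_le_pos; lra).
      assert (0 <= 2 / mu * (d1 * md T)) by (apply Rmult_le_pos; lra).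
      assert (0 <= C5 * (b - p) * z T ^ 2) by (apply Rmult_le_pos; nra).
      assert (0 <= A2 / N * z T ^ 2) by (apply Rmult_le_pos; lra).
      split; [|split].
      + replace (v1 T - u1 T - lin_d F N mu (d T) (P T))
          with ((v1 T - u1 T - lin_d F N mu (d T) (P T) - A2 / N * z T ^ 2) + A2 / N * z T ^ 2) by ring.
        eapply Rle_trans; [apply Rabs_triang|]. rewrite (Rabs_pos_eq (A2 / N * z T ^ 2)) by assumption.
        unfold E, C. nra.
      + unfold E, C. nra.
      + assert (EP : u1 T = P T / mu) by reflexivity. rewrite EP.
        assert (Rabs (P T) <= md T) by (unfold md; pose proof (Rabs_pos (d T)); lra).
        rewrite !Rabs_mult, Rabs_Ropp, (Rabs_pos_eq 2), (Rabs_pos_eq (z T)) by lra.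
        unfold Rdiv. rewrite Rabs_mult, (Rabs_pos_eq (/ mu)) by (apply Rlt_le, Rinv_0_lt_compat; lra).
        assert (i0 : 0 < / mu) by (now apply Rinv_0_lt_compat).
        assert (2 * z T * (Rabs (P T) * / mu) <= 2 * d1 * (md T * / mu)).
        { apply Rmult_le_compat; try lra.
          - apply Rmult_le_pos; [apply Rabs_pos|lra].
          - apply Rmult_le_compat_r; lra. }
        assert (0 <= lam / 4 * z T ^ 2) by (apply Rmult_le_pos; lra).
        unfold Rdiv in *. unfold E, Rdiv. nra.
    - now apply (near_limit_d d1).
    - now apply (near_limit_P d1).
    - assert (n0 := Hx' 0 ltac:(lra)). specialize (H2 _ n0).
      destruct (near_range _ _ n0) as (Rz & _ & _ & _ & RP & RQ & _).
      set (T := Point (tu t) (tv t) (ty t) 0) in *.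
      assert (E0 : tv t 0 = tu t 0) by (symmetry; apply Ht).
      rewrite E0, Rminus_diag, Rabs_R0, Rplus_0_l.
      change (f1 (tu t 0) - ty t 0) with (P T). change (b - tu t 0) with (z T).
      assert (PT : P T < f1 (tu T (tx T)) + f2 (tu T (tx T)) - K).
      { unfold T in *; simpl in *. unfold at_, jP, jQ in *; simpl in *. rewrite E0 in RQ. lra. }
      apply Rabs_le_between in H2. rewrite Rabs_pos_eq by lra.
      assert (z2 : 0 <= z T ^ 2) by apply pow2_ge_0.
      assert (z3 : z T ^ 3 <= (b - p) * z T ^ 2).
      { replace (z T ^ 3) with (z T * z T ^ 2) by ring. apply Rmult_le_compat_r; lra. }
      assert (C2 * z T ^ 3 <= C2 * ((b - p) * z T ^ 2)) by (apply Rmult_le_compat_l; lra).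
      unfold M. rewrite Rmult_assoc. apply Rmult_le_compat_l; [lra|].
      assert (0 <= 8 * C / lam * z T ^ 2) by (apply Rmult_le_pos; lra). lra. }
  assert (AM : 0 < A0 * M) by (apply Rmult_lt_0_compat; lra).
  exists d1. split; [exact d1p|]. split; [exact d1b|]. split; [exact d11|]. split.
  - exists (A0 * M). split; [exact AM|]. intros t Ht. now apply key.
  - exists (A0 * M). split; [exact AM|]. intros t Ht. now apply key.
Qed.

(* The initial point [u = v] is not on the slow manifold; the mismatch decays like this boundary layer. *)
Definition layer (t : point) : R := (b - tu t 0) ^ 2 * exp (- (lam / 4) * tx t).

Lemma layer_pos d1 t : near d1 t -> 0 < layer t.
Proof.
  intros H. destruct (near_range _ _ H) as (Rz & _ & _ & _ & _ & _ & _ & _ & Rz').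
  apply Rmult_lt_0_compat; [apply pow_lt; lra|apply exp_pos].
Qed.

(** Raises the order of a bound. The pair solves the linear saddle up to [z] times itself and
    [z^(n+1)], but its initial value is only [O(delta^2)], with [delta = b - u 0]; the layer carries
    that mismatch. Its rate [lam / 4] is the fastest that the slowness condition on [B] allows. *)
Lemma fast_step (n : nat) (d1 : R) (Wd WP Wd' WP' : R -> R -> R -> R) :
  0 < d1 -> d1 <= b - p ->
  bigO (near d1) P (fun t => z t ^ 2) ->
  bigO (near d1) (at_ Wd) (fun t => z t ^ 2) ->
  bigO (near d1) (at_ WP) (fun t => z t ^ 2) ->
  bigO (near d1) (fun t => at_ Wd' t - lin_d F N mu (at_ Wd t) (at_ WP t))
    (fun t => z t * (Rabs (at_ Wd t) + Rabs (at_ WP t)) + z t ^ S n) ->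
  bigO (near d1) (fun t => at_ WP' t - lin_P F N mu (at_ Wd t) (at_ WP t))
    (fun t => z t * (Rabs (at_ Wd t) + Rabs (at_ WP t)) + z t ^ S n) ->
  (forall t x, near d1 t -> 0 < x -> is_derive (state_C Wd t) x (state_C Wd' t x) /\
    is_derive (state_C WP t) x (state_C WP' t x)) ->
  (forall t x, near d1 t -> 0 <= x -> continuity_pt (state_C Wd t) x /\
    continuity_pt (state_C WP t) x) ->
  exists d2, 0 < d2 /\ d2 <= d1 /\
    bigO (near d2) (at_ Wd) (fun t => z t ^ S n + layer t) /\
    bigO (near d2) (at_ WP) (fun t => z t ^ S n + layer t).
Proof.
  intros d1p d1b [CP [HCP OP]] [Cd [HCd Od]] [Cp [HCp Op]] [C5 [HC5 H5]] [C6 [HC6 H6]] DW CW.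
  set (C := C5 + C6). set (E := C5 + C6 + INR (S n) * CP / mu).
  assert (Np : 0 < INR (S n) * CP / mu).
  { apply Rdiv_lt_0_compat; [|lra]. apply Rmult_lt_0_compat; [apply lt_0_INR; lia|lra]. }
  set (M := A0 * (8 * C / lam + Cd + Cp)).
  assert (M1 : 0 < 8 * C / lam) by (apply Rdiv_lt_0_compat; unfold C; lra).
  assert (Mp : 0 < M) by (apply Rmult_lt_0_compat; lra).
  destruct (small_enough E M ltac:(unfold E; lra) Mp) as (dd & ddp & ddb & dd1 & S1 & S2).
  set (d2 := Rmin dd d1).
  assert (L1 : d2 <= dd) by apply Rmin_l. assert (L2 : d2 <= d1) by apply Rmin_r.
  assert (d2p : 0 < d2) by now apply Rmin_glb_lt.
  assert (key : forall t, near d2 t ->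
    Rabs (at_ Wd t) <= A0 * M * (z t ^ S n + layer t) /\
    Rabs (at_ WP t) <= A0 * M * (z t ^ S n + layer t)).
  { intros t Ht2. assert (Ht : near d1 t) by (eapply near_sub; eauto).
    set (del := b - tu t 0).
    assert (Hx : forall x, 0 <= x -> near d2 (Point (tu t) (tv t) (ty t) x))
      by (intros; now apply near_move).
    assert (Hx' : forall x, 0 <= x -> near d1 (Point (tu t) (tv t) (ty t) x))
      by (intros; now apply near_move).
    assert (Htx : 0 <= tx t) by (destruct Ht as (_ & _ & _ & _ & _ & _ & _ & H); exact H).
    assert (delp : 0 < del).
    { destruct (near_range _ _ Ht) as (Rz & _ & _ & _ & _ & _ & _ & _ & Rz'). unfold del. lra. }
    assert (bdW : forall x, 0 <= x -> Rabs (state_C Wd t x) <= Cd * (b - tu t x) ^ 2 /\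
      Rabs (state_C WP t x) <= Cp * (b - tu t x) ^ 2).
    { intros x Hx0. split; [apply (Od _ (Hx' x Hx0))|apply (Op _ (Hx' x Hx0))]. }
    assert (Bpos : forall x, 0 <= x -> 0 < (b - tu t x) ^ S n /\ 0 < del ^ 2 * exp (- (lam / 4) * x)).
    { intros x Hx0. destruct (near_range _ _ (Hx x Hx0)) as (Rz & _).
      unfold at_, jz in Rz; simpl in Rz. split; [apply pow_lt; lra|].
      apply Rmult_lt_0_compat; [apply pow_lt; lra|apply exp_pos]. }
    apply (fast (dd * E) C M (state_C Wd t) (state_C WP t)
      (fun x => (b - tu t x) ^ S n + del ^ 2 * exp (- (lam / 4) * x))
      (state_C Wd' t) (state_C WP' t)
      (fun x => INR (S n) * (b - tu t x) ^ n * (- state_C (ju1 f1 mu) t x)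
        + del ^ 2 * (- (lam / 4) * exp (- (lam / 4) * x)))); auto.
    - apply Rmult_le_pos; unfold E; lra.
    - unfold C; lra.
    - unfold M. replace (A0 * (8 * C / lam + Cd + Cp) * lam / 8)
        with (A0 * C + A0 * ((Cd + Cp) * (lam / 8))) by (field; lra).
      assert (0 <= A0 * ((Cd + Cp) * (lam / 8))); [|lra].
      apply Rmult_le_pos; [lra|]. apply Rmult_le_pos; lra.
    - intros x Hx0. destruct (near_continuity d1 t x Ht Hx0) as (c1 & _).
      destruct (CW t x Ht Hx0) as [c2 c3]. destruct (Bpos x Hx0).
      split; [exact c2|]. split; [exact c3|]. split; [|lra].
      apply continuity_pt_plus.
      + apply (continuity_pt_comp (fun x => b - tu t x) (fun s => s ^ S n)).
        * apply continuity_pt_minus; [apply continuity_pt_const; now intros ? ?|exact c1].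
        * apply derivable_continuous_pt, derivable_pt_pow.
      + apply (continuity_pt_of_is_derive _ _ (del ^ 2 * (- (lam / 4) * exp (- (lam / 4) * x)))).
        auto_derive; [exact I|ring].
    - intros x Hx0. destruct (DW t x Ht Hx0) as [D1 D2].
      split; [exact D1|]. split; [exact D2|].
      destruct (near_is_derive d1 t x Ht Hx0) as (Du & _).
      apply is_derive_plus_R.
      + eapply is_derive_eq.
        * apply (is_derive_pow (fun x => b - tu t x) (S n) x (- state_C (ju1 f1 mu) t x)).
          eapply is_derive_eq.
          -- apply (is_derive_minus_R (fun _ => b) (tu t)); [apply @is_derive_const|exact Du].
          -- unfold zero; simpl. ring.
        * cbv beta. simpl Nat.pred. ring.
      + auto_derive; [exact I|ring].
    - intros x Hx0. assert (n2 := Hx x ltac:(lra)). assert (n1 := Hx' x ltac:(lra)).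
      destruct (Bpos x ltac:(lra)) as [Bp1 Bp2].
      specialize (H5 _ n1). specialize (H6 _ n1). specialize (OP _ n1).
      destruct (near_range _ _ n2) as (Rz & _).
      set (T := Point (tu t) (tv t) (ty t) x) in *.
      change (state_C Wd t x) with (at_ Wd T). change (state_C WP t x) with (at_ WP T).
      change (state_C Wd' t x) with (at_ Wd' T). change (state_C WP' t x) with (at_ WP' T).
      change (state_C (ju1 f1 mu) t x) with (u1 T).
      change (b - tu t x) with (z T) in *.
      set (m := Rabs (at_ Wd T) + Rabs (at_ WP T)) in *.
      assert (m0 : 0 <= m) by (unfold m; pose proof (Rabs_pos (at_ Wd T)); pose proof (Rabs_pos (at_ WP T)); lra).
      set (e := del ^ 2 * exp (- (lam / 4) * x)) in *.
      assert (zm : z T * m <= dd * m) by (apply Rmult_le_compat_r; lra).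
      assert (0 <= dd * m) by (apply Rmult_le_pos; lra).
      assert (q5 : C5 * (z T * m) <= C5 * (dd * m)) by (apply Rmult_le_compat_l; lra).
      assert (q6 : C6 * (z T * m) <= C6 * (dd * m)) by (apply Rmult_le_compat_l; lra).
      assert (0 <= C5 * (dd * m)) by (apply Rmult_le_pos; lra).
      assert (0 <= C6 * (dd * m)) by (apply Rmult_le_pos; lra).
      assert (0 <= INR (S n) * CP / mu * (dd * m)) by (apply Rmult_le_pos; lra).
      assert (0 <= C5 * z T ^ S n) by (apply Rmult_le_pos; lra).
      assert (0 <= C6 * z T ^ S n) by (apply Rmult_le_pos; lra).
      assert (0 <= C5 * e) by (apply Rmult_le_pos; lra).
      assert (0 <= C6 * e) by (apply Rmult_le_pos; lra).
      assert (EE : dd * E * m = C5 * (dd * m) + C6 * (dd * m) + INR (S n) * CP / mu * (dd * m))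
        by (unfold E; ring).
      assert (EC : C * (z T ^ S n + e) = C5 * z T ^ S n + C6 * z T ^ S n + C5 * e + C6 * e)
        by (unfold C; ring).
      split; [|split].
      + lra.
      + lra.
      + eapply Rle_trans; [apply Rabs_triang|].
        assert (Q1 : Rabs (del ^ 2 * (- (lam / 4) * exp (- (lam / 4) * x))) = lam / 4 * e).
        { replace (del ^ 2 * (- (lam / 4) * exp (- (lam / 4) * x))) with (- (lam / 4 * e)) by (unfold e; ring).
          rewrite Rabs_Ropp, Rabs_pos_eq; [reflexivity|]. apply Rmult_le_pos; lra. }
        rewrite Q1.
        assert (i0 : 0 < / mu) by now apply Rinv_0_lt_compat.
        assert (zn : 0 <= z T ^ n) by (apply pow_le; lra).
        assert (In : 0 < INR (S n)) by (apply lt_0_INR; lia).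
        assert (Q2 : Rabs (INR (S n) * z T ^ n * - u1 T) <= INR (S n) * CP / mu * dd * z T ^ S n).
        { assert (EP : u1 T = P T / mu) by reflexivity. rewrite EP.
          unfold Rdiv. rewrite !Rabs_mult, Rabs_Ropp, Rabs_mult.
          rewrite (Rabs_pos_eq (INR (S n))), (Rabs_pos_eq (z T ^ n)), (Rabs_pos_eq (/ mu)) by lra.
          assert (Q3 : Rabs (P T) <= CP * (dd * z T)).
          { eapply Rle_trans; [exact OP|]. apply Rmult_le_compat_l; [lra|].
            replace (z T ^ 2) with (z T * z T) by ring. apply Rmult_le_compat_r; lra. }
          replace (INR (S n) * CP * / mu * dd * z T ^ S n)
            with (INR (S n) * z T ^ n * ((CP * (dd * z T)) * / mu)) by (simpl pow; ring).
          apply Rmult_le_compat_l; [apply Rmult_le_pos; lra|]. apply Rmult_le_compat_r; lra. }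
        assert (Q4 : INR (S n) * CP / mu * dd <= lam / 16).
        { assert (dd * E <= lam / 16) by nra.
          assert (0 <= dd * (C5 + C6)) by (apply Rmult_le_pos; lra).
          assert (dd * E = dd * (C5 + C6) + INR (S n) * CP / mu * dd) by (unfold E; ring). lra. }
        assert (INR (S n) * CP / mu * dd * z T ^ S n <= lam / 16 * z T ^ S n)
          by (apply Rmult_le_compat_r; lra).
        assert (0 <= lam * z T ^ S n) by (apply Rmult_le_pos; lra).
        lra.
    - apply (is_lim_squeeze0 _ (fun x => Cd * (b - tu t x) ^ 2)); [intros x Hx0; now apply bdW|].
      replace 0 with (Cd * 0) by ring.
      apply (is_lim_scal_l (fun x => (b - tu t x) ^ 2) Cd p_infty 0). now apply (near_limit_z d1 t 1).
    - apply (is_lim_squeeze0 _ (fun x => Cp * (b - tu t x) ^ 2)); [intros x Hx0; now apply bdW|].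
      replace 0 with (Cp * 0) by ring.
      apply (is_lim_scal_l (fun x => (b - tu t x) ^ 2) Cp p_infty 0). now apply (near_limit_z d1 t 1).
    - destruct (bdW 0 ltac:(lra)) as [W1 W2]. fold del in W1, W2.
      rewrite Rmult_0_r, exp_0, Rmult_1_r. fold del.
      assert (0 < del ^ S n) by (now apply pow_lt). assert (0 < del ^ 2) by (now apply pow_lt).
      unfold M. rewrite Rmult_assoc. apply Rmult_le_compat_l; [lra|].
      assert (0 <= 8 * C / lam * (del ^ S n + del ^ 2)) by (apply Rmult_le_pos; lra).
      assert (0 <= (Cd + Cp) * del ^ S n) by (apply Rmult_le_pos; lra). nra. }
  assert (AM : 0 < A0 * M) by (apply Rmult_lt_0_compat; lra).
  exists d2. split; [exact d2p|]. split; [exact L2|].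
  split; exists (A0 * M); (split; [exact AM|]); intros t Ht; now apply key.
Qed.

(* To leading order [d] and [P] are slaved to [z]: [d = dh z^2], [P = Ph z^2], so that [u' = a z^2].
   [jWd], [jWP] below are the deviations from this slow manifold, [jWd1], [jWP1] their derivatives. *)
Let a := A2 / (mu + N + F ^ 2 / N).
Let Ph := mu * a.
Let dh := F * a / N.

(** The values [dh z^2] and [Ph z^2] balance the forcing [A2 / N z^2] of the fast pair; [a] is
    positive by convexity. *)
Lemma quasi_equilibrium : 0 < a /\ lin_d F N mu dh Ph = - (A2 / N) /\ lin_P F N mu dh Ph = 0.
Proof.
  assert (HN := N_pos). assert (0 <= F ^ 2 / N).
  { apply Rmult_le_pos; [apply pow2_ge_0|apply Rlt_le, Rinv_0_lt_compat; lra]. }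
  assert (Hden : 0 < mu * N + N * N + F ^ 2) by nra.
  assert (A2p : 0 < A2) by (unfold A2; lra).
  split; [apply Rdiv_lt_0_compat; lra|]. unfold lin_d, lin_P, dh, Ph, a.
  split; field; repeat split; lra.
Qed.

Definition jWd (u v y : R) : R := jd u v y - dh * jz u v y ^ 2.
Definition jWP (u v y : R) : R := jP u v y - Ph * jz u v y ^ 2.
Definition jWd1 (u v y : R) : R := jv1 f2 j K u v y - ju1 f1 mu u v y + 2 * dh * (jz u v y * ju1 f1 mu u v y).
Definition jWP1 (u v y : R) : R := mu * ju2 f1 df1 mu j u v y + 2 * Ph * (jz u v y * ju1 f1 mu u v y).
(** The derivative of [z u'] along an orbit, as [z' = - u']. *)
Definition jzu (u v y : R) : R := jz u v y * ju2 f1 df1 mu j u v y - ju1 f1 mu u v y ^ 2.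
Definition jWd2 (u v y : R) : R := jv2 f2 df2 j K u v y - ju2 f1 df1 mu j u v y + 2 * dh * jzu u v y.
Definition jWP2 (u v y : R) : R := mu * ju3 f1 df1 ddf1 f2 mu j K u v y + 2 * Ph * jzu u v y.

(** * Equations for the deviation from the slow manifold and for its derivative *)

Section Refined.
Variable d1 : R.
Hypothesis d1_pos : 0 < d1.
Hypothesis d1_le : d1 <= b - p.
Local Notation D := (near d1).
Hypothesis Od : bigO D d (fun t => z t ^ 2).
Hypothesis OP : bigO D P (fun t => z t ^ 2).

Lemma zf t : D t -> 0 < z t /\ z t <= b - p /\ 0 < b - p.
Proof. intros H. destruct (near_facts _ t H) as (? & ? & _). lra. Qed.

Lemma O_zpow n : bigO D (fun t => z t ^ n) (fun t => z t ^ n).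
Proof.
  apply bigO_le. intros t Ht. destruct (zf t Ht). rewrite Rabs_pos_eq; [apply Rle_refl|].
  apply pow_le. lra.
Qed.

Lemma O_zsucc n : bigO D (fun t => z t ^ S n) (fun t => z t ^ n).
Proof.
  exists (b - p). split; [lra|]. intros t Ht. destruct (zf t Ht).
  assert (0 <= z t ^ n) by (apply pow_le; lra).
  rewrite Rabs_pos_eq; [|apply pow_le; lra]. simpl. apply Rmult_le_compat_r; lra.
Qed.

Lemma O_z : bigO D z z.
Proof. apply O_self_z. Qed.

Lemma O_om : bigO D om z.
Proof.
  destruct Od as [C [HC H]]. exists (1 + C * (b - p)). split; [nra|].
  intros t Ht. destruct (zf t Ht). specialize (H t Ht).
  unfold om. rewrite Rabs_pos_eq by (pose proof (Rabs_pos (d t)); lra).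
  assert (C * z t ^ 2 <= C * ((b - p) * z t)).
  { apply Rmult_le_compat_l; [lra|]. replace (z t ^ 2) with (z t * z t) by ring.
    apply Rmult_le_compat_r; lra. }
  lra.
Qed.

Lemma O_md : bigO D md (fun t => z t ^ 2).
Proof.
  destruct Od as [C [HC H]]. destruct OP as [C' [HC' H']]. exists (C + C'). split; [lra|].
  intros t Ht. specialize (H t Ht). specialize (H' t Ht). unfold md.
  rewrite Rabs_pos_eq by (pose proof (Rabs_pos (d t)); pose proof (Rabs_pos (P t)); lra). lra.
Qed.

Lemma O_to (f g h : point -> R) : bigO D f g -> bigO D g h -> bigO D f h.
Proof. apply bigO_trans. Qed.

Lemma O_mult_to (f f' g g' h : point -> R) :
  bigO D f g -> bigO D f' g' -> (forall t, D t -> g t * g' t = h t) -> bigO D (fun t => f t * f' t) h.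
Proof.
  intros H H' E. apply (bigO_weaken D 1 _ (fun t => g t * g' t)); [lra|now apply bigO_mult|].
  intros t Ht. rewrite E by exact Ht. lra.
Qed.

Lemma O_vb : bigO D (fun t => tv t (tx t) - b) z.
Proof. eapply O_to; [|exact O_om]. apply bigO_le. exact (abs_v_b d1). Qed.

Lemma O_v_id : bigO D (fun t => tv t (tx t)) (fun _ => 1).
Proof.
  apply (O_bdd_v d1 (fun c => c) (fun _ => 1)). split.
  - intros c _. apply @is_derive_id.
  - exists 1. split; [lra|]. intros. rewrite Rabs_R1. lra.
Qed.

Lemma O_inv_v : bigO D (fun t => / tv t (tx t)) (fun _ => 1).
Proof. exact (O_bdd_v d1 Rinv _ inv_bounded). Qed.

Lemma O_u1 : bigO D u1 (fun t => z t ^ 2).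
Proof. apply (bigO_mult_1r P (fun _ => / mu)); [exact OP|apply bigO_const]. Qed.

Lemma O_Qz : bigO D Q (fun t => z t ^ 2).
Proof.
  eapply O_to; [apply O_Q|]. apply bigO_plus; [apply O_zpow|exact O_md].
Qed.

Lemma O_v1 : bigO D v1 (fun t => z t ^ 2).
Proof.
  apply (bigO_mult_1l (fun t => tv t (tx t) / j) Q); [|exact O_Qz].
  apply (bigO_mult_1r (fun t => tv t (tx t)) (fun _ => / j)); [exact O_v_id|apply bigO_const].
Qed.

Lemma O_G : bigO D G (fun t => z t ^ 2).
Proof.
  eapply bigO_ext; [|apply (bigO_scal j); apply (bigO_mult_1l _ d _ O_inv_v Od)].
  intros t Ht. assert (H := near_v_nonzero _ _ Ht). unfold at_, jG, jd. field. exact H.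
Qed.

Lemma O_p1 : bigO D (fun t => mu * u2 t) (fun t => z t ^ 2).
Proof.
  eapply bigO_ext; [|apply bigO_minus; [apply (bigO_mult_1l _ u1 _ (O_bdd_u d1 df1 ddf1 B1') O_u1)|exact O_G]].
  intros t Ht. unfold at_, ju2. field. lra.
Qed.

Lemma O_d1 : bigO D (fun t => v1 t - u1 t) (fun t => z t ^ 2).
Proof. apply bigO_minus; [exact O_v1|exact O_u1]. Qed.

Lemma O_z3 : bigO D (fun t => om t * md t + z t ^ 3) (fun t => z t ^ 3).
Proof.
  apply bigO_plus; [|apply O_zpow].
  apply (O_mult_to om md z (fun t => z t ^ 2)); [exact O_om|exact O_md|]. intros; ring.
Qed.

Lemma O_zu1 : bigO D (fun t => z t * u1 t) (fun t => z t ^ 3).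
Proof. apply (O_mult_to z u1 z (fun t => z t ^ 2)); [exact O_z|exact O_u1|]. intros; ring. Qed.

Lemma W_quadratic : bigO D (at_ jWd) (fun t => z t ^ 2) /\ bigO D (at_ jWP) (fun t => z t ^ 2).
Proof.
  split.
  - apply (bigO_minus d (fun t => dh * z t ^ 2)); [exact Od|apply bigO_scal, O_zpow].
  - apply (bigO_minus P (fun t => Ph * z t ^ 2)); [exact OP|apply bigO_scal, O_zpow].
Qed.

Lemma W1_quadratic : bigO D (at_ jWd1) (fun t => z t ^ 2) /\ bigO D (at_ jWP1) (fun t => z t ^ 2).
Proof.
  split.
  - apply (bigO_plus (fun t => v1 t - u1 t) (fun t => 2 * dh * (z t * u1 t))); [exact O_d1|].
    apply bigO_scal. eapply O_to; [exact O_zu1|apply O_zsucc].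
  - apply (bigO_plus (fun t => mu * u2 t) (fun t => 2 * Ph * (z t * u1 t))); [exact O_p1|].
    apply bigO_scal. eapply O_to; [exact O_zu1|apply O_zsucc].
Qed.

Lemma gauge_z3 (f g : point -> R) :
  bigO D (fun t => z t ^ 3) (fun t => z t * (Rabs (f t) + Rabs (g t)) + z t ^ 3).
Proof.
  apply bigO_le. intros t Ht. destruct (zf t Ht).
  assert (0 <= z t * (Rabs (f t) + Rabs (g t))).
  { apply Rmult_le_pos; [lra|]. pose proof (Rabs_pos (f t)). pose proof (Rabs_pos (g t)). lra. }
  rewrite Rabs_pos_eq; [lra|apply pow_le; lra].
Qed.

(** The quasi-equilibrium cancels the forcing; the correction due to its motion is a multiple of
    [z u'], which is [O(z^3)]. *)
Lemma W_equations :
  bigO D (fun t => at_ jWd1 t - lin_d F N mu (at_ jWd t) (at_ jWP t))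
    (fun t => z t * (Rabs (at_ jWd t) + Rabs (at_ jWP t)) + z t ^ 3) /\
  bigO D (fun t => at_ jWP1 t - lin_P F N mu (at_ jWd t) (at_ jWP t))
    (fun t => z t * (Rabs (at_ jWd t) + Rabs (at_ jWP t)) + z t ^ 3).
Proof.
  destruct quasi_equilibrium as (_ & Ed & EP).
  split; (eapply O_to; [|apply gauge_z3]).
  - eapply bigO_ext; [|apply bigO_plus; [eapply O_to; [apply O_d_equation|exact O_z3]|
      apply (bigO_scal (2 * dh) _ _ O_zu1)]].
    intros t Ht. cbv beta.
    replace (A2 / N) with (- lin_d F N mu dh Ph) by lra.
    unfold at_, jWd1, jWd, jWP, lin_d. ring.
  - eapply bigO_ext; [|apply bigO_plus; [eapply O_to; [apply O_P_equation|]|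
      apply (bigO_scal (2 * Ph) _ _ O_zu1)]].
    + intros t Ht. cbv beta.
      replace (mu * u2 t - lin_P F N mu (d t) (P t) + 2 * Ph * (z t * u1 t))
        with (mu * u2 t - lin_P F N mu (d t) (P t) + lin_P F N mu dh Ph * z t ^ 2 + 2 * Ph * (z t * u1 t))
        by (rewrite EP; ring).
      unfold at_, jWP1, jWd, jWP, lin_P. ring.
    + apply (O_mult_to om md z (fun t => z t ^ 2)); [exact O_om|exact O_md|]. intros; ring.
Qed.

(** The counterpart of [md] for the derivatives [d'] and [P' = mu u'']; [g4] is the error gauge of
    the differentiated equations. *)
Definition sd (t : point) : R := Rabs (v1 t - u1 t) + Rabs (mu * u2 t).
Definition g4 (t : point) : R := z t * sd t + z t ^ 4.

Lemma sd_pos t : 0 <= sd t.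
Proof. unfold sd. pose proof (Rabs_pos (v1 t - u1 t)). pose proof (Rabs_pos (mu * u2 t)). lra. Qed.

Lemma O_g4_pow (f : point -> R) : bigO D f (fun t => z t ^ 4) -> bigO D f g4.
Proof.
  intros H. apply (bigO_weaken D 1 _ (fun t => z t ^ 4)); [lra|exact H|].
  intros t Ht. destruct (zf t Ht). unfold g4.
  assert (0 <= z t * sd t) by (apply Rmult_le_pos; [lra|apply sd_pos]). lra.
Qed.

Lemma O_g4_mult (f h : point -> R) : bigO D f z -> bigO D h sd -> bigO D (fun t => f t * h t) g4.
Proof.
  intros Hf Hh. apply (bigO_weaken D 1 _ (fun t => z t * sd t)); [lra|now apply bigO_mult|].
  intros t Ht. destruct (zf t Ht). unfold g4.
  assert (0 <= z t ^ 4) by (apply pow_le; lra). lra.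
Qed.

Lemma O_sd_d1 : bigO D (fun t => v1 t - u1 t) sd.
Proof. apply bigO_le. intros t _. unfold sd. pose proof (Rabs_pos (mu * u2 t)). lra. Qed.

Lemma O_sd_p1 : bigO D (fun t => mu * u2 t) sd.
Proof. apply bigO_le. intros t _. unfold sd. pose proof (Rabs_pos (v1 t - u1 t)). lra. Qed.

(** By the sonic condition the constant term is absent; the difference between [u] and [v]
    contributes only at second order, through [d]. *)
Lemma O_dflux :
  bigO D (fun t => df1 (tu t (tx t)) + df2 (tv t (tx t)) + 2 * A2 * z t) (fun t => z t ^ 2).
Proof.
  destruct (taylor2_bound p q df1 ddf1 dddf1 B1' B1'') as [E1 [HE1 HE1']].
  destruct (taylor2_bound p q df2 ddf2 dddf2 B2' B2'') as [E2 [HE2 HE2']].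
  eapply bigO_ext; [|apply bigO_plus; [apply bigO_plus|apply (bigO_scal (ddf2 b) _ _ Od)]].
  2:{ exists E1. split; [exact HE1|]. intros t Ht.
      specialize (HE1' b _ ltac:(lra) (near_u _ t Ht)). rewrite (abs_u_b _ t Ht) in HE1'. exact HE1'. }
  2:{ eapply O_to.
      - exists E2. split; [exact HE2|]. intros t Ht.
        exact (HE2' b _ ltac:(lra) (near_v _ t Ht)).
      - apply (bigO_ext _ (fun t => (tv t (tx t) - b) * (tv t (tx t) - b))).
        + intros t _. rewrite <- Rsqr_pow2, <- Rsqr_abs. reflexivity.
        + eapply (O_mult_to _ _ z z); [exact O_vb|exact O_vb|]. intros; ring. }
  intros t Ht. cbv beta. unfold at_, jz, jd, A2.
  replace (df2 b) with (- df1 b) by lra. field.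
Qed.

(** This is the relation [Q = A2 z^2 - F d - P] differentiated. A bound on a remainder does not pass
    to its derivative, so the expansion is redone on the explicit function [Q1]. *)
Lemma O_Q1_refined :
  bigO D (fun t => Q1 t + F * (v1 t - u1 t) + mu * u2 t + 2 * A2 * (z t * u1 t)) g4.
Proof.
  eapply bigO_ext; [|apply bigO_plus].
  2:{ apply (O_g4_mult (fun t => df2 (tv t (tx t)) - df2 b) (fun t => v1 t - u1 t)); [|exact O_sd_d1].
      eapply O_to; [exact (O_lip_v d1 df2 ddf2 B2')|exact O_om]. }
  2:{ apply O_g4_pow. eapply (O_mult_to _ u1 (fun t => z t ^ 2) (fun t => z t ^ 2));
        [exact O_dflux|exact O_u1|]. intros; ring. }
  intros t Ht. cbv beta. unfold at_, jQ1, ju2.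
  replace (df2 b) with (- F) by (unfold F; lra). field. lra.
Qed.

Lemma O_Q1_bound : bigO D Q1 (fun t => sd t + z t ^ 3).
Proof.
  assert (S1 : forall f, bigO D f sd -> bigO D f (fun t => sd t + z t ^ 3)).
  { intros f Hf. apply (bigO_weaken D 1 _ sd); [lra|exact Hf|]. intros t Ht. destruct (zf t Ht).
    assert (0 <= z t ^ 3) by (apply pow_le; lra). lra. }
  eapply bigO_ext; [|apply bigO_minus; [apply bigO_minus; [apply bigO_minus|]|]].
  2:{ apply (bigO_weaken D (b - p + 1) _ g4); [lra|exact O_Q1_refined|]. intros t Ht. destruct (zf t Ht).
      unfold g4. assert (0 <= z t ^ 3) by (apply pow_le; lra). pose proof (sd_pos t).
      replace (z t ^ 4) with (z t * z t ^ 3) by ring.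
      assert (z t * sd t <= (b - p) * sd t) by (apply Rmult_le_compat_r; lra).
      assert (z t * z t ^ 3 <= (b - p) * z t ^ 3) by (apply Rmult_le_compat_r; lra). lra. }
  2:{ apply S1. apply (bigO_scal F _ _ O_sd_d1). }
  2:{ apply S1. exact O_sd_p1. }
  2:{ apply (bigO_weaken D 1 _ (fun t => z t ^ 3)); [lra|apply (bigO_scal (2 * A2) _ _ O_zu1)|].
      intros t Ht. pose proof (sd_pos t). lra. }
  intros t Ht. cbv beta. ring.
Qed.

(** In [v'' = (v' Q + v Q') / j] the product [v' Q] is [O(z^4)], and [v / j] differs from [1 / N] by
    [O(z)]. *)
Lemma O_d1_equation :
  bigO D (fun t => v2 t - u2 t - lin_d F N mu (v1 t - u1 t) (mu * u2 t) + 2 * A2 / N * (z t * u1 t)) g4.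
Proof.
  assert (HN := N_pos). destruct j_b_nonzero as [Nj Nb].
  eapply bigO_ext; [|apply bigO_plus; [apply (bigO_scal (/ N) _ _ O_Q1_refined)|
    apply bigO_plus; [apply (bigO_scal (/ j))|apply (bigO_scal (/ j))]]].
  2:{ apply O_g4_pow. apply (O_mult_to v1 Q (fun t => z t ^ 2) (fun t => z t ^ 2));
        [exact O_v1|exact O_Qz|]. intros; ring. }
  2:{ apply (bigO_weaken D 1 _ (fun t => z t * (sd t + z t ^ 3))); [lra| |].
      - apply (bigO_mult (fun t => tv t (tx t) - b) Q1); [exact O_vb|exact O_Q1_bound].
      - intros t Ht. unfold g4. apply Req_le. ring. }
  intros t Ht. cbv beta. unfold lin_d. unfold at_ at 1. unfold jv2. fold (Q1 t).
  change (jv1 f2 j K (tu t (tx t)) (tv t (tx t)) (ty t (tx t))) with (v1 t).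
  change (jQ f2 K (tu t (tx t)) (tv t (tx t)) (ty t (tx t))) with (Q t).
  change (jQ1 f2 df2 j K (tu t (tx t)) (tv t (tx t)) (ty t (tx t))) with (Q1 t).
  unfold N. field. repeat split; auto. lra.
Qed.

Lemma O_inv_v2 : bigO D (fun t => / tv t (tx t) ^ 2) (fun _ => 1).
Proof.
  apply (bigO_ext _ (fun t => / tv t (tx t) * / tv t (tx t))).
  - intros t Ht. assert (H := near_v_nonzero _ _ Ht). field. exact H.
  - apply (bigO_mult_1l _ _ _ O_inv_v O_inv_v).
Qed.

Lemma O_p1_equation :
  bigO D (fun t => mu * u3 t - lin_P F N mu (v1 t - u1 t) (mu * u2 t)) g4.
Proof.
  destruct j_b_nonzero as [Nj Nb].
  eapply bigO_ext; [|apply bigO_plus; [apply bigO_plus; [apply bigO_plus|]|]].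
  2:{ apply O_g4_pow. apply (bigO_mult_1l (fun t => ddf1 (tu t (tx t))) (fun t => u1 t ^ 2) _ (O_bdd_u d1 ddf1 dddf1 B1'')).
      apply (bigO_ext _ (fun t => u1 t * u1 t)); [intros; ring|].
      apply (O_mult_to u1 u1 (fun t => z t ^ 2) (fun t => z t ^ 2)); [exact O_u1|exact O_u1|]. intros; ring. }
  2:{ apply (bigO_scal (/ mu)). apply (O_g4_mult (fun t => df1 (tu t (tx t)) - df1 b) (fun t => mu * u2 t)); [|exact O_sd_p1].
      exact (O_lip_u d1 df1 ddf1 B1'). }
  2:{ apply O_g4_pow. apply (bigO_scal j). apply (bigO_mult_1l _ (fun t => u1 t * d t) _ O_inv_v2).
      apply (O_mult_to u1 d (fun t => z t ^ 2) (fun t => z t ^ 2)); [exact O_u1|exact Od|]. intros; ring. }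
  2:{ apply (O_g4_mult (fun t => j * (d t * / tv t (tx t) ^ 2 - (/ tv t (tx t) - / b))) (fun t => v1 t - u1 t)); [|exact O_sd_d1].
      apply bigO_scal. apply bigO_minus.
      - apply (bigO_mult_1r d); [|exact O_inv_v2].
        eapply O_to; [exact Od|]. apply (bigO_weaken D (b - p) _ (fun t => z t ^ 2)); [lra|apply O_zpow|].
        intros t Ht. destruct (zf t Ht). replace (z t ^ 2) with (z t * z t) by ring.
        apply Rmult_le_compat_r; lra.
      - eapply O_to; [exact (O_lip_v d1 Rinv _ inv_bounded)|exact O_om]. }
  intros t Ht. cbv beta. assert (H := near_v_nonzero _ _ Ht).
  unfold lin_P, at_, ju3, jG1, jd, N, F.
  set (U := tu t (tx t)). set (V := tv t (tx t)). set (Y := ty t (tx t)). fold V in H.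
  generalize (ju1 f1 mu U V Y) (jv1 f2 j K U V Y) (ju2 f1 df1 mu j U V Y). intros x1 x2 x3.
  field. repeat split; auto. lra.
Qed.

(** [d'] and [P'] differ from [jWd1] and [jWP1] by multiples of [z u' = O(z^3)], so the gauge [g4]
    can be expressed through the latter at the cost of a term [z^4]. *)
Lemma W1_equations :
  bigO D (fun t => at_ jWd2 t - lin_d F N mu (at_ jWd1 t) (at_ jWP1 t))
    (fun t => z t * (Rabs (at_ jWd1 t) + Rabs (at_ jWP1 t)) + z t ^ 4) /\
  bigO D (fun t => at_ jWP2 t - lin_P F N mu (at_ jWd1 t) (at_ jWP1 t))
    (fun t => z t * (Rabs (at_ jWd1 t) + Rabs (at_ jWP1 t)) + z t ^ 4).
Proof.
  destruct quasi_equilibrium as (_ & Ed & EP).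
  assert (OG : bigO D g4 (fun t => z t * (Rabs (at_ jWd1 t) + Rabs (at_ jWP1 t)) + z t ^ 4)).
  { destruct O_zu1 as [C [HC H]].
    exists (1 + (2 * Rabs dh + 2 * Rabs Ph) * C).
    pose proof (Rabs_pos dh) as q1. pose proof (Rabs_pos Ph) as q2.
    assert (q3 : 0 <= (2 * Rabs dh + 2 * Rabs Ph) * C) by (apply Rmult_le_pos; lra).
    split; [lra|]. intros t Ht. destruct (zf t Ht) as (z1 & z2 & _). specialize (H t Ht).
    set (m := Rabs (at_ jWd1 t) + Rabs (at_ jWP1 t)).
    assert (m0 : 0 <= m) by (unfold m; pose proof (Rabs_pos (at_ jWd1 t)); pose proof (Rabs_pos (at_ jWP1 t)); lra).
    assert (Hs : sd t <= m + (2 * Rabs dh + 2 * Rabs Ph) * C * z t ^ 3).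
    { unfold sd, m.
      replace (v1 t - u1 t) with (at_ jWd1 t + - (2 * (dh * (z t * u1 t)))) by (unfold at_, jWd1; ring).
      replace (mu * u2 t) with (at_ jWP1 t + - (2 * (Ph * (z t * u1 t)))) by (unfold at_, jWP1; ring).
      assert (R1 : forall k, Rabs (- (2 * (k * (z t * u1 t)))) <= 2 * Rabs k * C * z t ^ 3).
      { intros k. rewrite Rabs_Ropp, Rabs_mult, (Rabs_pos_eq 2), (Rabs_mult k) by lra.
        pose proof (Rabs_pos k).
        assert (Rabs k * Rabs (z t * u1 t) <= Rabs k * (C * z t ^ 3)) by (apply Rmult_le_compat_l; lra). lra. }
      eapply Rle_trans; [apply Rplus_le_compat; apply Rabs_triang|].
      assert (r1 := R1 dh). assert (r2 := R1 Ph). lra. }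
    assert (z4 : 0 <= z t ^ 4) by (apply pow_le; lra).
    assert (zm : 0 <= z t * m) by (apply Rmult_le_pos; lra).
    assert (zs : 0 <= z t * sd t) by (apply Rmult_le_pos; [lra|apply sd_pos]).
    unfold g4. rewrite Rabs_pos_eq by lra.
    assert (z t * sd t <= z t * (m + (2 * Rabs dh + 2 * Rabs Ph) * C * z t ^ 3)) by (apply Rmult_le_compat_l; lra).
    assert (0 <= (2 * Rabs dh + 2 * Rabs Ph) * C * (z t * m)) by (apply Rmult_le_pos; lra).
    replace (z t * (m + (2 * Rabs dh + 2 * Rabs Ph) * C * z t ^ 3))
      with (z t * m + (2 * Rabs dh + 2 * Rabs Ph) * C * z t ^ 4) in * by ring. lra. }
  assert (Ozu : bigO D (at_ jzu) g4).
  { apply (bigO_ext _ (fun t => z t * (mu * u2 t) * / mu - u1 t * u1 t)).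
    - intros t _. unfold at_, jzu. field. lra.
    - apply bigO_minus.
      + apply (bigO_mult_1r (fun t => z t * (mu * u2 t)) (fun _ => / mu)); [|apply bigO_const].
        apply (O_g4_mult z (fun t => mu * u2 t)); [exact O_z|exact O_sd_p1].
      + apply O_g4_pow. apply (O_mult_to u1 u1 (fun t => z t ^ 2) (fun t => z t ^ 2)); [exact O_u1|exact O_u1|].
        intros; ring. }
  split; (eapply O_to; [|exact OG]).
  - eapply bigO_ext; [|apply bigO_plus; [exact O_d1_equation|apply (bigO_scal (2 * dh) _ _ Ozu)]].
    intros t Ht. cbv beta.
    replace (2 * A2 / N) with (- (2 * lin_d F N mu dh Ph)) by (rewrite Ed; field; pose proof N_pos; lra).
    unfold at_, jWd2, jWd1, jWP1, lin_d. ring.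
  - eapply bigO_ext; [|apply bigO_plus; [exact O_p1_equation|apply (bigO_scal (2 * Ph) _ _ Ozu)]].
    intros t Ht. cbv beta.
    replace (mu * u3 t - lin_P F N mu (v1 t - u1 t) (mu * u2 t) + 2 * Ph * at_ jzu t) with
      (mu * u3 t - lin_P F N mu (v1 t - u1 t) (mu * u2 t) + 2 * Ph * at_ jzu t
        - 2 * lin_P F N mu dh Ph * (z t * u1 t)) by (rewrite EP; ring).
    unfold at_, jWP2, jWd1, jWP1, lin_P. ring.
Qed.

Lemma is_derive_W t x : D t -> 0 < x ->
  is_derive (state_C jWd t) x (state_C jWd1 t x) /\ is_derive (state_C jWP t) x (state_C jWP1 t x).
Proof.
  intros Ht Hx. destruct (near_is_derive d1 t x Ht Hx) as (Du & Dv & Du1 & Dv1 & Du2).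
  assert (Dz2 : forall k, is_derive (fun x => k * (b - tu t x) ^ 2) x
    (- (2 * k * ((b - tu t x) * state_C (ju1 f1 mu) t x)))).
  { intros k. assert (Eu : Derive (fun x => tu t x) x = state_C (ju1 f1 mu) t x) by now apply is_derive_unique.
    auto_derive; [eexists; exact Du|]. rewrite Eu. ring. }
  split.
  - eapply is_derive_eq.
    + apply (is_derive_minus_R (fun x => tv t x - tu t x) (fun x => dh * (b - tu t x) ^ 2)); [|apply Dz2].
      apply is_derive_minus_R; eassumption.
    + unfold state_C, jWd1, jz. ring.
  - eapply is_derive_eq.
    + apply (is_derive_minus_R (fun x => f1 (tu t x) - ty t x) (fun x => Ph * (b - tu t x) ^ 2)); [|apply Dz2].
      apply (is_derive_ext_R (fun x => mu * state_C (ju1 f1 mu) t x)).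
      * intros s. unfold state_C, ju1. field. lra.
      * apply is_derive_scal_R. exact Du1.
    + unfold state_C, jWP1, jz. ring.
Qed.

Lemma is_derive_W1 t x : D t -> 0 < x ->
  is_derive (state_C jWd1 t) x (state_C jWd2 t x) /\ is_derive (state_C jWP1 t) x (state_C jWP2 t x).
Proof.
  intros Ht Hx. destruct (near_is_derive d1 t x Ht Hx) as (Du & Dv & Du1 & Dv1 & Du2).
  assert (Dzu : is_derive (fun x => (b - tu t x) * state_C (ju1 f1 mu) t x) x (state_C jzu t x)).
  { eapply is_derive_eq.
    - apply is_derive_mult_R; [|exact Du1].
      apply (is_derive_minus_R (fun _ => b) (tu t)); [apply @is_derive_const|exact Du].
    - unfold state_C, jzu, jz, zero; simpl. ring. }
  split.
  - eapply is_derive_eq.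
    + apply (is_derive_plus_R (fun x => state_C (jv1 f2 j K) t x - state_C (ju1 f1 mu) t x)
        (fun x => 2 * dh * ((b - tu t x) * state_C (ju1 f1 mu) t x))).
      * apply is_derive_minus_R; [exact Dv1|exact Du1].
      * apply is_derive_scal_R. exact Dzu.
    + unfold state_C, jWd2. ring.
  - eapply is_derive_eq.
    + apply (is_derive_plus_R (fun x => mu * state_C (ju2 f1 df1 mu j) t x)
        (fun x => 2 * Ph * ((b - tu t x) * state_C (ju1 f1 mu) t x))).
      * apply is_derive_scal_R. exact Du2.
      * apply is_derive_scal_R. exact Dzu.
    + unfold state_C, jWP2. ring.
Qed.

Lemma continuity_state t x : D t -> 0 <= x ->
  continuity_pt (state_C jWd t) x /\ continuity_pt (state_C jWP t) x /\
  continuity_pt (state_C jWd1 t) x /\ continuity_pt (state_C jWP1 t) x.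
Proof.
  intros Ht Hx. destruct (near_continuity d1 t x Ht Hx) as (cu & cv & cy & pu & pv).
  destruct (sgn_div _ _ pv) as [Nv [Nj _]].
  assert (ck : forall k : R, continuity_pt (fun _ : R => k) x)
    by (intros; apply continuity_pt_const; now intros ? ?).
  assert (cf : forall f df s, C1_on j f df -> continuity_pt s x -> 0 < s x / j -> continuity_pt (fun x => f (s x)) x).
  { intros f df s Hf Hs Hp. apply (continuity_pt_comp s f); [exact Hs|]. now apply (C1_on_continuity j f df). }
  assert (cf1 := cf f1 df1 _ (proj1 C3_f1) cu pu).
  assert (cf2 := cf f2 df2 _ (proj1 C3_f2) cv pv).
  assert (cdf1 := cf df1 ddf1 _ (proj1 (proj2 C3_f1)) cu pu).
  assert (cz : continuity_pt (fun x => b - tu t x) x) by (apply continuity_pt_minus; auto).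
  assert (cP : continuity_pt (fun x => f1 (tu t x) - ty t x) x) by (apply continuity_pt_minus; auto).
  assert (cu1 : continuity_pt (state_C (ju1 f1 mu) t) x) by (apply continuity_pt_mult; auto).
  assert (cQ : continuity_pt (fun x => f2 (tv t x) + ty t x - K) x)
    by (apply continuity_pt_minus; [apply continuity_pt_plus|]; auto).
  assert (cv1 : continuity_pt (state_C (jv1 f2 j K) t) x)
    by (apply continuity_pt_mult; [apply continuity_pt_mult; auto|exact cQ]).
  assert (cG : continuity_pt (fun x => j * (1 - tu t x / tv t x)) x).
  { apply continuity_pt_mult; [auto|]. apply continuity_pt_minus; [auto|]. now apply continuity_pt_div. }
  assert (cu2 : continuity_pt (state_C (ju2 f1 df1 mu j) t) x).
  { apply continuity_pt_mult; [|auto]. apply continuity_pt_minus; [|exact cG]. apply continuity_pt_mult; auto. }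
  assert (cz2 : forall k, continuity_pt (fun x => k * (b - tu t x) ^ 2) x).
  { intros k. apply continuity_pt_mult; [auto|].
    apply (continuity_pt_comp (fun x => b - tu t x) (fun s => s ^ 2)); [exact cz|].
    apply derivable_continuous_pt, derivable_pt_pow. }
  assert (czu : forall k, continuity_pt (fun x => k * ((b - tu t x) * state_C (ju1 f1 mu) t x)) x).
  { intros k. apply continuity_pt_mult; [auto|]. apply continuity_pt_mult; auto. }
  split; [|split; [|split]].
  - apply continuity_pt_minus; [apply continuity_pt_minus; auto|apply cz2].
  - apply continuity_pt_minus; [exact cP|apply cz2].
  - apply continuity_pt_plus; [apply continuity_pt_minus; auto|apply czu].
  - apply continuity_pt_plus; [apply continuity_pt_mult; auto|apply czu].
Qed.

End Refined.

Definition B3 (t : point) : R := z t ^ 3 + layer t.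
Definition B4 (t : point) : R := z t ^ 4 + layer t.

(** [fast_step] is used with [n = 2] for the deviation and with [n = 3] for its derivative, which is
    treated as a pair in its own right and so gains one order more. *)
Lemma sonic_refined : exists d3, 0 < d3 /\ d3 <= b - p /\ d3 <= 1 /\
  bigO (near d3) d (fun t => z t ^ 2) /\ bigO (near d3) P (fun t => z t ^ 2) /\
  bigO (near d3) (at_ jWd) B3 /\ bigO (near d3) (at_ jWP) B3 /\
  bigO (near d3) (at_ jWd1) B4 /\ bigO (near d3) (at_ jWP1) B4.
Proof.
  destruct sonic_quadratic as (d1 & d1p & d1b & d11 & Od & OP).
  destruct (W_quadratic d1 Od OP) as [Wq1 Wq2].
  destruct (W_equations d1 d1p d1b Od OP) as [We1 We2].
  destruct (fast_step 2 d1 jWd jWP jWd1 jWP1 d1p d1b OP Wq1 Wq2 We1 We2) as (d2 & d2p & d21 & OW1 & OW2).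
  { exact (is_derive_W d1). }
  { intros t x Ht Hx. destruct (continuity_state d1 t x Ht Hx) as (c1 & c2 & _). auto. }
  assert (sub : forall t, near d2 t -> near d1 t) by (intros t; now apply near_sub).
  assert (Od2 := bigO_sub _ _ _ sub Od). assert (OP2 := bigO_sub _ _ _ sub OP).
  assert (d2b : d2 <= b - p) by lra.
  destruct (W1_quadratic d2 Od2 OP2) as [Xq1 Xq2].
  destruct (W1_equations d2 d2p d2b Od2 OP2) as [Xe1 Xe2].
  destruct (fast_step 3 d2 jWd1 jWP1 jWd2 jWP2 d2p d2b OP2 Xq1 Xq2 Xe1 Xe2) as (d3 & d3p & d32 & OX1 & OX2).
  { exact (is_derive_W1 d2). }
  { intros t x Ht Hx. destruct (continuity_state d2 t x Ht Hx) as (_ & _ & c1 & c2). auto. }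
  assert (sub3 : forall t, near d3 t -> near d2 t) by (intros t; now apply near_sub).
  exists d3. split; [exact d3p|]. split; [lra|]. split; [lra|].
  split; [exact (bigO_sub _ _ _ sub3 Od2)|]. split; [exact (bigO_sub _ _ _ sub3 OP2)|].
  split; [exact (bigO_sub _ _ _ sub3 OW1)|]. split; [exact (bigO_sub _ _ _ sub3 OW2)|].
  split; [exact OX1|exact OX2].
Qed.

(** * Derivatives up to order three against the gauges [B3] and [B4] *)

Section Final.
Variable d3 : R.
Hypothesis d3_pos : 0 < d3.
Hypothesis d3_le : d3 <= b - p.
Local Notation D := (near d3).
Hypothesis Od : bigO D d (fun t => z t ^ 2).
Hypothesis OP : bigO D P (fun t => z t ^ 2).
Hypothesis OWP : bigO D (at_ jWP) B3.
Hypothesis OWd1 : bigO D (at_ jWd1) B4.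
Hypothesis OWP1 : bigO D (at_ jWP1) B4.

Lemma bf t : D t -> 0 < z t /\ z t <= b - p /\ 0 < b - p /\ 0 < layer t /\ 0 < z t ^ 3 /\ 0 < z t ^ 4.
Proof.
  intros H. destruct (zf d3 t H) as (? & ? & ?). assert (L := layer_pos d3 t H).
  repeat split; auto; apply pow_lt; auto.
Qed.

Lemma O_B4_B3 f : bigO D f B4 -> bigO D f B3.
Proof.
  intros H. apply (bigO_weaken D (b - p + 1) _ B4); [lra|exact H|].
  intros t Ht. destruct (bf t Ht) as (z1 & z2 & z3 & l0 & p3 & p4). unfold B3, B4.
  replace (z t ^ 4) with (z t * z t ^ 3) by ring.
  assert (z t * z t ^ 3 <= (b - p) * z t ^ 3) by (apply Rmult_le_compat_r; lra).
  assert (0 <= (b - p) * layer t) by (apply Rmult_le_pos; lra). lra.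
Qed.

Lemma O_B3_pow f : bigO D f (fun t => z t ^ 3) -> bigO D f B3.
Proof.
  intros H. apply (bigO_weaken D 1 _ (fun t => z t ^ 3)); [lra|exact H|].
  intros t Ht. destruct (bf t Ht) as (z1 & z2 & z3 & l0 & p3 & p4). unfold B3. lra.
Qed.

Lemma O_B4_pow f : bigO D f (fun t => z t ^ 4) -> bigO D f B4.
Proof.
  intros H. apply (bigO_weaken D 1 _ (fun t => z t ^ 4)); [lra|exact H|].
  intros t Ht. destruct (bf t Ht) as (z1 & z2 & z3 & l0 & p3 & p4). unfold B4. lra.
Qed.

Lemma O_zB3 f g : bigO D f z -> bigO D g B3 -> bigO D (fun t => f t * g t) B4.
Proof.
  intros Hf Hg. apply (bigO_weaken D (b - p + 1) _ (fun t => z t * B3 t)); [lra|now apply bigO_mult|].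
  intros t Ht. destruct (bf t Ht) as (z1 & z2 & z3 & l0 & p3 & p4). unfold B3, B4.
  assert (z t * layer t <= (b - p) * layer t) by (apply Rmult_le_compat_r; lra).
  assert (0 <= (b - p) * z t ^ 4) by (apply Rmult_le_pos; lra).
  replace (z t * (z t ^ 3 + layer t)) with (z t ^ 4 + z t * layer t) by ring. lra.
Qed.

Lemma O_z2_z f : bigO D f (fun t => z t ^ 2) -> bigO D f z.
Proof.
  intros H. apply (bigO_weaken D (b - p) _ (fun t => z t ^ 2)); [lra|exact H|].
  intros t Ht. destruct (bf t Ht) as (z1 & z2 & z3 & _). replace (z t ^ 2) with (z t * z t) by ring.
  apply Rmult_le_compat_r; lra.
Qed.

Lemma O_d1_B3 : bigO D (fun t => v1 t - u1 t) B3.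
Proof.
  apply (bigO_ext _ (fun t => at_ jWd1 t - 2 * dh * (z t * u1 t))).
  - intros t _. unfold at_, jWd1. ring.
  - apply bigO_minus; [now apply O_B4_B3|]. apply O_B3_pow.
    apply bigO_scal, (O_zu1 d3); auto.
Qed.

Lemma O_p1_B3 : bigO D (fun t => mu * u2 t) B3.
Proof.
  apply (bigO_ext _ (fun t => at_ jWP1 t - 2 * Ph * (z t * u1 t))).
  - intros t _. unfold at_, jWP1. ring.
  - apply bigO_minus; [now apply O_B4_B3|]. apply O_B3_pow.
    apply bigO_scal, (O_zu1 d3); auto.
Qed.

Lemma O_u2_B3 : bigO D u2 B3.
Proof.
  apply (bigO_ext _ (fun t => / mu * (mu * u2 t))).
  - intros t _. field. lra.
  - apply bigO_scal, O_p1_B3.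
Qed.

Lemma O_sd_B3 : bigO D sd B3.
Proof.
  destruct O_d1_B3 as [C [HC H]]. destruct O_p1_B3 as [C' [HC' H']].
  exists (C + C'). split; [lra|]. intros t Ht. specialize (H t Ht). specialize (H' t Ht).
  rewrite Rabs_pos_eq by apply sd_pos. unfold sd. lra.
Qed.

Lemma O_zu_B4 : bigO D (at_ jzu) B4.
Proof.
  apply (bigO_minus (fun t => z t * u2 t) (fun t => u1 t ^ 2)).
  - apply O_zB3; [apply O_self_z|exact O_u2_B3].
  - apply O_B4_pow. apply (bigO_ext _ (fun t => u1 t * u1 t)); [intros; ring|].
    apply (O_mult_to d3 u1 u1 (fun t => z t ^ 2) (fun t => z t ^ 2));
      [apply (O_u1 d3); auto|apply (O_u1 d3); auto|intros; ring].
Qed.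

(** The equations express these derivatives through [jWd1] and [jWP1], which are [O(B4)] already. *)
Lemma O_W2 : bigO D (at_ jWd2) B4 /\ bigO D (at_ jWP2) B4.
Proof.
  destruct (W1_equations d3 d3_pos d3_le Od OP) as [E1 E2].
  assert (OG : bigO D (fun t => z t * (Rabs (at_ jWd1 t) + Rabs (at_ jWP1 t)) + z t ^ 4) B4).
  { apply (bigO_plus (fun t => z t * (Rabs (at_ jWd1 t) + Rabs (at_ jWP1 t))) (fun t => z t ^ 4)).
    - apply (O_zB3 z (fun t => Rabs (at_ jWd1 t) + Rabs (at_ jWP1 t))); [apply O_self_z|].
      apply bigO_plus.
      + destruct (O_B4_B3 _ OWd1) as [C [HC H]]. exists C. split; [exact HC|]. intros t Ht.
        rewrite Rabs_Rabsolu. auto.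
      + destruct (O_B4_B3 _ OWP1) as [C [HC H]]. exists C. split; [exact HC|]. intros t Ht.
        rewrite Rabs_Rabsolu. auto.
    - apply O_B4_pow, (O_zpow d3); auto. }
  split.
  - apply (bigO_ext _ (fun t => (at_ jWd2 t - lin_d F N mu (at_ jWd1 t) (at_ jWP1 t))
      + (- (F / N) * at_ jWd1 t - (1 / N + 1 / mu) * at_ jWP1 t))).
    + intros t _. unfold lin_d. ring.
    + apply bigO_plus; [eapply bigO_trans; [exact E1|exact OG]|].
      apply bigO_minus; now apply bigO_scal.
  - apply (bigO_ext _ (fun t => (at_ jWP2 t - lin_P F N mu (at_ jWd1 t) (at_ jWP1 t))
      + (F / mu * at_ jWP1 t - N * at_ jWd1 t))).
    + intros t _. unfold lin_P. ring.
    + apply bigO_plus; [eapply bigO_trans; [exact E2|exact OG]|].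
      apply bigO_minus; now apply bigO_scal.
Qed.

Lemma O_u3_B4 : bigO D u3 B4.
Proof.
  apply (bigO_ext _ (fun t => / mu * (at_ jWP2 t - 2 * Ph * at_ jzu t))).
  - intros t _. unfold at_, jWP2. field. lra.
  - apply bigO_scal, bigO_minus; [apply O_W2|apply bigO_scal, O_zu_B4].
Qed.

Lemma O_d2_B4 : bigO D (fun t => v2 t - u2 t) B4.
Proof.
  apply (bigO_ext _ (fun t => at_ jWd2 t - 2 * dh * at_ jzu t)).
  - intros t _. unfold at_, jWd2. ring.
  - apply bigO_minus; [apply O_W2|apply bigO_scal, O_zu_B4].
Qed.

Lemma O_v2_B3 : bigO D v2 B3.
Proof.
  apply (bigO_ext _ (fun t => (v2 t - u2 t) + u2 t)); [intros; ring|].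
  apply bigO_plus; [apply O_B4_B3, O_d2_B4|exact O_u2_B3].
Qed.

Lemma O_Q1_B3 : bigO D Q1 B3.
Proof.
  eapply bigO_trans; [apply (O_Q1_bound d3); auto|].
  apply (bigO_plus sd (fun t => z t ^ 3)); [exact O_sd_B3|]. apply O_B3_pow, (O_zpow d3); auto.
Qed.

Lemma O_v1_z : bigO D v1 z.
Proof. apply O_z2_z, (O_v1 d3); auto. Qed.

(* the two terms of [Q2] that are only [O(B3)] cancel to leading order because [df1 b + df2 b = 0] *)
Lemma O_Q2_B4 : bigO D Q2 B4.
Proof.
  apply (bigO_ext _ (fun t =>
    ddf2 (tv t (tx t)) * (v1 t * v1 t) + ddf1 (tu t (tx t)) * (u1 t * u1 t)
    + (df1 (tu t (tx t)) + df2 (tv t (tx t)) + 2 * A2 * z t - 2 * A2 * z t) * u2 t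
    + df2 (tv t (tx t)) * (v2 t - u2 t) - mu * u3 t)).
  - intros t _. unfold at_, jQ2, ju3. field. lra.
  - assert (sq : forall f, bigO D f (fun t => z t ^ 2) -> bigO D (fun t => f t * f t) B4).
    { intros f Hf. apply O_B4_pow.
      apply (O_mult_to d3 f f (fun t => z t ^ 2) (fun t => z t ^ 2)); auto. intros; ring. }
    apply bigO_minus; [apply bigO_plus; [apply bigO_plus; [apply bigO_plus|]|]|].
    + apply (bigO_mult_1l (fun t => ddf2 (tv t (tx t)))); [exact (O_bdd_v d3 ddf2 dddf2 B2'')|].
      apply sq, (O_v1 d3); auto.
    + apply (bigO_mult_1l (fun t => ddf1 (tu t (tx t)))); [exact (O_bdd_u d3 ddf1 dddf1 B1'')|].
      apply sq, (O_u1 d3); auto.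
    + apply (O_zB3 (fun t => df1 (tu t (tx t)) + df2 (tv t (tx t)) + 2 * A2 * z t - 2 * A2 * z t) u2); [|exact O_u2_B3].
      apply (bigO_minus (fun t => df1 (tu t (tx t)) + df2 (tv t (tx t)) + 2 * A2 * z t) (fun t => 2 * A2 * z t)).
      * apply O_z2_z, (O_dflux d3); auto.
      * apply bigO_scal, O_self_z.
    + apply (bigO_mult_1l (fun t => df2 (tv t (tx t)))); [exact (O_bdd_v d3 df2 ddf2 B2')|exact O_d2_B4].
    + apply bigO_scal, O_u3_B4.
Qed.

Lemma O_v3_B4 : bigO D v3 B4.
Proof.
  apply (bigO_ext _ (fun t => / j * (Q t * v2 t + 2 * (v1 t * Q1 t) + tv t (tx t) * Q2 t))).
  - intros t _. destruct j_b_nonzero as [Nj _]. unfold at_, jv3. field. exact Nj.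
  - apply bigO_scal, bigO_plus; [apply bigO_plus|].
    + apply (O_zB3 Q v2); [apply O_z2_z, (O_Qz d3); auto|exact O_v2_B3].
    + apply bigO_scal, (O_zB3 v1 Q1); [exact O_v1_z|exact O_Q1_B3].
    + apply (bigO_mult_1l (fun t => tv t (tx t))); [apply (O_v_id d3)|exact O_Q2_B4].
Qed.

Lemma O_u1_asymptotic : bigO D (fun t => u1 t - a * z t ^ 2) B3.
Proof.
  apply (bigO_ext _ (fun t => / mu * at_ jWP t)).
  - intros t _. unfold at_, jWP, ju1, jP, Ph. field. lra.
  - now apply bigO_scal.
Qed.

Lemma O_v1_asymptotic : bigO D (fun t => v1 t - a * z t ^ 2) B3.
Proof.
  apply (bigO_ext _ (fun t => (v1 t - u1 t) + (u1 t - a * z t ^ 2))); [intros; ring|].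
  apply bigO_plus; [exact O_d1_B3|exact O_u1_asymptotic].
Qed.

End Final.

(** * Two-sided comparison of [z] with the algebraic rate *)

Definition rate (t : point) : R := (b - tu t 0) / (1 + (b - tu t 0) * tx t).

Lemma is_derive_inv_z d1 t x : near d1 t -> 0 < x ->
  is_derive (fun x => / (b - tu t x)) x (state_C (ju1 f1 mu) t x / (b - tu t x) ^ 2).
Proof.
  intros Ht Hx. destruct (near_is_derive d1 t x Ht Hx) as (Du & _).
  destruct (near_range _ _ (near_move _ _ x Ht ltac:(lra))) as (Rz & _).
  unfold at_, jz in Rz; simpl in Rz.
  assert (Eu : Derive (fun x => tu t x) x = state_C (ju1 f1 mu) t x) by now apply is_derive_unique.
  auto_derive; [split; [eexists; exact Du|split; [lra|exact I]]|].
  rewrite Eu. field. lra.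
Qed.

Lemma continuity_inv_z d1 t x : near d1 t -> 0 <= x -> continuity_pt (fun x => / (b - tu t x)) x.
Proof.
  intros Ht Hx. destruct (near_continuity d1 t x Ht Hx) as (cu & _).
  destruct (near_range _ _ (near_move _ _ x Ht Hx)) as (Rz & _). unfold at_, jz in Rz; simpl in Rz.
  apply continuity_pt_inv; [|lra].
  apply continuity_pt_minus; [apply continuity_pt_const; now intros ? ?|exact cu].
Qed.

(** [(1 / z)' = u' / z^2] is bounded above, since [u' = P / mu = O(z^2)]; integration from 0 bounds
    [1 / z] by its initial value plus [C x]. *)
Lemma rate_lower (d1 : R) : 0 < d1 -> bigO (near d1) P (fun t => z t ^ 2) ->
  exists C, 1 <= C /\ forall t, near d1 t ->
    / z t <= / (b - tu t 0) + C * tx t /\ rate t <= C * z t.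
Proof.
  intros d1p [C0 [HC0 H0]]. set (C := C0 / mu + 1).
  assert (C0m : 0 < C0 / mu) by now apply Rdiv_lt_0_compat.
  exists C. split; [unfold C; lra|]. intros t Ht.
  destruct (near_range _ _ Ht) as (Rz & _ & _ & _ & _ & _ & _ & _ & Rz').
  set (del := b - tu t 0) in *.
  assert (Htx : 0 <= tx t) by (destruct Ht as (_ & _ & _ & _ & _ & _ & _ & H); exact H).
  assert (L : / z t <= / del + C * tx t).
  { enough (C * 0 - / (b - tu t 0) <= C * tx t - / (b - tu t (tx t))).
    { unfold at_, jz. fold del in H. lra. }
    apply (nondecreasing_of_derive (fun x => C * x - / (b - tu t x))
      (fun x => C - state_C (ju1 f1 mu) t x / (b - tu t x) ^ 2)); auto.
    - intros x Hx. apply is_derive_minus_R; [|apply (is_derive_inv_z d1); auto; lra].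
      auto_derive; [exact I|ring].
    - intros x Hx. apply continuity_pt_minus; [|apply (continuity_inv_z d1); auto; lra].
      apply continuity_pt_mult; [apply continuity_pt_const; now intros ? ?|].
      apply derivable_continuous_pt, derivable_pt_id.
    - intros x Hx. assert (nx := near_move _ _ x Ht ltac:(lra)).
      destruct (near_range _ _ nx) as (Rx & _). specialize (H0 _ nx).
      set (T := Point (tu t) (tv t) (ty t) x) in *. change (b - tu t x) with (z T).
      change (state_C (ju1 f1 mu) t x) with (P T / mu).
      assert (Q1 : P T / mu / z T ^ 2 <= C0 / mu); [|unfold C; lra].
      assert (z2 : 0 < z T ^ 2) by (apply pow_lt; lra).
      apply Rmult_le_reg_r with (z T ^ 2); [exact z2|].
      replace (P T / mu / z T ^ 2 * z T ^ 2) with (P T * / mu) by (field; lra).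
      replace (C0 / mu * z T ^ 2) with (C0 * z T ^ 2 * / mu) by (field; lra).
      apply Rmult_le_compat_r; [apply Rlt_le, Rinv_0_lt_compat; lra|].
      eapply Rle_trans; [apply Rle_abs|exact H0]. }
  split; [exact L|].
  assert (dp : 0 < del) by lra.
  assert (dx : 0 <= del * tx t) by (apply Rmult_le_pos; lra).
  unfold rate. fold del. apply Rmult_le_reg_r with (1 + del * tx t); [lra|].
  replace (del / (1 + del * tx t) * (1 + del * tx t)) with del by (field; lra).
  assert (L2 : del <= z t * (1 + C * (del * tx t))).
  { replace del with (del * z t * / z t) at 1 by (field; lra).
    replace (z t * (1 + C * (del * tx t))) with (del * z t * (/ del + C * tx t)) by (field; lra).
    apply Rmult_le_compat_l; [apply Rmult_le_pos; lra|exact L]. }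
  assert (z t * (1 + C * (del * tx t)) <= z t * (C * (1 + del * tx t))).
  { apply Rmult_le_compat_l; [lra|]. unfold C. lra. }
  lra.
Qed.

(** [(1 / z)'] is at least [a] minus terms of order [z] and [layer / z^2]. The second is harmless:
    by [rate_lower], [delta / z] grows at most linearly, so [layer / z^2] decays exponentially and
    its integral is a constant, to be compared with the large initial value [1 / delta]. *)
Lemma rate_upper (d1 : R) : 0 < d1 -> d1 <= b - p -> d1 <= 1 ->
  bigO (near d1) P (fun t => z t ^ 2) -> bigO (near d1) (at_ jWP) B3 ->
  exists d2 C, 0 < d2 /\ d2 <= d1 /\ 0 < C /\ forall t, near d2 t -> z t <= C * rate t.
Proof.
  intros d1p d1b d11 OP [C3 [HC3 H3]].
  destruct (rate_lower d1 d1p OP) as [C [HC HL]].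
  destruct quasi_equilibrium as (ap & _).
  set (kap := lam / 4). assert (kp : 0 < kap) by (unfold kap; lra).
  (* Chosen so that [1 + C x <= k exp (kap x / 4)]; squaring this still leaves half of the rate
     [kap]. *)
  set (k := 1 + 4 * C / kap).
  assert (Ck : 0 < 4 * C / kap) by (apply Rdiv_lt_0_compat; lra).
  set (C4 := C3 / mu * k ^ 2).
  assert (C3m : 0 < C3 / mu) by (apply Rdiv_lt_0_compat; lra).
  assert (C4p : 0 < C4) by (apply Rmult_lt_0_compat; [exact C3m|apply pow_lt; unfold k; lra]).
  (* The two thresholds make the term of order [z] at most [a / 2] and the integrated layer at most
     [1 / (2 delta)]. *)
  set (d2 := Rmin d1 (Rmin (a / (2 * (C3 / mu))) (kap / (4 * C4)))).
  assert (m1 : d2 <= d1) by apply Rmin_l.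
  assert (m2 : d2 <= Rmin (a / (2 * (C3 / mu))) (kap / (4 * C4))) by apply Rmin_r.
  assert (m3 : d2 <= a / (2 * (C3 / mu))) by (eapply Rle_trans; [exact m2|apply Rmin_l]).
  assert (m4 : d2 <= kap / (4 * C4)) by (eapply Rle_trans; [exact m2|apply Rmin_r]).
  assert (d2p : 0 < d2) by (repeat apply Rmin_glb_lt; auto; apply Rdiv_lt_0_compat; lra).
  assert (n3 : C3 / mu * d2 <= a / 2).
  { apply Rle_trans with (C3 / mu * (a / (2 * (C3 / mu)))); [apply Rmult_le_compat_l; lra|].
    apply Req_le. field. lra. }
  assert (n4 : 2 * C4 / kap * d2 <= / 2).
  { apply Rle_trans with (2 * C4 / kap * (kap / (4 * C4))).
    - apply Rmult_le_compat_l; [|lra]. apply Rlt_le, Rdiv_lt_0_compat; lra.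
    - apply Req_le. field. lra. }
  exists d2, (2 * (1 + / a)). split; [exact d2p|]. split; [exact m1|].
  assert (ia : 0 < / a) by now apply Rinv_0_lt_compat.
  split; [lra|]. intros t Ht2. assert (Ht : near d1 t) by (eapply near_sub; eauto).
  destruct (near_range _ _ Ht2) as (Rz & _ & _ & _ & _ & _ & _ & _ & Rz').
  assert (Hdel : b - tu t 0 <= d2) by (destruct Ht2 as (_ & _ & H & _); exact H).
  set (del := b - tu t 0) in *. assert (dp : 0 < del) by lra.
  assert (Htx : 0 <= tx t) by (destruct Ht as (_ & _ & _ & _ & _ & _ & _ & H); exact H).
  assert (L : / del - 2 * C4 / kap + a / 2 * tx t <= / z t).
  { set (g := fun x => / (b - tu t x) - a / 2 * x - 2 * C4 / kap * exp (- (kap / 2) * x)).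
    assert (Hg : g 0 <= g (tx t)).
    { apply (nondecreasing_of_derive g (fun x => state_C (ju1 f1 mu) t x / (b - tu t x) ^ 2 - a / 2
        + C4 * exp (- (kap / 2) * x))); auto.
      - intros x Hx. unfold g.
        eapply is_derive_eq.
        + apply (is_derive_minus_R (fun x => / (b - tu t x) - a / 2 * x)).
          * apply is_derive_minus_R; [apply (is_derive_inv_z d1); auto; lra|].
            apply (is_derive_scal_R (fun x => x)). apply @is_derive_id.
          * apply (is_derive_scal_R (fun x => exp (- (kap / 2) * x)) x (- (kap / 2) * exp (- (kap / 2) * x))).
            auto_derive; [exact I|ring].
        + change (@one R_AbsRing) with 1.
          generalize (state_C (ju1 f1 mu) t x / (b - tu t x) ^ 2). intros w. field. lra.
      - intros x Hx. apply continuity_pt_minus; [apply continuity_pt_minus|].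
        + apply (continuity_inv_z d1); auto; lra.
        + apply continuity_pt_mult; [apply continuity_pt_const; now intros ? ?|].
          apply derivable_continuous_pt, derivable_pt_id.
        + apply (continuity_pt_of_is_derive _ _ (2 * C4 / kap * (- (kap / 2) * exp (- (kap / 2) * x)))).
          auto_derive; [exact I|ring].
      - intros x Hx. assert (nx2 := near_move _ _ x Ht2 ltac:(lra)).
        assert (nx := near_move _ _ x Ht ltac:(lra)).
        destruct (near_range _ _ nx2) as (Rx & _). specialize (H3 _ nx). destruct (HL _ nx) as [HLx _].
        set (T := Point (tu t) (tv t) (ty t) x) in *. change (b - tu t x) with (z T).
        assert (EP : at_ jWP T = P T - mu * a * z T ^ 2) by (unfold at_, jWP, jP, jz, Ph; ring).
        change (state_C (ju1 f1 mu) t x) with (P T / mu).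
        assert (z2 : 0 < z T ^ 2) by (apply pow_lt; lra).
        assert (iz : 0 < / z T) by (apply Rinv_0_lt_compat; lra).
        rewrite EP in H3. apply Rabs_le_between in H3.
        assert (Lay : layer T * (/ z T) ^ 2 <= k ^ 2 * exp (- (kap / 2) * x)).
        { change (layer T) with (del ^ 2 * exp (- kap * x)).
          assert (Lz : del * / z T <= k * exp (kap / 4 * x)).
          { apply Rle_trans with (1 + C * x).
            - change (tx T) with x in HLx. change (tu T 0) with (tu t 0) in HLx. fold del in HLx.
              apply Rle_trans with (del * (/ del + C * x)); [apply Rmult_le_compat_l; lra|].
              replace (del * (/ del + C * x)) with (1 + del * (C * x)) by (field; lra).
              assert (0 <= C * x) by (apply Rmult_le_pos; lra). nra.
            - assert (1 + kap / 4 * x <= exp (kap / 4 * x)) by apply exp_ineq1_le.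
              apply Rle_trans with (k * (1 + kap / 4 * x)); [|apply Rmult_le_compat_l; unfold k; lra].
              unfold k. replace ((1 + 4 * C / kap) * (1 + kap / 4 * x))
                with (1 + C * x + (kap / 4 * x + 4 * C / kap)) by (field; lra).
              assert (0 <= kap / 4 * x) by (apply Rmult_le_pos; lra). lra. }
          replace (del ^ 2 * exp (- kap * x) * (/ z T) ^ 2) with ((del * / z T) ^ 2 * exp (- kap * x)) by ring.
          replace (k ^ 2 * exp (- (kap / 2) * x)) with ((k * exp (kap / 4 * x)) ^ 2 * exp (- kap * x)).
          - apply Rmult_le_compat_r; [apply Rlt_le, exp_pos|].
            apply pow_incr. split; [apply Rmult_le_pos; lra|exact Lz].
          - replace ((k * exp (kap / 4 * x)) ^ 2 * exp (- kap * x))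
              with (k ^ 2 * (exp (kap / 4 * x) * exp (kap / 4 * x) * exp (- kap * x))) by ring.
            rewrite <- !exp_plus. f_equal. f_equal. field. }
        assert (Pz : P T / mu / z T ^ 2 >= a - C3 / mu * z T - C3 / mu * (layer T * (/ z T) ^ 2)).
        { apply Rle_ge. apply Rmult_le_reg_r with (mu * z T ^ 2); [apply Rmult_lt_0_compat; lra|].
          replace (P T / mu / z T ^ 2 * (mu * z T ^ 2)) with (P T) by (field; lra).
          replace ((a - C3 / mu * z T - C3 / mu * (layer T * (/ z T) ^ 2)) * (mu * z T ^ 2))
            with (mu * a * z T ^ 2 - C3 * (z T ^ 3 + layer T)) by (field; lra).
          unfold B3 in H3. lra. }
        assert (C3 / mu * z T <= C3 / mu * d2) by (apply Rmult_le_compat_l; lra).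
        assert (C3 / mu * (layer T * (/ z T) ^ 2) <= C3 / mu * (k ^ 2 * exp (- (kap / 2) * x)))
          by (apply Rmult_le_compat_l; lra).
        replace (C4 * exp (- (kap / 2) * x)) with (C3 / mu * (k ^ 2 * exp (- (kap / 2) * x)))
          by (unfold C4; ring). lra. }
    unfold g in Hg. rewrite !Rmult_0_r, exp_0 in Hg. fold del in Hg.
    unfold at_, jz. assert (0 <= 2 * C4 / kap * exp (- (kap / 2) * tx t)).
    { apply Rmult_le_pos; [apply Rlt_le, Rdiv_lt_0_compat; lra|apply Rlt_le, exp_pos]. }
    lra. }
  assert (dx : 0 <= del * tx t) by (apply Rmult_le_pos; lra).
  assert (L2 : / (2 * del) + a / 2 * tx t <= / z t).
  { assert (2 * C4 / kap <= / (2 * del)); [|replace (/ del) with (/ (2 * del) + / (2 * del)) in L by (field; lra); lra].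
    apply Rmult_le_reg_r with del; [lra|].
    replace (/ (2 * del) * del) with (/ 2) by (field; lra).
    assert (0 <= 2 * C4 / kap) by (apply Rlt_le, Rdiv_lt_0_compat; lra).
    apply Rle_trans with (2 * C4 / kap * d2); [apply Rmult_le_compat_l; lra|exact n4]. }
  unfold rate. fold del.
  apply Rmult_le_reg_r with (/ z t); [apply Rinv_0_lt_compat; lra|].
  rewrite Rinv_r by lra.
  apply Rle_trans with (2 * (1 + / a) * (del / (1 + del * tx t)) * (/ (2 * del) + a / 2 * tx t)).
  - replace (2 * (1 + / a) * (del / (1 + del * tx t)) * (/ (2 * del) + a / 2 * tx t))
      with ((1 + / a) * ((1 + a * (del * tx t)) / (1 + del * tx t))) by (field; lra).
    apply Rmult_le_reg_r with (1 + del * tx t); [lra|].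
    replace ((1 + / a) * ((1 + a * (del * tx t)) / (1 + del * tx t)) * (1 + del * tx t))
      with (1 + del * tx t + (/ a + a * (del * tx t))) by (field; lra).
    assert (0 <= a * (del * tx t)) by (apply Rmult_le_pos; lra). lra.
  - apply Rmult_le_compat_l; [|exact L2].
    apply Rmult_le_pos; [lra|]. apply Rlt_le, Rdiv_lt_0_compat; lra.
Qed.

End FastPair.

Lemma sonic_estimates : exists d0 C kap a, 0 < d0 /\ d0 <= 1 /\ 0 < C /\ 0 < kap /\ 0 < a /\
  forall t, near d0 t ->
    let e := (b - tu t 0) ^ 2 * exp (- kap * tx t) in
    0 < z t /\ rate t <= C * z t /\ z t <= C * rate t /\ Rabs (tv t (tx t) - b) <= C * z t /\
    Rabs (u1 t) <= C * z t ^ 2 /\ Rabs (v1 t) <= C * z t ^ 2 /\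
    Rabs (u1 t - a * z t ^ 2) <= C * (z t ^ 3 + e) /\ Rabs (v1 t - a * z t ^ 2) <= C * (z t ^ 3 + e) /\
    Rabs (u2 t) <= C * (z t ^ 3 + e) /\ Rabs (v2 t) <= C * (z t ^ 3 + e) /\
    Rabs (u3 t) <= C * (z t ^ 4 + e) /\ Rabs (v3 t) <= C * (z t ^ 4 + e).
Proof.
  destruct (fast_pair_bound F N mu N_pos mu_pos) as (lam & A0 & lp & A0g & fast).
  destruct (sonic_refined lam A0 lp A0g fast) as (d3 & d3p & d3b & d31 & Od & OP & O1 & O2 & O3 & O4).
  destruct (rate_lower d3 d3p OP) as [C1 [HC1 H1]].
  destruct (rate_upper lam lp d3 d3p d3b d31 OP O2) as (d4 & C2 & d4p & d43 & HC2 & H2).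
  destruct quasi_equilibrium as (ap & _).
  destruct (O_vb d3 d3p d3b Od) as [C3 [HC3 H3]].
  destruct (O_u1 d3 OP) as [C4 [HC4 H4]].
  destruct (O_v1 d3 Od OP) as [C5 [HC5 H5]].
  destruct (O_u1_asymptotic lam d3 O2) as [C6 [HC6 H6]].
  destruct (O_v1_asymptotic lam d3 OP O2 O3) as [C7 [HC7 H7]].
  destruct (O_u2_B3 lam d3 OP O4) as [C8 [HC8 H8]].
  destruct (O_v2_B3 lam d3 d3p d3b Od OP O3 O4) as [C9 [HC9 H9]].
  destruct (O_u3_B4 lam d3 d3p d3b Od OP O3 O4) as [C10 [HC10 H10]].
  destruct (O_v3_B4 lam d3 d3p d3b Od OP O3 O4) as [C11 [HC11 H11]].
  set (C := C1 + C2 + C3 + C4 + C5 + C6 + C7 + C8 + C9 + C10 + C11).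
  exists d4, C, (lam / 4), (A2 / (mu + N + F ^ 2 / N)).
  split; [exact d4p|]. split; [lra|]. split; [unfold C; lra|]. split; [lra|]. split; [exact ap|].
  intros t Ht4 e. assert (Ht : near d3 t) by (eapply near_sub; eauto).
  destruct (bf lam d3 t Ht) as (z1 & _ & _ & l0 & p3 & p4).
  assert (up : forall c s g, 0 <= g -> 0 < c -> c <= C -> s <= c * g -> s <= C * g).
  { intros c s g Hg Hc0 Hc Hs. eapply Rle_trans; [exact Hs|]. now apply Rmult_le_compat_r. }
  change e with (layer lam t).
  assert (p2 : 0 < z t ^ 2) by (apply pow_lt; lra).
  assert (r0 : 0 <= rate t).
  { specialize (H2 t Ht4). apply Rnot_lt_le. intros Hn. nra. }
  destruct (H1 t Ht) as [_ H1'].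
  split; [exact z1|].
  split; [apply (up C1); unfold C; lra|]. split; [apply (up C2); [lra|lra|unfold C; lra|now apply H2]|].
  split; [apply (up C3); [lra|lra|unfold C; lra|now apply H3]|].
  split; [apply (up C4); [lra|lra|unfold C; lra|now apply H4]|].
  split; [apply (up C5); [lra|lra|unfold C; lra|now apply H5]|].
  split; [apply (up C6); [lra|lra|unfold C; lra|now apply H6]|].
  split; [apply (up C7); [lra|lra|unfold C; lra|now apply H7]|].
  split; [apply (up C8); [lra|lra|unfold C; lra|now apply H8]|].
  split; [apply (up C9); [lra|lra|unfold C; lra|now apply H9]|].
  split; [apply (up C10); [lra|lra|unfold C; lra|now apply H10]|].
  apply (up C11); [lra|lra|unfold C; lra|now apply H11].
Qed.

End Sonic.

(** * Smoothness *)

Definition ddflux (j A g c : R) : R := g * (g + 1) * A * Rpower (j / c) g / c ^ 2.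
Definition dddflux (j A g c : R) : R := - (g * (g + 1) * (g + 2)) * A * Rpower (j / c) g / c ^ 3.

(** Apart from its linear part, every derivative of the flux has the form [k (j / c)^g / c^n], so
    one rule serves all orders. *)
Lemma is_derive_Rpower_pow (j g k c : R) (n : nat) :
  0 < j / c -> c <> 0 ->
  is_derive (fun c => k * Rpower (j / c) g / c ^ n) c
    (- k * (g + INR n) * Rpower (j / c) g / c ^ S n).
Proof.
  intros Hj Hc.
  assert (D := is_derive_Rpower_quot j g c Hj Hc).
  assert (E : Derive (fun c => Rpower (j / c) g) c = - (g / c) * Rpower (j / c) g) by now apply is_derive_unique.
  assert (D2 : is_derive (fun c => k * / c ^ n) c (- (k * INR n * / c ^ S n))).
  { eapply is_derive_eq.
    - apply is_derive_scal_R. apply (is_derive_inv (fun c => c ^ n) c (INR n * 1 * c ^ Nat.pred n)).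
      + apply (is_derive_pow (fun c => c) n c 1). apply @is_derive_id.
      + now apply pow_nonzero.
    - destruct n as [|n]; [simpl; field; auto|]. simpl Nat.pred.
      assert (c ^ n <> 0) by now apply pow_nonzero. simpl pow.
      generalize (INR (S n)); intros m. revert H. generalize (c ^ n). intros d Hd.
      field. auto. }
  apply (is_derive_ext_R (fun c => (k * / c ^ n) * Rpower (j / c) g)).
  - intros t. unfold Rdiv. ring.
  - eapply is_derive_eq; [apply is_derive_mult_R; [exact D2|exact D]|].
    assert (c ^ n <> 0) by now apply pow_nonzero. simpl pow. cbv beta. generalize (INR n) (Rpower (j / c) g). revert H. generalize (c ^ n). intros d Hd m r. field. auto.
Qed.

Lemma continuity_Rpower_pow (j g k c : R) (n : nat) :
  0 < j / c -> c <> 0 -> continuity_pt (fun c => k * Rpower (j / c) g / c ^ n) c.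
Proof. intros Hj Hc. eapply continuity_pt_of_is_derive. now apply is_derive_Rpower_pow. Qed.

Lemma C3_on_flux (i j A g : R) :
  i < 0 -> j < 0 -> C3_on i (flux j A g) (dflux j A g) (ddflux j A g) (dddflux j A g).
Proof.
  intros Hi Hj.
  assert (H : forall c, 0 < c / i -> 0 < j / c /\ c <> 0).
  { intros c Hc. assert (c < 0) by (eapply div_pos_neg; eauto).
    split; [now apply neg_div_pos|lra]. }
  split; [now apply C1_on_flux|split].
  - intros c Hc. destruct (H c Hc) as [H1 H2]. split.
    + apply (is_derive_ext_R (fun c => j - g * A * Rpower (j / c) g / c ^ 1)).
      * intros t. unfold dflux. now rewrite pow_1.
      * eapply is_derive_eq.
        -- apply (is_derive_minus_R (fun _ => j)); [apply @is_derive_const|now apply is_derive_Rpower_pow].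
        -- unfold ddflux, zero; simpl. field. auto.
    + now apply (continuity_Rpower_pow j g (g * (g + 1) * A) c 2).
  - intros c Hc. destruct (H c Hc) as [H1 H2]. split.
    + eapply is_derive_eq.
      * apply (is_derive_Rpower_pow j g (g * (g + 1) * A) c 2); auto.
      * unfold dddflux. simpl INR. field. auto.
    + now apply (continuity_Rpower_pow j g (- (g * (g + 1) * (g + 2)) * A) c 3).
Qed.

Lemma ddflux_pos (j A g c : R) : 0 < A -> 1 <= g -> c <> 0 -> 0 < ddflux j A g c.
Proof.
  intros HA Hg Hc. unfold ddflux.
  assert (0 < c ^ 2) by (rewrite <- Rsqr_pow2; now apply Rsqr_pos_lt).
  apply Rdiv_lt_0_compat; [|assumption].
  apply Rmult_lt_0_compat; [|unfold Rpower; apply exp_pos].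
  apply Rmult_lt_0_compat; [nra|exact HA].
Qed.

(** Derivatives are carried as explicit functions, so that sums, products and compositions follow by
    induction on the order, away from [Derive_n]. *)
Fixpoint smooth_upto (k : nat) (f : R -> R) : Prop :=
  match k with
  | O => True
  | S k => exists g, (forall x, 0 < x -> is_derive f x (g x)) /\ smooth_upto k g
  end.

Lemma smooth_ext k f g : (forall x, 0 < x -> f x = g x) -> smooth_upto k f -> smooth_upto k g.
Proof.
  destruct k as [|k]; [easy|]. intros E [h [H1 H2]]. exists h. split; [|exact H2].
  intros x Hx. apply (is_derive_ext_loc f); [|auto]. now apply locally_positive.
Qed.

Lemma smooth_weaken k f : smooth_upto (S k) f -> smooth_upto k f.
Proof.
  revert f. induction k as [|k IH]; intros f; [easy|].
  intros [g [H1 H2]]. exists g. split; [exact H1|now apply IH].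
Qed.

Lemma smooth_const k c : smooth_upto k (fun _ => c).
Proof.
  revert c. induction k as [|k IH]; intros c; [exact I|].
  exists (fun _ => 0). split; [intros; apply @is_derive_const|apply IH].
Qed.

Lemma smooth_plus k f g : smooth_upto k f -> smooth_upto k g -> smooth_upto k (fun x => f x + g x).
Proof.
  revert f g. induction k as [|k IH]; intros f g; [easy|].
  intros [f' [F1 F2]] [g' [G1 G2]]. exists (fun x => f' x + g' x). split; [|now apply IH].
  intros x Hx. apply is_derive_plus_R; auto.
Qed.

Lemma smooth_mult k f g : smooth_upto k f -> smooth_upto k g -> smooth_upto k (fun x => f x * g x).
Proof.
  revert f g. induction k as [|k IH]; intros f g; [easy|].
  intros Hf Hg. assert (Hf' := smooth_weaken _ _ Hf). assert (Hg' := smooth_weaken _ _ Hg).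
  destruct Hf as [f' [F1 F2]]. destruct Hg as [g' [G1 G2]].
  exists (fun x => f' x * g x + f x * g' x). split.
  - intros x Hx. apply is_derive_mult_R; auto.
  - apply smooth_plus; now apply IH.
Qed.

Lemma smooth_inv k f : (forall x, 0 < x -> f x <> 0) -> smooth_upto k f -> smooth_upto k (fun x => / f x).
Proof.
  intros N. induction k as [|k IH]; [easy|].
  intros Hf. assert (Hf' := smooth_weaken _ _ Hf). destruct Hf as [f' [F1 F2]].
  exists (fun x => - 1 * (f' x * (/ f x * / f x))). split.
  - intros x Hx. eapply is_derive_eq; [apply (is_derive_inv f x (f' x)); auto|].
    specialize (N x Hx). field. exact N.
  - apply smooth_mult; [apply smooth_const|]. apply smooth_mult; [exact F2|].
    apply smooth_mult; now apply IH.
Qed.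

Lemma smooth_Rpower k j g f :
  (forall x, 0 < x -> 0 < j / f x /\ f x <> 0) -> smooth_upto k f ->
  smooth_upto k (fun x => Rpower (j / f x) g).
Proof.
  intros N. induction k as [|k IH]; [easy|].
  intros Hf. assert (Hf' := smooth_weaken _ _ Hf). destruct Hf as [f' [F1 F2]].
  exists (fun x => - g * (/ f x * (Rpower (j / f x) g * f' x))). split.
  - intros x Hx. destruct (N x Hx) as [N1 N2].
    eapply is_derive_eq.
    + apply (is_derive_comp (fun c => Rpower (j / c) g) f); [now apply is_derive_Rpower_quot|now apply F1].
    + unfold scal; simpl. unfold mult; simpl. field. exact N2.
  - apply smooth_mult; [apply smooth_const|]. apply smooth_mult.
    + apply smooth_inv; [intros; now apply N|exact Hf'].
    + apply smooth_mult; [now apply IH|exact F2].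
Qed.

Lemma smooth_flux k j A g f :
  (forall x, 0 < x -> 0 < j / f x /\ f x <> 0) -> smooth_upto k f ->
  smooth_upto k (fun x => flux j A g (f x)).
Proof.
  intros N Hf. apply smooth_plus.
  - apply smooth_mult; [apply smooth_const|exact Hf].
  - apply smooth_mult; [apply smooth_const|now apply smooth_Rpower].
Qed.

Lemma smooth_shift k f T : 0 <= T -> smooth_upto k f -> smooth_upto k (fun x => f (x + T)).
Proof.
  intros HT. revert f. induction k as [|k IH]; intros f; [easy|].
  intros [f' [F1 F2]]. exists (fun x => f' (x + T)). split; [|now apply IH].
  intros x Hx. eapply is_derive_eq.
  - apply (is_derive_comp f (fun x => x + T)); [apply F1; lra|].
    apply (is_derive_plus_R (fun x => x) (fun _ => T)); [apply @is_derive_id|apply @is_derive_const].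
  - unfold scal, one, zero; simpl. unfold mult; simpl. ring.
Qed.

(** Bootstrap: the right-hand sides are as smooth as the orbit, hence the orbit is smoother by one
    order. *)
Lemma smooth_orbit j1 A1 g1 j2 A2 g2 mu K u v y k :
  0 < mu -> j1 < 0 -> j2 < 0 ->
  orbit (flux j1 A1 g1) (flux j2 A2 g2) mu j2 K u v y ->
  smooth_upto k u /\ smooth_upto k v /\ smooth_upto k y.
Proof.
  intros Hmu H1 H2 O.
  assert (Nu : forall x, 0 < x -> u x < 0 /\ v x < 0).
  { intros x Hx. assert (O' := O (x + 1) ltac:(lra)).
    split; eapply div_pos_neg; try exact H2; apply O'; lra. }
  assert (Mu : forall x, 0 < x -> 0 < j1 / u x /\ u x <> 0).
  { intros x Hx. destruct (Nu x Hx). split; [now apply neg_div_pos|lra]. }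
  assert (Mv : forall x, 0 < x -> 0 < j2 / v x /\ v x <> 0).
  { intros x Hx. destruct (Nu x Hx). split; [now apply neg_div_pos|lra]. }
  induction k as [|k (IHu & IHv & IHy)]; [easy|].
  assert (D : forall x, 0 < x -> is_derive u x ((flux j1 A1 g1 (u x) - y x) / mu) /\
    is_derive v x (v x / j2 * (flux j2 A2 g2 (v x) + y x - K)) /\
    is_derive y x (j2 * (1 - u x / v x))).
  { intros x Hx. assert (O' := O (x + 1) ltac:(lra)).
    split; [exact (orbit_du O' x ltac:(lra))|]. split; [exact (orbit_dv O' x ltac:(lra))|].
    exact (orbit_dy O' x ltac:(lra)). }
  split; [|split]; (eexists; split; [intros x Hx; now apply D|]).
  - apply (smooth_mult k (fun x => flux j1 A1 g1 (u x) - y x) (fun _ => / mu)); [|apply smooth_const].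
    apply (smooth_ext k (fun x => flux j1 A1 g1 (u x) + -1 * y x)); [intros; ring|].
    apply smooth_plus; [now apply smooth_flux|]. apply smooth_mult; [apply smooth_const|exact IHy].
  - apply (smooth_mult k (fun x => v x / j2) (fun x => flux j2 A2 g2 (v x) + y x - K)).
    + apply (smooth_mult k v (fun _ => / j2)); [exact IHv|apply smooth_const].
    + apply (smooth_plus k (fun x => flux j2 A2 g2 (v x) + y x) (fun _ => - K)); [|apply smooth_const].
      apply smooth_plus; [now apply smooth_flux|exact IHy].
  - apply (smooth_mult k (fun _ => j2) (fun x => 1 - u x / v x)); [apply smooth_const|].
    apply (smooth_ext k (fun x => 1 + -1 * (u x * / v x))); [intros; unfold Rdiv; ring|].
    apply smooth_plus; [apply smooth_const|]. apply smooth_mult; [apply smooth_const|].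
    apply smooth_mult; [exact IHu|]. apply smooth_inv; [intros; now apply Mv|exact IHv].
Qed.

Lemma smooth_ex_derive_n f : (forall k, smooth_upto k f) -> smooth_half_line f.
Proof.
  assert (H : forall k f, smooth_upto (S k) f -> forall x, 0 < x -> ex_derive (Derive_n f k) x).
  { clear f. induction k as [|k IH]; intros f [g [H1 H2]] x Hx.
    - exists (g x). now apply H1.
    - apply (ex_derive_ext_loc (Derive_n g k)); [|now apply IH].
      apply locally_positive; [exact Hx|]. intros t Ht.
      change (Derive_n f (S k) t) with (Derive (Derive_n f k) t).
      transitivity (Derive_n (Derive f) k t).
      + apply Derive_n_ext_loc. apply locally_positive; [exact Ht|]. intros s Hs.
        symmetry. now apply is_derive_unique, H1.
      + change (Derive f) with (Derive_n f 1).
        rewrite Derive_n_comp. rewrite Nat.add_1_r. reflexivity. }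
  intros Hf k x Hx. destruct k as [|k]; [exact I|]. apply H; [apply Hf|exact Hx].
Qed.

(** * Derivatives along an orbit bounded by a single small quantity *)

Section JetBounds.
Variables (f1 df1 ddf1 dddf1 f2 df2 ddf2 dddf2 : R -> R) (mu j K b p q C : R).
Hypothesis B1' : C1_bounded p q df1 ddf1.
Hypothesis B1'' : C1_bounded p q ddf1 dddf1.
Hypothesis B2' : C1_bounded p q df2 ddf2.
Hypothesis B2'' : C1_bounded p q ddf2 dddf2.
Hypothesis q_neg : q < 0.

(** States with a size [e] attached: [bigO] over them yields bounds linear in [e] and uniform in the
    state. *)
Let T : Type := (R * R * R * R)%type.
Let te (t : T) := fst (fst (fst t)).
Let tu (t : T) := snd (fst (fst t)).
Let tv (t : T) := snd (fst t).
Let ty (t : T) := snd t.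
Let D (t : T) : Prop := 0 <= te t <= 1 /\ p <= tu t <= q /\ p <= tv t <= q /\
  Rabs (tu t - b) <= C * te t /\ Rabs (tv t - b) <= C * te t /\
  Rabs (f1 (tu t) - ty t) <= C * te t /\ Rabs (f2 (tv t) + ty t - K) <= C * te t.
Hypothesis C_pos : 0 < C.
Let ap (F : R -> R -> R -> R) (t : T) := F (tu t) (tv t) (ty t).

Let O_b_u f df : C1_bounded p q f df -> bigO D (fun t => f (tu t)) (fun _ => 1).
Proof. intros H. apply (bigO_comp_bounded D p q f df tu H). intros t Ht. apply Ht. Qed.
Let O_b_v f df : C1_bounded p q f df -> bigO D (fun t => f (tv t)) (fun _ => 1).
Proof. intros H. apply (bigO_comp_bounded D p q f df tv H). intros t Ht. apply Ht. Qed.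
Let id_b : C1_bounded p q (fun c => c) (fun _ => 1).
Proof. split; [intros; apply @is_derive_id|]. exists 1. split; [lra|]. intros. rewrite Rabs_R1. lra. Qed.
Let inv_b : C1_bounded p q (fun c => / c ^ 2) (fun c => - 2 * / c ^ 3).
Proof.
  split.
  - intros c Hc. assert (c <> 0) by lra. auto_derive; [|field; auto].
    apply Rmult_integral_contrapositive_currified; [auto|].
    apply Rmult_integral_contrapositive_currified; [auto|lra].
  - apply continuity_bounded. intros c Hc.
    apply continuity_pt_mult; [apply continuity_pt_const; now intros ? ?|].
    apply continuity_pt_inv; [apply derivable_continuous_pt, derivable_pt_pow|].
    apply pow_nonzero. lra.
Qed.
Let e_1 f : bigO D f te -> bigO D f (fun _ => 1).
Proof. intros H. eapply bigO_trans; [exact H|]. apply bigO_le. intros t [Ht _]. rewrite Rabs_pos_eq; lra. Qed.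
Let sq f : bigO D f te -> bigO D (fun t => f t ^ 2) te.
Proof.
  intros H. apply (bigO_ext _ (fun t => f t * f t)); [intros; ring|].
  apply bigO_mult_1l; [now apply e_1|exact H].
Qed.

Let O_P : bigO D (ap (fun u v y => f1 u - y)) te.
Proof. exists C. split; [exact C_pos|]. intros t Ht. apply Ht. Qed.
Let O_Q : bigO D (ap (jQ f2 K)) te.
Proof. exists C. split; [exact C_pos|]. intros t Ht. apply Ht. Qed.
Let O_d : bigO D (fun t => tv t - tu t) te.
Proof.
  exists (2 * C). split; [lra|]. intros t (_ & _ & _ & H1 & H2 & _). split_Rabs; lra.
Qed.
Let O_G : bigO D (ap (jG j)) te.
Proof.
  apply (bigO_ext _ (fun t => j * ((tv t - tu t) * (tv t * / tv t ^ 2)))).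
  - intros t (_ & _ & Hv & _). unfold ap, jG. field. lra.
  - apply bigO_scal, bigO_mult_1r; [exact O_d|].
    apply bigO_mult_1l; [exact (O_b_v _ _ id_b)|exact (O_b_v _ _ inv_b)].
Qed.
Let O_u1 : bigO D (ap (ju1 f1 mu)) te.
Proof. apply (bigO_mult_1r (ap (fun u v y => f1 u - y)) (fun _ => / mu)); [exact O_P|apply bigO_const]. Qed.
Let O_v1 : bigO D (ap (jv1 f2 j K)) te.
Proof.
  apply (bigO_mult_1l (fun t => tv t / j) (ap (jQ f2 K))); [|exact O_Q].
  apply (bigO_mult_1l tv (fun _ => / j)); [exact (O_b_v _ _ id_b)|apply bigO_const].
Qed.
Let O_u2 : bigO D (ap (ju2 f1 df1 mu j)) te.
Proof.
  apply (bigO_mult_1r (fun t => df1 (tu t) * ap (ju1 f1 mu) t - ap (jG j) t) (fun _ => / mu)); [|apply bigO_const].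
  apply bigO_minus; [|exact O_G]. apply (bigO_mult_1l (fun t => df1 (tu t))); [exact (O_b_u _ _ B1')|exact O_u1].
Qed.
Let O_Q1 : bigO D (ap (jQ1 f2 df2 j K)) te.
Proof.
  apply bigO_plus; [|exact O_G]. apply (bigO_mult_1l (fun t => df2 (tv t))); [exact (O_b_v _ _ B2')|exact O_v1].
Qed.
Let O_v2 : bigO D (ap (jv2 f2 df2 j K)) te.
Proof.
  apply (bigO_mult_1r (fun t => ap (jv1 f2 j K) t * ap (jQ f2 K) t + tv t * ap (jQ1 f2 df2 j K) t) (fun _ => / j)); [|apply bigO_const].
  apply bigO_plus; apply bigO_mult_1l; [now apply e_1|exact O_Q|exact (O_b_v _ _ id_b)|exact O_Q1].
Qed.
Let O_G1 : bigO D (ap (jG1 f1 f2 mu j K)) te.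
Proof.
  apply (bigO_mult_1r (fun t => - j * (ap (ju1 f1 mu) t * tv t - tu t * ap (jv1 f2 j K) t)) (fun t => / tv t ^ 2)).
  - apply bigO_scal, bigO_minus.
    + apply bigO_mult_1r; [exact O_u1|exact (O_b_v _ _ id_b)].
    + apply bigO_mult_1l; [exact (O_b_u _ _ id_b)|exact O_v1].
  - exact (O_b_v _ _ inv_b).
Qed.
Let O_u3 : bigO D (ap (ju3 f1 df1 ddf1 f2 mu j K)) te.
Proof.
  apply (bigO_mult_1r (fun t => ddf1 (tu t) * ap (ju1 f1 mu) t ^ 2 + df1 (tu t) * ap (ju2 f1 df1 mu j) t
    - ap (jG1 f1 f2 mu j K) t) (fun _ => / mu)); [|apply bigO_const].
  apply bigO_minus; [apply bigO_plus|exact O_G1].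
  - apply (bigO_mult_1l (fun t => ddf1 (tu t))); [exact (O_b_u _ _ B1'')|now apply sq].
  - apply (bigO_mult_1l (fun t => df1 (tu t))); [exact (O_b_u _ _ B1')|exact O_u2].
Qed.
Let O_v3 : bigO D (ap (jv3 f1 f2 df2 ddf2 mu j K)) te.
Proof.
  apply (bigO_mult_1r (fun t => ap (jv2 f2 df2 j K) t * ap (jQ f2 K) t
    + 2 * ap (jv1 f2 j K) t * ap (jQ1 f2 df2 j K) t + tv t * ap (jQ2 f1 f2 df2 ddf2 mu j K) t) (fun _ => / j)); [|apply bigO_const].
  apply bigO_plus; [apply bigO_plus|].
  - apply bigO_mult_1l; [now apply e_1|exact O_Q].
  - apply bigO_mult_1l; [|exact O_Q1]. now apply e_1, bigO_scal.
  - apply bigO_mult_1l; [exact (O_b_v _ _ id_b)|].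
    apply (bigO_plus (fun t => ddf2 (tv t) * ap (jv1 f2 j K) t ^ 2 + df2 (tv t) * ap (jv2 f2 df2 j K) t)
      (ap (jG1 f1 f2 mu j K))); [apply bigO_plus|exact O_G1].
    + apply (bigO_mult_1l (fun t => ddf2 (tv t))); [exact (O_b_v _ _ B2'')|now apply sq].
    + apply (bigO_mult_1l (fun t => df2 (tv t))); [exact (O_b_v _ _ B2')|exact O_v2].
Qed.

(** Every derivative is a combination of [f1 u - y], [f2 v + y - K] and [v - u] with bounded
    coefficients, so a common bound of these passes to it; [e <= 1] absorbs their products. *)
Lemma jets_bound : exists A, 0 < A /\ forall e u v y,
  0 <= e <= 1 -> p <= u <= q -> p <= v <= q ->
  Rabs (u - b) <= C * e -> Rabs (v - b) <= C * e ->
  Rabs (f1 u - y) <= C * e -> Rabs (f2 v + y - K) <= C * e ->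
  Rabs (ju1 f1 mu u v y) <= A * e /\ Rabs (jv1 f2 j K u v y) <= A * e /\
  Rabs (ju2 f1 df1 mu j u v y) <= A * e /\ Rabs (jv2 f2 df2 j K u v y) <= A * e /\
  Rabs (ju3 f1 df1 ddf1 f2 mu j K u v y) <= A * e /\ Rabs (jv3 f1 f2 df2 ddf2 mu j K u v y) <= A * e.
Proof.
  destruct O_u1 as [C1 [H1 H1']]. destruct O_v1 as [C2 [H2 H2']]. destruct O_u2 as [C3 [H3 H3']].
  destruct O_v2 as [C4 [H4 H4']]. destruct O_u3 as [C5 [H5 H5']]. destruct O_v3 as [C6 [H6 H6']].
  set (A := C1 + C2 + C3 + C4 + C5 + C6). exists A. split; [unfold A; lra|].
  intros e u v y He Hu Hv E1 E2 E3 E4.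
  assert (Dt : D (e, u, v, y)) by (unfold D, te, tu, tv, ty; cbn [fst snd]; tauto).
  specialize (H1' _ Dt). specialize (H2' _ Dt). specialize (H3' _ Dt).
  specialize (H4' _ Dt). specialize (H5' _ Dt). specialize (H6' _ Dt).
  assert (up : forall c s, c <= A -> s <= c * e -> s <= A * e).
  { intros c s Hc Hs. eapply Rle_trans; [exact Hs|]. apply Rmult_le_compat_r; lra. }
  split; [apply (up C1); [unfold A; lra|exact H1']|]. split; [apply (up C2); [unfold A; lra|exact H2']|].
  split; [apply (up C3); [unfold A; lra|exact H3']|]. split; [apply (up C4); [unfold A; lra|exact H4']|].
  split; [apply (up C5); [unfold A; lra|exact H5']|]. apply (up C6); [unfold A; lra|exact H6'].
Qed.

End JetBounds.

(** * Deviations from the far field *)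

Lemma Rabs_inv_pow_le (s q : R) (n : nat) : s <= q -> q < 0 -> Rabs (/ s ^ n) <= / (- q) ^ n.
Proof.
  intros Hs Hq. rewrite Rabs_inv, <- RPow_abs, (Rabs_left s) by lra.
  apply Rinv_le_contravar; [apply pow_lt; lra|apply pow_incr; lra].
Qed.

Lemma Rabs_mult_le (a b A B : R) : Rabs a <= A -> Rabs b <= B -> Rabs (a * b) <= A * B.
Proof. intros Ha Hb. rewrite Rabs_mult. apply Rmult_le_compat; auto using Rabs_pos. Qed.

Lemma Rabs_plus_le (a b A B : R) : Rabs a <= A -> Rabs b <= B -> Rabs (a + b) <= A + B.
Proof. intros Ha Hb. eapply Rle_trans; [apply Rabs_triang|lra]. Qed.

(** The conditions on the gauges let [s1^2] and [s1 s2] be absorbed by the bounds of the second and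
    third derivatives; [s1^3] is absorbed by using both in turn. *)
Lemma quot_bounds (J b q k : R) : q < 0 -> b <= q -> 0 < k ->
  exists C, 0 < C /\ forall s s1 s2 s3 e0 e1 e2 e3,
    s <= q -> Rabs (s - b) <= e0 -> Rabs s1 <= e1 -> Rabs s2 <= e2 -> Rabs s3 <= e3 ->
    e1 ^ 2 <= k * e2 -> e1 * e2 <= k * e3 ->
    Rabs (J / s - J / b) <= C * e0 /\ Rabs (q1 J s s1) <= C * e1 /\
    Rabs (q2 J s s1 s2) <= C * e2 /\ Rabs (q3 J s s1 s2 s3) <= C * e3.
Proof.
  intros Hq Hb Hk. set (r := / - q). set (a := Rabs J).
  assert (Hr : 0 < r) by (apply Rinv_0_lt_compat; lra).
  assert (Ha : 0 <= a) by apply Rabs_pos.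
  assert (ipow : forall n s, s <= q -> Rabs (/ s ^ n) <= r ^ n).
  { intros n s Hs. unfold r. rewrite pow_inv. now apply Rabs_inv_pow_le. }
  assert (ip1 : forall s, s <= q -> Rabs (/ s) <= r).
  { intros s Hs. rewrite <- (pow_1 s), <- (pow_1 r). now apply ipow. }
  assert (W : 0 <= a * r ^ 2 /\ 0 <= a * r ^ 3 /\ 0 <= a * r ^ 4).
  { repeat split; apply Rmult_le_pos; auto; apply pow_le; lra. }
  destruct W as (W2 & W3 & W4).
  set (C := a * r ^ 2 + 8 * (a * r ^ 3 * k) + 6 * (a * r ^ 4 * (k * k)) + 1).
  assert (V3 : 0 <= a * r ^ 3 * k) by (apply Rmult_le_pos; lra).
  assert (V4 : 0 <= a * r ^ 4 * (k * k)) by (apply Rmult_le_pos; nra).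
  assert (up : forall c e s, 0 <= e -> c <= C -> s <= c * e -> s <= C * e).
  { intros c e s He Hc Hs. eapply Rle_trans; [exact Hs|]. now apply Rmult_le_compat_r. }
  exists C. split; [unfold C; lra|].
  intros s s1 s2 s3 e0 e1 e2 e3 Hs H0 H1 H2 H3 H12 H123.
  assert (P0 := Rle_trans _ _ _ (Rabs_pos _) H0). assert (P1 := Rle_trans _ _ _ (Rabs_pos _) H1).
  assert (P2 := Rle_trans _ _ _ (Rabs_pos _) H2). assert (P3 := Rle_trans _ _ _ (Rabs_pos _) H3).
  assert (HJ : Rabs (- J) <= a) by (rewrite Rabs_Ropp; unfold a; lra).
  assert (HJ' : Rabs J <= a) by (unfold a; lra).
  assert (S1 : Rabs (s1 ^ 2) <= k * e2).
  { eapply Rle_trans; [|exact H12]. rewrite <- RPow_abs. apply pow_incr. split; [apply Rabs_pos|exact H1]. }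
  assert (S12 : Rabs (s1 * s2) <= k * e3) by (eapply Rle_trans; [exact (Rabs_mult_le _ _ _ _ H1 H2)|exact H123]).
  assert (S111 : Rabs (s1 * s1 ^ 2) <= k * (k * e3)).
  { eapply Rle_trans; [exact (Rabs_mult_le _ _ _ _ H1 S1)|].
    replace (e1 * (k * e2)) with (k * (e1 * e2)) by ring. apply Rmult_le_compat_l; lra. }
  assert (M3 : forall z n t T, Rabs z <= a -> Rabs t <= T -> Rabs (z * / s ^ n * t) <= a * r ^ n * T).
  { intros z n t T Hz Ht. apply Rabs_mult_le; [|exact Ht]. apply Rabs_mult_le; auto. }
  assert (Sc : forall c t T, 0 <= c -> Rabs t <= T -> Rabs (c * t) <= c * T).
  { intros c t T Hc Ht. rewrite Rabs_mult, (Rabs_pos_eq c) by exact Hc. now apply Rmult_le_compat_l. }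
  split; [|split; [|split]].
  - apply (up (a * r ^ 2)); [exact P0|unfold C; lra|].
    replace (J / s - J / b) with (- J * (/ s * / b) * (s - b)) by (field; lra).
    replace (r ^ 2) with (r * r) by ring.
    repeat apply Rabs_mult_le; auto.
  - apply (up (a * r ^ 2)); [exact P1|unfold C; lra|]. unfold q1.
    replace (- J * s1 / s ^ 2) with (- J * / s ^ 2 * s1) by (unfold Rdiv; ring).
    now apply M3.
  - apply (up (a * r ^ 2 + 2 * (a * r ^ 3 * k))); [exact P2|unfold C; lra|]. unfold q2.
    replace (- J * s2 / s ^ 2 + 2 * J * s1 ^ 2 / s ^ 3)
      with (- J * / s ^ 2 * s2 + 2 * (J * / s ^ 3 * s1 ^ 2)) by (unfold Rdiv; ring).
    replace ((a * r ^ 2 + 2 * (a * r ^ 3 * k)) * e2)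
      with (a * r ^ 2 * e2 + 2 * (a * r ^ 3 * (k * e2))) by ring.
    apply Rabs_plus_le; [now apply M3|apply Sc; [lra|now apply M3]].
  - apply (up (a * r ^ 2 + 6 * (a * r ^ 3 * k) + 6 * (a * r ^ 4 * (k * k)))); [exact P3|unfold C; lra|].
    unfold q3.
    replace (- J * s3 / s ^ 2 + 6 * J * s1 * s2 / s ^ 3 - 6 * J * s1 ^ 3 / s ^ 4)
      with (- J * / s ^ 2 * s3 + 6 * (J * / s ^ 3 * (s1 * s2)) + 6 * (- J * / s ^ 4 * (s1 * s1 ^ 2)))
      by (unfold Rdiv; ring).
    replace ((a * r ^ 2 + 6 * (a * r ^ 3 * k) + 6 * (a * r ^ 4 * (k * k))) * e3)
      with (a * r ^ 2 * e3 + 6 * (a * r ^ 3 * (k * e3)) + 6 * (a * r ^ 4 * (k * (k * e3)))) by ring.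
    apply Rabs_plus_le; [apply Rabs_plus_le|]; [now apply M3| |]; (apply Sc; [lra|now apply M3]).
Qed.

Section Deviation.
Variables (j1 : R) (f1 df1 ddf1 dddf1 f2 df2 ddf2 dddf2 : R -> R) (mu j2 K b : R).
Hypothesis C3_f1 : C3_on j2 f1 df1 ddf1 dddf1.
Hypothesis C3_f2 : C3_on j2 f2 df2 ddf2 dddf2.

Definition carried (w : profile) (u v : R -> R) : Prop := forall x, 0 <= x ->
  u x < 0 /\ v x < 0 /\ pu w x = u x /\ pv w x = v x /\ prho w x = j1 / u x /\ pn w x = j2 / v x.

Lemma profile_derivatives (w : profile) (u v y : R -> R) :
  orbit f1 f2 mu j2 K u v y -> carried w u v ->
  derivable_upto 3 w /\ forall x, 0 < x ->
  let s1 := ju1 f1 mu (u x) (v x) (y x) in let r1 := jv1 f2 j2 K (u x) (v x) (y x) in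
  let s2 := ju2 f1 df1 mu j2 (u x) (v x) (y x) in let r2 := jv2 f2 df2 j2 K (u x) (v x) (y x) in
  let s3 := ju3 f1 df1 ddf1 f2 mu j2 K (u x) (v x) (y x) in
  let r3 := jv3 f1 f2 df2 ddf2 mu j2 K (u x) (v x) (y x) in
  (dev (j1 / b) (j2 / b) b w 0 x <= Rabs (u x - b) + Rabs (v x - b)
     + Rabs (j1 / u x - j1 / b) + Rabs (j2 / v x - j2 / b)) /\
  (dev (j1 / b) (j2 / b) b w 1 x <= Rabs s1 + Rabs r1 + Rabs (q1 j1 (u x) s1) + Rabs (q1 j2 (v x) r1)) /\
  (dev (j1 / b) (j2 / b) b w 2 x <= Rabs s2 + Rabs r2
     + Rabs (q2 j1 (u x) s1 s2) + Rabs (q2 j2 (v x) r1 r2)) /\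
  (dev (j1 / b) (j2 / b) b w 3 x <= Rabs s3 + Rabs r3
     + Rabs (q3 j1 (u x) s1 s2 s3) + Rabs (q3 j2 (v x) r1 r2 r3)) /\
  Derive (pu w) x = s1 /\ Derive (pv w) x = r1.
Proof.
  intros O Hw. destruct C3_f1 as (F1 & F2 & F3). destruct C3_f2 as (G1 & G2 & G3).
  assert (Du : forall x, 0 < x -> is_derive u x (ju1 f1 mu (u x) (v x) (y x)))
    by (intros x Hx; eapply orbit_is_derive; eauto).
  assert (Dv : forall x, 0 < x -> is_derive v x (jv1 f2 j2 K (u x) (v x) (y x)))
    by (intros x Hx; eapply orbit_is_derive; eauto).
  assert (Du1 := is_derive_ju1 f1 df1 f2 mu j2 K F1 u v y O).
  assert (Du2 := is_derive_ju2 f1 df1 ddf1 f2 mu j2 K F1 F2 u v y O).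
  assert (Dv1 := is_derive_jv1 f1 f2 df2 mu j2 K G1 u v y O).
  assert (Dv2 := is_derive_jv2 f1 f2 df2 ddf2 mu j2 K G1 G2 u v y O).
  assert (Qu : forall x, 0 < x -> _) by
    (intros x Hx; exact (is_derive_quot j1 u _ _ _ x
      (Rlt_not_eq _ _ (proj1 (Hw x (Rlt_le _ _ Hx)))) (Du x Hx) (Du1 x Hx) (Du2 x Hx))).
  assert (Qv : forall x, 0 < x -> _) by
    (intros x Hx; exact (is_derive_quot j2 v _ _ _ x
      (Rlt_not_eq _ _ (proj1 (proj2 (Hw x (Rlt_le _ _ Hx))))) (Dv x Hx) (Dv1 x Hx) (Dv2 x Hx))).
  assert (Tu := Derive_n_chain (pu w) u _ _ _ b
    (fun x Hx => proj1 (proj2 (proj2 (Hw x (Rlt_le _ _ Hx))))) Du Du1 Du2).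
  assert (Tv := Derive_n_chain (pv w) v _ _ _ b
    (fun x Hx => proj1 (proj2 (proj2 (proj2 (Hw x (Rlt_le _ _ Hx)))))) Dv Dv1 Dv2).
  assert (Tr := Derive_n_chain (prho w) (fun x => j1 / u x) _ _ _ (j1 / b)
    (fun x Hx => proj1 (proj2 (proj2 (proj2 (proj2 (Hw x (Rlt_le _ _ Hx)))))))
    (fun x Hx => proj1 (Qu x Hx)) (fun x Hx => proj1 (proj2 (Qu x Hx)))
    (fun x Hx => proj2 (proj2 (Qu x Hx)))).
  assert (Tn := Derive_n_chain (pn w) (fun x => j2 / v x) _ _ _ (j2 / b)
    (fun x Hx => proj2 (proj2 (proj2 (proj2 (proj2 (Hw x (Rlt_le _ _ Hx)))))))
    (fun x Hx => proj1 (Qv x Hx)) (fun x Hx => proj1 (proj2 (Qv x Hx)))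
    (fun x Hx => proj2 (proj2 (Qv x Hx)))).
  clear Qu Qv. split.
  - intros k x Hk Hx. split; [now apply Tr|]. split; [now apply Tu|]. split; [now apply Tn|now apply Tv].
  - intros x Hx s1 r1 s2 r2 s3 r3.
    destruct (Tu x Hx) as (_ & U0 & U1 & U2 & U3). destruct (Tv x Hx) as (_ & V0 & V1 & V2 & V3).
    destruct (Tr x Hx) as (_ & R0 & R1 & R2 & R3). destruct (Tn x Hx) as (_ & N0 & N1 & N2 & N3).
    assert (perm : forall a b c d, sqrt (a ^ 2 + b ^ 2 + c ^ 2 + d ^ 2) <= Rabs b + Rabs d + Rabs a + Rabs c).
    { intros. eapply Rle_trans; [apply norm4_le|lra]. }
    split; [|split; [|split; [|split; [|split]]]].
    + unfold dev. simpl Derive_n. rewrite U0, V0, R0, N0. apply perm.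
    + unfold dev. rewrite U1, V1, R1, N1. apply perm.
    + unfold dev. rewrite U2, V2, R2, N2. apply perm.
    + unfold dev. rewrite U3, V3, R3, N3. apply perm.
    + apply is_derive_unique. apply (is_derive_ext_loc u); [|now apply Du].
      apply locally_positive; [exact Hx|]. intros t Ht. symmetry. now apply Hw; left.
    + apply is_derive_unique. apply (is_derive_ext_loc v); [|now apply Dv].
      apply locally_positive; [exact Hx|]. intros t Ht. symmetry. now apply Hw; left.
Qed.

(** The gauges [e0] to [e3] are left free: exponential decay uses multiples of one gauge for all
    orders, the sonic case increasing powers of [z], with the layer from order 2 on. *)
Lemma dev_bound (q k : R) : q < 0 -> b <= q -> 0 < k ->
  exists C, 0 < C /\ forall w u v y, orbit f1 f2 mu j2 K u v y -> carried w u v ->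
  derivable_upto 3 w /\ forall x, 0 < x -> u x <= q -> v x <= q ->
  let s1 := ju1 f1 mu (u x) (v x) (y x) in let r1 := jv1 f2 j2 K (u x) (v x) (y x) in
  let s2 := ju2 f1 df1 mu j2 (u x) (v x) (y x) in let r2 := jv2 f2 df2 j2 K (u x) (v x) (y x) in
  let s3 := ju3 f1 df1 ddf1 f2 mu j2 K (u x) (v x) (y x) in
  let r3 := jv3 f1 f2 df2 ddf2 mu j2 K (u x) (v x) (y x) in
  Derive (pu w) x = s1 /\ Derive (pv w) x = r1 /\
  forall e0 e1 e2 e3, Rabs (u x - b) <= e0 -> Rabs (v x - b) <= e0 ->
    Rabs s1 <= e1 -> Rabs r1 <= e1 -> Rabs s2 <= e2 -> Rabs r2 <= e2 -> Rabs s3 <= e3 -> Rabs r3 <= e3 ->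
    e1 ^ 2 <= k * e2 -> e1 * e2 <= k * e3 ->
    dev (j1 / b) (j2 / b) b w 0 x <= C * e0 /\ dev (j1 / b) (j2 / b) b w 1 x <= C * e1 /\
    dev (j1 / b) (j2 / b) b w 2 x <= C * e2 /\ dev (j1 / b) (j2 / b) b w 3 x <= C * e3.
Proof.
  intros Hq Hb Hk.
  destruct (quot_bounds j1 b q k Hq Hb Hk) as [Cu [HCu Bu]].
  destruct (quot_bounds j2 b q k Hq Hb Hk) as [Cv [HCv Bv]].
  exists (2 + Cu + Cv). split; [lra|]. intros w u v y O Hw.
  destruct (profile_derivatives w u v y O Hw) as [Hd D]. split; [exact Hd|].
  intros x Hx Hux Hvx s1 r1 s2 r2 s3 r3.
  destruct (D x Hx) as (D0 & D1 & D2 & D3 & E1 & E2).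
  split; [exact E1|]. split; [exact E2|].
  intros e0 e1 e2 e3 U0 V0 U1 V1 U2 V2 U3 V3 H12 H123.
  destruct (Bu (u x) s1 s2 s3 e0 e1 e2 e3) as (Bu0 & Bu1 & Bu2 & Bu3); auto.
  destruct (Bv (v x) r1 r2 r3 e0 e1 e2 e3) as (Bv0 & Bv1 & Bv2 & Bv3); auto.
  fold s1 r1 in D1, D2, D3. fold s2 r2 in D2, D3. fold s3 r3 in D3.
  repeat split; lra.
Qed.

End Deviation.

(** * Rates *)

Definition hyp_rate (delta x : R) : R := delta / (1 + delta * x).

Lemma alg_rate_pow (delta x : R) (k : nat) : 0 < 1 + delta * x -> alg_rate delta k x = hyp_rate delta x ^ (k + 1).
Proof. intros H. unfold alg_rate, hyp_rate, Rdiv. now rewrite Rpow_mult_distr, pow_inv. Qed.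

Lemma hyp_rate_range (delta x : R) : 0 < delta -> 0 <= x -> 0 < hyp_rate delta x <= delta.
Proof.
  intros Hd Hx. assert (0 <= delta * x) by nra. unfold hyp_rate. split.
  - apply Rdiv_lt_0_compat; lra.
  - apply Rle_div_l; [lra|]. nra.
Qed.

(** The shift adds 1 to the denominator [1 + delta x], hence at most doubles it. *)
Lemma hyp_rate_shift (delta x : R) : 0 < delta -> 0 <= x ->
  hyp_rate delta x / 2 <= hyp_rate delta (x + / delta) <= hyp_rate delta x.
Proof.
  intros Hd Hx. assert (0 <= delta * x) by nra. unfold hyp_rate.
  replace (1 + delta * (x + / delta)) with (2 + delta * x) by (field; lra). split.
  - replace (delta / (1 + delta * x) / 2) with (delta * / (2 * (1 + delta * x))) by (field; lra).
    apply Rmult_le_compat_l; [lra|]. apply Rinv_le_contravar; lra.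
  - apply Rmult_le_compat_l; [lra|]. apply Rinv_le_contravar; lra.
Qed.

Lemma hyp_rate_decreasing (delta x t : R) : 0 < delta -> 0 <= x <= t -> hyp_rate delta t <= hyp_rate delta x.
Proof.
  intros Hd Hx. unfold hyp_rate. apply Rmult_le_compat_l; [lra|]. apply Rinv_le_contravar; nra.
Qed.

(** The inequality [1 + delta x <= (1 + 4 / kap) exp (kap x / 4)] raised to the fourth power;
    [delta <= 1] makes its constant independent of [delta]. *)
Lemma exp_layer_rate (kap delta x : R) : 0 < kap -> 0 < delta <= 1 -> 0 <= x ->
  delta ^ 4 * exp (- kap * x) <= (1 + 4 / kap) ^ 4 * hyp_rate delta x ^ 4.
Proof.
  intros Hk Hd Hx. assert (0 <= delta * x) by nra.
  assert (Hik : 0 < / kap) by now apply Rinv_0_lt_compat.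
  assert (E1 : 1 + delta * x <= (1 + 4 / kap) * exp (kap * x / 4)).
  { assert (H1 := exp_ineq1_le (kap * x / 4)).
    assert (H2 : (1 + 4 / kap) * (1 + kap * x / 4) <= (1 + 4 / kap) * exp (kap * x / 4)).
    { apply Rmult_le_compat_l; [|exact H1]. unfold Rdiv. lra. }
    assert (H3 : (1 + 4 / kap) * (1 + kap * x / 4) = 1 + kap * x / 4 + 4 * / kap + x) by (field; lra).
    assert (0 <= kap * x) by (apply Rmult_le_pos; lra). nra. }
  assert (E2 : (1 + delta * x) ^ 4 <= (1 + 4 / kap) ^ 4 * exp (kap * x)).
  { eapply Rle_trans; [apply pow_incr; split; [lra|exact E1]|]. rewrite Rpow_mult_distr.
    apply Req_le. f_equal. simpl pow. rewrite Rmult_1_r, <- !exp_plus. f_equal. field. }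
  unfold hyp_rate, Rdiv. rewrite (Rpow_mult_distr delta), pow_inv.
  replace (- kap * x) with (- (kap * x)) by ring. rewrite exp_Ropp.
  assert (0 < exp (kap * x)) by apply exp_pos.
  assert (0 < (1 + delta * x) ^ 4) by (apply pow_lt; lra).
  assert (0 < delta ^ 4) by (apply pow_lt; lra).
  replace ((1 + 4 * / kap) ^ 4 * (delta ^ 4 * / (1 + delta * x) ^ 4))
    with (delta ^ 4 * ((1 + 4 * / kap) ^ 4 * / (1 + delta * x) ^ 4)) by ring.
  apply Rmult_le_compat_l; [lra|].
  apply (Rmult_le_reg_r ((1 + delta * x) ^ 4)); [assumption|].
  rewrite Rmult_assoc, Rinv_l, Rmult_1_r by lra.
  apply (Rmult_le_reg_l (exp (kap * x))); [assumption|].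
  rewrite <- Rmult_assoc, Rinv_r, Rmult_1_l by lra. unfold Rdiv in E2. lra.
Qed.

(** From [exp s >= s], used twice with [s = kap / (2 delta)]. *)
Lemma exp_inv_le_square (kap delta : R) : 0 < kap -> 0 < delta -> exp (- kap * / delta) <= 4 / kap ^ 2 * delta ^ 2.
Proof.
  intros Hk Hd.
  assert (Hs : 0 < kap / (2 * delta)) by (apply Rdiv_lt_0_compat; lra).
  replace (- kap * / delta) with (- (2 * (kap / (2 * delta)))) by (field; lra).
  set (s := kap / (2 * delta)) in *.
  assert (H1 := exp_ineq1_le s).
  assert (E : exp (2 * s) = exp s * exp s) by (rewrite <- exp_plus; f_equal; ring).
  rewrite exp_Ropp. replace (4 / kap ^ 2 * delta ^ 2) with (/ (s * s)) by (unfold s; field; lra).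
  apply Rinv_le_contravar; [nra|]. rewrite E. nra.
Qed.

(* A translation by [1 / delta] turns the boundary layer into a term of the size of the main profile. *)
Lemma exp_layer_shift (kap delta x : R) : 0 < kap -> 0 < delta <= 1 -> 0 <= x ->
  delta ^ 2 * exp (- kap * (x + / delta)) <= 4 / kap ^ 2 * (1 + 4 / kap) ^ 4 * hyp_rate delta x ^ 4.
Proof.
  intros Hk Hd Hx. replace (- kap * (x + / delta)) with (- kap * / delta + - kap * x) by ring.
  rewrite exp_plus. assert (H1 := exp_inv_le_square kap delta Hk ltac:(lra)).
  assert (H2 := exp_layer_rate kap delta x Hk Hd Hx).
  assert (0 < exp (- kap * x)) by apply exp_pos.
  assert (0 < 4 / kap ^ 2) by (apply Rdiv_lt_0_compat; [lra|apply pow_lt; lra]).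
  apply Rle_trans with (4 / kap ^ 2 * (delta ^ 4 * exp (- kap * x))).
  - replace (4 / kap ^ 2 * (delta ^ 4 * exp (- kap * x)))
      with (delta ^ 2 * (4 / kap ^ 2 * delta ^ 2 * exp (- kap * x))) by ring.
    apply Rmult_le_compat_l; [apply pow_le; lra|]. apply Rmult_le_compat_r; lra.
  - rewrite Rmult_assoc. apply Rmult_le_compat_l; lra.
Qed.

Lemma local_sign (f : R -> R) (b l : R) : is_derive f b l -> l < 0 ->
  exists d, 0 < d /\ forall c, Rabs (c - b) < d -> (c < b -> f b < f c) /\ (b < c -> f c < f b).
Proof.
  intros Hf Hl. apply is_derive_Reals in Hf.
  destruct (Hf (- l / 2) ltac:(lra)) as [d Hd]. exists d. split; [apply cond_pos|].
  intros c Hc.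
  assert (H : c <> b -> (f c - f b) / (c - b) < 0).
  { intros Hn. specialize (Hd (c - b) ltac:(lra) Hc).
    replace (b + (c - b)) with c in Hd by ring. apply Rabs_def2 in Hd. lra. }
  assert (E : c <> b -> f c - f b = (f c - f b) / (c - b) * (c - b)) by (intros Hn; field; intros E0; apply Hn; lra).
  split; intros Hcb.
  - specialize (H (Rlt_not_eq _ _ Hcb)). specialize (E (Rlt_not_eq _ _ Hcb)). nra.
  - specialize (H (Rgt_not_eq _ _ Hcb)). specialize (E (Rgt_not_eq _ _ Hcb)). nra.
Qed.

(** Two mean value steps, for [f] and then for [df]. The inequality on [df b] is weak in order to
    include the sonic case, where this derivative vanishes. *)
Lemma convex_above_left (f df ddf : R -> R) (b c : R) :
  (forall t, t < 0 -> is_derive f t (df t)) -> (forall t, t < 0 -> is_derive df t (ddf t)) ->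
  (forall t, t < 0 -> 0 < ddf t) -> b < 0 -> df b <= 0 -> c < b -> f b < f c.
Proof.
  intros D1 D2 Hp Hb Hdf Hc.
  destruct (mean_value_open f df c b Hc) as [s [Hs Es]].
  { intros t Ht. apply D1; lra. }
  { intros t Ht. eapply continuity_pt_of_is_derive. apply D1; lra. }
  destruct (mean_value_open df ddf s b (proj2 Hs)) as [r [Hr Er]].
  { intros t Ht. apply D2; lra. }
  { intros t Ht. eapply continuity_pt_of_is_derive. apply D2; lra. }
  assert (0 < ddf r * (b - s)) by (apply Rmult_lt_0_compat; [apply Hp|]; lra).
  assert (df s < 0) by lra. nra.
Qed.

Lemma convex_above_right (f df ddf : R -> R) (b c : R) :
  (forall t, t < 0 -> is_derive f t (df t)) -> (forall t, t < 0 -> is_derive df t (ddf t)) ->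
  (forall t, t < 0 -> 0 < ddf t) -> 0 <= df b -> b < c < 0 -> f b < f c.
Proof.
  intros D1 D2 Hp Hdf Hc.
  destruct (mean_value_open f df b c (proj1 Hc)) as [s [Hs Es]].
  { intros t Ht. apply D1; lra. }
  { intros t Ht. eapply continuity_pt_of_is_derive. apply D1; lra. }
  destruct (mean_value_open df ddf b s (proj1 Hs)) as [r [Hr Er]].
  { intros t Ht. apply D2; lra. }
  { intros t Ht. eapply continuity_pt_of_is_derive. apply D2; lra. }
  assert (0 < ddf r * (s - b)) by (apply Rmult_lt_0_compat; [apply Hp|]; lra).
  assert (0 < df s) by lra. nra.
Qed.

(** * The three regimes *)

Lemma C1_bounded_reflect (p q : R) (f df : R -> R) :
  C1_bounded p q f df -> C1_bounded (- q) (- p) (fun c => f (- c)) (fun c => - df (- c)).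
Proof.
  intros [H1 [B [HB H2]]]. split.
  - intros c Hc. apply is_derive_reflect, H1. lra.
  - exists B. split; [exact HB|]. intros c Hc. rewrite Rabs_Ropp. apply H2. lra.
Qed.

Lemma C1_bounded_opp (p q : R) (f df : R -> R) :
  C1_bounded p q f df -> C1_bounded (- q) (- p) (fun c => - f (- c)) (fun c => df (- c)).
Proof.
  intros [H1 [B [HB H2]]]. split.
  - intros c Hc. rewrite <- (Ropp_involutive (df (- c))).
    apply (is_derive_opp (fun t => f (- t))), is_derive_reflect, H1. lra.
  - exists B. split; [exact HB|]. intros c Hc. apply H2. lra.
Qed.

Lemma exp_le (x y : R) : x <= y -> exp x <= exp y.
Proof. intros [H|H]; [left; now apply exp_increasing|right; now f_equal]. Qed.

Lemma is_derive_opp_shift (f : R -> R) (x l T : R) :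
  is_derive f (x + T) l -> is_derive (fun t => - f (t + T)) x (- l).
Proof.
  intros H. apply (is_derive_opp (fun t => f (t + T))). eapply is_derive_eq.
  - apply (is_derive_comp f (fun t => t + T) x l 1); [exact H|]. auto_derive; [exact I|ring].
  - unfold scal; simpl. unfold mult; simpl. ring.
Qed.

(** * Estimates for a given solution, supersonic and sonic *)

Section Flow.
Variables (mu A1 A2 gamma alpha rho_p n_p b : R).
Hypothesis mu_pos : 0 < mu.
Hypothesis A1_pos : 0 < A1.
Hypothesis A2_pos : 0 < A2.
Hypothesis gamma_ge : 1 <= gamma.
Hypothesis alpha_ge : 1 <= alpha.
Hypothesis rho_pos : 0 < rho_p.
Hypothesis n_pos : 0 < n_p.
Hypothesis b_neg : b < 0.

Let j1 := rho_p * b.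
Let j2 := n_p * b.
Let f1 := flux j1 A1 gamma.
Let df1 := dflux j1 A1 gamma.
Let ddf1 := ddflux j1 A1 gamma.
Let dddf1 := dddflux j1 A1 gamma.
Let f2 := flux j2 A2 alpha.
Let df2 := dflux j2 A2 alpha.
Let ddf2 := ddflux j2 A2 alpha.
Let dddf2 := dddflux j2 A2 alpha.
Let K := f1 b + f2 b.
(** With [q], a window centred at [b] inside the negative half-line. *)
Let p := 3 * b / 2.
Let q := b / 2.

Let j1_neg : j1 < 0. Proof. unfold j1. nra. Qed.
Let j2_neg : j2 < 0. Proof. unfold j2. nra. Qed.
Let C3_f1 : C3_on j2 f1 df1 ddf1 dddf1. Proof. now apply C3_on_flux. Qed.
Let C3_f2 : C3_on j2 f2 df2 ddf2 dddf2. Proof. now apply C3_on_flux. Qed.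
Let C1_f1 : C1_on j2 f1 df1 := proj1 C3_f1.
Let C1_f2 : C1_on j2 f2 df2 := proj1 C3_f2.
Let neg_dom c : c < 0 -> 0 < c / j2.
Proof. intros H. now apply neg_div_pos. Qed.
Let range : p < b < q. Proof. unfold p, q. lra. Qed.
Let dom c : p <= c <= q -> 0 < c / j2.
Proof. intros H. apply neg_dom. unfold q in H. lra. Qed.
Let B1 : C1_bounded p q f1 df1 := C1_bounded_of_C1_on j2 p q f1 df1 dom (proj1 C3_f1).
Let B1' : C1_bounded p q df1 ddf1 := C1_bounded_of_C1_on j2 p q df1 ddf1 dom (proj1 (proj2 C3_f1)).
Let B1'' : C1_bounded p q ddf1 dddf1 := C1_bounded_of_C1_on j2 p q ddf1 dddf1 dom (proj2 (proj2 C3_f1)).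
Let B2 : C1_bounded p q f2 df2 := C1_bounded_of_C1_on j2 p q f2 df2 dom (proj1 C3_f2).
Let B2' : C1_bounded p q df2 ddf2 := C1_bounded_of_C1_on j2 p q df2 ddf2 dom (proj1 (proj2 C3_f2)).
Let B2'' : C1_bounded p q ddf2 dddf2 := C1_bounded_of_C1_on j2 p q ddf2 dddf2 dom (proj2 (proj2 C3_f2)).
Let rho_b : j1 / b = rho_p. Proof. unfold j1. field. lra. Qed.
Let n_b : j2 / b = n_p. Proof. unfold j2. field. lra. Qed.

Definition total_flux (c : R) : R := f1 c + f2 c.
Definition dtotal_flux (c : R) : R := df1 c + df2 c.

Lemma is_derive_total_flux c : c < 0 -> is_derive total_flux c (dtotal_flux c).
Proof.
  intros Hc. apply is_derive_plus_R; [now apply C1_f1, neg_dom|now apply C1_f2, neg_dom].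
Qed.

Lemma is_derive_dtotal_flux c : c < 0 -> is_derive dtotal_flux c (ddf1 c + ddf2 c).
Proof.
  intros Hc. apply is_derive_plus_R.
  - now apply (proj1 (proj2 C3_f1)), neg_dom.
  - now apply (proj1 (proj2 C3_f2)), neg_dom.
Qed.

Lemma ddtotal_flux_pos c : c < 0 -> 0 < ddf1 c + ddf2 c.
Proof.
  intros Hc. assert (c <> 0) by lra.
  apply Rplus_lt_0_compat; now apply ddflux_pos.
Qed.

Lemma total_flux_left c : dtotal_flux b <= 0 -> c < b -> total_flux b < total_flux c.
Proof.
  apply (convex_above_left total_flux dtotal_flux (fun c => ddf1 c + ddf2 c));
    auto using is_derive_total_flux, is_derive_dtotal_flux, ddtotal_flux_pos.
Qed.

Lemma total_flux_right c : 0 <= dtotal_flux b -> b < c < 0 -> total_flux b < total_flux c.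
Proof.
  apply (convex_above_right total_flux dtotal_flux (fun c => ddf1 c + ddf2 c));
    auto using is_derive_total_flux, is_derive_dtotal_flux, ddtotal_flux_pos.
Qed.

Definition connecting (u v y : R -> R) : Prop :=
  orbit f1 f2 mu j2 K u v y /\ u 0 = v 0 /\ is_lim u p_infty b /\ is_lim v p_infty b.

(** The signs make the orbit increasing, and an orbit increasing towards [b] starts below [b]. This
    second conclusion is what excludes data in the sonic and subsonic cases. *)
Lemma connecting_above u v y : connecting u v y -> total_flux b < total_flux (u 0) ->
  (forall x, 0 <= x -> 0 < f1 (u x) - y x /\ 0 < f2 (v x) + y x - K) /\ u 0 < b.
Proof.
  intros (O & E & L1 & L2) H.
  assert (PQ : forall x, 0 <= x -> 0 < f1 (u x) - y x /\ 0 < f2 (v x) + y x - K).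
  { apply (orbit_monotone f1 df1 f2 df2 mu j2 K b u v y); auto. unfold total_flux in H. fold K in H. lra. }
  split; [exact PQ|].
  apply (trapped_range f1 f2 mu j2 K b u v y mu_pos O L1 L2 PQ 0). lra.
Qed.

Lemma connecting_below u v y : connecting u v y -> total_flux (u 0) < total_flux b ->
  (forall x, 0 <= x -> f1 (u x) - y x < 0 /\ f2 (v x) + y x - K < 0) /\ b < u 0.
Proof.
  intros (O & E & L1 & L2) H.
  assert (O' := orbit_opp _ _ _ _ _ _ _ _ O).
  assert (L1' := is_lim_opp_finite _ _ L1). assert (L2' := is_lim_opp_finite _ _ L2).
  assert (PQ := orbit_monotone _ _ _ _ mu (- j2) (- K) (- b) _ _ _ mu_pos
    (C1_on_opp _ _ _ C1_f1) (C1_on_opp _ _ _ C1_f2) O' L1' L2').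
  cbv beta in PQ. rewrite !Ropp_involutive in PQ.
  unfold total_flux in H. fold K in H. specialize (PQ ltac:(lra) ltac:(lra)).
  assert (R0 := trapped_range _ _ mu _ _ _ _ _ _ mu_pos O' L1' L2' PQ 0 ltac:(lra)).
  split; [|lra]. intros x Hx. specialize (PQ x Hx). rewrite !Ropp_involutive in PQ. lra.
Qed.

(** Data above [b] are reduced to data below by reflection. The quantities [f1 u - y] and
    [f2 v + y - K] have the same sign, so each is bounded by their sum, which depends on the
    velocities alone. *)
Lemma supersonic_orbit : dtotal_flux b < 0 -> exists d C c, 0 < d /\ 0 < C /\ 0 < c /\
  forall u v y, connecting u v y -> 0 < Rabs (u 0 - b) < d -> forall x, 0 <= x ->
  Rabs (u x - b) <= C * (Rabs (u 0 - b) * exp (- c * x)) /\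
  Rabs (v x - b) <= C * (Rabs (u 0 - b) * exp (- c * x)) /\
  Rabs (f1 (u x) - y x) <= Rabs (f1 (u x) + f2 (v x) - K) /\
  Rabs (f2 (v x) + y x - K) <= Rabs (f1 (u x) + f2 (v x) - K).
Proof.
  intros Hs.
  destruct (supersonic_decay f1 df1 ddf1 f2 df2 ddf2 mu j2 K b p q mu_pos range dom B1 B1' B2 B2'
    eq_refl Hs) as (d1 & Ca & c1 & Hd1 & HCa & Hc1 & S1).
  destruct (supersonic_decay _ _ _ _ _ _ mu (- j2) (- K) (- b) (- q) (- p) mu_pos ltac:(lra)
    (fun c Hc => ltac:(replace (c / - j2) with (- c / j2) by (field; lra); apply dom; lra))
    (C1_bounded_opp _ _ _ _ B1) (C1_bounded_reflect _ _ _ _ B1')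
    (C1_bounded_opp _ _ _ _ B2) (C1_bounded_reflect _ _ _ _ B2')
    ltac:(cbv beta; rewrite !Ropp_involutive; unfold K; ring)
    ltac:(cbv beta; rewrite !Ropp_involutive; exact Hs)) as (d2 & Cb & c2 & Hd2 & HCb & Hc2 & S2).
  destruct (local_sign total_flux b _ (is_derive_total_flux b b_neg) Hs) as (d3 & Hd3 & S3).
  exists (Rmin d3 (Rmin d1 d2)), (Ca + Cb), (Rmin c1 c2).
  split; [repeat apply Rmin_pos; auto|]. split; [lra|]. split; [now apply Rmin_pos|].
  intros u v y Hc [Hn Hd] x Hx. set (c := Rmin c1 c2).
  assert (Rmin d3 (Rmin d1 d2) <= d3 /\ Rmin d3 (Rmin d1 d2) <= d1 /\ Rmin d3 (Rmin d1 d2) <= d2).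
  { pose proof (Rmin_l d3 (Rmin d1 d2)). pose proof (Rmin_r d3 (Rmin d1 d2)).
    pose proof (Rmin_l d1 d2). pose proof (Rmin_r d1 d2). lra. }
  assert (up : forall C' c' g, 0 < C' <= Ca + Cb -> c <= c' ->
    g <= C' * Rabs (u 0 - b) * exp (- c' * x) -> g <= (Ca + Cb) * (Rabs (u 0 - b) * exp (- c * x))).
  { intros C' c' g HC Hcc Hg. eapply Rle_trans; [exact Hg|]. rewrite Rmult_assoc.
    apply Rmult_le_compat; [lra| |lra|].
    - apply Rmult_le_pos; [apply Rabs_pos|left; apply exp_pos].
    - apply Rmult_le_compat_l; [apply Rabs_pos|]. apply exp_le. nra. }
  destruct (S3 (u 0) ltac:(lra)) as [Sl Sr].
  destruct (Rtotal_order (u 0) b) as [Hlt|[Heq|Hgt]].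
  - destruct (connecting_above u v y Hc (Sl Hlt)) as [PQ _]. destruct Hc as (O & E & L1 & L2).
    rewrite (Rabs_left (u 0 - b)) in * by lra. replace (- (u 0 - b)) with (b - u 0) in * by ring.
    destruct (S1 u v y O E ltac:(lra) L1 L2 PQ x Hx) as [H1 H2]. destruct (PQ x Hx).
    split; [|split; [|split]].
    + apply (up Ca c1); [lra|apply Rmin_l|exact H1].
    + apply (up Ca c1); [lra|apply Rmin_l|exact H2].
    + rewrite !Rabs_pos_eq by lra. lra.
    + rewrite !Rabs_pos_eq by lra. lra.
  - exfalso. rewrite Heq, Rminus_diag, Rabs_R0 in Hn. lra.
  - destruct (connecting_below u v y Hc (Sr Hgt)) as [PQ _]. destruct Hc as (O & E & L1 & L2).
    rewrite (Rabs_pos_eq (u 0 - b)) in * by lra.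
    destruct (S2 _ _ _ (orbit_opp _ _ _ _ _ _ _ _ O) ltac:(lra) ltac:(lra)
      (is_lim_opp_finite _ _ L1) (is_lim_opp_finite _ _ L2)) with (x := x) as [H1 H2]; [|exact Hx|].
    { intros t Ht. cbv beta. rewrite !Ropp_involutive. specialize (PQ t Ht). lra. }
    destruct (PQ x Hx). rewrite <- (Rabs_Ropp (u x - b)), <- (Rabs_Ropp (v x - b)).
    replace (- (u x - b)) with (- u x - - b) by ring. replace (- (v x - b)) with (- v x - - b) by ring.
    replace (- b - - u 0) with (u 0 - b) in H1, H2 by ring.
    split; [|split; [|split]].
    + apply (up Cb c2); [lra|apply Rmin_r|exact H1].
    + apply (up Cb c2); [lra|apply Rmin_r|exact H2].
    + rewrite !Rabs_left by lra. lra.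
    + rewrite !Rabs_left by lra. lra.
Qed.

Lemma supersonic_profile : dtotal_flux b < 0 -> exists d C c, 0 < d /\ 0 < C /\ 0 < c /\
  forall w u v y, connecting u v y -> carried j1 j2 w u v -> 0 < Rabs (u 0 - b) < d ->
  exp_decay rho_p n_p b C c (Rabs (u 0 - b)) w.
Proof.
  intros Hs. destruct (supersonic_orbit Hs) as (d0 & C0 & c & Hd0 & HC0 & Hc & S).
  destruct (lipschitz_bound p q f1 df1 B1) as [L1 [HL1 HL1']].
  destruct (lipschitz_bound p q f2 df2 B2) as [L2 [HL2 HL2']].
  set (C := C0 * (1 + L1 + L2)).
  assert (HC : C0 <= C /\ 0 < C) by (unfold C; split; nra).
  destruct (jets_bound f1 df1 ddf1 dddf1 f2 df2 ddf2 dddf2 mu j2 K b p q C B1' B1'' B2' B2''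
    ltac:(unfold q; lra) (proj2 HC)) as [A [HA J]].
  destruct (dev_bound j1 f1 df1 ddf1 dddf1 f2 df2 ddf2 dddf2 mu j2 K b C3_f1 C3_f2 q A
    ltac:(unfold q; lra) ltac:(lra) HA) as [D [HD HDv]].
  (* Keeps [C0 delta] below [- b / 2], so that the velocities stay in the window. *)
  set (r := - b / 2 / C0). assert (Hr : 0 < r) by (unfold r; apply Rdiv_lt_0_compat; lra).
  exists (Rmin d0 (Rmin 1 r)), (D * (A + C)), c.
  split; [repeat apply Rmin_pos; lra|]. split; [nra|]. split; [exact Hc|].
  intros w u v y Hcon Hw [Hn Hd]. set (delta := Rabs (u 0 - b)) in *.
  assert (Hdel : delta < d0 /\ delta < 1 /\ delta < r).
  { pose proof (Rmin_l d0 (Rmin 1 r)). pose proof (Rmin_r d0 (Rmin 1 r)).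
    pose proof (Rmin_l 1 r). pose proof (Rmin_r 1 r). lra. }
  assert (O := proj1 Hcon).
  destruct (HDv w u v y O Hw) as [Hup Hdev].
  split; [exact Hup|]. intros k x Hk Hx.
  destruct (S u v y Hcon ltac:(fold delta; lra) x ltac:(lra)) as (Su & Sv & SP & SQ). fold delta in Su, Sv.
  set (e := delta * exp (- c * x)) in *.
  assert (Hex : 0 < exp (- c * x) <= 1).
  { split; [apply exp_pos|]. rewrite <- exp_0. apply exp_le. nra. }
  assert (He : 0 <= e <= 1 /\ e <= delta) by (unfold e; nra).
  assert (Hr' : C0 * e <= - b / 2).
  { apply Rle_trans with (C0 * r); [apply Rmult_le_compat_l; lra|]. unfold r. apply Req_le. field. lra. }
  assert (Ru : p <= u x <= q) by (unfold p, q; apply Rabs_le_between in Su; lra).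
  assert (Rv : p <= v x <= q) by (unfold p, q; apply Rabs_le_between in Sv; lra).
  assert (HF : Rabs (f1 (u x) + f2 (v x) - K) <= C * e).
  { replace (f1 (u x) + f2 (v x) - K) with ((f1 (u x) - f1 b) + (f2 (v x) - f2 b)) by (unfold K; ring).
    specialize (HL1' b (u x) ltac:(lra) Ru). specialize (HL2' b (v x) ltac:(lra) Rv).
    eapply Rle_trans; [apply Rabs_triang|]. unfold C. nra. }
  assert (HCe : C0 * e <= C * e) by (apply Rmult_le_compat_r; lra).
  destruct (J e (u x) (v x) (y x) (proj1 He) Ru Rv ltac:(lra) ltac:(lra) ltac:(lra) ltac:(lra))
    as (U1 & V1 & U2 & V2 & U3 & V3).
  assert (HAe : (A * e) ^ 2 <= A * (A * e) /\ A * e * (A * e) <= A * (A * e)).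
  { assert (0 <= A * A * e) by (apply Rmult_le_pos; nra). split; nra. }
  destruct (Hdev x Hx ltac:(lra) ltac:(lra)) as (_ & _ & Hk').
  destruct (Hk' (C * e) (A * e) (A * e) (A * e)) as (D0 & D1 & D2 & D3); try tauto; try lra.
  rewrite rho_b, n_b in *.
  assert (E0 : D * (C * e) <= D * (A + C) * delta * exp (- c * x)).
  { replace (D * (A + C) * delta * exp (- c * x)) with (D * ((A + C) * e)) by (unfold e; ring).
    apply Rmult_le_compat_l; nra. }
  assert (E1 : D * (A * e) <= D * (A + C) * delta * exp (- c * x)).
  { replace (D * (A + C) * delta * exp (- c * x)) with (D * ((A + C) * e)) by (unfold e; ring).
    apply Rmult_le_compat_l; nra. }
  destruct k as [|[|[|[|k]]]]; [lra|lra|lra|lra|lia].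
Qed.

Let U1 (u v y : R -> R) (x : R) : R := ju1 f1 mu (u x) (v x) (y x).
Let V1 (u v y : R -> R) (x : R) : R := jv1 f2 j2 K (u x) (v x) (y x).
Let U2 (u v y : R -> R) (x : R) : R := ju2 f1 df1 mu j2 (u x) (v x) (y x).
Let V2 (u v y : R -> R) (x : R) : R := jv2 f2 df2 j2 K (u x) (v x) (y x).
Let U3 (u v y : R -> R) (x : R) : R := ju3 f1 df1 ddf1 f2 mu j2 K (u x) (v x) (y x).
Let V3 (u v y : R -> R) (x : R) : R := jv3 f1 f2 df2 ddf2 mu j2 K (u x) (v x) (y x).

Lemma sonic_orbit : dtotal_flux b = 0 -> exists d C kap a, 0 < d <= 1 /\ 1 <= C /\ 0 < kap /\ 0 < a /\
  forall u v y, connecting u v y -> 0 < b - u 0 < d -> forall x, 0 <= x ->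
  let z := b - u x in let h := hyp_rate (b - u 0) x in
  let e := (b - u 0) ^ 2 * exp (- kap * x) in
  0 < z <= 1 /\ v x <= b /\ h <= C * z /\ z <= C * h /\ Rabs (v x - b) <= C * z /\
  Rabs (U1 u v y x) <= C * z ^ 2 /\ Rabs (V1 u v y x) <= C * z ^ 2 /\
  Rabs (U1 u v y x - a * z ^ 2) <= C * (z ^ 3 + e) /\ Rabs (V1 u v y x - a * z ^ 2) <= C * (z ^ 3 + e) /\
  Rabs (U2 u v y x) <= C * (z ^ 3 + e) /\ Rabs (V2 u v y x) <= C * (z ^ 3 + e) /\
  Rabs (U3 u v y x) <= C * (z ^ 4 + e) /\ Rabs (V3 u v y x) <= C * (z ^ 4 + e).
Proof.
  intros Hs.
  destruct (sonic_estimates f1 df1 ddf1 dddf1 f2 df2 ddf2 dddf2 mu j2 K b p q mu_pos C3_f1 C3_f2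
    range dom eq_refl Hs (ddtotal_flux_pos b b_neg)) as (d0 & C & kap & a & Hd0 & Hd1 & HC & Hk & Ha & S).
  exists (Rmin d0 (- b / 2)), (1 + C), kap, a.
  pose proof (Rmin_l d0 (- b / 2)). pose proof (Rmin_r d0 (- b / 2)).
  split; [split; [apply Rmin_pos|]; lra|]. split; [lra|]. split; [exact Hk|]. split; [exact Ha|].
  intros u v y Hc Hd x Hx z h e.
  assert (Ht : near f1 f2 mu j2 K b p d0 (Point u v y x)).
  { destruct (connecting_above u v y Hc) as [PQ _]; [apply total_flux_left; lra|].
    destruct Hc as (O & E & L1 & L2). unfold near; simpl.
    split; [exact O|]. split; [exact E|]. split; [lra|]. split; [unfold p; lra|].
    split; [exact L1|]. split; [exact L2|]. split; [exact PQ|exact Hx]. }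
  destruct (near_range f1 f2 mu j2 K b p mu_pos d0 _ Ht) as (R1 & _ & _ & _ & _ & _ & _ & R2 & _).
  change (at_ (jz b) (Point u v y x)) with z in R1. simpl in R2.
  assert (T := S _ Ht). cbv zeta in T.
  change (at_ (jz b) (Point u v y x)) with z in T.
  change (rate b (Point u v y x)) with h in T.
  change ((b - tu (Point u v y x) 0) ^ 2 * exp (- kap * tx (Point u v y x))) with e in T.
  change (tv (Point u v y x) (tx (Point u v y x))) with (v x) in T.
  change (at_ (ju1 f1 mu) (Point u v y x)) with (U1 u v y x) in T.
  change (at_ (jv1 f2 j2 K) (Point u v y x)) with (V1 u v y x) in T.
  change (at_ (ju2 f1 df1 mu j2) (Point u v y x)) with (U2 u v y x) in T.
  change (at_ (jv2 f2 df2 j2 K) (Point u v y x)) with (V2 u v y x) in T.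
  change (at_ (ju3 f1 df1 ddf1 f2 mu j2 K) (Point u v y x)) with (U3 u v y x) in T.
  change (at_ (jv3 f1 f2 df2 ddf2 mu j2 K) (Point u v y x)) with (V3 u v y x) in T.
  destruct T as (T0 & T1 & T2 & T3 & T4 & T5 & T6 & T7 & T8 & T9 & T10 & T11).
  assert (He : 0 <= e) by (unfold e; apply Rmult_le_pos; [apply pow_le; lra|left; apply exp_pos]).
  assert (Hh : 0 < h) by (apply hyp_rate_range; lra).
  assert (Hz2 : 0 < z ^ 2) by now apply pow_lt. assert (Hz3 : 0 < z ^ 3) by now apply pow_lt.
  assert (Hz4 : 0 < z ^ 4) by now apply pow_lt.
  repeat split; lra.
Qed.

(** Orders 0 and 1 see no layer, as [u'] and [v'] are [O(z^2)]; hence a constant uniform in the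
    datum. Orders 2 and 3 and the expansion of the velocities do see it, and there [L] depends on
    the datum. The bounds on [sigma] stay uniform because its argument is shifted past the layer. *)
Lemma sonic_deviation : dtotal_flux b = 0 -> exists d C a, 0 < d <= 1 /\ 0 < C /\ 0 < a /\
  forall w u v y, connecting u v y -> carried j1 j2 w u v -> 0 < b - u 0 < d ->
  alg_decay 1 rho_p n_p b C (b - u 0) w /\
  (exists L, 0 < L /\ alg_decay 3 rho_p n_p b L (b - u 0) w /\
     forall x, 0 < x ->
       Rabs (Derive (pu w) x - a * (b - u (x + / (b - u 0))) ^ 2) <= L * Rabs (b - u (x + / (b - u 0))) ^ 3 /\
       Rabs (Derive (pv w) x - a * (b - u (x + / (b - u 0))) ^ 2) <= L * Rabs (b - u (x + / (b - u 0))) ^ 3) /\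
  sigma_profile a (/ C) C (b - u 0) (fun x => b - u (x + / (b - u 0))).
Proof.
  intros Hs.
  destruct (sonic_orbit Hs) as (d & C & kap & a & Hd & HC & Hk & Ha & S).
  (* Increasing orbits stay below [b], so [b] itself serves as the upper bound of the velocities. *)
  destruct (dev_bound j1 f1 df1 ddf1 dddf1 f2 df2 ddf2 dddf2 mu j2 K b C3_f1 C3_f2 b C
    b_neg (Rle_refl b) ltac:(lra)) as [D [HD HDv]].
  set (k0 := (1 + 4 / kap) ^ 4).
  assert (Hk0 : 0 < k0).
  { apply pow_lt. apply Rplus_lt_0_compat; [lra|]. apply Rdiv_lt_0_compat; lra. }
  set (Lam := 4 / kap ^ 2 * k0).
  assert (HLam : 0 < Lam).
  { apply Rmult_lt_0_compat; [|exact Hk0]. apply Rdiv_lt_0_compat; [lra|now apply pow_lt]. }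
  assert (HC2 : 1 <= C ^ 2) by now apply pow_R1_Rle.
  assert (HC3 : 1 <= C ^ 3) by now apply pow_R1_Rle.
  assert (HC4 : 1 <= C ^ 4) by now apply pow_R1_Rle.
  (* [Cd] bounds the deviation of orders 0 and 1, [Cs] everything about [sigma]; both are fixed
     before the datum, as the quantifiers demand. *)
  set (Cd := D * ((1 + C) * C + C * C ^ 2)).
  set (Cs := 2 * C + C * (1 + Lam * (8 * C ^ 3)) + C * C ^ 2 + C * (C ^ 3 + Lam) + C * (C ^ 4 + Lam)).
  assert (HCd : 0 < Cd) by (unfold Cd; apply Rmult_lt_0_compat; nra).
  assert (Q1 : 0 < C * (1 + Lam * (8 * C ^ 3))) by (apply Rmult_lt_0_compat; nra).
  assert (Q2 : 0 < C * (C ^ 3 + Lam)) by (apply Rmult_lt_0_compat; nra).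
  assert (Q3 : 0 < C * (C ^ 4 + Lam)) by (apply Rmult_lt_0_compat; nra).
  assert (Q4 : 0 < C * C ^ 2) by (apply Rmult_lt_0_compat; nra).
  assert (HCs : 2 * C <= Cs) by (unfold Cs; lra).
  exists d, (Cd + Cs), a. split; [exact Hd|]. split; [lra|]. split; [exact Ha|].
  intros w u v y Hcon Hw Hdel. set (delta := b - u 0) in *.
  assert (Hdi : 0 < / delta) by (apply Rinv_0_lt_compat; lra).
  specialize (S u v y Hcon Hdel). fold delta in S.
  assert (O := proj1 Hcon).
  destruct (HDv w u v y O Hw) as [Hup Hdev]. rewrite rho_b, n_b in Hdev.
  assert (Hh : forall x, 0 <= x -> 0 < hyp_rate delta x <= 1).
  { intros x Hx. pose proof (hyp_rate_range delta x ltac:(lra) Hx). lra. }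
  (* The price of absorbing the layer without a shift: [delta^2 exp (- kap x)] is bounded by the
     fourth power of the rate only with the factor [k0 / delta^2]. *)
  set (Ld := k0 / delta ^ 2).
  assert (HLd : 0 < Ld) by (apply Rdiv_lt_0_compat; [exact Hk0|apply pow_lt; lra]).
  assert (Hlayer : forall x, 0 <= x -> delta ^ 2 * exp (- kap * x) <= Ld * hyp_rate delta x ^ 4).
  { intros x Hx. assert (H := exp_layer_rate kap delta x Hk ltac:(lra) Hx). fold k0 in H.
    assert (Hd2 : 0 < delta ^ 2) by (apply pow_lt; lra).
    apply (Rmult_le_reg_l (delta ^ 2)); [exact Hd2|].
    replace (delta ^ 2 * (Ld * hyp_rate delta x ^ 4)) with (k0 * hyp_rate delta x ^ 4)
      by (unfold Ld; field; lra).
    replace (delta ^ 2 * (delta ^ 2 * exp (- kap * x))) with (delta ^ 4 * exp (- kap * x)) by ring.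
    exact H. }
  assert (pw : forall z h n, 0 < z -> z <= C * h -> z ^ n <= C ^ n * h ^ n).
  { intros z h n Hz Hzh. rewrite <- Rpow_mult_distr. apply pow_incr. lra. }
  assert (h43 : forall x, 0 <= x -> hyp_rate delta x ^ 4 <= hyp_rate delta x ^ 3 /\ 0 < hyp_rate delta x ^ 4
    /\ 0 < hyp_rate delta x ^ 3 /\ 0 < hyp_rate delta x ^ 2).
  { intros x Hx. specialize (Hh x Hx). assert (0 < hyp_rate delta x ^ 3) by (apply pow_lt; lra).
    assert (0 < hyp_rate delta x ^ 2) by (apply pow_lt; lra).
    replace (hyp_rate delta x ^ 4) with (hyp_rate delta x * hyp_rate delta x ^ 3) by ring.
    repeat split; nra. }
  assert (dev_all : forall x, 0 < x -> let h := hyp_rate delta x in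
    dev rho_p n_p b w 0 x <= Cd * h /\ dev rho_p n_p b w 1 x <= Cd * h ^ 2 /\
    dev rho_p n_p b w 2 x <= D * (C * (C ^ 3 + Ld)) * h ^ 3 /\
    dev rho_p n_p b w 3 x <= D * (C * (C ^ 4 + Ld)) * h ^ 4).
  { intros x Hx h. destruct (S x ltac:(lra)) as (Hz & Hv & T1 & T2 & T3 & T4 & T5 & _ & _ & T8 & T9 & T10 & T11).
    fold h in T1, T2. set (z := b - u x) in *. set (e := delta ^ 2 * exp (- kap * x)) in *.
    assert (He : e <= Ld * h ^ 4) by (apply Hlayer; lra).
    assert (He0 : 0 <= e) by (unfold e; apply Rmult_le_pos; [apply pow_le; lra|left; apply exp_pos]).
    destruct (h43 x ltac:(lra)) as (h1 & h2 & h3 & h4). fold h in h1, h2, h3, h4.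
    specialize (Hh x ltac:(lra)). fold h in Hh.
    destruct (Hdev x Hx ltac:(unfold z in Hz; lra) Hv) as (_ & _ & Hk').
    assert (Z2 : 0 < z ^ 2) by (apply pow_lt; lra). assert (Z3 : 0 < z ^ 3) by (apply pow_lt; lra).
    assert (Z4 : 0 < z ^ 4) by (apply pow_lt; lra).
    destruct (Hk' ((1 + C) * z) (C * z ^ 2) (C * (z ^ 3 + e)) (C * (z ^ 4 + e))) as (D0 & D1 & D2 & D3);
      auto.
    - replace (u x - b) with (- z) by (unfold z; ring). rewrite Rabs_Ropp, Rabs_pos_eq by lra. nra.
    - lra.
    - assert (z ^ 4 <= z ^ 3) by (replace (z ^ 4) with (z * z ^ 3) by ring; nra).
      replace ((C * z ^ 2) ^ 2) with (C * C * z ^ 4) by ring.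
      replace (C * (C * (z ^ 3 + e))) with (C * C * (z ^ 3 + e)) by ring.
      apply Rmult_le_compat_l; [nra|lra].
    - replace (C * z ^ 2 * (C * (z ^ 3 + e))) with (C * C * (z * z ^ 4 + z ^ 2 * e)) by ring.
      replace (C * (C * (z ^ 4 + e))) with (C * C * (z ^ 4 + e)) by ring.
      assert (z ^ 2 <= 1) by (replace (z ^ 2) with (z * z) by ring; nra).
      apply Rmult_le_compat_l; [nra|]. apply Rplus_le_compat; nra.
    - assert (P2 := pw z h 2%nat ltac:(lra) T2). assert (P3 := pw z h 3%nat ltac:(lra) T2).
      assert (P4 := pw z h 4%nat ltac:(lra) T2).
      split; [|split; [|split]].
      + eapply Rle_trans; [exact D0|]. unfold Cd. rewrite Rmult_assoc. apply Rmult_le_compat_l; [lra|].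
        assert ((1 + C) * z <= (1 + C) * (C * h)) by (apply Rmult_le_compat_l; lra). nra.
      + eapply Rle_trans; [exact D1|]. unfold Cd. rewrite Rmult_assoc. apply Rmult_le_compat_l; [lra|].
        assert (C * z ^ 2 <= C * (C ^ 2 * h ^ 2)) by (apply Rmult_le_compat_l; lra).
        assert (0 <= (1 + C) * C * h ^ 2) by (apply Rmult_le_pos; nra). lra.
      + eapply Rle_trans; [exact D2|]. rewrite !Rmult_assoc. apply Rmult_le_compat_l; [lra|].
        apply Rmult_le_compat_l; [lra|].
        assert (Ld * h ^ 4 <= Ld * h ^ 3) by (apply Rmult_le_compat_l; lra). lra.
      + eapply Rle_trans; [exact D3|]. rewrite !Rmult_assoc. apply Rmult_le_compat_l; [lra|].
        apply Rmult_le_compat_l; [lra|]. lra. }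
  assert (Hden : forall x, 0 < x -> 0 < 1 + delta * x) by (intros; nra).
  set (T := / delta) in *. set (sigma := fun x => b - u (x + T)).
  assert (sig : forall x, 0 <= x -> let h := hyp_rate delta x in let e := delta ^ 2 * exp (- kap * (x + T)) in
    0 < sigma x <= 1 /\ h <= 2 * C * sigma x /\ sigma x <= C * h /\ 0 <= e <= Lam * h ^ 4 /\
    h ^ 3 <= 8 * C ^ 3 * sigma x ^ 3).
  { intros x Hx h e. destruct (S (x + T) ltac:(lra)) as (Hz & _ & T1 & T2 & _).
    fold (sigma x) in Hz, T1, T2.
    destruct (hyp_rate_shift delta x ltac:(lra) Hx) as [h1 h2]. fold T h in h1, h2.
    assert (H1 : h <= 2 * C * sigma x) by lra.
    split; [exact Hz|]. split; [exact H1|]. split; [nra|]. split; [split|].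
    - unfold e. apply Rmult_le_pos; [apply pow_le; lra|left; apply exp_pos].
    - exact (exp_layer_shift kap delta x Hk ltac:(lra) Hx).
    - replace (8 * C ^ 3 * sigma x ^ 3) with ((2 * C * sigma x) ^ 3) by ring.
      apply pow_incr. specialize (Hh x Hx). fold h in Hh. lra. }
  split; [|split].
  - split; [intros k x Hk1 Hx; apply Hup; [lia|exact Hx]|]. intros k x Hk1 Hx.
    rewrite alg_rate_pow by auto. destruct (dev_all x Hx) as (D0 & D1 & _).
    destruct (h43 x ltac:(lra)) as (h1 & h2 & h3 & h4). specialize (Hh x ltac:(lra)).
    destruct k as [|[|k]]; [| |lia]; simpl Nat.add.
    + rewrite pow_1. nra.
    + nra.
  - set (L1 := D * (C * (C ^ 3 + Ld))). set (L2 := D * (C * (C ^ 4 + Ld))).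
    set (M := C * (C ^ 3 + Ld) + a * (2 * C ^ 4 * T)).
    assert (HL1 : 0 < L1) by (unfold L1; repeat apply Rmult_lt_0_compat; lra).
    assert (HL2 : 0 < L2) by (unfold L2; repeat apply Rmult_lt_0_compat; lra).
    assert (HM : 0 < M) by (unfold M; apply Rplus_lt_0_compat; repeat apply Rmult_lt_0_compat; lra).
    assert (HM8 : 0 < M * (8 * C ^ 3)) by (repeat apply Rmult_lt_0_compat; lra).
    exists (Cd + L1 + L2 + M * (8 * C ^ 3)). split; [lra|]. split.
    + split; [exact Hup|]. intros k x Hk1 Hx. rewrite alg_rate_pow by auto.
      destruct (dev_all x Hx) as (D0 & D1 & D2 & D3).
      destruct (h43 x ltac:(lra)) as (h1 & h2 & h3 & h4). specialize (Hh x ltac:(lra)).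
      assert (up : forall c s g, 0 <= g -> c <= Cd + L1 + L2 + M * (8 * C ^ 3) -> s <= c * g ->
        s <= (Cd + L1 + L2 + M * (8 * C ^ 3)) * g).
      { intros c s g Hg Hc Hsg. eapply Rle_trans; [exact Hsg|]. now apply Rmult_le_compat_r. }
      destruct k as [|[|[|[|k]]]]; [| | | |lia]; simpl Nat.add.
      * rewrite pow_1. apply (up Cd); lra.
      * apply (up Cd); lra.
      * apply (up L1); [lra|lra|exact D2].
      * apply (up L2); [lra|lra|exact D3].
    + intros x Hx. fold (sigma x). set (h := hyp_rate delta x).
      destruct (sig x ltac:(lra)) as (G1 & G2 & G3 & _ & G5). fold h in G2, G3, G5.
      destruct (S x ltac:(lra)) as (Hz & Hv & T1 & T2 & _ & _ & _ & T6 & T7 & _).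
      fold h in T1, T2. set (z := b - u x) in *. set (e := delta ^ 2 * exp (- kap * x)) in *.
      assert (He : e <= Ld * h ^ 4) by (apply Hlayer; lra).
      destruct (h43 x ltac:(lra)) as (h1 & h2 & h3 & h4). fold h in h1, h2, h3, h4.
      specialize (Hh x ltac:(lra)). fold h in Hh.
      destruct (Hdev x Hx ltac:(unfold z in Hz; lra) Hv) as (E1 & E2 & _).
      (* [z] and [sigma] differ by an increment of [u] over the length [1 / delta]; as
         [u' = O(h^2)], this is of second order in [h], with a constant depending on [delta]. *)
      assert (Hinc : Rabs (z - sigma x) <= C * (C ^ 2 * h ^ 2) * T).
      { destruct (mean_value_open u (U1 u v y) x (x + T) ltac:(lra)) as [s [Hs' Es]].
        - intros t Ht. eapply orbit_is_derive; eauto. lra.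
        - intros t Ht. apply (orbit_cu (O (t + 1) ltac:(lra))). lra.
        - replace (z - sigma x) with (U1 u v y s * T)
            by (unfold z, sigma; replace (x + T - x) with T in Es by ring; lra).
          rewrite Rabs_mult, (Rabs_pos_eq T) by lra. apply Rmult_le_compat_r; [lra|].
          destruct (S s ltac:(lra)) as (Hzs & _ & _ & T2s & _ & T4s & _).
          eapply Rle_trans; [exact T4s|]. apply Rmult_le_compat_l; [lra|].
          apply pw; [lra|]. eapply Rle_trans; [exact T2s|]. apply Rmult_le_compat_l; [lra|].
          apply hyp_rate_decreasing; lra. }
      assert (Hsq : Rabs (z ^ 2 - sigma x ^ 2) <= 2 * C ^ 4 * T * h ^ 3).
      { replace (z ^ 2 - sigma x ^ 2) with ((z - sigma x) * (z + sigma x)) by ring.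
        replace (2 * C ^ 4 * T * h ^ 3) with (C * (C ^ 2 * h ^ 2) * T * (2 * (C * h))) by ring.
        apply Rabs_mult_le; [exact Hinc|]. rewrite Rabs_pos_eq; lra. }
      assert (P3 := pw z h 3%nat ltac:(lra) T2).
      assert (Hz3 : C * (z ^ 3 + e) <= C * (C ^ 3 + Ld) * h ^ 3).
      { rewrite Rmult_assoc. apply Rmult_le_compat_l; [lra|].
        assert (Ld * h ^ 4 <= Ld * h ^ 3) by (apply Rmult_le_compat_l; lra). lra. }
      assert (fin : forall g, Rabs (g - a * z ^ 2) <= C * (z ^ 3 + e) ->
        Rabs (g - a * sigma x ^ 2) <= (Cd + L1 + L2 + M * (8 * C ^ 3)) * Rabs (sigma x) ^ 3).
      { intros g Hg. rewrite (Rabs_pos_eq (sigma x)) by lra.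
        assert (Hs3 : 0 < sigma x ^ 3) by (apply pow_lt; lra).
        apply Rle_trans with (M * h ^ 3).
        - replace (g - a * sigma x ^ 2) with ((g - a * z ^ 2) + a * (z ^ 2 - sigma x ^ 2)) by ring.
          replace (M * h ^ 3) with (C * (C ^ 3 + Ld) * h ^ 3 + a * (2 * C ^ 4 * T * h ^ 3)) by (unfold M; ring).
          apply Rabs_plus_le; [lra|]. rewrite Rabs_mult, (Rabs_pos_eq a) by lra.
          apply Rmult_le_compat_l; lra.
        - apply Rle_trans with (M * (8 * C ^ 3 * sigma x ^ 3)); [apply Rmult_le_compat_l; lra|].
          rewrite <- Rmult_assoc. apply Rmult_le_compat_r; lra. }
      split; [rewrite E1; apply fin; exact T6|rewrite E2; apply fin; exact T7].
  - assert (Du : forall x, 0 < x -> is_derive sigma x (- U1 u v y (x + T))).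
    { intros x Hx. apply (is_derive_ext_R (fun t => b + - u (t + T))); [intros; unfold sigma; ring|].
      rewrite <- (Rplus_0_l (- U1 u v y (x + T))).
      apply (is_derive_plus_R (fun _ => b)); [apply @is_derive_const|].
      apply is_derive_opp_shift. apply (orbit_is_derive f1 f2 mu j2 K u v y O). lra. }
    assert (Du1 : forall x, 0 < x -> is_derive (fun x => - U1 u v y (x + T)) x (- U2 u v y (x + T))).
    { intros x Hx. apply (is_derive_opp_shift (U1 u v y)).
      apply (is_derive_ju1 f1 df1 f2 mu j2 K C1_f1 u v y O). lra. }
    assert (Du2 : forall x, 0 < x -> is_derive (fun x => - U2 u v y (x + T)) x (- U3 u v y (x + T))).
    { intros x Hx. apply (is_derive_opp_shift (U2 u v y)).
      apply (is_derive_ju2 f1 df1 ddf1 f2 mu j2 K C1_f1 (proj1 (proj2 C3_f1)) u v y O). lra. }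
    assert (Ch := Derive_n_chain sigma sigma _ _ _ 0 (fun _ _ => eq_refl) Du Du1 Du2).
    split.
    + apply smooth_ex_derive_n. intros k.
      apply (smooth_ext k (fun x => b + -1 * u (x + T))); [intros; unfold sigma; ring|].
      apply smooth_plus; [apply smooth_const|]. apply smooth_mult; [apply smooth_const|].
      apply smooth_shift; [lra|]. apply (smooth_orbit _ _ _ _ _ _ _ _ _ _ _ k mu_pos j1_neg j2_neg O).
    + intros x Hx. destruct (Ch x Hx) as (_ & _ & E1 & E2 & E3).
      destruct (sig x ltac:(lra)) as (G1 & G2 & G3 & G4 & G5).
      destruct (S (x + T) ltac:(lra)) as (_ & _ & _ & _ & _ & T4 & _ & T6 & _ & T8 & _ & T10 & _).
      fold (sigma x) in T4, T6, T8, T10. set (h := hyp_rate delta x) in *.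
      set (e := delta ^ 2 * exp (- kap * (x + T))) in *.
      destruct (h43 x ltac:(lra)) as (h1 & h2 & h3 & h4). fold h in h1, h2, h3, h4.
      specialize (Hh x ltac:(lra)). fold h in Hh.
      assert (P2 := pw (sigma x) h 2%nat ltac:(lra) G3). assert (P3 := pw (sigma x) h 3%nat ltac:(lra) G3).
      assert (P4 := pw (sigma x) h 4%nat ltac:(lra) G3).
      assert (He3 : e <= Lam * h ^ 3) by (eapply Rle_trans; [apply G4|]; apply Rmult_le_compat_l; lra).
      assert (Hs3 : 0 < sigma x ^ 3) by (apply pow_lt; lra).
      assert (up : forall c s g, 0 <= g -> c <= Cs -> s <= c * g -> s <= (Cd + Cs) * g).
      { intros c s g Hg Hc Hsg. eapply Rle_trans; [exact Hsg|]. apply Rmult_le_compat_r; lra. }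
      split; [|split].
      * replace (Derive sigma x) with (- U1 u v y (x + T)) by (symmetry; now apply is_derive_unique, Du).
        replace (- U1 u v y (x + T) + a * sigma x ^ 2) with (- (U1 u v y (x + T) - a * sigma x ^ 2)) by ring.
        rewrite Rabs_Ropp, (Rabs_pos_eq (sigma x)) by lra.
        apply (up (C * (1 + Lam * (8 * C ^ 3)))); [lra|unfold Cs; lra|].
        eapply Rle_trans; [exact T6|]. rewrite Rmult_assoc. apply Rmult_le_compat_l; [lra|].
        assert (Lam * h ^ 3 <= Lam * (8 * C ^ 3 * sigma x ^ 3)) by (apply Rmult_le_compat_l; lra). lra.
      * fold (hyp_rate delta x). fold h. split.
        -- apply (Rmult_le_reg_l (Cd + Cs)); [lra|]. rewrite <- Rmult_assoc, Rinv_r, Rmult_1_l by lra. nra.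
        -- apply (up C); [lra|unfold Cs; lra|exact G3].
      * intros k Hk1. rewrite alg_rate_pow by auto. fold h.
        rewrite <- (Derive_n_ext (fun y => sigma y - 0) sigma k x) by (intros; ring).
        destruct k as [|[|[|[|k]]]]; [| | | |lia]; simpl Nat.add.
        -- change (Derive_n (fun y => sigma y - 0) 0 x) with (sigma x - 0).
           rewrite Rminus_0_r, pow_1, Rabs_pos_eq by lra. apply (up C); [lra|unfold Cs; lra|exact G3].
        -- rewrite E1, Rabs_Ropp. apply (up (C * C ^ 2)); [lra|unfold Cs; lra|].
           eapply Rle_trans; [exact T4|]. rewrite Rmult_assoc. apply Rmult_le_compat_l; lra.
        -- rewrite E2, Rabs_Ropp. apply (up (C * (C ^ 3 + Lam))); [lra|unfold Cs; lra|].
           eapply Rle_trans; [exact T8|]. rewrite Rmult_assoc. apply Rmult_le_compat_l; lra.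
        -- rewrite E3, Rabs_Ropp. apply (up (C * (C ^ 4 + Lam))); [lra|unfold Cs; lra|].
           eapply Rle_trans; [exact T10|]. rewrite Rmult_assoc. apply Rmult_le_compat_l; lra.
Qed.

End Flow.

(** * Solvability, uniqueness and the Mach number *)

Section Existence.
Variables (mu A1 A2 gamma alpha rho_p n_p b : R).
Hypothesis mu_pos : 0 < mu.
Hypothesis A1_pos : 0 < A1.
Hypothesis A2_pos : 0 < A2.
Hypothesis gamma_ge : 1 <= gamma.
Hypothesis alpha_ge : 1 <= alpha.
Hypothesis rho_pos : 0 < rho_p.
Hypothesis n_pos : 0 < n_p.
Hypothesis b_neg : b < 0.

Let solves := strong_solution mu A1 A2 gamma alpha rho_p n_p b.
Let j1 := rho_p * b.
Let j2 := n_p * b.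
Let f1 := flux j1 A1 gamma.
Let df1 := dflux j1 A1 gamma.
Let f2 := flux j2 A2 alpha.
Let df2 := dflux j2 A2 alpha.
Let F := total_flux A1 A2 gamma alpha rho_p n_p b.
Let dF := dtotal_flux A1 A2 gamma alpha rho_p n_p b b.
Let conn := connecting mu A1 A2 gamma alpha rho_p n_p b.

Let j1_neg : j1 < 0. Proof. unfold j1. nra. Qed.
Let j2_neg : j2 < 0. Proof. unfold j2. nra. Qed.
Let C1_f1 : C1_on j2 f1 df1. Proof. now apply C1_on_flux. Qed.
Let C1_f2 : C1_on j2 f2 df2. Proof. now apply C1_on_flux. Qed.

Lemma connecting_of_solution u_m w : u_m < 0 -> solves u_m w ->
  exists u v y, conn u v y /\ carried j1 j2 w u v /\ u 0 = u_m.
Proof.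
  intros Hm Hw.
  destruct (orbit_of_solution mu A1 A2 gamma alpha rho_p n_p b mu_pos rho_pos n_pos b_neg u_m w Hm Hw)
    as (u & v & y & O & Eu & Ev & L1 & L2 & R). exists u, v, y.
  split; [|split; [exact R|exact Eu]].
  split; [exact O|]. split; [congruence|]. split; assumption.
Qed.

(** Exchanging the two solutions, if necessary, gives the order of the values [y 0] under which
    orbits were shown to coincide. *)
Lemma solution_unique u_m w w' : u_m < 0 -> solves u_m w -> solves u_m w' -> profile_eq w' w.
Proof.
  intros Hm Hw Hw'.
  destruct (connecting_of_solution u_m w Hm Hw) as (u & v & y & (O & E & L1 & L2) & R & E0).
  destruct (connecting_of_solution u_m w' Hm Hw') as (u' & v' & y' & (O' & E' & L1' & L2') & R' & E0').
  assert (Hb : 0 < b / j2) by now apply neg_div_pos.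
  assert (H : forall x, 0 <= x -> u x = u' x /\ v x = v' x).
  { intros x Hx. destruct (Rle_or_lt (y' 0) (y 0)) as [Hy|Hy].
    - destruct (orbit_convergent_unique _ _ _ _ mu j2 _ mu_pos C1_f1 C1_f2 u v y u' v' y' b O O' Hb L1 L1'
        ltac:(congruence) ltac:(congruence) Hy x Hx) as (? & ? & _). auto.
    - destruct (orbit_convergent_unique _ _ _ _ mu j2 _ mu_pos C1_f1 C1_f2 u' v' y' u v y b O' O Hb L1' L1
        ltac:(congruence) ltac:(congruence) (Rlt_le _ _ Hy) x Hx) as (? & ? & _). auto. }
  intros x Hx. destruct (R x Hx) as (_ & _ & P1 & P2 & P3 & P4).
  destruct (R' x Hx) as (_ & _ & P1' & P2' & P3' & P4'). destruct (H x Hx) as [Hu Hv].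
  rewrite P1, P2, P3, P4, P1', P2', P3', P4', Hu, Hv. auto.
Qed.

(** Convexity puts the total flux above its value at [b] on all of [[u_m, b)], so shooting works for
    every datum below [b], without smallness. *)
Lemma solution_exists u_m : dF <= 0 -> u_m < b -> exists w, solves u_m w.
Proof.
  intros Hs Hm.
  destruct (shooting_converges f1 df1 f2 df2 mu j2 (f1 b + f2 b) u_m b mu_pos j2_neg Hm b_neg C1_f1 C1_f2 eq_refl)
    as (u & v & y & Eu & Ev & O & L1 & L2 & Hge).
  { intros c Hc. apply (total_flux_left A1 A2 gamma alpha rho_p n_p b); auto. lra. }
  eexists. apply (solution_of_orbit mu A1 A2 gamma alpha rho_p n_p b mu_pos rho_pos n_pos b_neg u_m u v y); auto.
  lra.
Qed.

(** With [c] the sound speed, [dF * b = (rho_p + n_p) * (b^2 - c^2)] is a positive multiple of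
    [M - 1]; the sign is reversed because [b < 0]. *)
Lemma mach_dtotal_flux :
  (mach A1 A2 gamma alpha rho_p n_p b = 1 <-> dF = 0) /\
  (1 < mach A1 A2 gamma alpha rho_p n_p b <-> dF < 0).
Proof.
  set (S := A1 * gamma * Rpower rho_p gamma + A2 * alpha * Rpower n_p alpha).
  assert (HS : 0 < S).
  { unfold S, Rpower. apply Rplus_lt_0_compat; (apply Rmult_lt_0_compat; [nra|apply exp_pos]). }
  assert (HdF : dF * b = (rho_p + n_p) * b ^ 2 - S).
  { unfold dF, dtotal_flux, dflux, S.
    replace (rho_p * b / b) with rho_p by (field; lra). replace (n_p * b / b) with n_p by (field; lra).
    field. lra. }
  set (c := sound_speed A1 A2 gamma alpha rho_p n_p).
  assert (Hc : 0 < c) by (apply sqrt_lt_R0, Rdiv_lt_0_compat; [exact HS|lra]).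
  assert (Hc2 : c * c = S / (rho_p + n_p)).
  { apply sqrt_sqrt. left. apply Rdiv_lt_0_compat; [exact HS|lra]. }
  assert (HcS : c * c * (rho_p + n_p) = S) by (rewrite Hc2; field; lra).
  assert (Hm : mach A1 A2 gamma alpha rho_p n_p b = - b / c) by (unfold mach; rewrite Rabs_left by lra; reflexivity).
  assert (Hfac : dF * b = (rho_p + n_p) * (- b - c) * (- b + c)) by (rewrite HdF, <- HcS; ring).
  rewrite Hm. assert (Hq : - b = - b / c * c) by (field; lra). set (M := - b / c) in *.
  assert (Hfac' : dF * b = (M - 1) * ((rho_p + n_p) * c * (- b + c))).
  { rewrite Hfac. replace (- b - c) with (M * c - c) by lra. ring. }
  assert (Hpos : 0 < (rho_p + n_p) * c * (- b + c)) by (repeat apply Rmult_lt_0_compat; lra).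
  set (W := (rho_p + n_p) * c * (- b + c)) in *.
  repeat split; intros H.
  - rewrite H in Hfac'. nra.
  - rewrite H in Hfac'. nra.
  - nra.
  - nra.
Qed.

(* In the sonic and subsonic cases the sign of the total flux at [u_m] contradicts the direction
   in which an orbit issued from [u_m] must move. *)
Lemma sonic_data_left u_m w : dF = 0 -> u_m < 0 -> solves u_m w -> u_m <= b.
Proof.
  intros Hs Hm Hw. destruct (Rle_or_lt u_m b) as [H|H]; [exact H|exfalso].
  destruct (connecting_of_solution u_m w Hm Hw) as (u & v & y & Hc & _ & E0).
  assert (HF := total_flux_right A1 A2 gamma alpha rho_p n_p b).
  destruct (connecting_above mu A1 A2 gamma alpha rho_p n_p b) with (u := u) (v := v) (y := y) as [_ Hlt]; auto.
  - rewrite E0. apply HF; auto. fold dF. lra.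
  - lra.
Qed.

Lemma subsonic_no_solution : 0 < dF -> exists d, 0 < d /\ forall u_m w,
  u_m < 0 -> 0 < Rabs (u_m - b) < d -> ~ solves u_m w.
Proof.
  intros Hs.
  destruct (local_sign (fun c => - F c) b (- dF)) as (d & Hd & S); [|lra|].
  { apply (is_derive_opp F). now apply is_derive_total_flux. }
  exists d. split; [exact Hd|]. intros u_m w Hm Hn Hw.
  destruct (connecting_of_solution u_m w Hm Hw) as (u & v & y & Hc & _ & E0).
  destruct (S u_m (proj2 Hn)) as [Sl Sr].
  destruct (Rtotal_order u_m b) as [H|[H|H]].
  - destruct (connecting_below mu A1 A2 gamma alpha rho_p n_p b) with (u := u) (v := v) (y := y) as [_ Hlt]; auto.
    + rewrite E0. specialize (Sl H). cbv beta in Sl. fold F. lra.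
    + lra.
  - rewrite H, Rminus_diag, Rabs_R0 in Hn. lra.
  - destruct (connecting_above mu A1 A2 gamma alpha rho_p n_p b) with (u := u) (v := v) (y := y) as [_ Hlt]; auto.
    + rewrite E0. specialize (Sr H). cbv beta in Sr. fold F. lra.
    + lra.
Qed.

End Existence.

Theorem theorem1p1 (mu A1 A2 gamma alpha rho_p n_p u_p : R)
  (hmu : 0 < mu) (hA1 : 0 < A1) (hA2 : 0 < A2)
  (hgamma : 1 <= gamma) (halpha : 1 <= alpha)
  (hrho : 0 < rho_p) (hn : 0 < n_p) (hu : u_p < 0) :
  let M := mach A1 A2 gamma alpha rho_p n_p u_p in
  let solves := strong_solution mu A1 A2 gamma alpha rho_p n_p u_p in
  exists Omega : R -> Prop,
    (forall u_m, Omega u_m -> u_m < 0) /\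
    (* [Omega] contains data with arbitrarily small [delta] *)
    (1 <= M -> forall eps, 0 < eps ->
       exists u_m, Omega u_m /\ 0 < Rabs (u_m - u_p) < eps) /\
    exists delta0 C1 C2 C3 c0 c1 a : R,
      0 < delta0 /\ 0 < C1 /\ 0 < C2 /\ 0 < C3 /\ 0 < c0 /\ 0 < c1 /\ 0 < a /\
      (* [Omega] contains all nearby data for which the problem is solvable *)
      (forall u_m, u_m < 0 -> 0 < Rabs (u_m - u_p) < delta0 ->
         (exists w, solves u_m w) -> Omega u_m) /\
      forall u_m, Omega u_m ->
        let delta := Rabs (u_m - u_p) in
        0 < delta < delta0 ->
        exists w : profile,
          solves u_m w /\
          (forall w', solves u_m w' -> profile_eq w' w) /\
          (M <> 1 -> exp_decay rho_p n_p u_p C1 c0 delta w) /\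
          (M = 1 ->
             alg_decay 1 rho_p n_p u_p C2 delta w /\
             exists (K : R) (sigma : R -> R),
               0 < K /\
               alg_decay 3 rho_p n_p u_p K delta w /\
               sigma_profile a c1 C3 delta sigma /\
               velocity_expansion a K sigma w).
Proof.
  intros M solves.
  destruct (mach_dtotal_flux A1 A2 gamma alpha rho_p n_p u_p hA1 hA2 hgamma halpha hrho hn hu) as [Msonic Msuper].
  fold M in Msonic, Msuper.
  set (dF := dtotal_flux A1 A2 gamma alpha rho_p n_p u_p u_p) in *.
  (* The largest possible choice: all negative data that admit a solution. Existence is then needed
     only for the accumulation at [u_p], where the data [u_p - eps / 2] provide it. *)
  exists (fun u_m => u_m < 0 /\ exists w, solves u_m w).
  split; [now intros u_m [H _]|]. split.
  { intros HM eps Heps. exists (u_p - eps / 2). split; [split; [lra|]|].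
    - apply solution_exists; auto; [|lra]. fold dF.
      destruct HM as [HM|HM]; [left; now apply Msuper|right; apply Msonic; now symmetry].
    - replace (u_p - eps / 2 - u_p) with (- (eps / 2)) by ring. rewrite Rabs_Ropp, Rabs_pos_eq; lra. }
  assert (uniq : forall u_m w, u_m < 0 -> solves u_m w -> forall w', solves u_m w' -> profile_eq w' w).
  { intros u_m w Hm Hw w' Hw'.
    now apply (solution_unique mu A1 A2 gamma alpha rho_p n_p u_p) with (u_m := u_m). }
  destruct (Rtotal_order dF 0) as [HF|[HF|HF]].
  - destruct (supersonic_profile mu A1 A2 gamma alpha rho_p n_p u_p) as (d & C & c & Hd & HC & Hc & S); auto.
    (* The constants of the sonic clause are set to 1, that clause being vacuous here. *)
    exists d, C, 1, 1, c, 1, 1. repeat (split; [lra|]). split; [now intros|].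
    intros u_m [Hm [w Hw]] delta Hdel. exists w. split; [exact Hw|]. split; [now apply uniq|]. split.
    + intros _. destruct (connecting_of_solution mu A1 A2 gamma alpha rho_p n_p u_p) with (u_m := u_m) (w := w)
        as (u & v & y & Hcon & Hcar & E0); auto.
      unfold delta in *. rewrite <- E0 in *. now apply (S w u v y).
    + intros HM. apply Msonic in HM. lra.
  - destruct (sonic_deviation mu A1 A2 gamma alpha rho_p n_p u_p) as (d & C & a & Hd & HC & Ha & S); auto.
    exists d, 1, C, C, 1, (/ C), a. assert (0 < / C) by now apply Rinv_0_lt_compat.
    repeat (split; [lra|]). split; [now intros|].
    intros u_m [Hm [w Hw]] delta Hdel. exists w. split; [exact Hw|]. split; [now apply uniq|]. split.
    + intros HM. exfalso. now apply HM, Msonic.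
    + intros _. destruct (connecting_of_solution mu A1 A2 gamma alpha rho_p n_p u_p) with (u_m := u_m) (w := w)
        as (u & v & y & Hcon & Hcar & E0); auto.
      (* Data above [u_p] admit no solution, so [delta] is [u_p - u_m]. *)
      assert (Hle : u_m <= u_p)
        by (apply (sonic_data_left mu A1 A2 gamma alpha rho_p n_p u_p) with (w := w); auto).
      assert (Ed : delta = u_p - u 0).
      { unfold delta in *. rewrite E0. rewrite Rabs_left1 by lra. ring. }
      rewrite Ed in *. destruct (S w u v y Hcon Hcar Hdel) as (D1 & (L & HL & D3 & V) & Hsig).
      split; [exact D1|]. exists L, (fun x => u_p - u (x + / (u_p - u 0))).
      split; [exact HL|]. split; [exact D3|]. split; [exact Hsig|exact V].
  - destruct (subsonic_no_solution mu A1 A2 gamma alpha rho_p n_p u_p) as (d & Hd & S); auto.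
    (* No datum with [0 < delta < d] belongs to [Omega], so any positive constants do. *)
    exists d, 1, 1, 1, 1, 1, 1. repeat (split; [lra|]). split; [now intros|].
    intros u_m [Hm [w Hw]] delta Hdel. exfalso. exact (S u_m w Hm Hdel Hw).
Qed.
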